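(* Let $N\in\{5,6,7,8,9,10,11,12,14,15,16,17,23\}$ and let $k$ be a positive even integer. Let $F(s)=\sum_{n\ge 1} a_n n^{-s}$ be a Dirichlet series which converges in some right half-plane, and suppose that $F$ is EBV and has both a functional equation and an Euler product of degree $2$, level $N$, and weight $k$. Put $f(z)=\sum_{n=1}^\infty a_n e^{2\pi i n z}$ for $z$ in the upper half-plane. Then $f|_k\gamma=f$ for all $\gamma\in\Gamma_0(N)$.
   Context: $\mathcal{H}$ is the complex upper half-plane. For $\gamma=\begin{pmatrix} a&b\\c&d\end{pmatrix}\in GL_2(\mathbb{R})^+$ and $g:\mathcal{H}\to\mathbb{C}$, $(g|_k\gamma)(z)=(\det\gamma)^{k/2}(cz+d)^{-k}g\left(\frac{az+b}{cz+d}\right)$. $\Gamma_0(N)=\left\{\begin{pmatrix} a&b\\c&d\end{pmatrix}\in SL_2(\mathbb{Z}) : N\mid c\right\}$. A Dirichlet series $F(s)$ converging in some right half-plane is called EBV if it continues to an entire function such that $\Gamma(s)F(s)$ is entire and bounded in vertical strips. $F$ satisfies a functional equation of degree $2$, level $N$, and weight $k$ if, with $\Phi(s)=\left(\frac{\sqrt N}{2\pi}\right)^s\Gamma(s)F(s)$, one has $\Phi(s)=\pm(-1)^{k/2}\Phi(k-s)$ for one choice of the sign $\pm$. $F$ has an Euler product of degree $2$, level $N$, and weight $k$ if (in a half-plane of absolute convergence) $F(s)=\prod_{p\text{ prime}}F_p(s)$, where $F_p(s)=(1-a_pp^{-s}+p^{k-1-2s})^{-1}$ if $p\nmid N$; $F_q(s)=(1-q^{\frac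 k2-1-s})^{-1}$ if $q\,\|\,N$ (that is, $q\mid N$ and $q^2\nmid N$); and $F_q(s)=1$ if $q^2\mid N$. *)

(* Defs.v *)
From Stdlib Require Export Reals ZArith Znumtheory List.
From Coquelicot Require Export Coquelicot.
Open Scope R_scope.

Definition Cexp (z : C) : C :=
  (exp (Re z) * cos (Im z), exp (Re z) * sin (Im z)).

(* x^s with the real logarithm of the base; meaningful for 0 < x. *)
Definition Cpower (x : R) (s : C) : C := Cexp (s * ln x)%C.

(* Componentwise sum; junk if the series diverges. *)
Definition CSeries (u : nat -> C) : C :=
  (Series (fun n => Re (u n)), Series (fun n => Im (u n))).

Definition entire (f : C -> C) : Prop :=
  forall z : C, ex_derive (K := C_AbsRing) (V := C_NormedModule) f z.

Definition bounded_in_vertical_strips (f : C -> C) : Prop :=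
  forall x y : R,
    exists M : R, forall s : C, x <= Re s <= y -> Cmod (f s) <= M.

(* Euler's integral of t^(s-1) e^(-t) over (0, oo), for 0 < Re s. *)
Definition Euler_integral (s : C) : C :=
  RInt_gen (V := C_R_CompleteNormedModule)
    (fun t : R => (Cpower t (s - 1) * exp (- t))%C)
    (at_right 0) (Rbar_locally p_infty).

Fixpoint rising_factorial (s : C) (n : nat) : C :=
  match n with
  | O => RtoC 1
  | S m => (rising_factorial s m * (s + INR m))%C
  end.

(* Continuation of Euler's integral by
   Gamma(s) = Gamma(s + n) / (s (s + 1) ... (s + n - 1)), with n the least
   natural number such that 0 < Re s + n; thus n = 0 when 0 < Re s.
   The value at a pole is junk. *)
Definition Gamma (s : C) : C :=
  let n := Z.to_nat (up (- Re s)) in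
  (Euler_integral (s + INR n) / rising_factorial s n)%C.

Definition Gamma_pole (s : C) : Prop := exists n : nat, s = (- INR n)%C.

(* Index m stands for the term n = m + 1, so the coefficient a 0 plays no
   role. *)
Definition dirichlet_term (a : nat -> C) (s : C) (m : nat) : C :=
  (a (S m) * Cpower (INR (S m)) (- s))%C.

(* The Dirichlet series with coefficients a converges in some right
   half-plane, with sum F there; elsewhere F denotes a continuation. *)
Definition is_dirichlet_series (a : nat -> C) (F : C -> C) : Prop :=
  exists sigma : R, forall s : C,
    sigma < Re s -> is_series (V := C_NormedModule) (dirichlet_term a s) (F s).

(* L is Gamma F with the removable singularities at the poles of Gamma
   filled in. *)
Definition EBV (F : C -> C) : Prop :=
  entire F /\
  exists L : C -> C,
    entire L /\ bounded_in_vertical_strips L /\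
    forall s : C, ~ Gamma_pole s -> L s = (Gamma s * F s)%C.

Definition Phi (N : nat) (F : C -> C) (s : C) : C :=
  (Cpower (sqrt (INR N) / (2 * PI)) s * Gamma s * F s)%C.

(* The identity is stated where both sides are given by their defining
   formula; when Gamma F is entire it extends to all s by continuity. *)
Definition functional_equation (N k : nat) (F : C -> C) : Prop :=
  exists eps : R, (eps = 1 \/ eps = -1) /\
    forall s : C, ~ Gamma_pole s -> ~ Gamma_pole (INR k - s)%C ->
      Phi N F s = (eps * (-1) ^ (k / 2) * Phi N F (INR k - s))%C.

Definition euler_factor (a : nat -> C) (N k p : nat) (s : C) : C :=
  if negb (N mod p =? 0)%nat then
    (/ (1 - a p * Cpower (INR p) (- s)
          + Cpower (INR p) (INR k - 1 - 2 * s)))%C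
  else if negb (N mod (p * p) =? 0)%nat then
    (/ (1 - Cpower (INR p) (INR k / 2 - 1 - s)))%C
  else RtoC 1.

(* Product of the Euler factors over the primes p <= n. *)
Fixpoint euler_partial_product (a : nat -> C) (N k : nat) (s : C) (n : nat)
  : C :=
  match n with
  | O => RtoC 1
  | S m =>
      (euler_partial_product a N k s m *
       (if prime_dec (Z.of_nat (S m)) then euler_factor a N k (S m) s else 1))%C
  end.

Definition euler_product (a : nat -> C) (N k : nat) (F : C -> C) : Prop :=
  exists sigma : R, forall s : C, sigma < Re s ->
    ex_series (fun m => Cmod (dirichlet_term a s m)) /\
    filterlim (euler_partial_product a N k s) eventually
      (locally (T := C_UniformSpace) (F s)).

Definition fourier_series (a : nat -> C) (z : C) : C :=
  CSeries (fun m => (a (S m) * Cexp (2 * PI * Ci * INR (S m) * z))%C).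

(* The matrix (a b; c d). *)
Record mat2 (T : Type) : Type := Mat2 { ma : T; mb : T; mc : T; md : T }.
Arguments Mat2 {T} _ _ _ _.
Arguments ma {T} _.
Arguments mb {T} _.
Arguments mc {T} _.
Arguments md {T} _.

Definition mat2_map {T U : Type} (h : T -> U) (g : mat2 T) : mat2 U :=
  Mat2 (h (ma g)) (h (mb g)) (h (mc g)) (h (md g)).

Definition Gamma0 (N : nat) (g : mat2 Z) : Prop :=
  (ma g * md g - mb g * mc g = 1)%Z /\ (Z.of_nat N | mc g)%Z.

Definition moebius (g : mat2 R) (z : C) : C :=
  ((ma g * z + mb g) / (mc g * z + md g))%C.

(* For g of positive determinant. *)
Definition slash (k : nat) (g : mat2 R) (f : C -> C) (z : C) : C :=
  (Rpower (ma g * md g - mb g * mc g)%R (INR k / 2)%R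
   * / (mc g * z + md g) ^ k * f (moebius g z))%C.

(* Main.v *)
(* Write f|A for the weight k slash action extended to GL_2(Q)^+. Inverting the Mellin
   transform, the functional equation gives f|(0 -1; N 0) = +-f. Comparing Euler product
   and Dirichlet series gives a_(pn) = a_p a_n - p^(k-1) a_(n/p) for p not dividing N, so
   f is an eigenvector of T_p, and similarly for U_q with q | N. Hence the right ideal
   {A in Z[GL_2(Q)^+] : f|A = 0} contains 1 - T, H -+ 1, is stable under left
   multiplication by T_2 or T_3 when these primes do not divide N, and in addition
   contains any B such that B(1 +- M) is in it for an elliptic M of infinite order: a
   holomorphic h with h|M = +-h vanishes. For each of the thirteen levels these rules
   produce 1 - g for a set of generators g of Gamma_0(N), by an explicit computation
   in the group ring. *)

(* EBV only bounds Gamma F on vertical strips, so moving the line of the inverse Mellin integral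
   would need a convexity argument for the horizontal sides. A uniqueness statement takes its place:
   two functions whose Mellin transforms on two lines are values of one holomorphic G on the strip
   between them coincide. Damping by e^(eps s^2) makes all integrals converge and tolerates growth
   e^(b |Im s|) of G. This room is spent on a factor e^(-i be s), which turns the ray of integration
   and yields the Fricke relation at every z of the upper half-plane directly, not only on the
   imaginary axis.

   Euler product and series are compared at large integers s only: a Dirichlet series that is O((X +
   1)^(-s)) there has no coefficients up to X.

   The slash action is normalised to ignore scalars. Then the relation coming from U_2 has
   coefficients 1 and -1 in every weight, and the unknown eigenvalues of T_2 and T_3 enter only
   through the stability of the ideal. Hence the certificates do not mention k, and one finite
   computation for each level and sign settles all weights. *)
Require Import Defs.
From Stdlib Require Import Lra Lia FunctionalExtensionality.
Import ListNotations.
Open Scope R_scope.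

(** * Continuity and differentiability in C *)

Notation ctn f x := (continuous (U := C_UniformSpace) f x).
Notation cctn f x := (continuous (T := C_UniformSpace) (U := C_UniformSpace) f x).

Lemma ctn_pair {T : UniformSpace} (f g : T -> R) (x : T) :
  continuous f x -> continuous g x -> ctn (fun t => (f t, g t) : C) x.
Proof.
  intros Hf Hg. unfold continuous in *.
  apply (filterlim_filter_le_2 (G := filter_prod (locally (f x)) (locally (g x)))).
  - intros P [eps HP]. exists (fun u => ball (f x) eps u) (fun v => ball (g x) eps v).
    + now exists eps.
    + now exists eps.
    + intros u v Hu Hv. apply HP. now split.
  - now apply filterlim_pair.
Qed.

Lemma ctn_re {T : UniformSpace} (f : T -> C) (x : T) :
  ctn f x -> continuous (fun t => Re (f t)) x.
Proof.
  intros Hf. apply (continuous_comp f (fun z : R * R => fst z)); auto.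
  apply (continuous_fst (U := R_UniformSpace) (V := R_UniformSpace)).
Qed.

Lemma ctn_im {T : UniformSpace} (f : T -> C) (x : T) :
  ctn f x -> continuous (fun t => Im (f t)) x.
Proof.
  intros Hf. apply (continuous_comp f (fun z : R * R => snd z)); auto.
  apply (continuous_snd (U := R_UniformSpace) (V := R_UniformSpace)).
Qed.

Lemma ctn_ext {T : UniformSpace} (f g : T -> C) (x : T) :
  (forall t, f t = g t) -> ctn f x -> ctn g x.
Proof. intros H. now apply continuous_ext. Qed.

Lemma ctn_const {T : UniformSpace} (c : C) (x : T) : ctn (fun _ => c) x.
Proof. apply continuous_const. Qed.

Lemma ctn_plus {T : UniformSpace} (f g : T -> C) (x : T) :
  ctn f x -> ctn g x -> ctn (fun t => f t + g t)%C x.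
Proof.
  intros Hf Hg. unfold Cplus.
  pose proof (ctn_re f x Hf). pose proof (ctn_im f x Hf).
  pose proof (ctn_re g x Hg). pose proof (ctn_im g x Hg).
  apply ctn_pair; apply (continuous_plus (K := R_AbsRing) (V := R_NormedModule)); assumption.
Qed.

Lemma ctn_opp {T : UniformSpace} (f : T -> C) (x : T) :
  ctn f x -> ctn (fun t => - f t)%C x.
Proof.
  intros Hf. unfold Copp.
  pose proof (ctn_re f x Hf). pose proof (ctn_im f x Hf).
  apply ctn_pair; apply (continuous_opp (K := R_AbsRing) (V := R_NormedModule)); assumption.
Qed.

Lemma ctn_minus {T : UniformSpace} (f g : T -> C) (x : T) :
  ctn f x -> ctn g x -> ctn (fun t => f t - g t)%C x.
Proof. intros Hf Hg. apply ctn_plus; auto. now apply ctn_opp. Qed.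

Lemma ctn_mult {T : UniformSpace} (f g : T -> C) (x : T) :
  ctn f x -> ctn g x -> ctn (fun t => f t * g t)%C x.
Proof.
  intros Hf Hg. unfold Cmult.
  assert (M : forall u v : T -> R, continuous u x -> continuous v x ->
     continuous (fun t => u t * v t) x)
    by (intros; now apply (continuous_mult (K := R_AbsRing))).
  assert (A : forall u v : T -> R, continuous u x -> continuous v x ->
     continuous (fun t => u t + v t) x)
    by (intros; now apply (continuous_plus (K := R_AbsRing) (V := R_NormedModule))).
  assert (O : forall u : T -> R, continuous u x ->
     continuous (fun t => - u t) x)
    by (intros; now apply (continuous_opp (K := R_AbsRing) (V := R_NormedModule))).
  pose proof (ctn_re f x Hf). pose proof (ctn_im f x Hf).
  pose proof (ctn_re g x Hg). pose proof (ctn_im g x Hg).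
  apply ctn_pair.
  - apply A; [|apply O]; apply M; assumption.
  - apply A; apply M; assumption.
Qed.

Lemma ctn_RtoC {T : UniformSpace} (f : T -> R) (x : T) :
  continuous f x -> ctn (fun t => RtoC (f t)) x.
Proof. intros Hf. apply ctn_pair; auto. apply continuous_const. Qed.

Lemma continuous_Rcomp {T : UniformSpace} (h : R -> R) (f : T -> R) (x : T) :
  continuity_pt h (f x) -> continuous f x -> continuous (fun t => h (f t)) x.
Proof.
  intros Hh Hf. apply (continuous_comp f h); auto.
  now apply continuity_pt_filterlim.
Qed.

Lemma ctn_Cexp {T : UniformSpace} (f : T -> C) (x : T) :
  ctn f x -> ctn (fun t => Cexp (f t)) x.
Proof.
  intros Hf. unfold Cexp.
  assert (M : forall u v : T -> R, continuous u x -> continuous v x ->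
     continuous (fun t => u t * v t) x)
    by (intros; now apply (continuous_mult (K := R_AbsRing))).
  apply ctn_pair; apply M.
  - apply (continuous_Rcomp exp); [apply derivable_continuous_pt, derivable_pt_exp | now apply ctn_re].
  - apply (continuous_Rcomp cos); [apply derivable_continuous_pt, derivable_pt_cos | now apply ctn_im].
  - apply (continuous_Rcomp exp); [apply derivable_continuous_pt, derivable_pt_exp | now apply ctn_re].
  - apply (continuous_Rcomp sin); [apply derivable_continuous_pt, derivable_pt_sin | now apply ctn_im].
Qed.

Lemma ctn_comp {T : UniformSpace} (f : T -> C) (g : C -> C) (x : T) :
  ctn f x -> cctn g (f x) -> ctn (fun t => g (f t)) x.
Proof. intros. now apply (continuous_comp (V := C_UniformSpace) f g). Qed.

Lemma ctn_Rcomp {T : UniformSpace} (f : T -> R) (g : R -> C) (x : T) :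
  continuous f x -> ctn g (f x) -> ctn (fun t => g (f t)) x.
Proof. intros. now apply (continuous_comp f g). Qed.

(** The clauses for partial applications such as [Rmult c] match functions that unification has left
    eta-reduced. *)
Ltac solve_ctn :=
  lazymatch goal with
  | |- continuous (fun t => Cplus (@?f t) (@?g t)) _ => apply ctn_plus; solve_ctn
  | |- continuous (fun t => Cminus (@?f t) (@?g t)) _ => apply ctn_minus; solve_ctn
  | |- continuous (fun t => Cmult (@?f t) (@?g t)) _ => apply ctn_mult; solve_ctn
  | |- continuous (fun t => Copp (@?f t)) _ => apply ctn_opp; solve_ctn
  | |- continuous (fun t => Cexp (@?f t)) _ => apply ctn_Cexp; solve_ctn
  | |- continuous (fun t => RtoC (@?f t)) _ => apply ctn_RtoC; solve_ctn
  | |- continuous (fun t => @pair _ _ (@?f t) (@?g t)) _ => apply ctn_pair; solve_ctn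
  | |- continuous (fun t => Rplus (@?f t) (@?g t)) _ =>
      apply (continuous_plus (K := R_AbsRing) (V := R_NormedModule)); solve_ctn
  | |- continuous (fun t => Rminus (@?f t) (@?g t)) _ =>
      apply (continuous_minus (K := R_AbsRing) (V := R_NormedModule)); solve_ctn
  | |- continuous (fun t => Ropp (@?f t)) _ =>
      apply (continuous_opp (K := R_AbsRing) (V := R_NormedModule)); solve_ctn
  | |- continuous (fun t => Rmult (@?f t) (@?g t)) _ => apply (continuous_mult (K := R_AbsRing)); solve_ctn
  | |- continuous (Rmult ?c) _ =>
      apply (continuous_mult (K := R_AbsRing) (fun _ => c) (fun t => t)); solve_ctn
  | |- continuous (Rplus ?c) _ =>
      apply (continuous_plus (K := R_AbsRing) (V := R_NormedModule) (fun _ => c) (fun t => t)); solve_ctn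
  | |- continuous (Rminus ?c) _ =>
      apply (continuous_minus (K := R_AbsRing) (V := R_NormedModule) (fun _ => c) (fun t => t)); solve_ctn
  | |- continuous Ropp _ =>
      apply (continuous_opp (K := R_AbsRing) (V := R_NormedModule) (fun t => t)); solve_ctn
  | |- continuous (Cmult ?c) _ => apply (ctn_mult (fun _ => c) (fun t => t)); solve_ctn
  | |- continuous (Cplus ?c) _ => apply (ctn_plus (fun _ => c) (fun t => t)); solve_ctn
  | |- continuous (Cminus ?c) _ => apply (ctn_minus (fun _ => c) (fun t => t)); solve_ctn
  | |- continuous (@pair _ _ ?c) _ => apply (ctn_pair (fun _ => c) (fun t => t)); solve_ctn
  | |- continuous Copp _ => apply (ctn_opp (fun t => t)); solve_ctn
  | |- continuous Cexp _ => apply (ctn_Cexp (fun t => t)); solve_ctn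
  | |- continuous RtoC _ => apply (ctn_RtoC (fun t => t)); solve_ctn
  | |- continuous fst _ =>
      apply (continuous_fst (U := R_UniformSpace) (V := R_UniformSpace))
  | |- continuous snd _ =>
      apply (continuous_snd (U := R_UniformSpace) (V := R_UniformSpace))
  | |- continuous (fun t => t) _ => apply continuous_id
  | |- continuous (fun t => fst t) _ =>
      apply (continuous_fst (U := R_UniformSpace) (V := R_UniformSpace))
  | |- continuous (fun t => snd t) _ =>
      apply (continuous_snd (U := R_UniformSpace) (V := R_UniformSpace))
  | |- _ => first [ assumption | apply continuous_const | idtac ]
  end.

(** * The modulus as a metric, and complex derivatives *)

Lemma Cmod_ball (x y : C) (eps : R) : Cmod (y - x) < eps -> ball (M := C_UniformSpace) x eps y.
Proof. apply C_NormedModule_mixin_compat1. Qed.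

(** A ball of the product structure on C is a square, whose corners lie at sqrt 2 times the radius;
    this is rounded up to 2. *)
Lemma ball_Cmod (x y : C) (eps : posreal) :
  ball (M := C_UniformSpace) x eps y -> Cmod (y - x) < 2 * eps.
Proof.
  intros H. pose proof (C_NormedModule_mixin_compat2 x y eps H) as B.
  apply Rlt_le_trans with (1 := B).
  apply Rmult_le_compat_r; [apply Rlt_le, cond_pos|].
  rewrite <- (sqrt_square 2) at 2 by lra. apply sqrt_le_1_alt. lra.
Qed.

Lemma ctn_metric {T : UniformSpace} (f : T -> C) (x : T) :
  (forall eps, 0 < eps -> locally x (fun y => Cmod (f y - f x) < eps)) -> ctn f x.
Proof.
  intros H P [eps HP]. unfold filtermap.
  generalize (H eps (cond_pos eps)). apply filter_imp.
  intros y Hy. apply HP. now apply Cmod_ball.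
Qed.

Lemma metric_ctn {T : UniformSpace} (f : T -> C) (x : T) :
  ctn f x -> forall eps, 0 < eps -> locally x (fun y => Cmod (f y - f x) < eps).
Proof.
  intros H eps He.
  assert (He2 : 0 < eps / 2) by lra.
  assert (L : locally (T := C_UniformSpace) (f x) (ball (M := C_UniformSpace) (f x) (eps/2)))
    by (exists (mkposreal _ He2); intros y hy; exact hy).
  generalize (H _ L).
  unfold filtermap. apply filter_imp. intros y Hy.
  apply (ball_Cmod _ _ (mkposreal _ He2)) in Hy. simpl in Hy. lra.
Qed.

(** Stated without a quotient, so that y = z needs no exception; [Goursat] and [elliptic_zero] use
    the estimate in exactly this form. *)
Definition cderiv (f : C -> C) (z l : C) : Prop :=
  forall eps, 0 < eps -> exists delta, 0 < delta /\
    forall y, Cmod (y - z) < delta ->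
      Cmod (f y - f z - l * (y - z)) <= eps * Cmod (y - z).

Lemma cd_is_derive (f : C -> C) (z l : C) :
  is_derive (K := C_AbsRing) (V := C_NormedModule) f z l -> cderiv f z l.
Proof.
  intros [_ H] eps He.
  specialize (H z (fun P hp => hp) (mkposreal eps He)).
  destruct H as [d Hd]. exists d. split; [apply cond_pos|].
  intros y Hy. specialize (Hd y Hy). simpl in Hd.
  replace (f y - f z - l * (y - z))%C with (minus (minus (f y) (f z)) (scal (V := C_NormedModule) (minus y z) l)).
  - change (Cmod (y - z)%C) with (norm (K := C_AbsRing) (V := AbsRing_NormedModule C_AbsRing) (minus y z)).
    exact Hd.
  - unfold minus, plus, opp, scal; simpl. unfold mult; simpl. ring.
Qed.

Lemma Ceq_dist (x y : C) : (forall eps, 0 < eps -> Cmod (x - y) <= eps) -> x = y.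
Proof.
  intros H. destruct (Req_dec (Cmod (x - y)) 0) as [E|E].
  - apply Cmod_eq_0 in E. replace x with (x - y + y)%C by ring. rewrite E. ring.
  - assert (0 <= Cmod (x - y)) by apply Cmod_ge_0.
    assert (Hp : 0 < Cmod (x - y) / 2) by lra. specialize (H _ Hp). lra.
Qed.

Lemma Cmod_triang_minus (x y : C) : Cmod (x - y) <= Cmod x + Cmod y.
Proof. unfold Cminus. eapply Rle_trans. apply Cmod_triangle. rewrite Cmod_opp. lra. Qed.

Lemma Cmod_dist (x y z : C) : Cmod (x - z) <= Cmod (x - y) + Cmod (y - z).
Proof. replace (x - z)%C with ((x - y) + (y - z))%C by ring. apply Cmod_triangle. Qed.

Lemma Cmod_sym (x y : C) : Cmod (x - y) = Cmod (y - x).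
Proof. rewrite <- Cmod_opp. f_equal. ring. Qed.

Lemma Cmod_triang_inv (x y : C) : Cmod x - Cmod y <= Cmod (x - y).
Proof. assert (H := Cmod_triangle (x - y) y). replace (x - y + y)%C with x in H by ring. lra. Qed.

Lemma cd_ctn (f : C -> C) (z l : C) : cderiv f z l -> cctn f z.
Proof.
  intros H. apply ctn_metric. intros eps He.
  destruct (H 1 Rlt_0_1) as [d [Hd H1]].
  assert (P : 0 < Rmin (d/2) (eps / (2 * (Cmod l + 2)))).
  { assert (0 <= Cmod l) by apply Cmod_ge_0. apply Rmin_case; [lra|].
    apply Rdiv_lt_0_compat; lra. }
  exists (mkposreal _ P). intros y Hy. apply (ball_Cmod z y (mkposreal _ P)) in Hy. simpl in Hy.
  assert (B1 := Rmin_l (d/2) (eps / (2 * (Cmod l + 2)))).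
  assert (B2 := Rmin_r (d/2) (eps / (2 * (Cmod l + 2)))).
  assert (Hl : 0 <= Cmod l) by apply Cmod_ge_0.
  specialize (H1 y ltac:(lra)).
  replace (f y - f z)%C with ((f y - f z - l * (y - z)) + l * (y - z))%C by ring.
  eapply Rle_lt_trans. apply Cmod_triangle. rewrite Cmod_mult.
  assert (E : Cmod (y - z) < eps / (Cmod l + 2)).
  { eapply Rlt_le_trans; [apply Hy|]. apply Rle_trans with (2 * (eps / (2 * (Cmod l + 2)))); [lra|].
    right. field. lra. }
  assert (0 <= Cmod (y - z)) by apply Cmod_ge_0.
  apply Rle_lt_trans with ((Cmod l + 2) * Cmod (y - z)); [nra|].
  apply (Rmult_lt_compat_l (Cmod l + 2)) in E; [|lra].
  replace ((Cmod l + 2) * (eps / (Cmod l + 2))) with eps in E by (field; lra). lra.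
Qed.

Lemma cd_bound (f : C -> C) (z l : C) : cderiv f z l -> exists d M, 0 < d /\ 0 < M /\
   forall y, Cmod (y - z) < d -> Cmod (f y - f z) <= M * Cmod (y - z).
Proof.
  intros H. destruct (H 1 Rlt_0_1) as [d [Hd H1]].
  assert (Hl : 0 <= Cmod l) by apply Cmod_ge_0.
  exists d, (1 + Cmod l). repeat split; auto; try lra. intros y Hy.
  replace (f y - f z)%C with ((f y - f z - l * (y - z)) + l * (y - z))%C by ring.
  eapply Rle_trans. apply Cmod_triangle. rewrite Cmod_mult. specialize (H1 y Hy). lra.
Qed.

Lemma cd_const (c z : C) : cderiv (fun _ => c) z 0.
Proof.
  intros eps He. exists 1. split; [lra|]. intros y _.
  replace (c - c - 0 * (y - z))%C with (RtoC 0) by ring. rewrite Cmod_0.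
  apply Rmult_le_pos; [lra|apply Cmod_ge_0].
Qed.

Lemma cd_id (z : C) : cderiv (fun x => x) z 1.
Proof.
  intros eps He. exists 1. split; [lra|]. intros y _.
  replace (y - z - 1 * (y - z))%C with (RtoC 0) by ring. rewrite Cmod_0.
  apply Rmult_le_pos; [lra|apply Cmod_ge_0].
Qed.

Lemma cd_ext_loc (f g : C -> C) (z l : C) (d : R) : 0 < d ->
  (forall y, Cmod (y - z) < d -> f y = g y) -> cderiv f z l -> cderiv g z l.
Proof.
  intros Hd E H eps He. destruct (H eps He) as [d1 [Hd1 H1]].
  exists (Rmin d d1). split; [now apply Rmin_case|].
  intros y Hy. rewrite <- E by (eapply Rlt_le_trans; [apply Hy|apply Rmin_l]).
  rewrite <- (E z).
  - apply H1. eapply Rlt_le_trans; [apply Hy|apply Rmin_r].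
  - replace (z - z)%C with (RtoC 0) by ring. rewrite Cmod_0. lra.
Qed.

Lemma cd_ext (f g : C -> C) (z l : C) : (forall y, f y = g y) -> cderiv f z l -> cderiv g z l.
Proof. intros E. apply (cd_ext_loc f g z l 1); auto. lra. Qed.

Lemma cd_plus (f g : C -> C) (z l m : C) :
  cderiv f z l -> cderiv g z m -> cderiv (fun y => f y + g y)%C z (l + m).
Proof.
  intros Hf Hg eps He. destruct (Hf (eps/2) ltac:(lra)) as [d1 [P1 H1]].
  destruct (Hg (eps/2) ltac:(lra)) as [d2 [P2 H2]].
  exists (Rmin d1 d2). split; [now apply Rmin_case|]. intros y Hy.
  assert (B1 := Rmin_l d1 d2). assert (B2 := Rmin_r d1 d2).
  specialize (H1 y ltac:(lra)). specialize (H2 y ltac:(lra)).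
  replace (f y + g y - (f z + g z) - (l + m) * (y - z))%C with
    ((f y - f z - l * (y - z)) + (g y - g z - m * (y - z)))%C by ring.
  eapply Rle_trans. apply Cmod_triangle. lra.
Qed.

Lemma cd_comp (f g : C -> C) (z l m : C) :
  cderiv f z l -> cderiv g (f z) m -> cderiv (fun y => g (f y)) z (m * l).
Proof.
  intros Hf Hg eps He.
  destruct (cd_bound f z l Hf) as [d0 [M [Hd0 [HM HB]]]].
  assert (Hm := Cmod_ge_0 m).
  destruct (Hg (eps / (2 * M)) ltac:(apply Rdiv_lt_0_compat; lra)) as [d1 [P1 H1]].
  destruct (Hf (eps / (2 * (Cmod m + 1))) ltac:(apply Rdiv_lt_0_compat; lra)) as [d2 [P2 H2]].
  exists (Rmin d0 (Rmin (d1 / M) d2)). split.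
  { repeat apply Rmin_case; auto. now apply Rdiv_lt_0_compat. }
  intros y Hy.
  assert (B1 := Rmin_l d0 (Rmin (d1/M) d2)). assert (B2 := Rmin_r d0 (Rmin (d1/M) d2)).
  assert (B3 := Rmin_l (d1/M) d2). assert (B4 := Rmin_r (d1/M) d2).
  specialize (HB y ltac:(lra)). specialize (H2 y ltac:(lra)).
  assert (Hy0 := Cmod_ge_0 (y - z)).
  assert (HH : Cmod (f y - f z) < d1).
  { eapply Rle_lt_trans; [apply HB|]. assert (Q : Cmod (y - z) < d1 / M) by lra.
    apply (Rmult_lt_compat_l M) in Q; auto. replace (M * (d1 / M)) with d1 in Q by (field; lra). lra. }
  specialize (H1 (f y) HH).
  replace (g (f y) - g (f z) - m * l * (y - z))%C with
    ((g (f y) - g (f z) - m * (f y - f z)) + m * (f y - f z - l * (y - z)))%C by ring.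
  eapply Rle_trans. apply Cmod_triangle. rewrite Cmod_mult.
  apply Rle_trans with (eps / (2 * M) * (M * Cmod (y - z)) + Cmod m * (eps / (2 * (Cmod m + 1)) * Cmod (y - z))).
  - apply Rplus_le_compat.
    + eapply Rle_trans; [apply H1|]. apply Rmult_le_compat_l; auto.
      apply Rlt_le, Rdiv_lt_0_compat; lra.
    + now apply Rmult_le_compat_l.
  - replace (eps / (2 * M) * (M * Cmod (y - z))) with (eps / 2 * Cmod (y - z)) by (field; lra).
    replace (Cmod m * (eps / (2 * (Cmod m + 1)) * Cmod (y - z))) with
      ((Cmod m / (Cmod m + 1)) * (eps / 2 * Cmod (y - z))) by (field; lra).
    assert (Cmod m / (Cmod m + 1) <= 1).
    { apply (Rmult_le_reg_r (Cmod m + 1)); [lra|]. unfold Rdiv. rewrite Rmult_assoc, Rinv_l by lra. lra. }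
    assert (0 <= eps / 2 * Cmod (y - z)) by (apply Rmult_le_pos; lra).
    nra.
Qed.

Lemma cd_sqr (z : C) : cderiv (fun y => y * y)%C z (2 * z).
Proof.
  intros eps He. exists eps. split; auto. intros y Hy.
  replace (y * y - z * z - 2 * z * (y - z))%C with ((y - z) * (y - z))%C by ring.
  rewrite Cmod_mult. assert (0 <= Cmod (y - z)) by apply Cmod_ge_0. nra.
Qed.

Lemma cd_scal (c : C) (f : C -> C) (z l : C) :
  cderiv f z l -> cderiv (fun y => c * f y)%C z (c * l).
Proof.
  intros H. apply (cd_comp f (fun x => c * x)%C z l c H).
  intros eps He. exists 1. split; [lra|]. intros y _.
  replace (c * y - c * f z - c * (y - f z))%C with (RtoC 0) by ring. rewrite Cmod_0.
  apply Rmult_le_pos; [lra|apply Cmod_ge_0].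
Qed.

(* Polarization reduces products to squares. *)
Lemma cd_mult (f g : C -> C) (z l m : C) :
  cderiv f z l -> cderiv g z m -> cderiv (fun y => f y * g y)%C z (l * g z + f z * m).
Proof.
  intros Hf Hg.
  assert (S := cd_plus f g z l m Hf Hg).
  assert (D := cd_plus f (fun y => (-(1)) * g y)%C z l (-(1) * m) Hf (cd_scal _ _ _ _ Hg)).
  assert (S2 := cd_comp _ (fun y => y * y)%C z _ _ S (cd_sqr _)).
  assert (D2 := cd_comp _ (fun y => y * y)%C z _ _ D (cd_sqr _)).
  assert (RR := cd_plus _ _ _ _ _ (cd_scal (/4) _ _ _ S2) (cd_scal (-/4) _ _ _ D2)).
  simpl in RR.
  assert (N4 : RtoC 4 <> 0%C) by (intros E; apply RtoC_inj in E; lra).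
  match type of RR with cderiv _ _ ?L => replace (l * g z + f z * m)%C with L by (field; auto) end.
  eapply cd_ext; [|exact RR]. intros y. simpl. field; auto.
Qed.

Lemma cd_minus (f g : C -> C) (z l m : C) :
  cderiv f z l -> cderiv g z m -> cderiv (fun y => f y - g y)%C z (l - m).
Proof.
  intros Hf Hg. replace (l - m)%C with (l + -(1) * m)%C by ring.
  eapply cd_ext; [|apply (cd_plus _ _ _ _ _ Hf (cd_scal (-(1))%C _ _ _ Hg))].
  intros y. simpl. ring.
Qed.

Lemma cd_inv (z : C) : z <> 0%C -> cderiv (fun y => / y)%C z (- (/ z * / z)).
Proof.
  intros Hz eps He.
  assert (Pz : 0 < Cmod z) by now apply Cmod_gt_0.
  (* The first bound keeps |y| above |z| / 2; with it the second makes the remainder |y - z|^2 /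
     (|y| |z|^2) at most eps |y - z|. *)
  exists (Rmin (Cmod z / 2) (eps * (Cmod z * Cmod z * Cmod z) / 2)). split.
  { apply Rmin_case; [lra|]. apply Rdiv_lt_0_compat; [|lra]. repeat apply Rmult_lt_0_compat; auto. }
  intros y Hy.
  assert (B1 := Rmin_l (Cmod z / 2) (eps * (Cmod z * Cmod z * Cmod z) / 2)).
  assert (B2 := Rmin_r (Cmod z / 2) (eps * (Cmod z * Cmod z * Cmod z) / 2)).
  assert (Hyz : Cmod z / 2 < Cmod y).
  { assert (H := Cmod_triang_inv z y). rewrite Cmod_sym in H. lra. }
  assert (y <> 0%C) by (apply Cmod_gt_0; lra).
  replace (/ y - / z - - (/ z * / z) * (y - z))%C with
    ((y - z) * ((y - z) * (/ y * (/ z * / z))))%C by (field; auto).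
  rewrite Cmod_mult, Rmult_comm. apply Rmult_le_compat_r; [apply Cmod_ge_0|].
  rewrite !Cmod_mult, !Cmod_inv by auto.
  apply (Rmult_le_reg_r (Cmod y * (Cmod z * Cmod z))).
  { repeat apply Rmult_lt_0_compat; lra. }
  replace (Cmod (y - z) * (/ Cmod y * (/ Cmod z * / Cmod z)) * (Cmod y * (Cmod z * Cmod z)))
    with (Cmod (y - z)) by (field; lra).
  assert (0 < Cmod z * Cmod z) by nra.
  assert (eps * (Cmod z * Cmod z * Cmod z) / 2 <= eps * (Cmod y * (Cmod z * Cmod z))).
  { apply Rle_trans with (eps * (Cmod z / 2 * (Cmod z * Cmod z))); [right; field|].
    apply Rmult_le_compat_l; [lra|]. apply Rmult_le_compat_r; lra. }
  lra.
Qed.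

(** * The complex exponential *)

Lemma Cexp_plus (x y : C) : Cexp (x + y) = (Cexp x * Cexp y)%C.
Proof.
  destruct x as [a b], y as [c d]. unfold Cexp, Cplus, Cmult; simpl.
  rewrite exp_plus, cos_plus, sin_plus. f_equal; ring.
Qed.

Lemma Cexp_0 : Cexp 0 = 1%C.
Proof. unfold Cexp, RtoC; simpl. rewrite exp_0, cos_0, sin_0. f_equal; ring. Qed.

Lemma Cmod_Cexp (z : C) : Cmod (Cexp z) = exp (Re z).
Proof.
  unfold Cmod, Cexp. simpl.
  replace (_ + _) with ((exp (Re z))² * ((sin (Im z))² + (cos (Im z))²)) by (unfold Rsqr; ring).
  rewrite sin2_cos2, Rmult_1_r. apply sqrt_Rsqr. apply Rlt_le, exp_pos.
Qed.

Lemma Cexp_neq0 (z : C) : Cexp z <> 0%C.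
Proof. apply Cmod_gt_0. rewrite Cmod_Cexp. apply exp_pos. Qed.

Lemma Cexp_R (x : R) : Cexp x = RtoC (exp x).
Proof. unfold Cexp, RtoC; simpl. rewrite cos_0, sin_0. f_equal; ring. Qed.

Lemma Cexp_opp (z : C) : Cexp (- z) = (/ Cexp z)%C.
Proof.
  assert (H : (Cexp (- z) * Cexp z = 1)%C).
  { rewrite <- Cexp_plus. replace (- z + z)%C with (RtoC 0) by ring. apply Cexp_0. }
  rewrite <- (Cmult_1_r (Cexp (- z))).
  rewrite <- (Cinv_r (Cexp z)) by apply Cexp_neq0.
  rewrite Cmult_assoc, H. ring.
Qed.

Lemma Cexp_pow (z : C) (n : nat) : Cexp (INR n * z) = (Cexp z ^ n)%C.
Proof.
  induction n.
  - simpl. rewrite Cmult_0_l. apply Cexp_0.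
  - rewrite S_INR, RtoC_plus. replace ((INR n + 1) * z)%C with (z + INR n * z)%C by ring.
    rewrite Cexp_plus, IHn. reflexivity.
Qed.

Lemma derivable_lin (f : R -> R) (l : R) : derivable_pt_lim f 0 l ->
  forall eps, 0 < eps -> exists d, 0 < d /\
   forall h, Rabs h < d -> Rabs (f h - f 0 - l * h) <= eps * Rabs h.
Proof.
  intros H eps He. destruct (H eps He) as [d Hd]. exists d. split; [apply cond_pos|].
  intros h Hh. destruct (Req_dec h 0) as [->|Hn].
  - replace (f 0 - f 0 - l * 0) with 0 by ring. rewrite !Rabs_R0. lra.
  - specialize (Hd h Hn Hh). rewrite Rplus_0_l in Hd.
    replace (f h - f 0 - l * h) with (((f h - f 0) / h - l) * h) by (field; auto).
    rewrite Rabs_mult. apply Rmult_le_compat_r; [apply Rabs_pos|lra].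
Qed.

Lemma im_le_Cmod (z : C) : Rabs (Im z) <= Cmod z.
Proof. eapply Rle_trans; [|apply Rmax_Cmod]. apply Rmax_r. Qed.

Lemma Ceq (x y : C) : Re x = Re y -> Im x = Im y -> x = y.
Proof. destruct x, y; simpl; now intros -> ->. Qed.

Lemma Cmod_le_re_im (z : C) : Cmod z <= Rabs (Re z) + Rabs (Im z).
Proof.
  destruct z as [x y]. simpl.
  replace ((x, y) : C) with (RtoC x + Ci * RtoC y)%C by (apply Ceq; simpl; ring).
  eapply Rle_trans; [apply Cmod_triangle|].
  rewrite Cmod_mult, Cmod_Ci, !Cmod_R. lra.
Qed.

Lemma cd_Cexp_0 : cderiv Cexp 0 1.
Proof.
  intros eps He.
  (* The four error terms below add up to at most 6 [e] |y|; [e <= 1] gives |exp a - 1| <= 2 |a|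
     and, with |a| < e / 2, also exp a <= 2. *)
  set (e := Rmin (eps / 8) 1).
  assert (He1 : 0 < e) by (apply Rmin_case; lra).
  assert (He2 : e <= eps / 8) by apply Rmin_l. assert (He3 : e <= 1) by apply Rmin_r.
  destruct (derivable_lin exp 1 derivable_pt_lim_exp_0 e He1) as [d1 [P1 H1]].
  assert (Dc : derivable_pt_lim cos 0 0).
  { replace 0 with (- sin 0) at 2 by (rewrite sin_0; ring). apply derivable_pt_lim_cos. }
  assert (Ds : derivable_pt_lim sin 0 1).
  { rewrite <- cos_0. apply derivable_pt_lim_sin. }
  destruct (derivable_lin cos 0 Dc e He1) as [d2 [P2 H2]].
  destruct (derivable_lin sin 1 Ds e He1) as [d3 [P3 H3]].
  exists (Rmin (Rmin d1 (e / 2)) (Rmin d2 d3)). split.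
  { repeat apply Rmin_case; auto; lra. }
  intros y Hy. replace (y - 0)%C with y in * by ring.
  pose proof (Rmin_l (Rmin d1 (e / 2)) (Rmin d2 d3)). pose proof (Rmin_r (Rmin d1 (e / 2)) (Rmin d2 d3)).
  pose proof (Rmin_l d1 (e / 2)). pose proof (Rmin_r d1 (e / 2)).
  pose proof (Rmin_l d2 d3). pose proof (Rmin_r d2 d3).
  destruct y as [a b].
  assert (Ra := re_le_Cmod (a, b)). assert (Rb := im_le_Cmod (a, b)). simpl in Ra, Rb.
  specialize (H1 a ltac:(lra)). specialize (H2 b ltac:(lra)). specialize (H3 b ltac:(lra)).
  rewrite exp_0 in H1. rewrite cos_0 in H2. rewrite sin_0 in H3.
  set (m := Cmod (a, b)) in *. assert (0 <= m) by apply Cmod_ge_0.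
  assert (Pa := Rabs_pos a). assert (Pb := Rabs_pos b).
  assert (Ea : Rabs (exp a - 1) <= 2 * Rabs a).
  { replace (exp a - 1) with ((exp a - 1 - 1 * a) + a) by ring.
    eapply Rle_trans; [apply Rabs_triang|].
    assert (e * Rabs a <= 1 * Rabs a) by (apply Rmult_le_compat_r; lra). lra. }
  assert (Ea2 : Rabs (exp a) <= 2).
  { replace (exp a) with ((exp a - 1) + 1) by ring.
    eapply Rle_trans; [apply Rabs_triang|]. rewrite Rabs_R1. lra. }
  rewrite Cexp_0. eapply Rle_trans; [apply Cmod_le_re_im|].
  replace (Re (Cexp (a, b) - 1 - 1 * (a, b))) with
    ((exp a - 1 - 1 * a) + exp a * (cos b - 1 - 0 * b)) by (unfold Re, Cexp; simpl; ring).
  replace (Im (Cexp (a, b) - 1 - 1 * (a, b))) with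
    (exp a * (sin b - 0 - 1 * b) + (exp a - 1) * b) by (unfold Im, Cexp; simpl; ring).
  assert (T1 := Rabs_triang (exp a - 1 - 1 * a) (exp a * (cos b - 1 - 0 * b))).
  assert (T2 := Rabs_triang (exp a * (sin b - 0 - 1 * b)) ((exp a - 1) * b)).
  rewrite Rabs_mult in T1. rewrite (Rabs_mult (exp a)), (Rabs_mult (exp a - 1) b) in T2.
  assert (Q1 : Rabs (exp a) * Rabs (cos b - 1 - 0 * b) <= 2 * (e * m)).
  { apply Rmult_le_compat; try apply Rabs_pos; auto.
    eapply Rle_trans; [apply H2|]. apply Rmult_le_compat_l; lra. }
  assert (Q2 : Rabs (exp a) * Rabs (sin b - 0 - 1 * b) <= 2 * (e * m)).
  { apply Rmult_le_compat; try apply Rabs_pos; auto.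
    eapply Rle_trans; [apply H3|]. apply Rmult_le_compat_l; lra. }
  assert (Q3 : Rabs (exp a - 1) * Rabs b <= e * m).
  { apply Rmult_le_compat; try apply Rabs_pos; auto. lra. }
  assert (Q4 : Rabs (exp a - 1 - 1 * a) <= e * m).
  { eapply Rle_trans; [apply H1|]. apply Rmult_le_compat_l; lra. }
  assert (8 * (e * m) <= eps * m) by (assert (e * m <= eps / 8 * m) by (apply Rmult_le_compat_r; lra); lra).
  assert (0 <= e * m) by (apply Rmult_le_pos; lra). lra.
Qed.

Lemma cd_Cexp (z : C) : cderiv Cexp z (Cexp z).
Proof.
  intros eps He.
  assert (P : 0 < Cmod (Cexp z)) by (apply Cmod_gt_0, Cexp_neq0).
  destruct (cd_Cexp_0 (eps / Cmod (Cexp z))) as [d [Hd H]]; [now apply Rdiv_lt_0_compat|].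
  exists d. split; auto. intros y Hy.
  specialize (H (y - z)%C). replace (y - z - 0)%C with (y - z)%C in H by ring.
  specialize (H Hy). rewrite Cexp_0 in H.
  replace (Cexp y) with (Cexp z * Cexp (y - z))%C by (rewrite <- Cexp_plus; f_equal; ring).
  replace (Cexp z * Cexp (y - z) - Cexp z - Cexp z * (y - z))%C with
    (Cexp z * (Cexp (y - z) - 1 - 1 * (y - z)))%C by ring.
  rewrite Cmod_mult. apply Rle_trans with (Cmod (Cexp z) * (eps / Cmod (Cexp z) * Cmod (y - z))).
  - apply Rmult_le_compat_l; lra.
  - right. field. lra.
Qed.

Lemma cd_pow (f : C -> C) (z l : C) (n : nat) : cderiv f z l -> exists m, cderiv (fun y => f y ^ n)%C z m.
Proof.
  intros H. induction n as [|n [m Hm]].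
  - exists 0%C. apply (cd_const 1).
  - eexists. apply (cd_mult f (fun y => f y ^ n)%C); eauto.
Qed.

Definition holo (H : C -> C) : Prop := forall z, exists l, cderiv H z l.

Lemma holo_const (c : C) : holo (fun _ => c).
Proof. intros z. eexists. apply cd_const. Qed.
Lemma holo_id : holo (fun z => z).
Proof. intros z. eexists. apply cd_id. Qed.
Lemma holo_plus (f g : C -> C) : holo f -> holo g -> holo (fun z => f z + g z)%C.
Proof. intros Hf Hg z. destruct (Hf z), (Hg z). eexists. apply cd_plus; eauto. Qed.
Lemma holo_mult (f g : C -> C) : holo f -> holo g -> holo (fun z => f z * g z)%C.
Proof. intros Hf Hg z. destruct (Hf z), (Hg z). eexists. apply cd_mult; eauto. Qed.
Lemma holo_Cexp (f : C -> C) : holo f -> holo (fun z => Cexp (f z)).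
Proof. intros Hf z. destruct (Hf z). eexists. apply (cd_comp f Cexp); eauto. apply cd_Cexp. Qed.
Lemma holo_opp (f : C -> C) : holo f -> holo (fun z => - f z)%C.
Proof.
  intros Hf z. destruct (Hf z) as [l Hl]. exists (0 - l)%C.
  eapply cd_ext; [|apply (cd_minus (fun _ => 0%C) f z 0 l (cd_const 0 z) Hl)]. intros y. simpl. ring.
Qed.
Ltac solve_holo := repeat first [ assumption | apply holo_const | apply holo_id | apply holo_Cexp | apply holo_plus | apply holo_mult | apply holo_opp ].

(** * Integration of C-valued functions *)

Definition cint (f : R -> C) (a b : R) : C :=
  RInt (V := C_R_CompleteNormedModule) f a b.

Definition Cont (f : R -> C) : Prop := forall t : R, ctn f t.

Lemma ex_RInt_Cont (f : R -> C) (a b : R) : Cont f ->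
  ex_RInt (V := C_R_CompleteNormedModule) f a b.
Proof. intros H. apply (ex_RInt_continuous (V := C_R_CompleteNormedModule)). intros z _. apply H. Qed.

Lemma is_RInt_cint (f : R -> C) (a b : R) : Cont f ->
  is_RInt (V := C_R_NormedModule) f a b (cint f a b).
Proof. intros H. apply (RInt_correct (V := C_R_CompleteNormedModule)). now apply ex_RInt_Cont. Qed.

Lemma cint_re (f : R -> C) (a b : R) : Cont f ->
  Re (cint f a b) = RInt (fun t => Re (f t)) a b.
Proof.
  intros H. symmetry. apply is_RInt_unique.
  apply (is_RInt_fct_extend_fst (U := R_NormedModule) (V := R_NormedModule)).
  now apply is_RInt_cint.
Qed.

Lemma cint_im (f : R -> C) (a b : R) : Cont f ->
  Im (cint f a b) = RInt (fun t => Im (f t)) a b.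
Proof.
  intros H. symmetry. apply is_RInt_unique.
  apply (is_RInt_fct_extend_snd (U := R_NormedModule) (V := R_NormedModule)).
  now apply is_RInt_cint.
Qed.

Lemma cint_pair (f : R -> C) (a b : R) (x y : R) :
  is_RInt (fun t => Re (f t)) a b x -> is_RInt (fun t => Im (f t)) a b y ->
  cint f a b = (x, y).
Proof.
  intros H1 H2. apply (is_RInt_unique (V := C_R_CompleteNormedModule)).
  now apply (is_RInt_fct_extend_pair (U := R_NormedModule) (V := R_NormedModule)).
Qed.

Lemma cint_ext (f g : R -> C) (a b : R) : (forall x, f x = g x) -> cint f a b = cint g a b.
Proof. intros H. apply (RInt_ext (V := C_R_CompleteNormedModule)). intros; apply H. Qed.

Lemma cint_plus (f g : R -> C) (a b : R) : Cont f -> Cont g ->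
  cint (fun t => f t + g t)%C a b = (cint f a b + cint g a b)%C.
Proof.
  intros Hf Hg. apply (RInt_plus (V := C_R_CompleteNormedModule)); now apply ex_RInt_Cont.
Qed.

Lemma cint_Chasles (f : R -> C) (a b c : R) : Cont f ->
  (cint f a b + cint f b c)%C = cint f a c.
Proof. intros H. apply (RInt_Chasles (V := C_R_CompleteNormedModule)); now apply ex_RInt_Cont. Qed.

Lemma cint_swap (f : R -> C) (a b : R) : Cont f -> cint f b a = (- cint f a b)%C.
Proof.
  intros H. symmetry. apply (opp_RInt_swap (V := C_R_CompleteNormedModule)).
  now apply ex_RInt_Cont.
Qed.

Lemma cint_point (f : R -> C) (a : R) : cint f a a = 0%C.
Proof. apply (RInt_point (V := C_R_CompleteNormedModule)). Qed.

Lemma Cont_ext (f g : R -> C) : (forall t, f t = g t) -> Cont f -> Cont g.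
Proof. intros E H t. eapply ctn_ext; [apply E|apply H]. Qed.

Lemma Cont_scal (c : C) (f : R -> C) : Cont f -> Cont (fun t => c * f t)%C.
Proof. intros H t. apply ctn_mult; [apply ctn_const|apply H]. Qed.

Lemma Cont_plus (f g : R -> C) : Cont f -> Cont g -> Cont (fun t => f t + g t)%C.
Proof. intros Hf Hg t. apply ctn_plus; [apply Hf|apply Hg]. Qed.

Lemma Cont_mult (f g : R -> C) : Cont f -> Cont g -> Cont (fun t => f t * g t)%C.
Proof. intros Hf Hg t. apply ctn_mult; [apply Hf|apply Hg]. Qed.

Lemma is_RInt_lin2 (u v : R -> R) (a b x y p q : R) :
  is_RInt u a b x -> is_RInt v a b y ->
  is_RInt (fun t => p * u t + q * v t) a b (p * x + q * y).
Proof.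
  intros Hu Hv.
  apply (is_RInt_plus (V := R_NormedModule)); now apply (is_RInt_scal (V := R_NormedModule)).
Qed.

(** The integral takes values in a module over R, which provides real scalars only; for complex [c]
    the components are recombined by hand. *)
Lemma cint_scal (c : C) (f : R -> C) (a b : R) : Cont f ->
  cint (fun t => c * f t)%C a b = (c * cint f a b)%C.
Proof.
  intros H.
  assert (H1 := is_RInt_cint f a b H).
  assert (R1 := is_RInt_fct_extend_fst (U := R_NormedModule) (V := R_NormedModule) _ _ _ _ H1).
  assert (R2 := is_RInt_fct_extend_snd (U := R_NormedModule) (V := R_NormedModule) _ _ _ _ H1).
  replace (c * cint f a b)%C with (Re c * Re (cint f a b) + (- Im c) * Im (cint f a b),
     Im c * Re (cint f a b) + Re c * Im (cint f a b))
    by (apply Ceq; unfold Cmult, Re, Im; simpl; ring).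
  apply cint_pair.
  - eapply is_RInt_ext; [|apply (is_RInt_lin2 _ _ _ _ _ _ (Re c) (- Im c) R1 R2)].
    intros x _. unfold Cmult, Re, Im. simpl. ring.
  - eapply is_RInt_ext; [|apply (is_RInt_lin2 _ _ _ _ _ _ (Im c) (Re c) R1 R2)].
    intros x _. unfold Cmult, Re, Im. simpl. ring.
Qed.

Lemma cint_minus (f g : R -> C) (a b : R) : Cont f -> Cont g ->
  cint (fun t => f t - g t)%C a b = (cint f a b - cint g a b)%C.
Proof.
  intros Hf Hg. apply (RInt_minus (V := C_R_CompleteNormedModule)); now apply ex_RInt_Cont.
Qed.

Lemma cint_norm_le (f : R -> C) (g : R -> R) (a b l : R) : a <= b -> Cont f ->
  (forall t, a <= t <= b -> Cmod (f t) <= g t) -> is_RInt g a b l ->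
  Cmod (cint f a b) <= l.
Proof.
  intros Hab Hf Hg HI. rewrite Cmod_norm.
  apply (norm_RInt_le (V := C_R_NormedModule) f g a b _ _ Hab); auto.
  - intros x Hx. specialize (Hg x Hx). now rewrite Cmod_norm in Hg.
  - now apply is_RInt_cint.
Qed.

Lemma cint_norm_const (f : R -> C) (a b M : R) : a <= b -> Cont f ->
  (forall t, a <= t <= b -> Cmod (f t) <= M) -> Cmod (cint f a b) <= (b - a) * M.
Proof.
  intros Hab Hf Hg. apply (cint_norm_le f (fun _ => M)); auto.
  apply (is_RInt_const (V := R_NormedModule)).
Qed.

Lemma scal_C (u : R) (z : C) : scal (V := C_R_CompleteNormedModule) u z = (RtoC u * z)%C.
Proof.
  destruct z as [x y].
  change (scal (V := C_R_CompleteNormedModule) u (x, y)) with ((u * x, u * y) : C).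
  unfold Cmult; simpl. f_equal; ring.
Qed.

Lemma cint_comp_lin (f : R -> C) (u v a b : R) : Cont f ->
  (u * cint (fun t => f (u * t + v)%R) a b)%C = cint f (u * a + v) (u * b + v).
Proof.
  intros H. rewrite <- cint_scal.
  - unfold cint.
    rewrite <- (RInt_comp_lin (V := C_R_CompleteNormedModule)) by now apply ex_RInt_Cont.
    apply (RInt_ext (V := C_R_CompleteNormedModule)). intros x _. symmetry. apply scal_C.
  - intros t. apply (ctn_Rcomp (fun t => u * t + v)); [|apply H].
    solve_ctn.
Qed.

Lemma cint_shift (f : R -> C) (v a b : R) : Cont f ->
  cint (fun t => f (t + v)%R) a b = cint f (a + v) (b + v).
Proof.
  intros H. assert (E := cint_comp_lin f 1 v a b H). rewrite !Rmult_1_l in E. rewrite <- E.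
  rewrite Cmult_1_l. apply cint_ext. intros x. now rewrite Rmult_1_l.
Qed.

Lemma cint_reflect (f : R -> C) (a b : R) : Cont f ->
  cint (fun t => f (- t)%R) a b = cint f (- b) (- a).
Proof.
  intros H. assert (E := cint_comp_lin f (-1) 0 a b H).
  rewrite (cint_swap f (- a) (- b)) by auto.
  replace (-1 * a + 0) with (- a) in E by ring. replace (-1 * b + 0) with (- b) in E by ring.
  rewrite <- E. rewrite (cint_ext (fun t => f (- t)%R) (fun t => f (-1 * t + 0)%R)).
  - replace (RtoC (-1)) with (- (1))%C by (rewrite <- RtoC_opp; f_equal; lra). ring.
  - intros x. f_equal. ring.
Qed.

(** * Integrals depending on a parameter, and Fubini on rectangles *)

Definition Cont2 (g : R -> R -> C) : Prop :=
  forall u t : R, continuous (T := prod_UniformSpace R_UniformSpace R_UniformSpace)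
    (U := C_UniformSpace) (fun p : R * R => g (fst p) (snd p)) (u, t).

Lemma Cont2_l (g : R -> R -> C) (t : R) : Cont2 g -> Cont (fun u => g u t).
Proof.
  intros H u.
  apply (continuous_comp (U := R_UniformSpace) (V := prod_UniformSpace R_UniformSpace R_UniformSpace) (W := C_UniformSpace)
     (fun u : R => (u, t)) (fun p : R * R => g (fst p) (snd p)) u).
  - apply (ctn_pair (T := R_UniformSpace)); [apply (continuous_id (U := R_UniformSpace))|apply continuous_const].
  - apply H.
Qed.

Lemma Cont2_r (g : R -> R -> C) (u : R) : Cont2 g -> Cont (g u).
Proof.
  intros H t.
  apply (continuous_comp (U := R_UniformSpace) (V := prod_UniformSpace R_UniformSpace R_UniformSpace) (W := C_UniformSpace)
     (fun t : R => (u, t)) (fun p : R * R => g (fst p) (snd p)) t).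
  - apply (ctn_pair (T := R_UniformSpace)); [apply continuous_const|apply (continuous_id (U := R_UniformSpace))].
  - apply H.
Qed.

(** For a <= b this is uniform continuity along [a, b]; the 1 in b - a + 1 covers a = b. The other
    orientation follows by a sign. *)
Lemma RInt_param_continuous (g : R -> R -> R) (a b t : R) :
  (forall u t, continuity_2d_pt g u t) ->
  continuous (fun t => RInt (fun u => g u t) a b) t.
Proof.
  intros H.
  assert (W : forall a b, a <= b -> continuous (fun t => RInt (fun u => g u t) a b) t).
  { clear a b. intros a b Hab. apply continuity_pt_filterlim. intros eps He.
    assert (P : 0 < eps / (2 * (b - a + 1))) by (apply Rdiv_lt_0_compat; lra).
    destruct (uniform_continuity_2d_1d g a b t (fun x _ => H x t) (mkposreal _ P)) as [d Hd].
    exists d. split; [apply cond_pos|].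
    intros y [_ Hy]. simpl in Hy |- *. unfold R_dist in *.
    assert (EX : forall s, ex_RInt (fun u => g u s) a b).
    { intros s. apply (ex_RInt_continuous (V := R_CompleteNormedModule)). intros x _.
      apply continuity_pt_filterlim. intros e2 He2.
      destruct (H x s (mkposreal e2 He2)) as [d2 Hd2]. exists d2. split; [apply cond_pos|].
      intros w [_ Hw]. apply Hd2; [exact Hw|]. rewrite Rminus_diag, Rabs_R0. apply cond_pos. }
    assert (E : RInt (fun u => g u y) a b - RInt (fun u => g u t) a b =
                RInt (fun u => g u y - g u t) a b).
    { symmetry. apply (RInt_minus (V := R_CompleteNormedModule)); apply EX. }
    rewrite E.
    apply Rle_lt_trans with ((b - a) * (eps / (2 * (b - a + 1)))).
    - apply (norm_RInt_le_const (V := R_NormedModule) (fun u => g u y - g u t) a b); auto.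
      + intros x Hx. apply Rlt_le. apply (Hd x t x y); auto; try (split; lra).
        * destruct d; simpl in *; lra.
        * apply Rabs_lt_between in Hy. lra.
        * rewrite Rminus_diag, Rabs_R0. apply cond_pos.
      + apply (RInt_correct (V := R_CompleteNormedModule)). apply (ex_RInt_minus (V := R_CompleteNormedModule)); apply EX.
    - apply Rle_lt_trans with (eps / 2); [|lra].
      replace ((b - a) * (eps / (2 * (b - a + 1)))) with ((b - a) / (b - a + 1) * (eps / 2)) by (field; lra).
      assert ((b - a) / (b - a + 1) <= 1).
      { apply (Rmult_le_reg_r (b - a + 1)); [lra|]. unfold Rdiv. rewrite Rmult_assoc, Rinv_l by lra. lra. }
      assert (0 < eps / 2) by lra. nra. }
  destruct (Rle_or_lt a b) as [Hab|Hab]; [now apply W|].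
  apply (continuous_ext (fun t => opp (RInt (fun u => g u t) b a))).
  - intros s. apply (opp_RInt_swap (V := R_CompleteNormedModule)).
    apply (ex_RInt_continuous (V := R_CompleteNormedModule)). intros x _.
    apply continuity_pt_filterlim. intros e2 He2.
    destruct (H x s (mkposreal e2 He2)) as [d2 Hd2]. exists d2. split; [apply cond_pos|].
    intros w [_ Hw]. apply Hd2; [exact Hw|]. rewrite Rminus_diag, Rabs_R0. apply cond_pos.
  - apply (continuous_opp (K := R_AbsRing) (V := R_NormedModule)). apply W. lra.
Qed.

(** As functions of the upper limit [d] both sides vanish at [c] and have the same derivative, by
    differentiation under the integral sign. *)
Lemma RInt_Fubini (g : R -> R -> R) (a b c d : R) :
  (forall u t, continuity_2d_pt g u t) ->
  RInt (fun t => RInt (fun u => g u t) a b) c d =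
  RInt (fun u => RInt (fun t => g u t) c d) a b.
Proof.
  intros H.
  assert (Hsym : forall u t, continuity_2d_pt (fun t u => g u t) t u).
  { intros u t eps. destruct (H u t eps) as [e He]. exists e. intros; now apply He. }
  assert (Cr : forall u t, continuous (fun t => g u t) t).
  { intros u t. apply continuity_pt_filterlim. intros e2 He2.
    destruct (H u t (mkposreal e2 He2)) as [d2 Hd2]. exists d2. split; [apply cond_pos|].
    intros w [_ Hw]. apply Hd2; [|exact Hw]. rewrite Rminus_diag, Rabs_R0. apply cond_pos. }
  assert (D : forall T, is_derive (fun T => RInt (fun u => RInt (fun t => g u t) c T) a b) T
                (RInt (fun u => g u T) a b)).
  { intros T.
    assert (DD : forall T u, is_derive (fun T => RInt (fun t => g u t) c T) T (g u T)).
    { intros T' u. apply (is_derive_RInt (V := R_NormedModule) _ _ c).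
      - apply filter_forall. intros y. apply (RInt_correct (V := R_CompleteNormedModule)).
        apply (ex_RInt_continuous (V := R_CompleteNormedModule)). intros; apply Cr.
      - apply Cr. }
    assert (E : RInt (fun u => g u T) a b =
      RInt (fun u => Derive (fun T => RInt (fun t => g u t) c T) T) a b).
    { apply RInt_ext. intros u _. symmetry. now apply is_derive_unique. }
    rewrite E.
    apply (is_derive_RInt_param (fun T u => RInt (fun t => g u t) c T)).
    - apply filter_forall. intros y u _. exists (g u y). apply DD.
    - intros u _. apply (continuity_2d_pt_ext (fun t u => g u t)).
      + intros x y. symmetry. now apply is_derive_unique.
      + apply Hsym.
    - apply filter_forall. intros y. apply (ex_RInt_continuous (V := R_CompleteNormedModule)).
      intros z _. apply (RInt_param_continuous (fun t u => g u t)). intros; apply Hsym. }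
  assert (I := is_RInt_derive (V := R_CompleteNormedModule) _ _ c d (fun x _ => D x)
     (fun x _ => RInt_param_continuous g a b x H)).
  apply is_RInt_unique in I. rewrite I.
  assert (Z : RInt (fun u => RInt (fun t => g u t) c c) a b = 0).
  { rewrite (RInt_ext _ (fun _ => 0)).
    - rewrite RInt_const. apply (scal_zero_r (K := R_AbsRing) (V := R_NormedModule)).
    - intros u _. apply (RInt_point (V := R_CompleteNormedModule)). }
  rewrite Z. unfold minus, plus, opp; simpl. ring.
Qed.

Lemma cint_param_cont (g : R -> R -> C) (a b : R) : Cont2 g ->
  Cont (fun t => cint (fun u => g u t) a b).
Proof.
  intros H t.
  apply (ctn_ext (fun t => (RInt (fun u => Re (g u t)) a b, RInt (fun u => Im (g u t)) a b) : C)).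
  - intros s. apply Ceq; simpl.
    + symmetry. apply (cint_re (fun u => g u s)). now apply Cont2_l.
    + symmetry. apply (cint_im (fun u => g u s)). now apply Cont2_l.
  - apply ctn_pair; apply RInt_param_continuous; intros u s; apply continuity_2d_pt_filterlim.
    + apply (ctn_re (T := prod_UniformSpace R_UniformSpace R_UniformSpace) (fun p : R * R => g (fst p) (snd p)) (u, s)), H.
    + apply (ctn_im (T := prod_UniformSpace R_UniformSpace R_UniformSpace) (fun p : R * R => g (fst p) (snd p)) (u, s)), H.
Qed.

Lemma Cont2_sym (g : R -> R -> C) : Cont2 g -> Cont2 (fun t u => g u t).
Proof.
  intros H t u.
  apply (continuous_comp (U := prod_UniformSpace R_UniformSpace R_UniformSpace)
    (V := prod_UniformSpace R_UniformSpace R_UniformSpace) (W := C_UniformSpace)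
    (fun p : R * R => (snd p, fst p)) (fun p : R * R => g (fst p) (snd p)) (t, u)).
  - apply (ctn_pair (T := prod_UniformSpace R_UniformSpace R_UniformSpace)); solve_ctn.
  - apply H.
Qed.

Lemma cint_Fubini (g : R -> R -> C) (a b c d : R) : Cont2 g ->
  cint (fun t => cint (fun u => g u t) a b) c d =
  cint (fun u => cint (fun t => g u t) c d) a b.
Proof.
  intros H. assert (Hs := Cont2_sym g H).
  apply Ceq.
  - rewrite (cint_re _ c d) by now apply cint_param_cont.
    rewrite (cint_re _ a b) by now apply (cint_param_cont (fun t u => g u t)).
    rewrite (RInt_ext _ (fun t => RInt (fun u => Re (g u t)) a b))
      by (intros x _; apply (cint_re (fun u => g u x)); now apply Cont2_l).
    rewrite (RInt_ext (fun t => Re _) (fun u => RInt (fun t => Re (g u t)) c d))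
      by (intros x _; apply (cint_re (fun t => g x t)); now apply Cont2_r).
    apply (RInt_Fubini (fun u t => Re (g u t))). intros u t. apply continuity_2d_pt_filterlim.
    apply (ctn_re (T := prod_UniformSpace R_UniformSpace R_UniformSpace) (fun p : R * R => g (fst p) (snd p)) (u, t)), H.
  - rewrite (cint_im _ c d) by now apply cint_param_cont.
    rewrite (cint_im _ a b) by now apply (cint_param_cont (fun t u => g u t)).
    rewrite (RInt_ext _ (fun t => RInt (fun u => Im (g u t)) a b))
      by (intros x _; apply (cint_im (fun u => g u x)); now apply Cont2_l).
    rewrite (RInt_ext (fun t => Im _) (fun u => RInt (fun t => Im (g u t)) c d))
      by (intros x _; apply (cint_im (fun t => g x t)); now apply Cont2_r).
    apply (RInt_Fubini (fun u t => Im (g u t))). intros u t. apply continuity_2d_pt_filterlim.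
    apply (ctn_im (T := prod_UniformSpace R_UniformSpace R_UniformSpace) (fun p : R * R => g (fst p) (snd p)) (u, t)), H.
Qed.

(** * Integrals over R of exponentially decaying functions *)

Definition exp_decay (K : R) (f : R -> C) : Prop :=
  forall t : R, Cmod (f t) <= K * exp (- Rabs t).

(* Principal value over R, meaningful for integrands satisfying [exp_decay]. *)
Definition line_int (f : R -> C) : C :=
  (real (Lim_seq (fun n => Re (cint f (- INR n) (INR n)))),
   real (Lim_seq (fun n => Im (cint f (- INR n) (INR n))))).

Lemma dec_pos (K : R) (f : R -> C) : exp_decay K f -> 0 <= K.
Proof.
  intros H. specialize (H 0). rewrite Rabs_R0, Ropp_0, exp_0 in H.
  assert (0 <= Cmod (f 0)) by apply Cmod_ge_0. lra.
Qed.

Lemma cint_tail_r (K : R) (f : R -> C) (b b' : R) : Cont f -> exp_decay K f -> 0 <= b <= b' ->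
  Cmod (cint f b b') <= K * exp (- b).
Proof.
  intros Hc Hd Hb. assert (K0 := dec_pos _ _ Hd).
  apply Rle_trans with (K * exp (- b) - K * exp (- b')).
  - apply (cint_norm_le f (fun t => K * exp (- t))); auto; try lra.
    + intros t Ht. rewrite <- (Rabs_pos_eq t) at 2 by lra. apply Hd.
    + replace (K * exp (- b) - K * exp (- b')) with (minus (- K * exp (- b')) (- K * exp (- b)))
        by (unfold minus, plus, opp; simpl; ring).
      apply (is_RInt_derive (V := R_CompleteNormedModule) (fun t => - K * exp (- t))).
      * intros x _. auto_derive; auto. ring.
      * intros x _. apply (ex_derive_continuous (K := R_AbsRing) (V := R_NormedModule)). auto_derive. auto.
  - assert (0 < exp (- b')) by apply exp_pos. nra.
Qed.

Lemma cint_tail_l (K : R) (f : R -> C) (a a' : R) : Cont f -> exp_decay K f -> a' <= a <= 0 ->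
  Cmod (cint f a' a) <= K * exp a.
Proof.
  intros Hc Hd Ha.
  assert (Hc' : Cont (fun t => f (- t))).
  { intros t. apply (ctn_Rcomp (fun t => - t)); [solve_ctn|apply Hc]. }
  assert (Hd' : exp_decay K (fun t => f (- t))).
  { intros t. rewrite <- (Rabs_Ropp t). apply Hd. }
  assert (E := cint_reflect f (- a) (- a') Hc). rewrite !Ropp_involutive in E. rewrite <- E.
  rewrite <- (Ropp_involutive a) at 2. apply cint_tail_r; auto. lra.
Qed.

Lemma exp_le (x y : R) : x <= y -> exp x <= exp y.
Proof. intros [H|H]; [left; now apply exp_increasing|right; now f_equal]. Qed.

Lemma cint_window (K : R) (f : R -> C) (a b a' b' : R) : Cont f -> exp_decay K f ->
  a' <= a <= 0 -> 0 <= b <= b' ->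
  Cmod (cint f a' b' - cint f a b) <= K * (exp a + exp (- b)).
Proof.
  intros Hc Hd Ha Hb.
  rewrite <- (cint_Chasles f a' a b') by auto. rewrite <- (cint_Chasles f a b b') by auto.
  replace (cint f a' a + (cint f a b + cint f b b') - cint f a b)%C
    with (cint f a' a + cint f b b')%C by ring.
  eapply Rle_trans; [apply Cmod_triangle|]. rewrite Rmult_plus_distr_l.
  apply Rplus_le_compat; [now apply cint_tail_l|now apply cint_tail_r].
Qed.

Lemma exp_small (eps : R) : 0 < eps -> exists U, 0 <= U /\ exp (- U) <= eps.
Proof.
  intros He. exists (Rmax 0 (- ln eps)). split; [apply Rmax_l|].
  rewrite <- (exp_ln eps) at 2 by auto. apply exp_le.
  assert (H := Rmax_r 0 (- ln eps)). lra.
Qed.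

Lemma exp_small_mult (K eps : R) : 0 <= K -> 0 < eps -> exists U, 0 <= U /\ K * exp (- U) <= eps.
Proof.
  intros HK He. destruct (exp_small (eps / (K + 1))) as [U [H0 HU]].
  - apply Rdiv_lt_0_compat; lra.
  - exists U. split; auto. apply Rle_trans with ((K + 1) * (eps / (K + 1))).
    + apply Rmult_le_compat; auto; try lra. apply Rlt_le, exp_pos.
    + right; field; lra.
Qed.

Lemma INR_unbounded (x : R) : exists n : nat, x <= INR n.
Proof.
  exists (Z.to_nat (up x)). destruct (archimed x) as [H _].
  destruct (Z_le_gt_dec 0 (up x)) as [h|h].
  - rewrite INR_IZR_INZ, Z2Nat.id by auto. lra.
  - assert (IZR (up x) <= 0) by (apply IZR_le; lia).
    assert (0 <= INR (Z.to_nat (up x))) by apply pos_INR. lra.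
Qed.

Lemma Re_minus (x y : C) : Re (x - y) = Re x - Re y.
Proof. reflexivity. Qed.

Lemma Im_minus (x y : C) : Im (x - y) = Im x - Im y.
Proof. reflexivity. Qed.

Lemma Ccauchy_lim (u : nat -> C) :
  (forall eps, 0 < eps -> exists N, forall n m, (N <= n)%nat -> (n <= m)%nat -> Cmod (u m - u n) <= eps) ->
  forall eps, 0 < eps -> exists N, forall n, (N <= n)%nat ->
    Cmod ((real (Lim_seq (fun n => Re (u n))), real (Lim_seq (fun n => Im (u n)))) - u n) <= eps.
Proof.
  intros H.
  assert (W : forall v : nat -> R, (forall m n, Rabs (v m - v n) <= Cmod (u m - u n)) ->
     is_lim_seq v (real (Lim_seq v))).
  { intros v Hv. apply Lim_seq_correct'. apply ex_lim_seq_cauchy_corr.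
    intros eps. assert (He := cond_pos eps). destruct (H (eps/2) ltac:(lra)) as [N HN]. exists N.
    intros n m Hn Hm.
    apply Rle_lt_trans with (eps/2); [|lra].
    eapply Rle_trans; [apply Hv|].
    destruct (Nat.le_gt_cases n m).
    - rewrite Cmod_sym. now apply HN.
    - apply HN; lia. }
  assert (W1 := W (fun n => Re (u n)) (fun m n => re_le_Cmod (u m - u n))).
  assert (W2 := W (fun n => Im (u n)) (fun m n => im_le_Cmod (u m - u n))).
  apply is_lim_seq_spec in W1. apply is_lim_seq_spec in W2.
  intros eps He. assert (He4 : 0 < eps / 2) by lra.
  destruct (W1 (mkposreal _ He4)) as [N1 H1]. destruct (W2 (mkposreal _ He4)) as [N2 H2].
  exists (max N1 N2). intros n Hn.
  eapply Rle_trans; [apply Cmod_le_re_im|]. rewrite Re_minus, Im_minus.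
  specialize (H1 n ltac:(lia)). specialize (H2 n ltac:(lia)). simpl in H1, H2.
  rewrite Rabs_minus_sym in H1. rewrite Rabs_minus_sym in H2. simpl. lra.
Qed.

(** By [cint_window] the integrals over [-n, n] form a Cauchy sequence; the error for [a, b] is
    found by comparison with a window that contains it. *)
Lemma II_spec (K : R) (f : R -> C) (a b : R) : Cont f -> exp_decay K f -> a <= 0 -> 0 <= b ->
  Cmod (line_int f - cint f a b) <= K * (exp a + exp (- b)).
Proof.
  intros Hc Hd Ha Hb. assert (K0 := dec_pos _ _ Hd).
  apply Rnot_lt_le. intros Hlt.
  set (g := Cmod (line_int f - cint f a b) - K * (exp a + exp (- b))) in *.
  assert (Hg : 0 < g / 2) by (unfold g; lra).
  destruct (Ccauchy_lim (fun n => cint f (- INR n) (INR n))) with (eps := g/2) as [N HN]; auto.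
  { intros eps He. destruct (exp_small_mult (2 * K) eps) as [U [HU0 HU]]; auto; try lra.
    destruct (INR_unbounded U) as [N HN]. exists N. intros n m Hn Hm.
    assert (INR N <= INR n) by now apply le_INR.
    assert (INR n <= INR m) by now apply le_INR.
    eapply Rle_trans; [apply (cint_window K); auto; lra|].
    assert (exp (- INR n) <= exp (- U)) by (apply exp_le; lra). nra. }
  destruct (INR_unbounded (Rmax (- a) b)) as [M HM].
  assert (B1 := Rmax_l (- a) b). assert (B2 := Rmax_r (- a) b).
  set (n := max N M). specialize (HN n ltac:(lia)).
  assert (INR M <= INR n) by (apply le_INR; lia).
  assert (HW := cint_window K f a b (- INR n) (INR n) Hc Hd ltac:(lra) ltac:(lra)).
  fold (line_int f) in HN.
  assert (T := Cmod_dist (line_int f) (cint f (- INR n) (INR n)) (cint f a b)).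
  unfold g in *. lra.
Qed.

(** Only some windows reaching arbitrarily far are required, so shifted and reflected ones will do
    as well. *)
Lemma II_unique (K : R) (f : R -> C) (l : C) : Cont f -> exp_decay K f ->
  (forall eps U, 0 < eps -> exists a b, a <= - U /\ U <= b /\ Cmod (l - cint f a b) <= eps) ->
  line_int f = l.
Proof.
  intros Hc Hd H. assert (K0 := dec_pos _ _ Hd). apply Ceq_dist. intros eps He.
  destruct (exp_small_mult (2 * K) (eps/2)) as [U [HU0 HU]]; auto; try lra.
  destruct (H (eps/2) U ltac:(lra)) as [a [b [Ha [Hb HH]]]].
  assert (S := II_spec K f a b Hc Hd ltac:(lra) ltac:(lra)).
  assert (T := Cmod_dist (line_int f) (cint f a b) l). rewrite (Cmod_sym (cint f a b)) in T.
  assert (exp a <= exp (- U)) by (apply exp_le; lra).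
  assert (exp (- b) <= exp (- U)) by (apply exp_le; lra). nra.
Qed.

Lemma II_bound (K : R) (f : R -> C) : Cont f -> exp_decay K f -> Cmod (line_int f) <= 2 * K.
Proof.
  intros Hc Hd. assert (S := II_spec K f 0 0 Hc Hd ltac:(lra) ltac:(lra)).
  rewrite cint_point, Ropp_0, exp_0 in S.
  replace (line_int f - 0)%C with (line_int f) in S by ring. lra.
Qed.

Lemma II_ext (f g : R -> C) : (forall t, f t = g t) -> line_int f = line_int g.
Proof. intros H. f_equal. now apply functional_extensionality. Qed.

Lemma dec_scal (K : R) (c : C) (f : R -> C) : exp_decay K f -> exp_decay (Cmod c * K) (fun t => c * f t)%C.
Proof.
  intros H t. rewrite Cmod_mult, Rmult_assoc.
  apply Rmult_le_compat_l; [apply Cmod_ge_0|apply H].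
Qed.

Lemma dec_plus (K L : R) (f g : R -> C) : exp_decay K f -> exp_decay L g -> exp_decay (K + L) (fun t => f t + g t)%C.
Proof.
  intros H1 H2 t. eapply Rle_trans; [apply Cmod_triangle|].
  specialize (H1 t). specialize (H2 t). lra.
Qed.

Lemma dec_minus (K L : R) (f g : R -> C) : exp_decay K f -> exp_decay L g -> exp_decay (K + L) (fun t => f t - g t)%C.
Proof.
  intros H1 H2 t. eapply Rle_trans; [apply Cmod_triang_minus|].
  specialize (H1 t). specialize (H2 t). lra.
Qed.

Lemma dec_weak (K L : R) (f : R -> C) : K <= L -> exp_decay K f -> exp_decay L f.
Proof.
  intros H D t. eapply Rle_trans; [apply D|]. apply Rmult_le_compat_r; auto.
  apply Rlt_le, exp_pos.
Qed.

Lemma Cont_minus (f g : R -> C) : Cont f -> Cont g -> Cont (fun t => f t - g t)%C.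
Proof. intros Hf Hg t. apply ctn_minus; [apply Hf|apply Hg]. Qed.

Lemma II_scal (K : R) (c : C) (f : R -> C) : Cont f -> exp_decay K f -> line_int (fun t => c * f t)%C = (c * line_int f)%C.
Proof.
  intros Hc Hd. assert (K0 := dec_pos _ _ Hd).
  apply (II_unique (Cmod c * K)); [now apply Cont_scal|now apply dec_scal|].
  intros eps U He.
  assert (C0 := Cmod_ge_0 c).
  destruct (exp_small_mult (2 * K * Cmod c) eps) as [V [HV0 HV]]; auto; [nra|].
  exists (- Rmax U V), (Rmax U V).
  pose proof (Rmax_l U V). pose proof (Rmax_r U V).
  split; [lra|]. split; [lra|].
    rewrite cint_scal by auto.
    replace (c * line_int f - c * cint f (- Rmax U V) (Rmax U V))%C with
      (c * (line_int f - cint f (- Rmax U V) (Rmax U V)))%C by ring.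
    rewrite Cmod_mult.
    assert (S := II_spec K f (- Rmax U V) (Rmax U V) Hc Hd ltac:(lra) ltac:(lra)).
    assert (exp (- Rmax U V) <= exp (- V)) by (apply exp_le; lra).
    apply Rle_trans with (Cmod c * (K * (exp (- V) + exp (- V)))); [|lra].
    apply Rmult_le_compat_l; auto. eapply Rle_trans; [apply S|].
    apply Rmult_le_compat_l; lra.
Qed.

Lemma II_minus (K L : R) (f g : R -> C) : Cont f -> Cont g -> exp_decay K f -> exp_decay L g ->
  line_int (fun t => f t - g t)%C = (line_int f - line_int g)%C.
Proof.
  intros Hc Hc' Hd Hd'. assert (K0 := dec_pos _ _ Hd). assert (L0 := dec_pos _ _ Hd').
  apply (II_unique (K + L)); [now apply Cont_minus|now apply dec_minus|].
  intros eps U He.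
  destruct (exp_small_mult (2 * (K + L)) eps) as [V [HV0 HV]]; auto; [nra|].
  exists (- Rmax U V), (Rmax U V).
  pose proof (Rmax_l U V). pose proof (Rmax_r U V).
  split; [lra|]. split; [lra|].
  rewrite cint_minus by auto.
  replace (line_int f - line_int g - (cint f (- Rmax U V) (Rmax U V) - cint g (- Rmax U V) (Rmax U V)))%C with
      ((line_int f - cint f (- Rmax U V) (Rmax U V)) - (line_int g - cint g (- Rmax U V) (Rmax U V)))%C by ring.
  eapply Rle_trans; [apply Cmod_triang_minus|].
  assert (S := II_spec K f (- Rmax U V) (Rmax U V) Hc Hd ltac:(lra) ltac:(lra)).
  assert (S' := II_spec L g (- Rmax U V) (Rmax U V) Hc' Hd' ltac:(lra) ltac:(lra)).
  assert (exp (- Rmax U V) <= exp (- V)) by (apply exp_le; lra). nra.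
Qed.

Lemma dec_shift (K v : R) (f : R -> C) : exp_decay K f -> exp_decay (K * exp (Rabs v)) (fun t => f (t + v)%R).
Proof.
  intros H t. eapply Rle_trans; [apply H|]. rewrite Rmult_assoc.
  apply Rmult_le_compat_l; [now apply (dec_pos K f)|]. rewrite <- exp_plus. apply exp_le.
  assert (T := Rabs_triang (t + v) (- v)). rewrite Rabs_Ropp in T.
  replace (t + v + - v) with t in T by ring. lra.
Qed.

Lemma Cont_shift (v : R) (f : R -> C) : Cont f -> Cont (fun t => f (t + v)%R).
Proof. intros H t. apply (ctn_Rcomp (fun t => t + v)); [solve_ctn|apply H]. Qed.

Lemma II_shift (K v : R) (f : R -> C) : Cont f -> exp_decay K f -> line_int (fun t => f (t + v)%R) = line_int f.
Proof.
  intros Hc Hd. assert (K0 := dec_pos _ _ Hd).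
  apply (II_unique (K * exp (Rabs v))); [now apply Cont_shift|now apply dec_shift|].
  intros eps U He.
  destruct (exp_small_mult (2 * K) eps) as [V [HV0 HV]]; auto; [nra|].
  pose proof (Rmax_l U V). pose proof (Rmax_r U V). pose proof (Rabs_pos v).
  pose proof (Rle_abs v). pose proof (Rle_abs (- v)) as Q. rewrite Rabs_Ropp in Q.
  exists (- (Rmax U V + Rabs v)), (Rmax U V + Rabs v).
  split; [lra|]. split; [lra|].
  rewrite cint_shift by auto.
  eapply Rle_trans; [apply (II_spec K); auto; lra|].
  assert (exp (- (Rmax U V + Rabs v) + v) <= exp (- V)) by (apply exp_le; lra).
  assert (exp (- (Rmax U V + Rabs v + v)) <= exp (- V)) by (apply exp_le; lra). nra.
Qed.

Lemma II_reflect (K : R) (f : R -> C) : Cont f -> exp_decay K f -> line_int (fun t => f (- t)%R) = line_int f.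
Proof.
  intros Hc Hd. assert (K0 := dec_pos _ _ Hd).
  apply (II_unique K).
  - intros t. apply (ctn_Rcomp (fun t => - t)); [solve_ctn|apply Hc].
  - intros t. rewrite <- (Rabs_Ropp t). apply Hd.
  - intros eps U He.
    destruct (exp_small_mult (2 * K) eps) as [V [HV0 HV]]; auto; [nra|].
    pose proof (Rmax_l U V). pose proof (Rmax_r U V).
    exists (- Rmax U V), (Rmax U V). split; [lra|]. split; [lra|].
    rewrite cint_reflect, Ropp_involutive by auto.
    eapply Rle_trans; [apply (II_spec K); auto; lra|].
    assert (exp (- (Rmax U V)) <= exp (- V)) by (apply exp_le; lra). nra.
Qed.

Lemma Cont_unif_lim (f : R -> C) :
  (forall eps, 0 < eps -> exists g, Cont g /\ forall t, Cmod (f t - g t) <= eps) -> Cont f.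
Proof.
  intros H t. apply ctn_metric. intros eps He.
  destruct (H (eps/4) ltac:(lra)) as [g [Hg HH]].
  generalize (metric_ctn g t (Hg t) (eps/4) ltac:(lra)). apply filter_imp.
  intros y Hy. assert (A1 := HH y). assert (A2 := HH t).
  assert (T1 := Cmod_dist (f y) (g y) (f t)). assert (T2 := Cmod_dist (g y) (g t) (f t)).
  rewrite (Cmod_sym (g t) (f t)) in T2. lra.
Qed.

Lemma II_param_Cont (K L : R) (g : R -> R -> C) : Cont2 g -> 0 <= L ->
  (forall t, exp_decay (K * L) (fun u => g u t)) -> Cont (fun t => line_int (fun u => g u t)).
Proof.
  intros Hg HL Hd. apply Cont_unif_lim. intros eps He.
  assert (P := dec_pos _ _ (Hd 0)).
  destruct (exp_small_mult (2 * (K * L)) eps) as [V [HV0 HV]]; auto; [nra|].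
  exists (fun t => cint (fun u => g u t) (- V) V). split; [now apply cint_param_cont|].
  intros t. eapply Rle_trans; [apply (II_spec (K * L)); auto; [now apply Cont2_l|lra]|]. nra.
Qed.

(** Both iterated integrals are compared with the one over the square [-U, U]^2, where [cint_Fubini]
    applies; the product form of the bound makes the truncation errors small together. *)
Lemma II_Fubini (K : R) (g : R -> R -> C) : Cont2 g ->
  (forall u t, Cmod (g u t) <= K * exp (- Rabs u) * exp (- Rabs t)) ->
  line_int (fun t => line_int (fun u => g u t)) = line_int (fun u => line_int (fun t => g u t)).
Proof.
  intros Hg HK.
  assert (Hgs := Cont2_sym g Hg).
  assert (K0 : 0 <= K).
  { specialize (HK 0 0). rewrite Rabs_R0, Ropp_0, exp_0 in HK.
    assert (0 <= Cmod (g 0 0)) by apply Cmod_ge_0. lra. }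
  assert (E1 : forall x, 0 < exp (- Rabs x) <= 1).
  { intros x. split; [apply exp_pos|]. rewrite <- exp_0. apply exp_le.
    assert (0 <= Rabs x) by apply Rabs_pos. lra. }
  assert (D1 : forall t, exp_decay (K * exp (- Rabs t)) (fun u => g u t)).
  { intros t u. eapply Rle_trans; [apply HK|]. right. ring. }
  assert (D2 : forall u, exp_decay (K * exp (- Rabs u)) (fun t => g u t)).
  { intros t u. eapply Rle_trans; [apply HK|]. right. ring. }
  assert (C1 : Cont (fun t => line_int (fun u => g u t))).
  { apply (II_param_Cont K 1); auto; try lra. intros t. apply (dec_weak (K * exp (- Rabs t))); auto.
    apply Rmult_le_compat_l; auto. apply E1. }
  assert (C2 : Cont (fun u => line_int (fun t => g u t))).
  { apply (II_param_Cont K 1 (fun t u => g u t)); auto; try lra. intros t. apply (dec_weak (K * exp (- Rabs t))); [|apply D2].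
    apply Rmult_le_compat_l; auto. apply E1. }
  assert (D3 : exp_decay (2 * K) (fun t => line_int (fun u => g u t))).
  { intros t. eapply Rle_trans; [apply (II_bound (K * exp (- Rabs t))); auto; now apply Cont2_l|]. right; ring. }
  assert (D4 : exp_decay (2 * K) (fun u => line_int (fun t => g u t))).
  { intros t. eapply Rle_trans; [apply (II_bound (K * exp (- Rabs t))); auto; now apply Cont2_r|]. right; ring. }
  apply (II_unique (2 * K)); auto. intros eps U0 He.
  (* 12 = 4 + 4 + 4: the outer tail, and the inner tails of the two iterated integrals. *)
  destruct (exp_small_mult (12 * K) eps) as [V [HV0 HV]]; auto; [nra|].
  pose proof (Rmax_l U0 V). pose proof (Rmax_r U0 V).
  set (U := Rmax U0 V) in *. exists (- U), U. split; [lra|]. split; [lra|].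
  assert (S1 := II_spec (2 * K) (fun u => line_int (fun t => g u t)) (- U) U C2 D4 ltac:(lra) ltac:(lra)).
  (* the difference of the truncated and the full inner integral decays in the outer variable *)
  assert (B : forall (h : R -> R -> C), Cont2 h -> (forall t, exp_decay (K * exp (- Rabs t)) (fun u => h u t)) ->
     Cont (fun t => line_int (fun u => h u t)) ->
     Cmod (cint (fun t => line_int (fun u => h u t)) (- U) U -
           cint (fun t => cint (fun u => h u t) (- U) U) (- U) U) <= 2 * (2 * K * exp (- U))).
  { intros h Hh Dh Ch. assert (C3 := cint_param_cont h (- U) U Hh).
    rewrite <- cint_minus by auto.
    set (r := fun t => (line_int (fun u => h u t) - cint (fun u => h u t) (- U) U)%C).
    assert (Cr : Cont r) by now apply Cont_minus.
    assert (Dr : exp_decay (2 * K * exp (- U)) r).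
    { intros t. unfold r. eapply Rle_trans.
      - apply (II_spec (K * exp (- Rabs t))); auto; try lra. now apply Cont2_l.
      - right; ring. }
    rewrite <- (cint_Chasles r (- U) 0 U) by auto.
    eapply Rle_trans; [apply Cmod_triangle|].
    assert (T1 := cint_tail_l _ r 0 (- U) Cr Dr ltac:(lra)).
    assert (T2 := cint_tail_r _ r 0 U Cr Dr ltac:(lra)).
    rewrite Ropp_0, exp_0 in T2. rewrite exp_0 in T1. lra. }
  assert (B1 := B g Hg D1 C1).
  assert (B2 := B (fun t u => g u t) Hgs D2 C2).
  rewrite (cint_Fubini g) in B1 by auto.
  set (X := cint (fun u => cint (fun t => g u t) (- U) U) (- U) U) in *.
  set (Y1 := cint (fun t => line_int (fun u => g u t)) (- U) U) in *.
  set (Y2 := cint (fun u => line_int (fun t => g u t)) (- U) U) in *.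
  assert (T1 := Cmod_dist (line_int (fun u => line_int (fun t => g u t))) Y2 Y1).
  assert (T2 := Cmod_dist Y2 X Y1). rewrite (Cmod_sym X Y1) in T2.
  assert (exp (- U) <= exp (- V)) by (apply exp_le; lra).
  assert (0 < exp (- U)) by apply exp_pos. nra.
Qed.

Lemma holo_ctn (H : C -> C) (z : C) : holo H -> cctn H z.
Proof. intros h. destruct (h z) as [l Hl]. now apply (cd_ctn H z l). Qed.

(** * Cauchy's theorem for rectangles *)

Definition hline (H : C -> C) (y : R) : R -> C := fun x => H (x, y).
Definition vline (H : C -> C) (x : R) : R -> C := fun y => H (x, y).

Definition Ccont (H : C -> C) : Prop := forall z, cctn H z.

Lemma Cont_hor (H : C -> C) (y : R) : Ccont H -> Cont (hline H y).
Proof.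
  intros h t. apply (ctn_comp (fun x : R => (x, y) : C)); [|apply h].
  apply (ctn_pair (fun x : R => x)); solve_ctn.
Qed.

Lemma Cont_ver (H : C -> C) (x : R) : Ccont H -> Cont (vline H x).
Proof.
  intros h t. apply (ctn_comp (fun y : R => (x, y) : C)); [|apply h].
  apply (ctn_pair (fun _ => x) (fun y : R => y)); solve_ctn.
Qed.

Definition rect_int (H : C -> C) (a b c d : R) : C :=
  (cint (hline H c) a b + Ci * cint (vline H b) c d
   - cint (hline H d) a b - Ci * cint (vline H a) c d)%C.

Lemma rint_split_x (H : C -> C) (a m b c d : R) : Ccont H ->
  rect_int H a b c d = (rect_int H a m c d + rect_int H m b c d)%C.
Proof.
  intros h. unfold rect_int.
  rewrite <- (cint_Chasles (hline H c) a m b) by now apply Cont_hor.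
  rewrite <- (cint_Chasles (hline H d) a m b) by now apply Cont_hor. ring.
Qed.

Lemma rint_split_y (H : C -> C) (a b c m d : R) : Ccont H ->
  rect_int H a b c d = (rect_int H a b c m + rect_int H a b m d)%C.
Proof.
  intros h. unfold rect_int.
  rewrite <- (cint_Chasles (vline H a) c m d) by now apply Cont_ver.
  rewrite <- (cint_Chasles (vline H b) c m d) by now apply Cont_ver. ring.
Qed.

Lemma rint_minus (F G : C -> C) (a b c d : R) : Ccont F -> Ccont G ->
  rect_int (fun z => F z - G z)%C a b c d = (rect_int F a b c d - rect_int G a b c d)%C.
Proof.
  intros hF hG. unfold rect_int.
  assert (E1 := fun y => cint_minus (hline F y) (hline G y) a b (Cont_hor F y hF) (Cont_hor G y hG)).
  assert (E2 := fun x => cint_minus (vline F x) (vline G x) c d (Cont_ver F x hF) (Cont_ver G x hG)).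
  unfold hline, vline in *. rewrite !E1, !E2. ring.
Qed.

(** Explicit real integrals. In [Goursat] this removes the linear approximation of H at the limit
    point. *)
Lemma rint_lin (p q : C) (a b c d : R) : rect_int (fun z => p + q * z)%C a b c d = 0%C.
Proof.
  assert (I1 : forall u v : R, is_RInt (fun x => x) u v ((v * v - u * u) / 2)).
  { intros u v. replace ((v * v - u * u) / 2) with (minus (v * v / 2) (u * u / 2))
      by (unfold minus, plus, opp; simpl; field).
    apply (is_RInt_derive (V := R_CompleteNormedModule) (fun x => x * x / 2)).
    - intros x _. auto_derive; auto. field.
    - intros x _. apply continuous_id. }
  assert (I2 : forall k u v : R, is_RInt (fun _ => k) u v ((v - u) * k)).
  { intros. apply (is_RInt_const (V := R_NormedModule)). }
  assert (A : forall y, cint (hline (fun z => p + q * z)%C y) a b =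
     ((b - a) * p + q * (((b * b - a * a) / 2)%R, ((b - a) * y)%R))%C).
  { intros y. unfold hline.
    rewrite (cint_plus (fun _ => p) (fun x : R => q * (x, y))%C).
    - rewrite cint_scal.
      + f_equal.
        * rewrite (cint_pair (fun _ => p) a b ((b - a) * Re p) ((b - a) * Im p)); auto.
          apply Ceq; unfold Re, Im; simpl; ring.
        * f_equal. apply cint_pair; [exact (I1 a b)|exact (I2 y a b)].
      + intros t. apply (ctn_pair (fun x : R => x)); solve_ctn.
    - intros t. solve_ctn.
    - apply Cont_scal. intros t. apply (ctn_pair (fun x : R => x)); solve_ctn. }
  assert (B : forall x, cint (vline (fun z => p + q * z)%C x) c d =
     ((d - c) * p + q * (((d - c) * x)%R, ((d * d - c * c) / 2)%R))%C).
  { intros x. unfold vline.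
    rewrite (cint_plus (fun _ => p) (fun y : R => q * (x, y))%C).
    - rewrite cint_scal.
      + f_equal.
        * rewrite (cint_pair (fun _ => p) c d ((d - c) * Re p) ((d - c) * Im p)); auto.
          apply Ceq; unfold Re, Im; simpl; ring.
        * f_equal. apply cint_pair; [exact (I2 x c d)|exact (I1 c d)].
      + intros t. apply (ctn_pair (fun _ => x) (fun x : R => x)); solve_ctn.
    - intros t. solve_ctn.
    - apply Cont_scal. intros t. apply (ctn_pair (fun _ => x) (fun x : R => x)); solve_ctn. }
  unfold rect_int. rewrite !A, !B. apply Ceq; unfold Re, Im; simpl; field.
Qed.

Lemma rint_bound (F : C -> C) (a b c d M : R) : Ccont F -> a <= b -> c <= d ->
  (forall x y, a <= x <= b -> c <= y <= d -> Cmod (F (x, y)) <= M) ->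
  Cmod (rect_int F a b c d) <= 2 * (b - a + (d - c)) * M.
Proof.
  intros hF Hab Hcd HM. unfold rect_int.
  assert (h1 : Cmod (cint (hline F c) a b) <= (b - a) * M).
  { apply cint_norm_const; auto; [now apply Cont_hor|]. intros; apply HM; lra. }
  assert (h2 : Cmod (cint (hline F d) a b) <= (b - a) * M).
  { apply cint_norm_const; auto; [now apply Cont_hor|]. intros; apply HM; lra. }
  assert (h3 : Cmod (Ci * cint (vline F b) c d) <= (d - c) * M).
  { rewrite Cmod_mult, Cmod_Ci, Rmult_1_l.
    apply cint_norm_const; auto; [now apply Cont_ver|]. intros; apply HM; lra. }
  assert (h4 : Cmod (Ci * cint (vline F a) c d) <= (d - c) * M).
  { rewrite Cmod_mult, Cmod_Ci, Rmult_1_l.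
    apply cint_norm_const; auto; [now apply Cont_ver|]. intros; apply HM; lra. }
  eapply Rle_trans; [apply Cmod_triang_minus|].
  eapply Rle_trans; [apply Rplus_le_compat_r, Cmod_triang_minus|].
  eapply Rle_trans; [apply Rplus_le_compat_r, Rplus_le_compat_r, Cmod_triangle|].
  lra.
Qed.

Section Goursat.

Variable H : C -> C.
Hypothesis hH : holo H.

Let cH : Ccont H.
Proof. intros z. now apply holo_ctn. Qed.

Record rect := Rect { ra : R; rb : R; rc : R; rd : R }.

Definition rsize (r : rect) : R := (rb r - ra r) + (rd r - rc r).
Definition rV (r : rect) : R := Cmod (rect_int H (ra r) (rb r) (rc r) (rd r)).
Definition rok (r : rect) : Prop := ra r <= rb r /\ rc r <= rd r.

(** [eta] is the ratio of the integral to the square of the half perimeter. Halving the sides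
    divides that square by 4, so one of the four quarters keeps the ratio. Testing them in turn
    makes the selection a function, without an appeal to choice. *)
Definition quarter (eta : R) (r : rect) : rect :=
  let mx := (ra r + rb r) / 2 in
  let my := (rc r + rd r) / 2 in
  let q1 := Rect (ra r) mx (rc r) my in
  let q2 := Rect mx (rb r) (rc r) my in
  let q3 := Rect (ra r) mx my (rd r) in
  let q4 := Rect mx (rb r) my (rd r) in
  let ok q := Rle_dec (eta * (rsize r / 2) ^ 2) (rV q) in
  if ok q1 then q1 else if ok q2 then q2 else if ok q3 then q3 else q4.

Lemma quarter_spec (eta : R) (r : rect) : rok r -> eta * rsize r ^ 2 <= rV r ->
  let q := quarter eta r in
  rok q /\ rsize q = rsize r / 2 /\ eta * rsize q ^ 2 <= rV q /\
  ra r <= ra q /\ rb q <= rb r /\ rc r <= rc q /\ rd q <= rd r.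
Proof.
  intros [H1 H2] HV q.
  assert (S : (rV (Rect (ra r) ((ra r + rb r) / 2) (rc r) ((rc r + rd r) / 2)) +
    rV (Rect ((ra r + rb r) / 2) (rb r) (rc r) ((rc r + rd r) / 2)) +
    rV (Rect (ra r) ((ra r + rb r) / 2) ((rc r + rd r) / 2) (rd r)) +
    rV (Rect ((ra r + rb r) / 2) (rb r) ((rc r + rd r) / 2) (rd r)) >= rV r)).
  { unfold rV at 5.
    rewrite (rint_split_x H (ra r) ((ra r + rb r) / 2) (rb r)) by auto.
    rewrite (rint_split_y H (ra r) ((ra r + rb r) / 2) (rc r) ((rc r + rd r) / 2) (rd r)) by auto.
    rewrite (rint_split_y H ((ra r + rb r) / 2) (rb r) (rc r) ((rc r + rd r) / 2) (rd r)) by auto.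
    apply Rle_ge. eapply Rle_trans; [apply Cmod_triangle|].
    eapply Rle_trans; [apply Rplus_le_compat; apply Cmod_triangle|].
    unfold rV; simpl. lra. }
  unfold q, quarter, rsize, rok in *. simpl.
  match goal with |- context [if ?b then _ else _] => destruct b as [h1|h1] end.
  { simpl. repeat split; lra. }
  match goal with |- context [if ?b then _ else _] => destruct b as [h2|h2] end.
  { simpl. repeat split; lra. }
  match goal with |- context [if ?b then _ else _] => destruct b as [h3|h3] end.
  { simpl. repeat split; lra. }
  simpl. repeat split; try lra.
Qed.

Lemma nested (a b : nat -> R) : (forall n, a n <= a (S n)) -> (forall n, b (S n) <= b n) ->
  (forall n, a n <= b n) -> exists x, forall n, a n <= x <= b n.
Proof.
  intros Ha Hb Hab.
  assert (Ma : forall n m, (n <= m)%nat -> a n <= a m).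
  { intros n m Hm. induction Hm; [lra|]. specialize (Ha m). lra. }
  assert (Mb : forall n m, (n <= m)%nat -> b m <= b n).
  { intros n m Hm. induction Hm; [lra|]. specialize (Hb m). lra. }
  destruct (completeness (fun x => exists n, x = a n)) as [x [Hx1 Hx2]].
  - exists (b O). intros y [n ->]. apply Rle_trans with (b n); auto. apply Mb. lia.
  - exists (a O), O. reflexivity.
  - exists x. intros n. split; [apply Hx1; now exists n|].
    apply Hx2. intros y [m ->].
    apply Rle_trans with (a (max n m)); [apply Ma; lia|].
    apply Rle_trans with (b (max n m)); [auto|apply Mb; lia].
Qed.

Theorem Goursat (a b c d : R) : a <= b -> c <= d -> rect_int H a b c d = 0%C.
Proof.
  intros Hab Hcd. apply Cmod_eq_0.
  destruct (Req_dec (Cmod (rect_int H a b c d)) 0) as [E|E]; auto. exfalso.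
  assert (V0 : 0 < Cmod (rect_int H a b c d)) by (assert (X := Cmod_ge_0 (rect_int H a b c d)); lra).
  set (r0 := Rect a b c d).
  assert (L0 : 0 < rsize r0).
  { unfold rsize, r0; simpl. destruct (Rle_lt_or_eq_dec 0 (b - a + (d - c))) as [X|X]; try lra.
    (* A rectangle of size 0 is a point, and the integral over it vanishes. *)
    exfalso. apply E. replace b with a by lra. replace d with c by lra.
    unfold rect_int. rewrite !cint_point. replace (0 + Ci * 0 - 0 - Ci * 0)%C with (RtoC 0) by ring.
    apply Cmod_0. }
  set (eta := Cmod (rect_int H a b c d) / rsize r0 ^ 2).
  assert (Heta : 0 < eta) by (apply Rdiv_lt_0_compat; auto; now apply pow_lt).
  set (r := fun n => Nat.iter n (quarter eta) r0).
  assert (HI : forall n, rok (r n) /\ rsize (r n) = rsize r0 / 2 ^ n /\ eta * rsize (r n) ^ 2 <= rV (r n)).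
  { induction n as [|n [I1 [I2 I3]]].
    - unfold r; simpl Nat.iter. split; [split; simpl; auto|]. split; [simpl; field|].
      unfold eta, rV, r0; simpl ra; simpl rb; simpl rc; simpl rd. right. field.
      fold r0. lra.
    - destruct (quarter_spec eta (r n) I1 I3) as [Q1 [Q2 [Q3 _]]].
      change (r (S n)) with (quarter eta (r n)). split; auto. split; auto.
      rewrite Q2, I2. simpl. field. apply pow_nonzero. lra. }
  assert (HM : forall n, ra (r n) <= ra (r (S n)) /\ rb (r (S n)) <= rb (r n) /\
     rc (r n) <= rc (r (S n)) /\ rd (r (S n)) <= rd (r n)).
  { intros n. destruct (HI n) as [I1 [I2 I3]].
    destruct (quarter_spec eta (r n) I1 I3) as [_ [_ [_ Q]]].
    change (r (S n)) with (quarter eta (r n)). tauto. }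
  destruct (nested (fun n => ra (r n)) (fun n => rb (r n))) as [x Hx]; try (intros n; apply HM); try (intros n; apply HI).
  destruct (nested (fun n => rc (r n)) (fun n => rd (r n))) as [y Hy]; try (intros n; apply HM); try (intros n; apply HI).
  set (z := (x, y) : C).
  destruct (hH z) as [l Hl].
  (* With eta / 4 the remainder integrates to at most (2 size)(eta size / 4) = eta size^2 / 2 over a
     small rectangle, against the lower bound eta size^2. *)
  destruct (Hl (eta / 4) ltac:(lra)) as [del [Hdel HD]].
  assert (exists n, rsize (r n) < del) as [n Hn].
  { destruct (pow_lt_1_zero (/ 2) ltac:(rewrite Rabs_pos_eq; lra) (del / rsize r0)) as [n Hn].
    - now apply Rdiv_lt_0_compat.
    - exists n. specialize (Hn n ltac:(lia)). destruct (HI n) as [_ [-> _]].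
      rewrite Rabs_pos_eq in Hn by (apply pow_le; lra).
      rewrite pow_inv in Hn.
      apply (Rmult_lt_compat_l (rsize r0)) in Hn; auto.
      replace (rsize r0 * (del / rsize r0)) with del in Hn by (field; lra).
      exact Hn. }
  destruct (HI n) as [[I1 I1'] [I2 I3]]. specialize (Hx n). specialize (Hy n).
  set (rn := r n) in *.
  assert (Hs : 0 < rsize rn).
  { rewrite I2. apply Rdiv_lt_0_compat; auto. apply pow_lt. lra. }
  assert (EB : rV rn <= 2 * rsize rn * (eta / 4 * rsize rn)).
  { unfold rV.
    set (G := fun w : C => (H z - l * z + l * w)%C).
    assert (cG : Ccont G) by (intros w; unfold G; solve_ctn).
    replace (rect_int H (ra rn) (rb rn) (rc rn) (rd rn)) with
      (rect_int (fun w => H w - G w)%C (ra rn) (rb rn) (rc rn) (rd rn)).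
    - apply rint_bound; auto.
      { intros w. apply ctn_minus; [apply cH|apply cG]. }
      intros u v Hu Hv. unfold G.
      assert (D : Cmod ((u, v) - z) <= rsize rn).
      { eapply Rle_trans; [apply Cmod_le_re_im|]. unfold z, rsize. simpl.
        apply Rplus_le_compat; apply Rabs_le; lra. }
      replace (H (u, v) - (H z - l * z + l * (u, v)))%C with (H (u, v) - H z - l * ((u, v) - z))%C by ring.
      eapply Rle_trans; [apply HD; lra|]. apply Rmult_le_compat_l; lra.
    - rewrite rint_minus by auto. unfold G. rewrite rint_lin. ring. }
  assert (0 < rsize rn * rsize rn) by nra. nra.
Qed.

End Goursat.

(** Cauchy's theorem on a rectangle of height 2 W; each horizontal side contributes at most (s2 -
    s1) K e^(-W). *)
Lemma contour_shift (H : C -> C) (K s1 s2 : R) : holo H -> s1 <= s2 ->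
  (forall s t, s1 <= s <= s2 -> Cmod (H (s, t)) <= K * exp (- Rabs t)) ->
  line_int (vline H s1) = line_int (vline H s2).
Proof.
  intros h Hs HK.
  assert (cH : Ccont H) by (intros z; now apply holo_ctn).
  assert (D1 : exp_decay K (vline H s1)) by (intros t; apply HK; lra).
  assert (D2 : exp_decay K (vline H s2)) by (intros t; apply HK; lra).
  assert (K0 := dec_pos _ _ D1).
  apply (II_unique K); auto; [now apply Cont_ver|].
  intros eps U He.
  destruct (exp_small_mult (2 * K + 2 * (s2 - s1) * K) eps) as [V [HV0 HV]]; auto; [nra|].
  pose proof (Rmax_l U V). pose proof (Rmax_r U V).
  set (W := Rmax U V) in *. exists (- W), W. split; [lra|]. split; [lra|].
  assert (G := Goursat H h s1 s2 (- W) W Hs ltac:(lra)). unfold rect_int in G.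
  assert (S := II_spec K (vline H s2) (- W) W (Cont_ver H s2 cH) D2 ltac:(lra) ltac:(lra)).
  assert (EW : exp (- W) <= exp (- V)) by (apply exp_le; lra).
  assert (h1 : Cmod (cint (hline H (- W)) s1 s2) <= (s2 - s1) * (K * exp (- V))).
  { apply cint_norm_const; auto; [now apply Cont_hor|]. intros t Ht.
    eapply Rle_trans; [apply HK; lra|]. rewrite Rabs_Ropp, Rabs_pos_eq by lra.
    apply Rmult_le_compat_l; auto. }
  assert (h2 : Cmod (cint (hline H W) s1 s2) <= (s2 - s1) * (K * exp (- V))).
  { apply cint_norm_const; auto; [now apply Cont_hor|]. intros t Ht.
    eapply Rle_trans; [apply HK; lra|]. rewrite Rabs_pos_eq by lra.
    apply Rmult_le_compat_l; auto. }
  assert (E : cint (vline H s1) (- W) W =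
     (cint (vline H s2) (- W) W + - Ci * (cint (hline H (- W)) s1 s2 - cint (hline H W) s1 s2))%C).
  { set (p := cint (hline H (- W)) s1 s2) in *. set (q := cint (hline H W) s1 s2) in *.
    set (u := cint (vline H s1) (- W) W) in *. set (v := cint (vline H s2) (- W) W) in *.
    (* [ring] treats Ci as an indeterminate, so the identity is arranged to display the vanishing
       contour integral and the factor 1 + Ci^2. *)
    replace u with (v + - Ci * (p - q) + Ci * (p + Ci * v - q - Ci * u) + (1 + Ci * Ci) * (u - v))%C by ring.
    rewrite G. replace (Ci * Ci)%C with (- (1))%C by (apply Ceq; unfold Re, Im; simpl; ring). ring. }
  rewrite E.
  replace (line_int (vline H s2) - (cint (vline H s2) (- W) W + - Ci * (cint (hline H (- W)) s1 s2 - cint (hline H W) s1 s2)))%C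
   with ((line_int (vline H s2) - cint (vline H s2) (- W) W) + Ci * (cint (hline H (- W)) s1 s2 - cint (hline H W) s1 s2))%C by ring.
  eapply Rle_trans; [apply Cmod_triangle|]. rewrite Cmod_mult, Cmod_Ci.
  assert (T := Cmod_triang_minus (cint (hline H (- W)) s1 s2) (cint (hline H W) s1 s2)).
  assert (K * (exp (- W) + exp (- W)) <= 2 * K * exp (- V)) by nra.
  lra.
Qed.

(** * Uniqueness of the Mellin transform *)

Lemma cint_tail_r_loc (L : R) (f : R -> C) (b b' : R) : Cont f -> 0 <= b <= b' -> 0 <= L ->
  (forall t, b <= t <= b' -> Cmod (f t) <= L * exp (- t)) ->
  Cmod (cint f b b') <= L.
Proof.
  intros Hc Hb L0 Hd.
  apply Rle_trans with (L * exp (- b) - L * exp (- b')).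
  - apply (cint_norm_le f (fun t => L * exp (- t))); auto; try lra.
    replace (L * exp (- b) - L * exp (- b')) with (minus (- L * exp (- b')) (- L * exp (- b)))
        by (unfold minus, plus, opp; simpl; ring).
    apply (is_RInt_derive (V := R_CompleteNormedModule) (fun t => - L * exp (- t))).
    + intros x _. auto_derive; auto. ring.
    + intros x _. apply (ex_derive_continuous (K := R_AbsRing) (V := R_NormedModule)). auto_derive. auto.
  - assert (0 < exp (- b')) by apply exp_pos.
    assert (exp (- b) <= 1) by (rewrite <- exp_0; apply exp_le; lra). nra.
Qed.

(** [K] guarantees convergence, while the size of the tail is governed by [L], which may be far
    smaller because it is a bound outside the window only. *)
Lemma II_tail_loc (K L del : R) (f : R -> C) : Cont f -> exp_decay K f -> 0 <= del -> 0 <= L ->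
  (forall t, del <= Rabs t -> Cmod (f t) <= L * exp (- Rabs t)) ->
  Cmod (line_int f - cint f (- del) del) <= 2 * L.
Proof.
  intros Hc Hd Hdel HL Hf. assert (K0 := dec_pos _ _ Hd).
  apply Rnot_lt_le. intros Hlt.
  set (g := Cmod (line_int f - cint f (- del) del) - 2 * L) in *.
  assert (Hg : 0 < g / 2) by (unfold g; lra).
  destruct (exp_small_mult (2 * K) (g / 2)) as [V [HV0 HV]]; auto; [nra|].
  pose proof (Rmax_l del V). pose proof (Rmax_r del V). set (W := Rmax del V) in *.
  assert (S := II_spec K f (- W) W Hc Hd ltac:(lra) ltac:(lra)).
  assert (EW : exp (- W) <= exp (- V)) by (apply exp_le; lra).
  assert (T1 : Cmod (cint f del W) <= L).
  { apply cint_tail_r_loc; auto; try lra. intros t Ht.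
    rewrite <- (Rabs_pos_eq t) at 2 by lra. apply Hf. rewrite Rabs_pos_eq; lra. }
  assert (T2 : Cmod (cint f (- W) (- del)) <= L).
  { rewrite <- cint_reflect by auto.
    apply cint_tail_r_loc; auto; try lra.
    - intros t. apply (ctn_Rcomp (fun t => - t)); [solve_ctn|apply Hc].
    - intros t Ht. rewrite <- (Rabs_pos_eq t) at 2 by lra. rewrite <- (Rabs_Ropp t).
      apply Hf. rewrite Rabs_Ropp, Rabs_pos_eq; lra. }
  rewrite <- (cint_Chasles f (- W) (- del) W) in S by auto.
  rewrite <- (cint_Chasles f (- del) del W) in S by auto.
  assert (E : Cmod (line_int f - cint f (- del) del) <=
     Cmod (line_int f - (cint f (- W) (- del) + (cint f (- del) del + cint f del W))) +
     (Cmod (cint f (- W) (- del)) + Cmod (cint f del W))).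
  { replace (line_int f - cint f (- del) del)%C with
    ((line_int f - (cint f (- W) (- del) + (cint f (- del) del + cint f del W))) +
     (cint f (- W) (- del) + cint f del W))%C at 1 by ring.
    eapply Rle_trans; [apply Cmod_triangle|]. apply Rplus_le_compat_l. apply Cmod_triangle. }
  assert (K * (exp (- W) + exp (- W)) <= 2 * K * exp (- V)) by nra.
  unfold g in *. lra.
Qed.

(** * Gaussians *)

Definition gauss (lam v : R) : R := exp (- (lam * (v * v))).

Lemma Rabs_sqr (v : R) : v * v = Rabs v * Rabs v.
Proof. rewrite <- Rabs_mult. symmetry. apply Rabs_pos_eq. apply Rle_0_sqr. Qed.

Lemma gs_le (lam v : R) : 0 < lam -> gauss lam v <= exp (/ (4 * lam)) * exp (- Rabs v).
Proof.
  intros Hl. unfold gauss. rewrite <- exp_plus. apply exp_le.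
  assert (E : v * v = Rabs v * Rabs v) by apply Rabs_sqr.
  rewrite E. assert (0 <= lam * ((Rabs v - / (2 * lam)) * (Rabs v - / (2 * lam)))).
  { apply Rmult_le_pos; [lra|]. apply Rle_0_sqr. }
  replace (lam * ((Rabs v - / (2 * lam)) * (Rabs v - / (2 * lam)))) with
    (lam * (Rabs v * Rabs v) - Rabs v + / (4 * lam)) in H by (field; lra). lra.
Qed.

(** Completing the square in |v| around (b + 1) / (2 lam). *)
Lemma gs_exp_le (lam b v : R) : 0 < lam -> 0 <= b ->
  exp (b * Rabs v) * gauss lam v <= exp ((b + 1) * (b + 1) / (4 * lam)) * exp (- Rabs v).
Proof.
  intros Hl Hb. unfold gauss. rewrite <- !exp_plus. apply exp_le. rewrite (Rabs_sqr v).
  assert (Q : 0 <= lam * ((Rabs v - (b + 1) / (2 * lam)) * (Rabs v - (b + 1) / (2 * lam)))).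
  { apply Rmult_le_pos; [lra|]. apply Rle_0_sqr. }
  replace (lam * ((Rabs v - (b + 1) / (2 * lam)) * (Rabs v - (b + 1) / (2 * lam)))) with
    (lam * (Rabs v * Rabs v) - (b + 1) * Rabs v + (b + 1) * (b + 1) / (4 * lam)) in Q by (field; lra). lra.
Qed.

Lemma gs_cont (lam : R) (v : R) : continuous (gauss lam) v.
Proof.
  unfold gauss. apply (continuous_Rcomp exp); [apply derivable_continuous_pt, derivable_pt_exp|]. solve_ctn.
Qed.

Lemma gs_lower (lam del U : R) : 0 < del -> 0 < lam -> del / 2 <= U ->
  exists W, is_RInt (gauss lam) (- U) U W /\ del * exp (- (lam * (del * del / 4))) <= W.
Proof.
  intros Hd Hl HU.
  assert (EX : forall a b, ex_RInt (gauss lam) a b).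
  { intros a b. apply (ex_RInt_continuous (V := R_CompleteNormedModule)). intros; apply gs_cont. }
  assert (P : forall a b, a <= b -> 0 <= RInt (gauss lam) a b).
  { intros a b Hab. apply RInt_ge_0; auto. intros x _. apply Rlt_le, exp_pos. }
  exists (RInt (gauss lam) (- U) U). split; [apply (RInt_correct (V := R_CompleteNormedModule)), EX|].
  rewrite <- (RInt_Chasles (V := R_CompleteNormedModule) _ (- U) (- (del / 2)) U) by apply EX.
  rewrite <- (RInt_Chasles (V := R_CompleteNormedModule) _ (- (del / 2)) (del / 2) U) by apply EX.
  assert (P1 := P (- U) (- (del / 2)) ltac:(lra)).
  assert (P2 := P (del / 2) U ltac:(lra)).
  assert (P3 : del * exp (- (lam * (del * del / 4))) <= RInt (gauss lam) (- (del / 2)) (del / 2)).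
  { replace (del * exp (- (lam * (del * del / 4)))) with (RInt (fun _ => exp (- (lam * (del * del / 4)))) (- (del / 2)) (del / 2)).
    - apply RInt_le; auto; try lra.
      + apply ex_RInt_const.
      + intros x Hx. unfold gauss. apply exp_le. apply Ropp_le_contravar. apply Rmult_le_compat_l; [lra|]. nra.
    - rewrite RInt_const. unfold scal; simpl; unfold mult; simpl. field. }
  unfold plus; simpl. lra.
Qed.

(* With narrow Gaussians the part of the integral away from 0 is exponentially
   smaller than e(0) times the mass near 0. *)
Lemma gauss_zero (A B : R) (e : R -> C) : 0 <= A -> 0 <= B -> Cont e ->
  (forall v, Cmod (e v) <= A * exp (B * Rabs v)) ->
  (forall lam, 1 <= lam -> line_int (fun v => e v * gauss lam v)%C = 0%C) -> e 0 = 0%C.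
Proof.
  intros HA HB Hc Hb HI. apply Cmod_eq_0.
  destruct (Req_dec (Cmod (e 0)) 0) as [E|E]; auto. exfalso.
  assert (P : 0 < Cmod (e 0)) by (assert (X := Cmod_ge_0 (e 0)); lra).
  (* Near 0 the deviation |e v - e 0| stays below [eta], so at least half of the contribution of e 0
     survives there. *)
  set (eta := Cmod (e 0) / 2). assert (Heta : 0 < eta) by (unfold eta; lra).
  destruct (metric_ctn e 0 (Hc 0) eta Heta) as [d0 Hd0].
  set (del := d0 / 2). assert (Hdel : 0 < del) by (unfold del; assert (X := cond_pos d0); lra).
  assert (Hnear : forall v, - del <= v <= del -> Cmod (e v - e 0) <= eta).
  { intros v Hv. apply Rlt_le. apply Hd0.
    unfold ball; simpl; unfold AbsRing_ball, abs, minus, plus, opp; simpl.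
    replace (v + - 0) with v by ring. apply Rle_lt_trans with del; [apply Rabs_le; lra|].
    unfold del. assert (X := cond_pos d0). lra. }
  set (K1 := exp ((B + 1) * (B + 1) / 4)).
  assert (HK1 : 0 < K1) by apply exp_pos.
  assert (Cf : forall lam, Cont (fun v => e v * gauss lam v)%C).
  { intros lam t. apply ctn_mult; [apply Hc|]. apply ctn_RtoC, gs_cont. }
  assert (BB : forall v lam, 1 <= lam -> Cmod (e v * gauss lam v) <=
     A * K1 * exp (- ((lam - 1) * (v * v))) * exp (- Rabs v)).
  { intros v lam Hl. rewrite Cmod_mult, Cmod_R, Rabs_pos_eq by (apply Rlt_le, exp_pos).
    apply Rle_trans with (A * exp (B * Rabs v) * gauss lam v).
    - apply Rmult_le_compat_r; [apply Rlt_le, exp_pos|apply Hb].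
    - rewrite !Rmult_assoc. apply Rmult_le_compat_l; auto. unfold K1, gauss.
      rewrite <- !exp_plus. apply exp_le.
      assert (Ev : v * v = Rabs v * Rabs v) by apply Rabs_sqr.
      rewrite Ev. assert (0 <= (Rabs v - (B + 1) / 2) * (Rabs v - (B + 1) / 2)) by apply Rle_0_sqr. nra. }
  (* The mass is measured on |v| <= del / 2 while the tail starts at del, so the exponents are lam
     del^2 / 4 on the left and (lam - 1) del^2 on the right. *)
  assert (Main : forall lam, 1 <= lam ->
     eta * (del * exp (- (lam * (del * del / 4)))) <= 2 * (A * K1 * exp (- ((lam - 1) * (del * del))))).
  { intros lam Hl.
    assert (Dk : exp_decay (A * K1) (fun v => e v * gauss lam v)%C).
    { intros v. eapply Rle_trans; [now apply BB|]. apply Rmult_le_compat_r; [apply Rlt_le, exp_pos|].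
      rewrite <- (Rmult_1_r (A * K1)) at 2. apply Rmult_le_compat_l; [nra|].
      apply Rle_trans with (exp 0); [|rewrite exp_0; lra]. apply exp_le.
      assert (0 <= (lam - 1) * (v * v)) by (apply Rmult_le_pos; [lra|apply Rle_0_sqr]). lra. }
    assert (T := II_tail_loc (A * K1) (A * K1 * exp (- ((lam - 1) * (del * del)))) del _ (Cf lam) Dk ltac:(lra)).
    rewrite (HI lam Hl) in T.
    eapply Rle_trans; [|apply T].
    - replace (0 - cint (fun v => e v * gauss lam v) (- del) del)%C with
        (- cint (fun v => e v * gauss lam v) (- del) del)%C by ring. rewrite Cmod_opp.
      destruct (gs_lower lam del del Hdel ltac:(lra) ltac:(lra)) as [W [HW1 HW2]].
      assert (Cg : Cont (fun v => RtoC (gauss lam v))) by (intros t; apply ctn_RtoC, gs_cont).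
      assert (IW : cint (fun v => RtoC (gauss lam v)) (- del) del = RtoC W).
      { apply cint_pair; [exact HW1|]. 
        replace 0 with ((del - - del) * 0) by ring.
        apply (is_RInt_const (V := R_NormedModule)). }
      assert (Cd : Cont (fun v => (e v - e 0) * gauss lam v)%C).
      { intros t. apply ctn_mult; [|apply ctn_RtoC, gs_cont]. apply ctn_minus; [apply Hc|apply ctn_const]. }
      assert (E1 : cint (fun v => e v * gauss lam v)%C (- del) del =
         (e 0 * W + cint (fun v => (e v - e 0) * gauss lam v) (- del) del)%C).
      { rewrite <- IW, <- cint_scal, <- cint_plus by (auto; now apply Cont_scal).
        apply cint_ext. intros x. ring. }
      rewrite E1.
      assert (E2 : Cmod (cint (fun v => (e v - e 0) * gauss lam v)%C (- del) del) <= eta * W).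
      { apply (cint_norm_le _ (fun v => eta * gauss lam v)); auto; try lra.
        - intros t Ht. rewrite Cmod_mult, Cmod_R, (Rabs_pos_eq (gauss lam t)) by (apply Rlt_le, exp_pos).
          apply Rmult_le_compat_r; [apply Rlt_le, exp_pos|]. now apply Hnear.
        - apply (is_RInt_scal (V := R_NormedModule)). exact HW1. }
      assert (E3 : Cmod (e 0 * W) = 2 * eta * W).
      { rewrite Cmod_mult, Cmod_R, Rabs_pos_eq; [unfold eta; field|].
        eapply Rle_trans; [|apply HW2]. apply Rmult_le_pos; [lra|apply Rlt_le, exp_pos]. }
      assert (E4 := Cmod_triang_inv (e 0 * W)%C (- cint (fun v => (e v - e 0) * gauss lam v)%C (- del) del)%C).
      rewrite Cmod_opp in E4.
      replace (e 0 * W - - cint (fun v => (e v - e 0) * gauss lam v)%C (- del) del)%C with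
        (e 0 * W + cint (fun v => (e v - e 0) * gauss lam v)%C (- del) del)%C in E4 by ring.
      assert (eta * (del * exp (- (lam * (del * del / 4)))) <= eta * W) by (apply Rmult_le_compat_l; lra).
      lra.
    - apply Rmult_le_pos; [nra|apply Rlt_le, exp_pos].
    - intros t Ht. eapply Rle_trans; [now apply BB|].
      apply Rmult_le_compat_r; [apply Rlt_le, exp_pos|].
      apply Rmult_le_compat_l; [nra|]. apply exp_le.
      assert (Et : t * t = Rabs t * Rabs t) by apply Rabs_sqr.
      rewrite Et. apply Ropp_le_contravar. apply Rmult_le_compat_l; [lra|]. apply Rmult_le_compat; lra. }
  (* divide by exp(-(lam-1) del^2): the left side grows like exp(3 lam del^2/4) *)
  set (Q := 2 * (A * K1)).
  assert (HQ : 0 <= Q) by (unfold Q; nra).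
  (* Chosen such that 3/4 del^2 (lam - 1) = Q exp(del^2 / 4) / (eta del) + 1; the bound 1 + x <= exp
     x then contradicts [M3]. *)
  set (lam := 1 + 4 / 3 / (del * del) * (Q * exp (del * del / 4) / (eta * del) + 1)).
  assert (Hl : 1 <= lam).
  { unfold lam. assert (0 <= 4 / 3 / (del * del) * (Q * exp (del * del / 4) / (eta * del) + 1)); [|lra].
    assert (0 < exp (del * del / 4)) by apply exp_pos.
    apply Rmult_le_pos.
    - apply Rlt_le. apply Rdiv_lt_0_compat; nra.
    - assert (0 <= Q * exp (del * del / 4) / (eta * del)); [|lra].
      apply Rmult_le_pos; [nra|]. apply Rlt_le, Rinv_0_lt_compat. nra. }
  specialize (Main lam Hl).
  assert (Y : exp (- (lam * (del * del / 4))) = exp (- ((lam - 1) * (del * del))) *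
     (exp (3 / 4 * (del * del) * (lam - 1)) * exp (- (del * del / 4)))).
  { rewrite <- !exp_plus. f_equal. field. }
  rewrite Y in Main.
  assert (Z0 : 0 < exp (- ((lam - 1) * (del * del)))) by apply exp_pos.
  assert (M2 : eta * del * exp (3 / 4 * (del * del) * (lam - 1)) * exp (- (del * del / 4)) <= Q).
  { apply (Rmult_le_reg_l (exp (- ((lam - 1) * (del * del))))); auto. unfold Q. lra. }
  assert (Z1 : exp (del * del / 4) * exp (- (del * del / 4)) = 1).
  { rewrite <- exp_plus. replace (_ + _) with 0 by ring. apply exp_0. }
  assert (M3 : eta * del * exp (3 / 4 * (del * del) * (lam - 1)) <= Q * exp (del * del / 4)).
  { assert (0 < exp (del * del / 4)) by apply exp_pos.
    apply (Rmult_le_compat_r (exp (del * del / 4))) in M2; [|lra].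
    rewrite Rmult_assoc, (Rmult_comm (exp (- (del * del / 4)))), Z1, Rmult_1_r in M2. exact M2. }
  replace (3 / 4 * (del * del) * (lam - 1)) with (Q * exp (del * del / 4) / (eta * del) + 1) in M3
    by (unfold lam; field; lra).
  assert (X := exp_ineq1_le (Q * exp (del * del / 4) / (eta * del) + 1)).
  assert (M4 : eta * del * (1 + (Q * exp (del * del / 4) / (eta * del) + 1)) <= Q * exp (del * del / 4)).
  { eapply Rle_trans; [|apply M3]. apply Rmult_le_compat_l; [nra|apply X]. }
  replace (eta * del * (1 + (Q * exp (del * del / 4) / (eta * del) + 1))) with
    (2 * (eta * del) + Q * exp (del * del / 4)) in M4 by (field; lra). nra.
Qed.

Lemma holo_cexp_quad (p q : C) : holo (fun s => Cexp (p * s + q * (s * s)))%C.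
Proof. solve_holo. Qed.

Lemma Rabs_le_max (c d s : R) : Rmin c d <= s <= Rmax c d -> Rabs s <= Rabs c + Rabs d.
Proof.
  unfold Rmin, Rmax. destruct (Rle_dec c d); intros [h1 h2]; apply Rabs_le;
  pose proof (Rle_abs c); pose proof (Rle_abs d); pose proof (Rle_abs (- c)); pose proof (Rle_abs (- d));
  rewrite Rabs_Ropp in *; pose proof (Rabs_pos c); pose proof (Rabs_pos d);
  pose proof (Rabs_Ropp d); split; lra.
Qed.

Lemma contour_shift' (H : C -> C) (K s1 s2 : R) : holo H ->
  (forall s t, Rabs s <= Rabs s1 + Rabs s2 -> Cmod (H (s, t)) <= K * exp (- Rabs t)) ->
  line_int (vline H s1) = line_int (vline H s2).
Proof.
  intros h HK. destruct (Rle_or_lt s1 s2) as [L|L].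
  - apply (contour_shift H K); auto. intros s t Hs. apply HK. apply Rabs_le_max.
    rewrite Rmin_left, Rmax_right; lra.
  - symmetry. apply (contour_shift H K); auto; try lra. intros s t Hs. apply HK. apply Rabs_le_max.
    rewrite Rmin_right, Rmax_left; lra.
Qed.

Lemma gauss_line (b eps c : R) : 0 < eps ->
  line_int (fun t => Cexp (b * (c, t) + eps * ((c, t) * (c, t)))%C) =
  (gauss (/ (4 * eps)) b * line_int (fun t => RtoC (gauss eps t)))%C.
Proof.
  intros He.
  set (H := fun s : C => Cexp (b * s + eps * (s * s))%C).
  (* On the line through the stationary point of b s + eps s^2 the exponent is real, namely -b^2 /
     (4 eps) - eps t^2. *)
  set (s0 := - b / (2 * eps)).
  assert (M : forall s t, Cmod (H (s, t)) = exp (b * s + eps * (s * s)) * gauss eps t).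
  { intros s t. unfold H, gauss. rewrite Cmod_Cexp, <- exp_plus. f_equal. simpl. ring. }
  change (line_int (vline H c) = (gauss (/ (4 * eps)) b * line_int (fun t => RtoC (gauss eps t)))%C).
  set (S := Rabs c + Rabs s0).
  rewrite (contour_shift' H (exp (Rabs b * S + eps * (S * S)) * exp (/ (4 * eps))) c s0).
  - rewrite <- (II_scal (exp (/ (4 * eps)))).
    + apply II_ext. intros t. unfold vline, H.
      replace (b * (s0, t) + eps * ((s0, t) * (s0, t)))%C with
        (RtoC (- (/ (4 * eps) * (b * b)) + - (eps * (t * t)))).
      * rewrite Cexp_R, exp_plus, RtoC_mult. reflexivity.
      * apply Ceq; unfold Re, Im, s0; simpl; field; lra.
    + intros t. apply ctn_RtoC, gs_cont.
    + intros t. rewrite Cmod_R, Rabs_pos_eq by (apply Rlt_le, exp_pos). now apply gs_le.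
  - apply holo_cexp_quad.
  - intros s t Hs. fold S in Hs. rewrite M, Rmult_assoc.
    apply Rmult_le_compat; try (apply Rlt_le, exp_pos); [|now apply gs_le].
    apply exp_le.
    assert (A1 : b * s <= Rabs b * S).
    { eapply Rle_trans; [apply Rle_abs|]. rewrite Rabs_mult. apply Rmult_le_compat_l; auto. apply Rabs_pos. }
    assert (A2 : s * s <= S * S).
    { rewrite (Rabs_sqr s).
      assert (X := Rabs_pos s). nra. }
    nra.
Qed.

Notation R2 := (prod_UniformSpace R_UniformSpace R_UniformSpace).

Definition gauss_weight (x eps c t : R) : C := Cexp (- x * (c, t) + eps * ((c, t) * (c, t)))%C.

Lemma Cmod_wt (x eps c t : R) : Cmod (gauss_weight x eps c t) = exp (- x * c + eps * (c * c)) * gauss eps t.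
Proof. unfold gauss_weight, gauss. rewrite Cmod_Cexp, <- exp_plus. f_equal. unfold Re; simpl. ring. Qed.

Lemma Cmod_exp_line (c u t : R) : Cmod (Cexp (u * (c, t))) = exp (u * c).
Proof. rewrite Cmod_Cexp. f_equal. simpl. ring. Qed.

Lemma Cont_unweight (psi : R -> C) (c : R) : Cont psi -> forall tau, Cont (fun u => psi u * Cexp (u * (c, tau)))%C.
Proof. intros H tau u. apply ctn_mult; [apply H|]. solve_ctn. Qed.

Lemma dec_line (psi : R -> C) (c K : R) : exp_decay K (fun u => psi u * exp (u * c))%C ->
  forall tau, exp_decay K (fun u => psi u * Cexp (u * (c, tau)))%C.
Proof.
  intros H tau u. specialize (H u). cbv beta in H. rewrite Cmod_mult, Cmod_R, Rabs_pos_eq in H by (apply Rlt_le, exp_pos).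
  now rewrite Cmod_mult, Cmod_exp_line.
Qed.

Lemma psi_bound (psi : R -> C) (c K : R) : exp_decay K (fun u => psi u * exp (u * c))%C ->
  forall u, Cmod (psi u) <= K * exp (- Rabs u) * exp (- (u * c)).
Proof.
  intros H u. specialize (H u). cbv beta in H. rewrite Cmod_mult, Cmod_R, Rabs_pos_eq in H by (apply Rlt_le, exp_pos).
  apply (Rmult_le_compat_r (exp (- (u * c)))) in H; [|apply Rlt_le, exp_pos].
  rewrite Rmult_assoc, <- exp_plus in H. replace (u * c + - (u * c)) with 0 in H by ring.
  rewrite exp_0 in H. lra.
Qed.

(** The Gaussian absorbs the factor e^(-u c) lost in [psi_bound], by completing the square in u -
    x. *)
Lemma dec_gauss (psi : R -> C) (c K lam x : R) : 0 < lam -> exp_decay K (fun u => psi u * exp (u * c))%C ->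
  exp_decay (K * exp (- (c * x) + c * c / (4 * lam))) (fun u => psi u * gauss lam (u - x))%C.
Proof.
  intros Hl H u. assert (K0 := dec_pos _ _ H).
  rewrite Cmod_mult, Cmod_R, Rabs_pos_eq by (apply Rlt_le, exp_pos).
  apply Rle_trans with (K * exp (- Rabs u) * exp (- (u * c)) * gauss lam (u - x)).
  - apply Rmult_le_compat_r; [apply Rlt_le, exp_pos|]. now apply psi_bound.
  - unfold gauss. rewrite !Rmult_assoc. apply Rmult_le_compat_l; auto. rewrite <- !exp_plus. apply exp_le.
    assert (Q : 0 <= lam * ((u - x + c / (2 * lam)) * (u - x + c / (2 * lam)))).
    { apply Rmult_le_pos; [lra|apply Rle_0_sqr]. }
    replace (lam * ((u - x + c / (2 * lam)) * (u - x + c / (2 * lam)))) with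
      (lam * ((u - x) * (u - x)) + u * c - x * c + c * c / (4 * lam)) in Q by (field; lra). lra.
Qed.

Lemma Cont_gauss (psi : R -> C) (lam x : R) : Cont psi -> Cont (fun u => psi u * gauss lam (u - x))%C.
Proof.
  intros H u. apply ctn_mult; [apply H|]. apply ctn_RtoC.
  apply (continuous_comp (fun u => u - x) (gauss lam)); [solve_ctn|apply gs_cont].
Qed.

(** Fubini, then [gauss_line] in the inner variable. The right-hand side no longer depends on the
    line [c]; this is what allows two lines to be compared in [strip_uniqueness]. *)
Lemma parseval (psi : R -> C) (c K eps x : R) : 0 < eps -> Cont psi ->
  exp_decay K (fun u => psi u * exp (u * c))%C ->
  line_int (fun t => line_int (fun u => psi u * Cexp (u * (c, t))) * gauss_weight x eps c t)%C =
  (line_int (fun t => RtoC (gauss eps t)) * line_int (fun u => psi u * gauss (/ (4 * eps)) (u - x)))%C.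
Proof.
  intros He Hc Hd. assert (K0 := dec_pos _ _ Hd).
  set (g := fun u t : R => (psi u * Cexp ((u - x) * (c, t) + eps * ((c, t) * (c, t))))%C).
  assert (Hg : forall u t, (psi u * Cexp (u * (c, t)) * gauss_weight x eps c t = g u t)%C).
  { intros u t. unfold gauss_weight, g. rewrite <- Cmult_assoc, <- Cexp_plus. f_equal. f_equal. ring. }
  assert (C2 : Cont2 g).
  { intros u t. unfold g. apply (ctn_mult (T := R2)).
    - apply (ctn_Rcomp (T := R2) (fun p : R * R => fst p)); [|apply Hc].
      apply (continuous_fst (U := R_UniformSpace) (V := R_UniformSpace)).
    - solve_ctn. }
  assert (Hb : forall u t, Cmod (g u t) <= K * exp (- x * c + eps * (c * c)) * exp (/ (4 * eps)) *
      exp (- Rabs u) * exp (- Rabs t)).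
  { intros u t. rewrite <- Hg, !Cmod_mult, Cmod_wt, Cmod_exp_line.
    assert (D := Hd u). cbv beta in D. rewrite Cmod_mult, Cmod_R, Rabs_pos_eq in D by (apply Rlt_le, exp_pos).
    assert (G := gs_le eps t He).
    apply Rle_trans with ((K * exp (- Rabs u)) * (exp (- x * c + eps * (c * c)) * (exp (/ (4 * eps)) * exp (- Rabs t)))).
    - apply Rmult_le_compat; auto.
      + apply Rmult_le_pos; [apply Cmod_ge_0|apply Rlt_le, exp_pos].
      + apply Rmult_le_pos; apply Rlt_le, exp_pos.
      + apply Rmult_le_compat_l; auto. apply Rlt_le, exp_pos.
    - right; ring. }
  rewrite (II_ext _ (fun t => line_int (fun u => g u t))).
  - rewrite (II_Fubini _ g C2 Hb).
    rewrite (II_ext _ (fun u => line_int (fun t => RtoC (gauss eps t)) * (psi u * gauss (/ (4 * eps)) (u - x)))%C).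
    + apply (II_scal (K * exp (- (c * x) + c * c / (4 * / (4 * eps))))).
      * now apply Cont_gauss.
      * apply dec_gauss; auto. apply Rinv_0_lt_compat. lra.
    + intros u. unfold g.
      rewrite (II_scal (exp (Rabs (u - x) * Rabs c + eps * (c * c)) * exp (/ (4 * eps)))).
      * rewrite <- RtoC_minus, gauss_line by auto. ring.
      * intros t. solve_ctn.
      * intros t. rewrite Cmod_Cexp.
        replace (Re ((u - x) * (c, t) + eps * ((c, t) * (c, t)))) with
          (((u - x) * c + eps * (c * c)) + - (eps * (t * t))) by (unfold Re; simpl; ring).
        rewrite exp_plus, Rmult_assoc. apply Rmult_le_compat; try (apply Rlt_le, exp_pos).
        -- apply exp_le. apply Rplus_le_compat_r. eapply Rle_trans; [apply Rle_abs|].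
           rewrite Rabs_mult. lra.
        -- now apply gs_le.
  - intros t. rewrite Cmult_comm.
    rewrite <- (II_scal K) by first [now apply Cont_unweight | now apply dec_line].
    apply II_ext. intros u. rewrite <- Hg. ring.
Qed.

Lemma gauss_pos (eps : R) : 0 < eps -> line_int (fun t => RtoC (gauss eps t)) <> 0%C.
Proof.
  intros He E.
  assert (Hc : Cont (fun t => RtoC (gauss eps t))) by (intros t; apply ctn_RtoC, gs_cont).
  assert (Hd : exp_decay (exp (/ (4 * eps))) (fun t => RtoC (gauss eps t))).
  { intros t. rewrite Cmod_R, Rabs_pos_eq by (apply Rlt_le, exp_pos). now apply gs_le. }
  assert (P : 0 < exp (- (eps * (1 * 1 / 4)))) by apply exp_pos.
  destruct (exp_small_mult (2 * exp (/ (4 * eps))) (exp (- (eps * (1 * 1 / 4))) / 2)) as [V [HV0 HV]]; [|lra|].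
  { assert (0 < exp (/ (4 * eps))) by apply exp_pos. lra. }
  set (U := Rmax 1 V). pose proof (Rmax_l 1 V). pose proof (Rmax_r 1 V). fold U in H, H0.
  destruct (gs_lower eps 1 U) as [W [HW1 HW2]]; try lra.
  assert (S := II_spec _ _ (- U) U Hc Hd ltac:(lra) ltac:(lra)).
  rewrite E in S.
  rewrite (cint_pair _ (- U) U W 0) in S.
  - replace (0 - ((W : R), 0%R))%C with (RtoC (- W)) in S by (apply Ceq; unfold Re, Im; simpl; ring).
    rewrite Cmod_R, Rabs_Ropp, Rabs_pos_eq in S by lra.
    assert (EW : exp (- U) <= exp (- V)) by (apply exp_le; lra).
    assert (0 < exp (/ (4 * eps))) by apply exp_pos. nra.
  - exact HW1.
  - replace 0 with ((U - - U) * 0) by ring. apply (is_RInt_const (V := R_NormedModule)).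
Qed.

(* Multiply G by e^(-xs + eps s^2) and integrate over both vertical lines. By Fubini
   each integral is the convolution of psi_j with a Gaussian at x, by the contour shift
   they agree, and [gauss_zero] recovers psi_1 = psi_2. *)
Theorem strip_uniqueness (G : C -> C) (c1 c2 K1 K2 B b : R) (psi1 psi2 : R -> C) :
  holo G -> c2 <= c1 -> 0 <= b ->
  (forall s, c2 <= Re s <= c1 -> Cmod (G s) <= B * exp (b * Rabs (Im s))) ->
  Cont psi1 -> Cont psi2 ->
  exp_decay K1 (fun u => psi1 u * exp (u * c1))%C -> exp_decay K2 (fun u => psi2 u * exp (u * c2))%C ->
  (forall t, G (c1, t) = line_int (fun u => psi1 u * Cexp (u * (c1, t)))%C) ->
  (forall t, G (c2, t) = line_int (fun u => psi2 u * Cexp (u * (c2, t)))%C) ->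
  forall x, psi1 x = psi2 x.
Proof.
  intros HG Hc Hb0 HB C1 C2 D1 D2 E1 E2 x.
  assert (P1 := dec_pos _ _ D1). assert (P2 := dec_pos _ _ D2).
  assert (B0 : 0 <= B).
  { specialize (HB (c1, 0) ltac:(simpl; lra)). simpl in HB.
    rewrite Rabs_R0, Rmult_0_r, exp_0, Rmult_1_r in HB.
    eapply Rle_trans; [apply Cmod_ge_0|apply HB]. }
  assert (EQ : forall lam, 0 < lam -> line_int (fun u => psi1 u * gauss lam (u - x))%C = line_int (fun u => psi2 u * gauss lam (u - x))%C).
  { intros lam Hl. set (eps := / (4 * lam)).
    assert (He : 0 < eps) by (apply Rinv_0_lt_compat; lra).
    replace lam with (/ (4 * eps)) by (unfold eps; field; lra).
    assert (S1 := parseval psi1 c1 K1 eps x He C1 D1).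
    assert (S2 := parseval psi2 c2 K2 eps x He C2 D2).
    assert (SH : line_int (vline (fun s => G s * Cexp (- x * s + eps * (s * s)))%C c2) =
                 line_int (vline (fun s => G s * Cexp (- x * s + eps * (s * s)))%C c1)).
    { apply (contour_shift _ (B * exp (Rabs x * (Rabs c1 + Rabs c2) + eps * ((Rabs c1 + Rabs c2) * (Rabs c1 + Rabs c2))) * exp ((b + 1) * (b + 1) / (4 * eps)))); auto.
      - solve_holo.
      - intros s t Hs. change (Cexp (- x * (s, t) + eps * ((s, t) * (s, t)))) with (gauss_weight x eps s t).
        rewrite Cmod_mult, Cmod_wt.
        apply Rle_trans with (B * exp (b * Rabs t) * (exp (- x * s + eps * (s * s)) * gauss eps t)).
        { apply Rmult_le_compat_r; [apply Rmult_le_pos; apply Rlt_le, exp_pos|].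
          apply (HB (s, t)). simpl. lra. }
        replace (B * exp (b * Rabs t) * (exp (- x * s + eps * (s * s)) * gauss eps t)) with
          (B * (exp (- x * s + eps * (s * s)) * (exp (b * Rabs t) * gauss eps t))) by ring.
        rewrite !Rmult_assoc. apply Rmult_le_compat_l; auto.
        apply Rmult_le_compat; try (apply Rlt_le, exp_pos).
        + apply Rmult_le_pos; apply Rlt_le, exp_pos.
        + assert (Rs : Rabs s <= Rabs c1 + Rabs c2).
          { rewrite Rplus_comm. apply Rabs_le_max. rewrite Rmin_left, Rmax_right; lra. }
          apply exp_le. apply Rplus_le_compat.
          * eapply Rle_trans; [apply Rle_abs|]. rewrite Rabs_mult, Rabs_Ropp.
            apply Rmult_le_compat_l; auto. apply Rabs_pos.
          * apply Rmult_le_compat_l; [lra|]. rewrite Rabs_sqr.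
            apply Rmult_le_compat; auto; apply Rabs_pos.
        + now apply gs_exp_le. }
    rewrite (II_ext (vline (fun s => G s * Cexp (- x * s + eps * (s * s)))%C c2) (fun t => line_int (fun u => psi2 u * Cexp (u * (c2, t))) * gauss_weight x eps c2 t)%C) in SH
      by (intros t; unfold vline; now rewrite E2).
    rewrite (II_ext (vline (fun s => G s * Cexp (- x * s + eps * (s * s)))%C c1) (fun t => line_int (fun u => psi1 u * Cexp (u * (c1, t))) * gauss_weight x eps c1 t)%C) in SH
      by (intros t; unfold vline; now rewrite E1).
    rewrite S1, S2 in SH.
    assert (NZ := gauss_pos eps He).
    set (k := line_int (fun t => RtoC (gauss eps t))) in *.
    rewrite <- (Cmult_1_l (line_int _)). rewrite <- (Cinv_l k) by auto. rewrite <- Cmult_assoc, <- SH.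
    field. auto. }
  (* Translation by x moves the point of interest to 0, where [gauss_zero] applies. *)
  assert (Z : (psi1 (0 + x)%R - psi2 (0 + x)%R = 0)%C).
  { apply (gauss_zero (K1 * exp (Rabs c1 * Rabs x) + K2 * exp (Rabs c2 * Rabs x)) (Rabs c1 + Rabs c2)
      (fun v => psi1 (v + x)%R - psi2 (v + x)%R)%C).
    - apply Rplus_le_le_0_compat; apply Rmult_le_pos; auto; apply Rlt_le, exp_pos.
    - apply Rplus_le_le_0_compat; apply Rabs_pos.
    - apply Cont_minus; now apply Cont_shift.
    - intros v.
      assert (Q : forall (psi : R -> C) (c K c' : R), 0 <= K -> exp_decay K (fun u => psi u * exp (u * c))%C ->
        Cmod (psi (v + x)) <= K * exp (Rabs c * Rabs x) * exp ((Rabs c + Rabs c') * Rabs v)).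
      { intros psi c K c' HK D. eapply Rle_trans; [apply (psi_bound psi c K D)|].
        rewrite !Rmult_assoc. apply Rmult_le_compat_l; auto. rewrite <- !exp_plus. apply exp_le.
        assert (T1 := Rle_abs (- ((v + x) * c))). rewrite Rabs_Ropp, Rabs_mult in T1.
        assert (T2 := Rabs_triang v x). pose proof (Rabs_pos c). pose proof (Rabs_pos c').
        pose proof (Rabs_pos v). pose proof (Rabs_pos (v + x)). nra. }
      eapply Rle_trans; [apply Cmod_triang_minus|]. rewrite Rmult_plus_distr_r.
      apply Rplus_le_compat; [now apply Q|]. rewrite (Rplus_comm (Rabs c1)). now apply Q.
    - intros lam Hl.
      assert (G1 := dec_gauss psi1 c1 K1 lam x ltac:(lra) D1).
      assert (G2 := dec_gauss psi2 c2 K2 lam x ltac:(lra) D2).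
      assert (F1 := Cont_gauss psi1 lam x C1). assert (F2 := Cont_gauss psi2 lam x C2).
      set (h := fun u => (psi1 u * gauss lam (u - x)%R - psi2 u * gauss lam (u - x)%R)%C).
      rewrite (II_ext _ (fun v => h (v + x))).
      + rewrite (II_shift (K1 * exp (- (c1 * x) + c1 * c1 / (4 * lam)) + K2 * exp (- (c2 * x) + c2 * c2 / (4 * lam))) x h).
        * unfold h. rewrite (II_minus _ _ _ _ F1 F2 G1 G2), EQ by lra. ring.
        * now apply Cont_minus.
        * now apply dec_minus.
      + intros v. unfold h. replace (v + x - x) with v by ring. ring. }
  rewrite Rplus_0_l in Z. replace (psi1 x) with (psi1 x - psi2 x + psi2 x)%C by ring. rewrite Z. ring.
Qed.

(** * Series *)

Fixpoint partial_sum (u : nat -> C) (n : nat) : C :=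
  match n with O => u O | S m => (partial_sum u m + u (S m))%C end.

Definition sums_to (u : nat -> C) (l : C) : Prop :=
  forall eps, 0 < eps -> exists N, forall n, (N <= n)%nat -> Cmod (partial_sum u n - l) <= eps.

Lemma csum_sum_n (u : nat -> C) (n : nat) : sum_n (G := C_NormedModule) u n = partial_sum u n.
Proof.
  induction n as [|n IH]; [now rewrite sum_O|].
  rewrite sum_Sn, IH. reflexivity.
Qed.

Lemma is_series_csums (u : nat -> C) (l : C) : is_series (V := C_NormedModule) u l -> sums_to u l.
Proof.
  intros H eps He.
  assert (L : locally (T := C_UniformSpace) l (fun y => Cmod (y - l) < eps)).
  { assert (He2 : 0 < eps / 2) by lra. exists (mkposreal _ He2). intros y Hy.
    apply (ball_Cmod l y (mkposreal _ He2)) in Hy. simpl in Hy. lra. }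
  destruct (H _ L) as [N HN]. exists N. intros n Hn. rewrite <- csum_sum_n.
  apply Rlt_le. now apply HN.
Qed.

Lemma csums_unique (u : nat -> C) (l m : C) : sums_to u l -> sums_to u m -> l = m.
Proof.
  intros H1 H2. apply Ceq_dist. intros eps He.
  destruct (H1 (eps/2) ltac:(lra)) as [N1 A1]. destruct (H2 (eps/2) ltac:(lra)) as [N2 A2].
  specialize (A1 (max N1 N2) ltac:(lia)). specialize (A2 (max N1 N2) ltac:(lia)).
  assert (T := Cmod_dist l (partial_sum u (max N1 N2)) m).
  rewrite (Cmod_sym l (partial_sum u _)) in T. lra.
Qed.

Lemma csum_ext (u v : nat -> C) (n : nat) : (forall n, u n = v n) -> partial_sum u n = partial_sum v n.
Proof. intros H. induction n; simpl; [apply H|]. now rewrite IHn, H. Qed.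

Lemma csums_ext (u v : nat -> C) (l : C) : (forall n, u n = v n) -> sums_to u l -> sums_to v l.
Proof.
  intros H Hu eps He. destruct (Hu eps He) as [N HN]. exists N. intros n Hn.
  rewrite <- (csum_ext u v n H). auto.
Qed.

Lemma csum_scal (c : C) (u : nat -> C) (n : nat) : partial_sum (fun n => c * u n)%C n = (c * partial_sum u n)%C.
Proof. induction n; simpl; [reflexivity|]. rewrite IHn. ring. Qed.

Lemma csum_plus (u v : nat -> C) (n : nat) : partial_sum (fun n => u n + v n)%C n = (partial_sum u n + partial_sum v n)%C.
Proof. induction n; simpl; [reflexivity|]. rewrite IHn. ring. Qed.

Lemma csums_scal (c : C) (u : nat -> C) (l : C) : sums_to u l -> sums_to (fun n => c * u n)%C (c * l)%C.
Proof.
  intros H eps He. assert (C0 := Cmod_ge_0 c).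
  destruct (H (eps / (Cmod c + 1))) as [N HN]; [apply Rdiv_lt_0_compat; lra|].
  exists N. intros n Hn. specialize (HN n Hn). rewrite csum_scal.
  replace (c * partial_sum u n - c * l)%C with (c * (partial_sum u n - l))%C by ring. rewrite Cmod_mult.
  assert (X := Cmod_ge_0 (partial_sum u n - l)).
  apply Rle_trans with ((Cmod c + 1) * (eps / (Cmod c + 1))); [|right; field; lra].
  apply Rmult_le_compat; lra.
Qed.

Lemma csums_plus (u v : nat -> C) (l m : C) : sums_to u l -> sums_to v m -> sums_to (fun n => u n + v n)%C (l + m)%C.
Proof.
  intros H1 H2 eps He.
  destruct (H1 (eps/2) ltac:(lra)) as [N1 A1]. destruct (H2 (eps/2) ltac:(lra)) as [N2 A2].
  exists (max N1 N2). intros n Hn.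
  specialize (A1 n ltac:(lia)). specialize (A2 n ltac:(lia)). rewrite csum_plus.
  replace (partial_sum u n + partial_sum v n - (l + m))%C with ((partial_sum u n - l) + (partial_sum v n - m))%C by ring.
  eapply Rle_trans; [apply Cmod_triangle|]. lra.
Qed.

Lemma csums_minus (u v : nat -> C) (l m : C) : sums_to u l -> sums_to v m -> sums_to (fun n => u n - v n)%C (l - m)%C.
Proof.
  intros H1 H2.
  replace (l - m)%C with (l + - (1) * m)%C by ring.
  apply (csums_ext (fun n => u n + - (1) * v n)%C); [intros n; ring|].
  apply csums_plus; auto. now apply csums_scal.
Qed.

Lemma csum_re (u : nat -> C) (n : nat) : Re (partial_sum u n) = sum_n (fun n => Re (u n)) n.
Proof.
  induction n; [now rewrite sum_O|]. rewrite sum_Sn, <- IHn. reflexivity.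
Qed.

Lemma csum_im (u : nat -> C) (n : nat) : Im (partial_sum u n) = sum_n (fun n => Im (u n)) n.
Proof.
  induction n; [now rewrite sum_O|]. rewrite sum_Sn, <- IHn. reflexivity.
Qed.

Lemma csums_CSeries (u : nat -> C) (l : C) : sums_to u l -> CSeries u = l.
Proof.
  intros H. unfold CSeries. apply Ceq; simpl.
  - apply is_series_unique. intros P [e He].
    destruct (H (e / 2)) as [N HN]; [assert (X := cond_pos e); lra|].
    exists N. intros n Hn. apply He. specialize (HN n Hn).
    change (Rabs (sum_n (fun n => Re (u n)) n - Re l) < e). rewrite <- csum_re, <- Re_minus.
    assert (X := cond_pos e). eapply Rle_lt_trans; [apply re_le_Cmod|]. lra.
  - apply is_series_unique. intros P [e He].
    destruct (H (e / 2)) as [N HN]; [assert (X := cond_pos e); lra|].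
    exists N. intros n Hn. apply He. specialize (HN n Hn).
    change (Rabs (sum_n (fun n => Im (u n)) n - Im l) < e). rewrite <- csum_im, <- Im_minus.
    assert (X := cond_pos e). eapply Rle_lt_trans; [apply im_le_Cmod|]. lra.
Qed.

Lemma csum_cauchy (u : nat -> C) (v : nat -> R) (N k : nat) : (forall n, Cmod (u n) <= v n) ->
  Cmod (partial_sum u (N + k) - partial_sum u N) <= sum_n v (N + k) - sum_n v N.
Proof.
  intros H. induction k.
  - rewrite Nat.add_0_r. replace (partial_sum u N - partial_sum u N)%C with (RtoC 0) by ring. rewrite Cmod_0. lra.
  - rewrite Nat.add_succ_r. simpl partial_sum. rewrite sum_Sn. unfold plus; simpl.
    replace (partial_sum u (N + k) + u (S (N + k)) - partial_sum u N)%C with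
      ((partial_sum u (N + k) - partial_sum u N) + u (S (N + k)))%C by ring.
    eapply Rle_trans; [apply Cmod_triangle|]. specialize (H (S (N + k))). lra.
Qed.

Lemma series_pos_le (v : nat -> R) (L : R) (N : nat) : (forall n, 0 <= v n) -> is_series v L -> sum_n v N <= L.
Proof.
  intros Hv HL. apply Rnot_lt_le. intros Hlt.
  assert (Hp : 0 < sum_n v N - L) by lra.
  destruct (HL (ball L (mkposreal _ Hp))) as [M HM]; [now exists (mkposreal _ Hp)|].
  specialize (HM (max M N) ltac:(lia)).
  change (Rabs (sum_n v (max M N) - L) < sum_n v N - L) in HM.
  assert (Mon : forall n, (N <= n)%nat -> sum_n v N <= sum_n v n).
  { intros n Hn. induction Hn; [lra|]. rewrite sum_Sn. unfold plus; simpl. specialize (Hv (S m)). lra. }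
  specialize (Mon (max M N) ltac:(lia)).
  rewrite Rabs_pos_eq in HM by lra. lra.
Qed.

Lemma csums_tail (u : nat -> C) (v : nat -> R) (l : C) (L : R) (N : nat) :
  (forall n, Cmod (u n) <= v n) -> is_series v L -> sums_to u l ->
  Cmod (l - partial_sum u N) <= L - sum_n v N.
Proof.
  intros H HL Hu.
  assert (Hv : forall n, 0 <= v n) by (intros n; eapply Rle_trans; [apply Cmod_ge_0|apply H]).
  apply Rnot_lt_le. intros Hlt.
  destruct (Hu ((Cmod (l - partial_sum u N) - (L - sum_n v N)) / 2)) as [M HM]; [lra|].
  specialize (HM (N + M)%nat ltac:(lia)).
  assert (T1 := csum_cauchy u v N M H). assert (T2 := series_pos_le v L (N + M) Hv HL).
  assert (T := Cmod_dist l (partial_sum u (N + M)) (partial_sum u N)). rewrite (Cmod_sym l (partial_sum u (N + M))) in T. lra.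
Qed.

Lemma csums_bound (u : nat -> C) (v : nat -> R) (l : C) (L : R) :
  (forall n, Cmod (u n) <= v n) -> is_series v L -> sums_to u l -> Cmod l <= L.
Proof.
  intros H HL Hu.
  assert (T := csums_tail u v l L 0 H HL Hu). rewrite sum_O in T. simpl in T.
  specialize (H O). assert (X := Cmod_dist l (u O) 0).
  replace (l - 0)%C with l in X by ring. replace (u O - 0)%C with (u O) in X by ring. lra.
Qed.

Lemma series_tail_small (v : nat -> R) (L : R) : is_series v L -> forall eps, 0 < eps ->
  exists N, forall n, (N <= n)%nat -> L - sum_n v n <= eps.
Proof.
  intros HL eps He. destruct (HL (ball L (mkposreal _ He))) as [M HM]; [now exists (mkposreal _ He)|].
  exists M. intros n Hn. specialize (HM n Hn).
  change (Rabs (sum_n v n - L) < eps) in HM. apply Rabs_lt_between in HM. lra.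
Qed.

Lemma csums_abs (u : nat -> C) (v : nat -> R) :
  (forall n, Cmod (u n) <= v n) -> ex_series v -> sums_to u (CSeries u).
Proof.
  intros H [L HL].
  assert (Hv : forall n, 0 <= v n) by (intros n; eapply Rle_trans; [apply Cmod_ge_0|apply H]).
  set (l := (real (Lim_seq (fun n => Re (partial_sum u n))), real (Lim_seq (fun n => Im (partial_sum u n)))) : C).
  assert (CS : sums_to u l).
  { intros eps He.
    destruct (Ccauchy_lim (partial_sum u)) with (eps := eps) as [N HN]; auto.
    - intros e He'. destruct (series_tail_small v L HL e He') as [N HN].
      exists N. intros n m Hn Hm. replace m with (n + (m - n))%nat by lia.
      eapply Rle_trans; [apply (csum_cauchy u v); auto|].
      assert (T := series_pos_le v L (n + (m - n)) Hv HL). specialize (HN n Hn). lra.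
    - exists N. intros n Hn. rewrite Cmod_sym. now apply HN. }
  now rewrite (csums_CSeries u l CS).
Qed.

Lemma II_csum (t : nat -> R -> C) (K : nat -> R) (N : nat) :
  (forall n, Cont (t n)) -> (forall n, exp_decay (K n) (t n)) ->
  Cont (fun u => partial_sum (fun n => t n u) N) /\ (exists L, exp_decay L (fun u => partial_sum (fun n => t n u) N)) /\
  line_int (fun u => partial_sum (fun n => t n u) N) = partial_sum (fun n => line_int (t n)) N.
Proof.
  intros Hc Hd. induction N as [|N [I1 [[L I2] I3]]]; simpl.
  - split; [apply Hc|]. split; [exists (K O); apply Hd|]. now apply II_ext.
  - split; [|split].
    + now apply Cont_plus.
    + exists (L + K (S N)). now apply dec_plus.
    + rewrite <- I3.
      assert (M := II_scal _ (- (1))%C _ (Hc (S N)) (Hd (S N))).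
      rewrite (II_ext _ (fun u => partial_sum (fun n => t n u) N - - (1) * t (S N) u)%C) by (intros; ring).
      rewrite (II_minus L (Cmod (- (1)) * K (S N))); auto.
      * rewrite M. ring.
      * apply Cont_scal, Hc.
      * apply dec_scal, Hd.
Qed.

(** The remainder after n terms satisfies [exp_decay] with the tail of the series [v] as constant,
    and [II_bound] turns this into a bound for its integral. *)
Lemma II_series (t : nat -> R -> C) (v : nat -> R) :
  (forall n, Cont (t n)) -> (forall n, exp_decay (v n) (t n)) -> ex_series v ->
  Cont (fun u => CSeries (fun n => t n u)) /\
  exp_decay (Series v) (fun u => CSeries (fun n => t n u)) /\
  sums_to (fun n => line_int (t n)) (line_int (fun u => CSeries (fun n => t n u))).
Proof.
  intros Hc Hd Hv.
  assert (HL := Series_correct v Hv). set (L := Series v) in *.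
  assert (E1 : forall u, 0 < exp (- Rabs u) <= 1).
  { intros x. split; [apply exp_pos|]. rewrite <- exp_0. apply exp_le.
    assert (0 <= Rabs x) by apply Rabs_pos. lra. }
  assert (V0 : forall n, 0 <= v n) by (intros n; eapply dec_pos; apply Hd).
  assert (HLu : forall u, is_series (fun n => v n * exp (- Rabs u)) (L * exp (- Rabs u))).
  { intros u. apply is_series_scal_r. exact HL. }
  assert (CS : forall u, sums_to (fun n => t n u) (CSeries (fun n => t n u))).
  { intros u. apply (csums_abs _ (fun n => v n * exp (- Rabs u))).
    - intros n. apply Hd.
    - eexists. apply HLu. }
  assert (TL : forall u N, Cmod (CSeries (fun n => t n u) - partial_sum (fun n => t n u) N) <=
      (L - sum_n v N) * exp (- Rabs u)).
  { intros u N.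
    assert (T := csums_tail (fun n => t n u) (fun n => v n * exp (- Rabs u)) _ _ N (fun n => Hd n u) (HLu u) (CS u)).
    assert (SS : sum_n (fun n => v n * exp (- Rabs u)) N = sum_n v N * exp (- Rabs u))
      by apply (sum_n_mult_r (K := R_Ring)).
    rewrite SS in T. lra. }
  assert (CT : Cont (fun u => CSeries (fun n => t n u))).
  { apply Cont_unif_lim. intros eps He.
    destruct (series_tail_small v L HL eps He) as [N HN].
    exists (fun u => partial_sum (fun n => t n u) N). split.
    - destruct (II_csum t v N Hc Hd) as [A _]. exact A.
    - intros u. eapply Rle_trans; [apply TL|].
      assert (P := series_pos_le v L N V0 HL). specialize (HN N (le_n N)).
      destruct (E1 u). nra. }
  assert (DT : exp_decay L (fun u => CSeries (fun n => t n u))).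
  { intros u. apply (csums_bound _ _ _ _ (fun n => Hd n u) (HLu u) (CS u)). }
  split; [|split]; auto.
  intros eps He.
  destruct (series_tail_small v L HL (eps/2) ltac:(lra)) as [N HN].
  exists N. intros n Hn. specialize (HN n Hn).
  destruct (II_csum t v n Hc Hd) as [A [[L' B] C']]. rewrite <- C', Cmod_sym.
  rewrite <- (II_minus L L') by auto.
  eapply Rle_trans; [apply (II_bound (L - sum_n v n))|].
  - now apply Cont_minus.
  - intros u. apply TL.
  - lra.
Qed.

Lemma exp_INR_mult (n : nat) (x : R) : exp (INR n * x) = exp x ^ n.
Proof.
  induction n; [simpl; now rewrite Rmult_0_l, exp_0|].
  rewrite S_INR, Rmult_plus_distr_r, exp_plus, IHn, Rmult_1_l. simpl. ring.
Qed.

(** The n-th power of Y / n <= exp(Y / n). For n = 0 the right-hand side is 1, since 0 ^ 0 = 1. *)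
Lemma exp_neg_pow (n : nat) (Y : R) : 0 < Y -> exp (- Y) <= INR n ^ n / Y ^ n.
Proof.
  intros HY. destruct n as [|n].
  - simpl. rewrite <- exp_0. apply Rle_trans with (exp 0); [apply exp_le; lra|]. rewrite exp_0; lra.
  - set (k := S n). assert (Hk : 0 < INR k) by (apply lt_0_INR; unfold k; lia).
    rewrite exp_Ropp. replace (INR k ^ k / Y ^ k) with (/ ((Y / INR k) ^ k)).
    + apply Rinv_le_contravar; [apply pow_lt; now apply Rdiv_lt_0_compat|].
      replace Y with (INR k * (Y / INR k)) at 2 by (field; lra).
      rewrite exp_INR_mult. apply pow_incr. split; [apply Rlt_le; now apply Rdiv_lt_0_compat|].
      assert (X := exp_ineq1_le (Y / INR k)). lra.
    + unfold Rdiv. rewrite Rpow_mult_distr, pow_inv. field. split; apply pow_nonzero; lra.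
Qed.

(** * The inverse Mellin transform of the functional equation *)

(** The exponents J - 1 and J + 2 lie at distance at least 1 on either side of the strip J <= Re s
    <= J + 1. Thus [exp_neg_pow] with the first gives decay e^u for u <= 0, and with the second
    e^(-u) for u > 0. *)
Definition ker_const (J : nat) (Y : R) : R :=
  INR (J - 1) ^ (J - 1) / Y ^ (J - 1) + INR (J + 2) ^ (J + 2) / Y ^ (J + 2).

Lemma kernel_dec (J : nat) (sg Y u : R) : (1 <= J)%nat -> 0 < Y -> INR J <= sg <= INR J + 1 ->
  exp (u * sg) * exp (- (Y * exp u)) <= ker_const J Y * exp (- Rabs u).
Proof.
  intros HJ HY Hs.
  assert (G : forall n, exp (u * sg) * exp (- (Y * exp u)) <= INR n ^ n / Y ^ n * exp (u * (sg - INR n))).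
  { intros n. assert (H := exp_neg_pow n (Y * exp u) ltac:(apply Rmult_lt_0_compat; [auto|apply exp_pos])).
    rewrite Rpow_mult_distr, <- exp_INR_mult in H.
    apply (Rmult_le_compat_l (exp (u * sg))) in H; [|apply Rlt_le, exp_pos].
    eapply Rle_trans; [apply H|]. right.
    replace (u * sg) with (u * (sg - INR n) + INR n * u) by ring. rewrite exp_plus.
    field. split; [apply pow_nonzero; lra|apply Rgt_not_eq, exp_pos]. }
  assert (PP : forall n, 0 <= INR n ^ n / Y ^ n).
  { intros n. apply Rmult_le_pos; [apply pow_le, pos_INR|]. apply Rlt_le, Rinv_0_lt_compat. now apply pow_lt. }
  assert (P1 := PP (J - 1)%nat). assert (P2 := PP (J + 2)%nat).
  assert (E := exp_pos (- Rabs u)).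
  unfold ker_const. rewrite Rmult_plus_distr_r. destruct (Rle_or_lt u 0) as [Hu|Hu].
  - eapply Rle_trans; [apply (G (J - 1)%nat)|].
    assert (exp (u * (sg - INR (J - 1))) <= exp (- Rabs u)).
    { apply exp_le. rewrite Rabs_left1 by lra. rewrite minus_INR by lia. simpl. nra. }
    assert (X := Rmult_le_compat_l _ _ _ P1 H).
    assert (0 <= INR (J + 2) ^ (J + 2) / Y ^ (J + 2) * exp (- Rabs u)) by (apply Rmult_le_pos; lra). lra.
  - eapply Rle_trans; [apply (G (J + 2)%nat)|].
    assert (exp (u * (sg - INR (J + 2))) <= exp (- Rabs u)).
    { apply exp_le. rewrite Rabs_pos_eq by lra. rewrite plus_INR. simpl. nra. }
    assert (X := Rmult_le_compat_l _ _ _ P2 H).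
    assert (0 <= INR (J - 1) ^ (J - 1) / Y ^ (J - 1) * exp (- Rabs u)) by (apply Rmult_le_pos; lra). lra.
Qed.

(* Euler's integrand t^s e^(-Y t) dt/t on the ray t = e^(u + i be). *)
Definition ker (Y be : R) (s : C) (u : R) : C := Cexp ((u, be) * s - Y * Cexp (u, be))%C.

Lemma Cont_ker (Y be : R) (s : C) : Cont (ker Y be s).
Proof.
  intros u. unfold ker. apply ctn_Cexp. apply ctn_minus; apply ctn_mult; try apply ctn_const.
  - apply (ctn_pair (fun u : R => u) (fun _ => be)); solve_ctn.
  - apply ctn_Cexp. apply (ctn_pair (fun u : R => u) (fun _ => be)); solve_ctn.
Qed.

Lemma Cmod_ker (Y be : R) (s : C) (u : R) :
  Cmod (ker Y be s u) = exp (- (be * Im s)) * (exp (u * Re s) * exp (- (Y * cos be * exp u))).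
Proof.
  unfold ker. rewrite Cmod_Cexp, <- !exp_plus. f_equal. unfold Cexp, Re, Im. simpl. ring.
Qed.

Lemma dec_ker (J : nat) (Y be : R) (s : C) : (1 <= J)%nat -> 0 < Y -> 0 < cos be ->
  INR J <= Re s <= INR J + 1 ->
  exp_decay (exp (- (be * Im s)) * ker_const J (Y * cos be)) (ker Y be s).
Proof.
  intros HJ HY Hb Hs u. rewrite Cmod_ker, (Rmult_assoc (exp (- (be * Im s)))).
  apply Rmult_le_compat_l; [apply Rlt_le, exp_pos|].
  apply kernel_dec; auto. now apply Rmult_lt_0_compat.
Qed.

Lemma KJ_anti (J : nat) (Y Y' : R) : 0 < Y -> Y <= Y' -> ker_const J Y' <= ker_const J Y.
Proof.
  intros HY H. unfold ker_const. apply Rplus_le_compat; apply Rmult_le_compat_l;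
   try (apply pow_le, pos_INR); apply Rinv_le_contravar; try (now apply pow_lt); apply pow_incr; lra.
Qed.

Lemma cos_between (b be : R) : Rabs b <= Rabs be -> Rabs be < PI / 2 -> cos be <= cos b.
Proof.
  intros H1 H2. assert (E : forall x, cos (Rabs x) = cos x).
  { intros x. unfold Rabs. destruct (Rcase_abs x); auto. apply cos_neg. }
  rewrite <- (E be), <- (E b). assert (P := PI_RGT_0).
  apply cos_decr_1; try apply Rabs_pos; lra.
Qed.

(** In the variable log t = u + i b, turning the ray is a translation of a horizontal line.
    Multiplication by -i makes the lines vertical, as [contour_shift'] expects; cos b > 0 keeps the
    integrand small in between. *)
Lemma ker_rotate (J : nat) (be : R) (s : C) : (1 <= J)%nat -> Rabs be < PI / 2 ->
  INR J <= Re s <= INR J + 1 -> line_int (ker 1 be s) = line_int (ker 1 0 s).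
Proof.
  intros HJ Hb Hs.
  assert (Pc : 0 < cos be) by (apply cos_gt_0; apply Rabs_def2 in Hb; lra).
  set (H := fun z : C => Cexp ((- Ci * z) * s - Cexp (- Ci * z))%C).
  assert (E : forall b u, ker 1 b s u = vline H (- b) u).
  { intros b u. unfold ker, vline, H. rewrite Cmult_1_l.
    replace (- Ci * ((- b)%R, u))%C with ((u, b) : C) by (apply Ceq; unfold Re, Im; simpl; ring).
    reflexivity. }
  rewrite (II_ext _ _ (E be)), (II_ext _ _ (E 0)).
  apply (contour_shift' H (exp (Rabs be * Rabs (Im s)) * ker_const J (cos be))).
  - unfold H. solve_holo.
  - intros x t Hx. rewrite Ropp_0, Rabs_R0, Rabs_Ropp, Rplus_0_r in Hx.
    change (H (x, t)) with (vline H x t). rewrite <- (Ropp_involutive x), <- E, Cmod_ker, (Rmult_assoc (exp (Rabs be * Rabs (Im s)))).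
    apply Rmult_le_compat; try (apply Rlt_le, exp_pos).
    + apply Rmult_le_pos; apply Rlt_le, exp_pos.
    + apply exp_le. eapply Rle_trans; [apply Rle_abs|].
      rewrite Rabs_Ropp, Rabs_mult, Rabs_Ropp. apply Rmult_le_compat_r; auto. apply Rabs_pos.
    + eapply Rle_trans; [apply (kernel_dec J)|]; auto.
      * rewrite cos_neg. assert (X := cos_between x be Hx Hb). lra.
      * rewrite cos_neg, Rmult_1_l. apply Rmult_le_compat_r; [apply Rlt_le, exp_pos|].
        apply KJ_anti; auto. now apply cos_between.
Qed.

Lemma Cpower_plus (x : R) (s t : C) : Cpower x (s + t) = (Cpower x s * Cpower x t)%C.
Proof. unfold Cpower. rewrite <- Cexp_plus. f_equal. ring. Qed.

Lemma Cpower_mult_base (x y : R) (s : C) : 0 < x -> 0 < y -> Cpower (x * y) s = (Cpower x s * Cpower y s)%C.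
Proof. intros Hx Hy. unfold Cpower. rewrite ln_mult by auto. rewrite <- Cexp_plus, RtoC_plus. f_equal. ring. Qed.

Lemma Cpower_inv_base (x : R) (s : C) : 0 < x -> Cpower (/ x) s = Cpower x (- s).
Proof. intros Hx. unfold Cpower. rewrite ln_Rinv by auto. rewrite RtoC_opp. f_equal. ring. Qed.

Lemma Cexp_shift (u v be : R) : Cexp (u + v, be) = (exp v * Cexp (u, be))%C.
Proof.
  rewrite <- Cexp_R, <- Cexp_plus. f_equal. apply Ceq; unfold Re, Im; simpl; ring.
Qed.

Lemma ker_scale (J : nat) (Y be : R) (s : C) : (1 <= J)%nat -> 0 < cos be -> 0 < Y ->
  INR J <= Re s <= INR J + 1 -> line_int (ker Y be s) = (Cpower Y (- s) * line_int (ker 1 be s))%C.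
Proof.
  intros HJ Hb HY Hs.
  assert (D := dec_ker J 1 be s HJ Rlt_0_1 Hb Hs).
  rewrite <- (II_shift _ (ln Y) _ (Cont_ker 1 be s) D).
  rewrite <- (II_scal (exp (- (be * Im s)) * ker_const J (1 * cos be) * exp (Rabs (ln Y)))).
  - apply II_ext. intros u. unfold ker, Cpower. rewrite <- Cexp_plus. f_equal.
    rewrite Cexp_shift, exp_ln by auto.
    replace ((u + ln Y)%R, be) with ((u, be) + RtoC (ln Y))%C by (apply Ceq; unfold Re, Im; simpl; ring).
    ring.
  - apply Cont_shift, Cont_ker.
  - now apply dec_shift.
Qed.

(** The substitution t = e^u. The filters at 0 and at infinity become the two ends of the line,
    where [II_spec] controls the error. *)
Lemma Euler_integral_II (J : nat) (s : C) : (1 <= J)%nat -> INR J <= Re s <= INR J + 1 ->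
  Euler_integral s = line_int (ker 1 0 s).
Proof.
  intros HJ Hs. unfold Euler_integral.
  assert (c0 : 0 < cos 0) by (rewrite cos_0; lra).
  assert (D := dec_ker J 1 0 s HJ Rlt_0_1 c0 Hs). assert (Ck := Cont_ker 1 0 s).
  set (K := exp (- (0 * Im s)) * ker_const J (1 * cos 0)) in *. assert (K0 := dec_pos _ _ D).
  assert (CV : forall a b, 0 < a -> a <= b ->
    is_RInt (V := C_R_NormedModule) (fun t => (Cpower t (s - 1) * exp (- t))%C) a b (cint (ker 1 0 s) (ln a) (ln b))).
  { intros a b Ha Hb.
    apply (is_RInt_ext (V := C_R_NormedModule) (fun y => scal (V := C_R_CompleteNormedModule) (/ y) (ker 1 0 s (ln y)))).
    - intros x Hx. rewrite Rmin_left in Hx by lra.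
      rewrite scal_C. unfold ker, Cpower.
      assert (Px : 0 < x) by lra.
      replace ((ln x, 0) : C) with (RtoC (ln x)) by reflexivity.
      rewrite Cexp_R, exp_ln by auto.
      replace (/ x) with (exp (- ln x)) by (rewrite exp_Ropp, exp_ln; auto).
      rewrite <- !Cexp_R, <- !Cexp_plus. f_equal. rewrite !RtoC_opp. ring.
    - apply (is_RInt_comp (V := C_R_CompleteNormedModule)).
      + intros x _. apply Ck.
      + intros x Hx. rewrite Rmin_left in Hx by lra. split.
        * apply is_derive_Reals. apply derivable_pt_lim_ln. lra.
        * apply continuity_pt_filterlim. apply derivable_continuous_pt.
          apply derivable_pt_inv; [lra|apply derivable_pt_id]. }
  apply (is_RInt_gen_unique (V := C_R_CompleteNormedModule)).
  intros P [eps HP].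
  assert (He : 0 < eps / 2) by (assert (X := cond_pos eps); lra).
  destruct (exp_small_mult (2 * K) (eps / 2)) as [U [HU0 HU]]; auto; [lra|].
  exists (fun a => 0 < a /\ a <= exp (- U)) (fun b => exp U <= b).
  - exists (mkposreal (exp (- U)) (exp_pos _)). intros y Hy Hy0. split; auto.
    unfold ball in Hy; simpl in Hy; unfold AbsRing_ball, abs, minus, plus, opp in Hy; simpl in Hy.
    rewrite Rabs_pos_eq in Hy; lra.
  - exists (exp U). intros y Hy. lra.
  - intros a b [Ha1 Ha2] Hb.
    assert (E1 : exp (- U) <= 1) by (rewrite <- exp_0; apply exp_le; lra).
    assert (E2 : 1 <= exp U) by (rewrite <- exp_0; apply exp_le; lra).
    exists (cint (ker 1 0 s) (ln a) (ln b)). split; [apply CV; simpl; lra|].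
    apply HP. apply Cmod_ball. rewrite Cmod_sym.
    assert (La : ln a <= - U).
    { rewrite <- (ln_exp (- U)). destruct Ha2 as [h|h]; [left; now apply ln_increasing|right; now rewrite h]. }
    assert (Lb : U <= ln b).
    { rewrite <- (ln_exp U). destruct Hb as [h|h]; [left; apply ln_increasing; [apply exp_pos|auto]|right; now rewrite h]. }
    assert (S := II_spec K (ker 1 0 s) (ln a) (ln b) Ck D ltac:(lra) ltac:(lra)).
    assert (exp (ln a) <= exp (- U)) by (apply exp_le; lra).
    assert (exp (- ln b) <= exp (- U)) by (apply exp_le; lra).
    assert (X := cond_pos eps). nra.
Qed.

Lemma Gamma_II (J : nat) (s : C) : (1 <= J)%nat -> INR J <= Re s <= INR J + 1 ->
  Gamma s = line_int (ker 1 0 s).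
Proof.
  intros HJ Hs. unfold Gamma.
  (* As Re s >= 1, [up (- Re s)] is at most 0 and [Z.to_nat] truncates it, so [Gamma] is Euler's
     integral itself here. *)
  assert (Z : Z.to_nat (up (- Re s)) = O).
  { destruct (archimed (- Re s)) as [A1 A2].
    assert (1 <= INR J) by (now apply (le_INR 1)).
    assert (IZR (up (- Re s)) < 1) by lra.
    assert (up (- Re s) < 1)%Z by (now apply lt_IZR). lia. }
  rewrite Z. simpl. rewrite Cplus_0_r. replace (Euler_integral s / 1)%C with (Euler_integral s) by (field; auto).
  now apply (Euler_integral_II J).
Qed.

Lemma is_series_telescope : is_series (fun m => / INR (S m) - / INR (S (S m))) 1.
Proof.
  assert (E : forall n, sum_n (fun m => / INR (S m) - / INR (S (S m))) n = 1 - / INR (S (S n))).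
  { induction n.
    - rewrite sum_O. simpl. field.
    - rewrite sum_Sn, IHn. unfold plus; simpl plus. change (1 - / INR (S (S n)) + (/ INR (S (S n)) - / INR (S (S (S n)))) = 1 - / INR (S (S (S n)))). ring. }
  intros P [eps HP]. destruct (INR_unbounded (/ eps)) as [M HM].
  exists M. intros n Hn. apply HP. rewrite E.
  change (Rabs (1 - / INR (S (S n)) - 1) < eps).
  replace (1 - / INR (S (S n)) - 1) with (- / INR (S (S n))) by ring.
  assert (P0 : 0 < INR (S (S n))) by (apply lt_0_INR; lia).
  rewrite Rabs_Ropp, Rabs_pos_eq by (apply Rlt_le, Rinv_0_lt_compat; auto).
  assert (X := cond_pos eps).
  apply (Rmult_lt_reg_r (INR (S (S n)))); auto. rewrite Rinv_l by lra.
  assert (L : INR M + 1 <= INR (S (S n))) by (rewrite <- S_INR; apply le_INR; lia).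
  apply Rlt_le_trans with (eps * (INR M + 1)).
  - apply (Rmult_le_compat_l eps) in HM; [|lra]. rewrite Rinv_r in HM by lra. lra.
  - apply Rmult_le_compat_l; lra.
Qed.

(** A telescoping majorant of the sum of n^(-2), which also makes the tails explicit in
    [wterm_bound]. *)
Lemma inv_sq_telescope (m : nat) : / INR (S m) ^ 2 <= 2 * (/ INR (S m) - / INR (S (S m))).
Proof.
  assert (P : 1 <= INR (S m)) by (apply (le_INR 1); lia).
  rewrite (S_INR (S m)). set (x := INR (S m)) in *.
  replace (2 * (/ x - / (x + 1))) with (2 / (x * (x + 1))) by (field; lra).
  replace (/ x ^ 2) with (/ (x * x)) by (f_equal; ring).
  apply (Rmult_le_reg_r (x * x * (x + 1))); [nra|].
  replace (/ (x * x) * (x * x * (x + 1))) with (x + 1) by (field; lra).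
  replace (2 / (x * (x + 1)) * (x * x * (x + 1))) with (2 * x) by (field; lra). lra.
Qed.

Lemma inv_pow_le_sq (m p : nat) : (2 <= p)%nat -> / INR (S m) ^ p <= / INR (S m) ^ 2.
Proof.
  intros Hp. assert (P : 1 <= INR (S m)) by (apply (le_INR 1); lia).
  apply Rinv_le_contravar; [apply pow_lt; lra|]. now apply Rle_pow.
Qed.

Lemma ex_series_inv_pow (p : nat) : (2 <= p)%nat -> ex_series (fun m => / INR (S m) ^ p).
Proof.
  intros Hp.
  apply (ex_series_le (V := R_CompleteNormedModule) _ (fun m => 2 * (/ INR (S m) - / INR (S (S m))))).
  - intros n. change (Rabs (/ INR (S n) ^ p) <= 2 * (/ INR (S n) - / INR (S (S n)))).
    assert (P : 1 <= INR (S n)) by (apply (le_INR 1); lia).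
    rewrite Rabs_pos_eq by (apply Rlt_le, Rinv_0_lt_compat, pow_lt; lra).
    eapply Rle_trans; [now apply inv_pow_le_sq|apply inv_sq_telescope].
  - apply (ex_series_scal_l (K := R_AbsRing) (V := R_NormedModule) 2 (fun m => / INR (S m) - / INR (S (S m)))). exists 1. apply is_series_telescope.
Qed.

(** The saving n^(-(J - 1)) makes the kernels summable against coefficients of growth n^B once J >=
    B + 3. *)
Lemma KJ_scale (J n : nat) (Y : R) : (1 <= n)%nat -> (1 <= J)%nat -> 0 < Y ->
  ker_const J (INR n * Y) <= ker_const J Y * / INR n ^ (J - 1).
Proof.
  intros Hn HJ HY. assert (P : 1 <= INR n) by now apply (le_INR 1).
  unfold ker_const. rewrite !Rpow_mult_distr, Rmult_plus_distr_r.
  apply Rplus_le_compat.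
  - right. field. split; apply pow_nonzero; lra.
  - replace (INR (J + 2) ^ (J + 2) / (INR n ^ (J + 2) * Y ^ (J + 2))) with
      (INR (J + 2) ^ (J + 2) / Y ^ (J + 2) * / INR n ^ (J + 2)) by (field; split; apply pow_nonzero; lra).
    apply Rmult_le_compat_l.
    + apply Rmult_le_pos; [apply pow_le, pos_INR|apply Rlt_le, Rinv_0_lt_compat; now apply pow_lt].
    + apply Rinv_le_contravar; [apply pow_lt; lra|]. apply Rle_pow; [lra|lia].
Qed.

(** * The Mellin transform of the Fourier series along rays *)

Definition poly_bound (a : nat -> C) (A : R) (B : nat) : Prop :=
  0 <= A /\ forall m, Cmod (a (S m)) <= A * INR (S m) ^ B.

(* The Fourier series at z = i Y e^(u + i be) / (2 pi). *)
Definition psi (a : nat -> C) (Y be u : R) : C :=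
  CSeries (fun m => a (S m) * Cexp (- (INR (S m) * Y) * Cexp (u, be)))%C.

Lemma ker_split (Y be : R) (s : C) (u : R) :
  ker Y be s u = (Cexp (Ci * be * s) * (Cexp (- Y * Cexp (u, be)) * Cexp (u * s)))%C.
Proof.
  unfold ker. rewrite <- !Cexp_plus. f_equal.
  replace ((u, be) : C) with (RtoC u + Ci * be)%C at 1 by (apply Ceq; unfold Re, Im; simpl; ring). ring.
Qed.

Lemma Cmod_Cexp_i (t : R) : Cmod (Cexp (Ci * t)) = 1.
Proof. rewrite Cmod_Cexp. replace (Re (Ci * t)) with 0 by (unfold Re; simpl; ring). apply exp_0. Qed.

(** Termwise integration: [ker_scale] and [ker_rotate] turn the integral of each term into (n
    Y)^(-s) Gamma(s). The factor e^(i be s) is the share of t^s that belongs to the argument of the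
    ray. *)
Lemma psi_spec (a : nat -> C) (A : R) (B J : nat) (Y be : R) : poly_bound a A B ->
  (B + 3 <= J)%nat -> 0 < Y -> Rabs be < PI / 2 -> forall s, INR J <= Re s <= INR J + 1 ->
  Cont (psi a Y be) /\
  (exists K, exp_decay K (fun u => psi a Y be u * exp (u * Re s))%C) /\
  sums_to (fun m => a (S m) * (Cpower (INR (S m) * Y) (- s) * Gamma s))%C
        (Cexp (Ci * be * s) * line_int (fun u => psi a Y be u * Cexp (u * s)))%C.
Proof.
  intros [HA Ha] HJ HY Hb s Hs.
  assert (Pc : 0 < cos be) by (apply cos_gt_0; apply Rabs_def2 in Hb; lra).
  assert (HJ1 : (1 <= J)%nat) by lia.
  assert (Pn : forall m, 1 <= INR (S m)) by (intros m; apply (le_INR 1); lia).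
  assert (PY : forall m, 0 < INR (S m) * Y) by (intros m; specialize (Pn m); apply Rmult_lt_0_compat; lra).
  set (t := fun (z : C) m u => (a (S m) * ker (INR (S m) * Y) be z u)%C).
  assert (W : forall z, INR J <= Re z <= INR J + 1 ->
    Cont (fun u => CSeries (fun m => t z m u)) /\
    (exists K, exp_decay K (fun u => CSeries (fun m => t z m u))) /\
    (forall u, sums_to (fun m => t z m u) (CSeries (fun m => t z m u))) /\
    sums_to (fun m => line_int (t z m)) (line_int (fun u => CSeries (fun m => t z m u)))).
  { intros z Hz.
    set (v := fun m => A * exp (- (be * Im z)) * ker_const J (Y * cos be) * / INR (S m) ^ 2).
    assert (Ct : forall m, Cont (t z m)) by (intros m; apply Cont_scal, Cont_ker).
    assert (Dt : forall m, exp_decay (v m) (t z m)).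
    { intros m. apply (dec_weak (Cmod (a (S m)) * (exp (- (be * Im z)) * ker_const J (INR (S m) * Y * cos be)))).
      - unfold v. specialize (Ha m).
        assert (KS := KJ_scale J (S m) (Y * cos be) ltac:(lia) HJ1 ltac:(now apply Rmult_lt_0_compat)).
        assert (E0 : 0 < exp (- (be * Im z))) by apply exp_pos.
        assert (K0 : 0 <= ker_const J (Y * cos be)).
        { assert (X := kernel_dec J (INR J) (Y * cos be) 0 HJ1 ltac:(now apply Rmult_lt_0_compat) ltac:(lra)).
          rewrite Rabs_R0, Ropp_0, exp_0 in X.
          assert (0 < exp (0 * INR J) * exp (- (Y * cos be * 1))) by (apply Rmult_lt_0_compat; apply exp_pos). lra. }
        assert (PW : INR (S m) ^ B * / INR (S m) ^ (J - 1) <= / INR (S m) ^ 2).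
        { replace (J - 1)%nat with (B + (J - 1 - B))%nat by lia. rewrite pow_add.
          assert (0 < INR (S m) ^ B) by (apply pow_lt; specialize (Pn m); lra).
          assert (0 < INR (S m) ^ (J - 1 - B)) by (apply pow_lt; specialize (Pn m); lra).
          replace (INR (S m) ^ B * / (INR (S m) ^ B * INR (S m) ^ (J - 1 - B))) with (/ INR (S m) ^ (J - 1 - B)) by (field; lra).
          apply inv_pow_le_sq. lia. }
        rewrite (Rmult_assoc _ Y).
        apply Rle_trans with (A * INR (S m) ^ B * (exp (- (be * Im z)) * (ker_const J (Y * cos be) * / INR (S m) ^ (J - 1)))).
        + apply Rmult_le_compat; auto; try apply Cmod_ge_0.
          * apply Rmult_le_pos; [lra|]. 
            assert (X := kernel_dec J (INR J) (INR (S m) * (Y * cos be)) 0 HJ1).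
            rewrite Rabs_R0, Ropp_0, exp_0 in X.
            assert (0 < exp (0 * INR J) * exp (- (INR (S m) * (Y * cos be) * 1))) by (apply Rmult_lt_0_compat; apply exp_pos).
            specialize (X ltac:(rewrite <- Rmult_assoc; now apply Rmult_lt_0_compat) ltac:(lra)). lra.
          * apply Rmult_le_compat_l; lra.
        + replace (A * INR (S m) ^ B * (exp (- (be * Im z)) * (ker_const J (Y * cos be) * / INR (S m) ^ (J - 1)))) with
           (A * exp (- (be * Im z)) * ker_const J (Y * cos be) * (INR (S m) ^ B * / INR (S m) ^ (J - 1))) by ring.
          apply Rmult_le_compat_l; auto. apply Rmult_le_pos; auto. apply Rmult_le_pos; lra.
      - apply dec_scal. now apply dec_ker. }
    assert (Ev : ex_series v).
    { apply (ex_series_scal_l (K := R_AbsRing) (V := R_NormedModule)). apply ex_series_inv_pow. lia. }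
    destruct (II_series (t z) v Ct Dt Ev) as [A1 [A2 A3]].
    split; [exact A1|]. split; [eexists; exact A2|]. split; [|exact A3].
    intros u. apply (csums_abs _ (fun m => v m * exp (- Rabs u))).
    - intros m. apply Dt.
    - destruct Ev as [L HL]. exists (L * exp (- Rabs u)). now apply is_series_scal_r. }
  assert (E : forall z, INR J <= Re z <= INR J + 1 -> forall u,
     CSeries (fun m => t z m u) = (Cexp (Ci * be * z) * (psi a Y be u * Cexp (u * z)))%C).
  { intros z Hz u. destruct (W z Hz) as [_ [_ [H3 _]]]. specialize (H3 u).
    assert (NZ := Cexp_neq0 (Ci * be * z)). assert (NZ' := Cexp_neq0 (u * z)).
    unfold psi.
    assert (SS := csums_scal (/ (Cexp (Ci * be * z) * Cexp (u * z))) _ _ H3).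
    rewrite (csums_CSeries (fun m => a (S m) * Cexp (- (INR (S m) * Y) * Cexp (u, be)))%C
      (/ (Cexp (Ci * be * z) * Cexp (u * z)) * CSeries (fun m => t z m u))).
    - field; auto.
    - eapply csums_ext; [|exact SS]. intros m. unfold t. rewrite ker_split.
      rewrite RtoC_mult. field; auto. }
  (* Continuity and decay of [psi] are read off at the real point Re s, where e^(i be s) has modulus
     1 and e^(u s) is positive. *)
  assert (Hc : INR J <= Re (RtoC (Re s)) <= INR J + 1) by (simpl; lra).
  destruct (W s Hs) as [W1 [W2 [W3 W4]]].
  destruct (W (RtoC (Re s)) Hc) as [V1 [[K V2] [V3 V4]]].
  assert (U : Cmod (Cexp (- (Ci * be * Re s))) = 1).
  { replace (- (Ci * be * Re s))%C with (Ci * (- (be * Re s))%R)%C by (rewrite RtoC_opp, RtoC_mult; ring).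
    apply Cmod_Cexp_i. }
  assert (Ep : forall u, (psi a Y be u * exp (u * Re s) =
     Cexp (- (Ci * be * Re s)) * CSeries (fun m => t (RtoC (Re s)) m u))%C).
  { intros u. rewrite (E (RtoC (Re s)) Hc). rewrite Cexp_opp, <- Cexp_R, RtoC_mult.
    field. apply Cexp_neq0. }
  assert (DK : exp_decay K (fun u => psi a Y be u * exp (u * Re s))%C).
  { intros u. cbv beta. rewrite Ep, Cmod_mult, U, Rmult_1_l. apply V2. }
  assert (CP : Cont (psi a Y be)).
  { apply (Cont_ext (fun u => Cexp (- (u * Re s)) * (Cexp (- (Ci * be * Re s)) * CSeries (fun m => t (RtoC (Re s)) m u)))%C).
    - intros u. rewrite <- Ep, <- Cexp_R, Cexp_opp, RtoC_mult. field. apply Cexp_neq0.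
    - apply Cont_mult; [|apply Cont_scal; exact V1]. intros u. solve_ctn. }
  split; [exact CP|]. split; [exists K; exact DK|].
  rewrite <- (II_scal K).
  - rewrite (II_ext _ (fun u => CSeries (fun m => t s m u))).
    + eapply csums_ext; [|exact W4]. intros m. unfold t.
      rewrite (II_scal (exp (- (be * Im s)) * ker_const J (INR (S m) * Y * cos be))).
      * f_equal. rewrite (ker_scale J) by auto.
        rewrite (ker_rotate J), <- (Gamma_II J) by auto. reflexivity.
      * apply Cont_ker.
      * now apply dec_ker.
    + intros u. now rewrite E.
  - destruct s as [c tau]. now apply Cont_unweight.
  - destruct s as [c tau]. now apply dec_line.
Qed.

(** For Y = 2 pi / sqrt N one has (sqrt N / (2 pi))^s n^(-s) = (n Y)^(-s), the scaling of
    [psi_spec]. *)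
Lemma Phi_psi (N k : nat) (a : nat -> C) (A : R) (B J : nat) (F : C -> C) (be : R) (s : C) :
  (0 < N)%nat -> poly_bound a A B -> (B + 3 <= J)%nat -> Rabs be < PI / 2 ->
  INR J <= Re s <= INR J + 1 ->
  is_series (V := C_NormedModule) (dirichlet_term a s) (F s) ->
  Phi N F s = (Cexp (Ci * be * s) * line_int (fun u => psi a (2 * PI / sqrt (INR N)) be u * Cexp (u * s)))%C.
Proof.
  intros HN Ha HJ Hb Hs HF.
  assert (PN : 0 < sqrt (INR N)) by (apply sqrt_lt_R0, lt_0_INR; auto).
  assert (PP := PI_RGT_0).
  assert (HY : 0 < 2 * PI / sqrt (INR N)) by (apply Rdiv_lt_0_compat; lra).
  destruct (psi_spec a A B J (2 * PI / sqrt (INR N)) be Ha HJ HY Hb s Hs) as [_ [_ H]].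
  apply is_series_csums in HF.
  apply (csums_scal (Cpower (sqrt (INR N) / (2 * PI)) s * Gamma s)) in HF.
  unfold Phi. apply (csums_unique _ _ _ HF).
  eapply csums_ext; [|exact H]. intros m. unfold dirichlet_term.
  rewrite Cpower_mult_base by (auto; apply lt_0_INR; lia).
  replace (Cpower (sqrt (INR N) / (2 * PI)) s) with (Cpower (2 * PI / sqrt (INR N)) (- s)).
  - ring.
  - rewrite <- Cpower_inv_base by auto. f_equal. field. lra.
Qed.

Lemma fourier_psi (N : nat) (a : nat -> C) (u be : R) : (0 < N)%nat ->
  fourier_series a (Ci * Cexp (u, be) / sqrt (INR N))%C = psi a (2 * PI / sqrt (INR N)) be u.
Proof.
  intros HN. unfold fourier_series, psi. f_equal. apply functional_extensionality. intros m.
  f_equal. f_equal.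
  assert (PN : 0 < sqrt (INR N)) by (apply sqrt_lt_R0, lt_0_INR; auto).
  assert (NZ : RtoC (sqrt (INR N)) <> 0%C) by (intros h; apply RtoC_inj in h; lra).
  rewrite RtoC_div by lra. rewrite RtoC_mult.
  replace (2 * PI * Ci * INR (S m) * (Ci * Cexp (u, be) / sqrt (INR N)))%C with
    ((Ci * Ci) * (2 * PI * INR (S m) * Cexp (u, be) / sqrt (INR N)))%C by (field; auto).
  replace (Ci * Ci)%C with (- (1))%C by (apply Ceq; unfold Re, Im; simpl; ring). field; auto.
Qed.

Lemma polar_right (x : C) : 0 < Re x -> exists u be, Rabs be < PI / 2 /\ x = Cexp (u, be).
Proof.
  intros Hx. destruct x as [p q]. simpl in Hx.
  set (r := sqrt (p * p + q * q)).
  assert (Hr : 0 < r) by (apply sqrt_lt_R0; nra).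
  assert (E : r = p * sqrt (1 + (q / p)²)).
  { assert (X := Rle_0_sqr (q / p)). unfold r.
    replace (p * sqrt (1 + (q / p)²)) with (sqrt (p * p) * sqrt (1 + (q / p)²)) by (rewrite sqrt_square; lra).
    rewrite <- sqrt_mult by nra.
    f_equal. unfold Rsqr. field. lra. }
  assert (Hs : 0 < sqrt (1 + (q / p)²)).
  { apply sqrt_lt_R0. assert (X := Rle_0_sqr (q / p)). lra. }
  exists (ln r), (atan (q / p)). split.
  - assert (X := atan_bound (q / p)). apply Rabs_def1; lra.
  - unfold Cexp. simpl. rewrite exp_ln by auto.
    rewrite cos_atan, sin_atan, E. f_equal; field; lra.
Qed.

(** In the coordinates (u, be) the involution z -> -1 / (N z) becomes (u, be) -> (-u, -be). *)
Lemma upper_param (N : nat) (z : C) : (0 < N)%nat -> 0 < Im z ->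
  exists u be, Rabs be < PI / 2 /\ z = (Ci * Cexp (u, be) / sqrt (INR N))%C.
Proof.
  intros HN Hz.
  assert (PN : 0 < sqrt (INR N)) by (apply sqrt_lt_R0, lt_0_INR; auto).
  assert (NZ : RtoC (sqrt (INR N)) <> 0%C) by (intros h; apply RtoC_inj in h; lra).
  destruct (polar_right (- Ci * sqrt (INR N) * z)) as [u [be [Hb E]]].
  - destruct z as [x y]. unfold Re. simpl in *. nra.
  - exists u, be. split; auto. rewrite <- E.
    replace (Ci * (- Ci * sqrt (INR N) * z) / sqrt (INR N))%C with (- (Ci * Ci) * z)%C by (field; auto).
    replace (Ci * Ci)%C with (- (1))%C by (apply Ceq; unfold Re, Im; simpl; ring). ring.
Qed.

Lemma holo_of_entire (f : C -> C) : entire f -> holo f.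
Proof. intros H z. destruct (H z) as [l Hl]. exists l. now apply cd_is_derive. Qed.

Lemma Cpow_2 (z : C) (m : nat) : (z ^ (2 * m) = (z * z) ^ m)%C.
Proof.
  induction m; [reflexivity|]. replace (2 * S m)%nat with (S (S (2 * m))) by lia.
  simpl. simpl in IHm. rewrite IHm. ring.
Qed.

Lemma Cpow_mul_l (x y : C) (m : nat) : ((x * y) ^ m = x ^ m * y ^ m)%C.
Proof. induction m; simpl; [ring|]. rewrite IHm. ring. Qed.

Lemma Cpow_neq0 (x : C) (m : nat) : x <> 0%C -> (x ^ m <> 0)%C.
Proof.
  intros H. induction m; simpl.
  - intros E. apply RtoC_inj in E. lra.
  - now apply Cmult_neq_0.
Qed.

(** On Re s = c the function e^(-i be s) Phi(s) is the Mellin transform of [psi] at angle be. On Re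
    s = k - c the functional equation makes it the transform of [psi] at angle -be, reflected in u.
    By [strip_uniqueness] the two functions of u agree, which is the relation at the point z with
    coordinates (x, be). *)
Lemma fricke (N m : nat) (a : nat -> C) (A : R) (B : nat) (F : C -> C) :
  (0 < N)%nat -> poly_bound a A B -> is_dirichlet_series a F -> EBV F ->
  functional_equation N (2 * m) F ->
  exists eps : R, (eps = 1 \/ eps = -1) /\
   forall z, 0 < Im z ->
    (fourier_series a (- / (INR N * z)) = eps * (INR N * (z * z)) ^ m * fourier_series a z)%C.
Proof.
  intros HN Ha [sg HF] [_ [L [HL [HLb HLe]]]] [eps [Heps Hfe]].
  exists eps. split; auto. intros z Hz.
  set (k := (2 * m)%nat) in *.
  assert (PN : 0 < sqrt (INR N)) by (apply sqrt_lt_R0, lt_0_INR; auto).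
  assert (PP := PI_RGT_0).
  set (Y := 2 * PI / sqrt (INR N)).
  assert (HY : 0 < Y) by (apply Rdiv_lt_0_compat; lra).
  destruct (upper_param N z HN Hz) as [x [be [Hb Ez]]].
  destruct (INR_unbounded sg) as [J0 HJ0].
  (* J0 ensures convergence of the series, B + 3 the hypothesis of [psi_spec], and k that the
     reflected line k - c lies to the left of c. *)
  set (J := (J0 + B + 3 + k)%nat).
  assert (LJ0 : INR J0 <= INR J) by (apply le_INR; unfold J; lia).
  assert (LJk : INR k <= INR J) by (apply le_INR; unfold J; lia).
  assert (LJ1 : 1 <= INR J) by (apply (le_INR 1); unfold J; lia).
  (* A half-integer, so that neither c nor k - c is the real part of a pole of Gamma. *)
  set (c := INR J + / 2).
  assert (Hc2e : exists c2, c2 = INR k - c) by eauto. destruct Hc2e as [c2 Hc2].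
  assert (Hc : forall tau, INR J <= Re (c, tau) <= INR J + 1) by (intros tau; unfold c; simpl; lra).
  assert (Hb' : Rabs (- be) < PI / 2) by now rewrite Rabs_Ropp.
  assert (Hnp1 : forall tau, ~ Gamma_pole (c, tau)).
  { intros tau [n Hn]. apply (f_equal Re) in Hn. rewrite <- RtoC_opp in Hn. simpl in Hn.
    assert (X := pos_INR n). unfold c in Hn. lra. }
  assert (Hnp2 : forall tau, ~ Gamma_pole (c2, tau)).
  { intros tau [n Hn]. apply (f_equal Re) in Hn. rewrite <- RtoC_opp in Hn. simpl in Hn.
    rewrite Hc2 in Hn. unfold c in Hn.
    assert (E : 2 * INR J + 1 = 2 * INR k + 2 * INR n) by lra.
    assert (E2 : INR (2 * J + 1) = INR (2 * k + 2 * n)) by (rewrite !plus_INR, !mult_INR; simpl; lra).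
    apply INR_eq in E2. lia. }
  set (eta := (eps * (-1) ^ (k / 2))%C).
  assert (Phi_fe : forall tau, Phi N F (c2, tau) = (eta * Phi N F (c, (- tau)%R))%C).
  { intros tau. rewrite (Hfe (c2, tau)); auto.
    - unfold eta. f_equal. f_equal. rewrite Hc2. apply Ceq; unfold Re, Im; simpl; ring.
    - replace (INR k - (c2, tau))%C with ((c, (- tau)%R) : C) by (rewrite Hc2; apply Ceq; unfold Re, Im; simpl; ring).
      apply Hnp1. }
  assert (PP1 : forall b tau, Rabs b < PI / 2 -> Phi N F (c, tau) =
     (Cexp (Ci * b * (c, tau)) * line_int (fun u => psi a Y b u * Cexp (u * (c, tau))))%C).
  { intros b tau Hbb. apply (Phi_psi N k a A B J); auto; [unfold J; lia|].
    apply HF. simpl. unfold c. lra. }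
  assert (HJB : (B + 3 <= J)%nat) by (unfold J; lia).
  assert (Hc0 := Hc 0).
  destruct (psi_spec a A B J Y be Ha HJB HY Hb (c, 0) Hc0) as [C1 [[K1 D1] _]].
  destruct (psi_spec a A B J Y (- be) Ha HJB HY Hb' (c, 0) Hc0) as [C2 [[K2 D2] _]].
  simpl in D1, D2.
  (* In the integral at k - s the reflection u -> -u leaves e^(-u k), and the rotation by -be leaves
     e^(-i be k). *)
  set (psi2 := fun u : R => (eta * Cexp (- (Ci * be * INR k)) * (psi a Y (- be) (- u) * exp (- (u * INR k))))%C).
  (* [L] takes the place of Gamma F, which makes G holomorphic at the poles too; the factor e^(-i be
     s) costs growth e^(|be| |Im s|). *)
  set (G := fun s : C => (Cexp (- (Ci * be) * s) * (Cpower (sqrt (INR N) / (2 * PI)) s * L s))%C).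
  assert (HG : holo G).
  { unfold G, Cpower. assert (HLh := holo_of_entire L HL). solve_holo. }
  assert (C3 : Cont psi2).
  { apply Cont_scal. intros u. apply ctn_mult.
    - apply (ctn_Rcomp (fun u => - u)); [solve_ctn|apply C2].
    - apply ctn_RtoC. apply (continuous_Rcomp exp (fun u => - (u * INR k))); [apply derivable_continuous_pt, derivable_pt_exp|]. solve_ctn. }
  assert (Ue : Cmod eta = 1).
  { unfold eta. rewrite Cmod_mult, Cmod_pow, !Cmod_R.
    replace (Rabs (-1)) with 1 by (rewrite Rabs_left; lra). rewrite pow1, Rmult_1_r.
    destruct Heps as [-> | ->]; [apply Rabs_R1|rewrite Rabs_left; lra]. }
  assert (Uk : Cmod (Cexp (- (Ci * be * INR k))) = 1).
  { replace (- (Ci * be * INR k))%C with (Ci * (- (be * INR k))%R)%C by (rewrite RtoC_opp, RtoC_mult; ring).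
    apply Cmod_Cexp_i. }
  assert (D3 : exp_decay K2 (fun u => psi2 u * exp (u * c2))%C).
  { intros u. unfold psi2. rewrite !Cmod_mult, Ue, Uk, !Rmult_1_l.
    specialize (D2 (- u)). cbv beta in D2. rewrite Cmod_mult in D2. rewrite Rabs_Ropp in D2.
    eapply Rle_trans; [|exact D2]. right. rewrite Rmult_assoc. f_equal.
    rewrite <- Cmod_mult, <- RtoC_mult, <- exp_plus. f_equal. f_equal. f_equal. rewrite Hc2. ring. }
  assert (Ginv : forall s, ~ Gamma_pole s -> G s = (Cexp (- (Ci * be) * s) * Phi N F s)%C).
  { intros s Hs. unfold G, Phi. rewrite HLe by auto. ring. }
  assert (UQ : psi a Y be x = psi2 x).
  { destruct (HLb c2 c) as [M HM].
    assert (M0 : 0 <= M).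
    { eapply Rle_trans; [apply Cmod_ge_0|apply (HM (c, 0))]. simpl. rewrite Hc2. unfold c. lra. }
    set (lq := ln (sqrt (INR N) / (2 * PI))).
    apply (strip_uniqueness G c c2 K1 K2 (exp (Rabs lq * (Rabs c + Rabs c2)) * M) (Rabs be)); auto.
    - rewrite Hc2. unfold c. lra.
    - apply Rabs_pos.
    - intros s Hs. unfold G. rewrite !Cmod_mult. unfold Cpower. rewrite !Cmod_Cexp. fold lq.
      replace (Re (- (Ci * be) * s)) with (be * Im s) by (unfold Re, Im; simpl; ring).
      replace (Re (s * lq)) with (lq * Re s) by (unfold Re; simpl; ring).
      rewrite (Rmult_comm (exp (be * Im s))).
      assert (Rs : Rabs (Re s) <= Rabs c + Rabs c2).
      { rewrite Rplus_comm. apply Rabs_le_max. assert (c2 <= c) by (rewrite Hc2; unfold c; lra). rewrite Rmin_left, Rmax_right; lra. }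
      apply Rmult_le_compat.
      + apply Rmult_le_pos; [apply Rlt_le, exp_pos|apply Cmod_ge_0].
      + apply Rlt_le, exp_pos.
      + apply Rmult_le_compat; [apply Rlt_le, exp_pos|apply Cmod_ge_0| |now apply HM].
        apply exp_le. eapply Rle_trans; [apply Rle_abs|]. rewrite Rabs_mult.
        apply Rmult_le_compat_l; auto. apply Rabs_pos.
      + apply exp_le. eapply Rle_trans; [apply Rle_abs|]. rewrite Rabs_mult. lra.
    - intros tau. rewrite Ginv by auto. rewrite (PP1 be tau Hb).
      rewrite Cmult_assoc, <- Cexp_plus.
      replace (- (Ci * be) * (c, tau) + Ci * be * (c, tau))%C with (RtoC 0) by ring.
      rewrite Cexp_0. ring.
    - intros tau. rewrite Ginv by auto. rewrite Phi_fe, (PP1 (- be) (- tau) Hb').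
      set (g := fun u => (psi a Y (- be) u * Cexp (u * (c, (- tau)%R)))%C).
      assert (Cg : Cont g) by now apply Cont_unweight.
      assert (Dg : exp_decay K2 g) by now apply dec_line.
      rewrite <- (II_reflect K2 g) by auto.
      replace (Cexp (- (Ci * be) * (c2, tau)) * (eta * (Cexp (Ci * (- be)%R * (c, (- tau)%R)) * line_int (fun t => g (- t)%R))))%C
        with ((eta * (Cexp (- (Ci * be) * (c2, tau)) * Cexp (Ci * (- be)%R * (c, (- tau)%R)))) * line_int (fun t => g (- t)%R))%C by ring.
      rewrite <- Cexp_plus.
      rewrite <- (II_scal K2).
      + apply II_ext. intros u. unfold g, psi2.
        replace (- (Ci * be) * (c2, tau) + Ci * (- be)%R * (c, (- tau)%R))%C with
          (- (Ci * be * INR k))%C by (rewrite RtoC_opp, Hc2; apply Ceq; unfold Re, Im; simpl; ring).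
        rewrite <- !Cmult_assoc. do 2 f_equal. f_equal.
        rewrite <- Cexp_R, <- Cexp_plus. f_equal. rewrite Hc2.
        apply Ceq; unfold Re, Im; simpl; ring.
      + intros t. apply (ctn_Rcomp (fun t => - t)); [solve_ctn|apply Cg].
      + intros t. rewrite <- (Rabs_Ropp t). apply Dg. }
  assert (NZ : RtoC (sqrt (INR N)) <> 0%C) by (intros h; apply RtoC_inj in h; lra).
  assert (SQ : (RtoC (sqrt (INR N)) * RtoC (sqrt (INR N)) = INR N)%C).
  { rewrite <- RtoC_mult, sqrt_sqrt; auto. apply pos_INR. }
  assert (CiCi : (Ci * Ci = - (1))%C) by (apply Ceq; unfold Re, Im; simpl; ring).
  set (e := Cexp (x, be)) in *.
  assert (Ne : e <> 0%C) by apply Cexp_neq0.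
  assert (Z1 : (- / (INR N * z))%C = (Ci * Cexp ((- x)%R, (- be)%R) / sqrt (INR N))%C).
  { replace (((- x)%R, (- be)%R) : C) with (- (x, be))%C by (apply Ceq; unfold Re, Im; simpl; ring).
    rewrite Cexp_opp. fold e. rewrite Ez, <- SQ.
    assert (Nci : Ci <> 0%C) by (intros h; apply (f_equal Im) in h; simpl in h; lra).
    replace (Ci * / e / sqrt (INR N))%C with ((- (1)) / (Ci * e * sqrt (INR N)))%C.
    - field; auto.
    - rewrite <- CiCi. field; auto. }
  assert (F0 : fourier_series a z = psi a Y be x) by (rewrite Ez; unfold e; now apply fourier_psi).
  rewrite Z1, fourier_psi by auto. fold Y. rewrite F0, UQ. unfold psi2.
  assert (Ek : (Cexp (- (Ci * be * INR k)) * exp (- (x * INR k)) = / (e * e) ^ m)%C).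
  { rewrite <- Cexp_R, <- Cexp_plus. unfold e. rewrite <- Cpow_2. fold k.
    rewrite <- Cexp_pow, <- Cexp_opp. f_equal. apply Ceq; unfold Re, Im; simpl; ring. }
  (* Since N z^2 = - e^2, the power (N z^2)^m carries the sign (-1)^m that cancels (-1)^(k/2) of the
     functional equation. *)
  assert (NZ2 : ((INR N * (z * z)) = - (1) * (e * e))%C).
  { rewrite Ez, <- SQ, <- CiCi. field; auto. }
  rewrite NZ2, Cpow_mul_l.
  assert (M1 : ((- (1)) ^ m * (-1) ^ m = 1)%C).
  { rewrite <- Cpow_mul_l. replace (- (1) * -1)%C with (RtoC 1) by (apply Ceq; unfold Re, Im; simpl; ring).
    clear. induction m; simpl; [reflexivity|]. rewrite IHm. ring. }
  assert (K2m : (k / 2 = m)%nat) by (unfold k; rewrite Nat.mul_comm; now apply Nat.div_mul).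
  unfold eta. rewrite K2m.
  assert (Ee : (eps * eps = 1)%C).
  { rewrite <- RtoC_mult. f_equal. destruct Heps as [-> | ->]; ring. }
  assert (Nem : ((e * e) ^ m <> 0)%C) by (apply Cpow_neq0; now apply Cmult_neq_0).
  replace (eps * ((- (1)) ^ m * (e * e) ^ m) * (eps * (-1) ^ m * Cexp (- (Ci * be * INR k)) * (psi a Y (- be) (- x) * exp (- (x * INR k)))))%C
   with ((eps * eps) * ((- (1)) ^ m * (-1) ^ m) * (e * e) ^ m * (Cexp (- (Ci * be * INR k)) * exp (- (x * INR k))) * psi a Y (- be) (- x))%C by ring.
  rewrite Ee, M1, Ek. field. auto.
Qed.

(** * Hecke relations from the Euler product *)

(* The coefficients of p^(-s) times the Dirichlet series with coefficients b. *)
Definition dilate (p : nat) (b : nat -> C) (n : nat) : C :=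
  if (n mod p =? 0)%nat then b (n / p)%nat else 0%C.

(** Dilation only inserts zeros, so convergence passes in both directions, without rearrangement. *)
Lemma csum_dil (p : nat) (u : nat -> C) (n : nat) : (1 <= p)%nat ->
  partial_sum (dilate p u) n = partial_sum u (n / p).
Proof.
  intros Hp. induction n as [|n IH].
  - simpl partial_sum. unfold dilate. rewrite Nat.Div0.mod_0_l, Nat.Div0.div_0_l. reflexivity.
  - simpl partial_sum. rewrite IH. unfold dilate.
    assert (D := Nat.div_mod_eq n p). assert (Mb := Nat.mod_upper_bound n p ltac:(lia)).
    destruct (Nat.eq_dec (S (n mod p)) p) as [E|E].
    + assert (Q : (S n / p = S (n / p))%nat).
      { symmetry. apply (Nat.div_unique _ _ _ 0); lia. }
      assert (M : (S n mod p = 0)%nat).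
      { symmetry. apply (Nat.mod_unique _ _ (S (n / p))); lia. }
      rewrite M, Q. simpl. reflexivity.
    + assert (Q : (S n / p = n / p)%nat).
      { symmetry. apply (Nat.div_unique _ _ _ (S (n mod p))); lia. }
      assert (M : (S n mod p = S (n mod p))%nat).
      { symmetry. apply (Nat.mod_unique _ _ (n / p)); lia. }
      rewrite M, Q. simpl. ring.
Qed.

Lemma csums_dil (p : nat) (u : nat -> C) (l : C) : (1 <= p)%nat -> sums_to u l -> sums_to (dilate p u) l.
Proof.
  intros Hp H eps He. destruct (H eps He) as [N HN]. exists (p * N)%nat. intros n Hn.
  rewrite csum_dil by auto. apply HN. apply Nat.div_le_lower_bound; lia.
Qed.

Lemma csums_undil (p : nat) (u : nat -> C) (l : C) : (1 <= p)%nat -> sums_to (dilate p u) l -> sums_to u l.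
Proof.
  intros Hp H eps He. destruct (H eps He) as [N HN]. exists N. intros n Hn.
  specialize (HN (p * n)%nat ltac:(nia)). rewrite csum_dil in HN by auto.
  rewrite Nat.mul_comm, Nat.div_mul in HN by lia. exact HN.
Qed.

Lemma dil_mult (p : nat) (b : nat -> C) (n : nat) : (1 <= p)%nat -> dilate p b (p * n) = b n.
Proof.
  intros Hp. unfold dilate. rewrite Nat.mul_comm, Nat.Div0.mod_mul, Nat.div_mul by lia. reflexivity.
Qed.

Lemma mod_0_ex (n p : nat) : (1 <= p)%nat -> (n mod p =? 0)%nat = true -> n = (p * (n / p))%nat.
Proof. intros Hp H. apply Nat.eqb_eq in H. assert (D := Nat.div_mod_eq n p). lia. Qed.

Lemma dil_dil (p q : nat) (b : nat -> C) (n : nat) : (1 <= p)%nat -> (1 <= q)%nat ->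
  dilate p (dilate q b) n = dilate (p * q) b n.
Proof.
  intros Hp Hq. unfold dilate at 1. destruct (n mod p =? 0)%nat eqn:E.
  - apply mod_0_ex in E; auto. set (k := (n / p)%nat) in *. rewrite E.
    unfold dilate. rewrite Nat.Div0.mul_mod_distr_l, Nat.Div0.div_mul_cancel_l by lia.
    destruct (k mod q =? 0)%nat eqn:F.
    + apply Nat.eqb_eq in F. rewrite F, Nat.mul_0_r. reflexivity.
    + apply Nat.eqb_neq in F. destruct (p * (k mod q) =? 0)%nat eqn:G; auto.
      apply Nat.eqb_eq in G. exfalso. apply Nat.eq_mul_0 in G. lia.
  - unfold dilate. destruct (n mod (p * q) =? 0)%nat eqn:F; auto.
    apply mod_0_ex in F; [|nia]. exfalso. apply Nat.eqb_neq in E. apply E.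
    rewrite F, <- Nat.mul_assoc, Nat.mul_comm. apply Nat.Div0.mod_mul.
Qed.

Section Euler.

Variables (e1 e2 : nat -> C).

(* The coefficients of (1 - e1 p^(-s) + e2 p^(-2s)) times the Dirichlet series of b. *)
Definition euler_op (p : nat) (b : nat -> C) (n : nat) : C :=
  (b n - e1 p * dilate p b n + e2 p * dilate (p * p) b n)%C.

Definition prime_nat (n : nat) : bool := if prime_dec (Z.of_nat n) then true else false.

(** Division by the Euler factors of all primes up to X; [euler_ops_skip] leaves out p, so that the
    factor of p can be applied first. *)
Fixpoint euler_ops (X : nat) (b : nat -> C) : nat -> C :=
  match X with O => b | S X' => if prime_nat (S X') then euler_op (S X') (euler_ops X' b) else euler_ops X' b end.

Fixpoint euler_ops_skip (p X : nat) (b : nat -> C) : nat -> C :=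
  match X with O => b
  | S X' => if andb (prime_nat (S X')) (negb (S X' =? p)%nat) then euler_op (S X') (euler_ops_skip p X' b) else euler_ops_skip p X' b end.

Lemma dil_lin (r : nat) (f g h : nat -> C) (x y : C) (n : nat) :
  dilate r (fun n => f n - x * g n + y * h n)%C n = (dilate r f n - x * dilate r g n + y * dilate r h n)%C.
Proof. unfold dilate. destruct (n mod r =? 0)%nat; ring. Qed.

Lemma Dop_comm (p q : nat) (b : nat -> C) : (1 <= p)%nat -> (1 <= q)%nat ->
  euler_op p (euler_op q b) = euler_op q (euler_op p b).
Proof.
  intros Hp Hq. apply functional_extensionality. intros n. unfold euler_op at 1 3.
  change (euler_op q b) with (fun n => b n - e1 q * dilate q b n + e2 q * dilate (q * q) b n)%C.
  change (euler_op p b) with (fun n => b n - e1 p * dilate p b n + e2 p * dilate (p * p) b n)%C.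
  rewrite !dil_lin, !dil_dil by nia.
  rewrite (Nat.mul_comm q p), (Nat.mul_comm q (p * p)), (Nat.mul_comm (q * q) p), (Nat.mul_comm (q * q) (p * p)).
  ring.
Qed.

Lemma isp_pos (n : nat) : prime_nat n = true -> (2 <= n)%nat.
Proof.
  unfold prime_nat. destruct (prime_dec (Z.of_nat n)) as [H|H]; [|discriminate].
  intros _. destruct H as [H _]. lia.
Qed.

Lemma Dskip_comm (p X : nat) (b : nat -> C) : (1 <= p)%nat -> euler_ops_skip p X (euler_op p b) = euler_op p (euler_ops_skip p X b).
Proof.
  intros Hp. induction X; [reflexivity|]. cbn [euler_ops_skip].
  destruct (prime_nat (S X)) eqn:E; cbn [andb]; auto. destruct (S X =? p)%nat; cbn [negb]; auto.
  rewrite IHX. apply Dop_comm; lia.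
Qed.

Lemma Dskip_small (p X : nat) (b : nat -> C) : (X < p)%nat -> euler_ops_skip p X b = euler_ops X b.
Proof.
  induction X; intros H; [reflexivity|]. cbn [euler_ops_skip euler_ops].
  rewrite (proj2 (Nat.eqb_neq (S X) p)) by lia. rewrite Bool.andb_true_r, IHX by lia. reflexivity.
Qed.

Lemma Dops_split (p X : nat) (b : nat -> C) : prime_nat p = true -> (p <= X)%nat ->
  euler_ops X b = euler_ops_skip p X (euler_op p b).
Proof.
  intros Hp. assert (P2 := isp_pos p Hp). induction X; intros H; [lia|].
  cbn [euler_ops_skip euler_ops]. destruct (Nat.eq_dec (S X) p) as [E|E].
  - rewrite (proj2 (Nat.eqb_eq (S X) p) E). cbn [negb]. rewrite Bool.andb_false_r. rewrite E, Hp.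
    rewrite Dskip_comm by lia. rewrite Dskip_small by lia. reflexivity.
  - rewrite (proj2 (Nat.eqb_neq (S X) p) E). rewrite Bool.andb_true_r, IHX by lia. reflexivity.
Qed.

(** Solved for [b n], the equation [euler_op q b n = 0] involves only n / q and n / q^2, which are
    smaller than n and still multiples of p because q is another prime. Strong induction applies. *)
Lemma Dop_reflect (p q X : nat) (b : nat -> C) : prime_nat p = true -> prime_nat q = true -> q <> p ->
  (forall n, (1 <= n <= X)%nat -> Nat.divide p n -> euler_op q b n = 0%C) ->
  forall n, (1 <= n <= X)%nat -> Nat.divide p n -> b n = 0%C.
Proof.
  intros Pp Pq Hne H n. assert (P2 := isp_pos p Pp). assert (Q2 := isp_pos q Pq).
  assert (Hcop : forall r, Nat.divide p (q * r) -> Nat.divide p r).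
  { intros r Hr. unfold prime_nat in Pp, Pq.
    destruct (prime_dec (Z.of_nat p)) as [Hp|]; [|discriminate].
    destruct (prime_dec (Z.of_nat q)) as [Hq|]; [|discriminate].
    destruct Hr as [k Hk].
    assert (D : (Z.of_nat p | Z.of_nat q * Z.of_nat r)%Z) by (exists (Z.of_nat k); lia).
    destruct (prime_mult _ Hp _ _ D) as [h|h].
    - exfalso. assert (X0 := prime_div_prime _ _ Hp Hq h). lia.
    - destruct h as [j Hj]. exists (Z.to_nat j). nia. }
  assert (Z0 : forall r m, (1 <= m <= X)%nat -> Nat.divide p m -> (2 <= r)%nat ->
    (forall s, Nat.divide p (r * s) -> Nat.divide p s) ->
    (forall m', (m' < m)%nat -> (1 <= m' <= X)%nat -> Nat.divide p m' -> b m' = 0%C) -> dilate r b m = 0%C).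
  { intros r m Hm Dm Hr Hc IH. unfold dilate. destruct (m mod r =? 0)%nat eqn:E; auto.
    apply mod_0_ex in E; [|lia]. set (j := (m / r)%nat) in *. apply IH; try nia.
    apply Hc. now rewrite <- E. }
  induction n as [n IH] using (well_founded_induction lt_wf). intros Hn Dn.
  specialize (H n Hn Dn). unfold euler_op in H.
  rewrite (Z0 q n) in H by auto. rewrite (Z0 (q * q)%nat n) in H; auto.
  - rewrite <- H. ring.
  - nia.
  - intros s Hs. apply Hcop, Hcop. now rewrite Nat.mul_assoc.
Qed.

Lemma Dskip_reflect (p Y X : nat) (b : nat -> C) : prime_nat p = true ->
  (forall n, (1 <= n <= X)%nat -> Nat.divide p n -> euler_ops_skip p Y b n = 0%C) ->
  forall n, (1 <= n <= X)%nat -> Nat.divide p n -> b n = 0%C.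
Proof.
  intros Hp. induction Y; intros H; [exact H|]. apply IHY. cbn [euler_ops_skip] in H.
  destruct (prime_nat (S Y)) eqn:E; cbn [andb] in H; auto.
  destruct (S Y =? p)%nat eqn:F; cbn [negb] in H; auto.
  apply (Dop_reflect p (S Y)); auto. now apply Nat.eqb_neq.
Qed.

(** The hypothesis says that the Euler factors up to X reduce the series to its first coefficient,
    up to index X. Undoing the factors of all primes except p keeps the zeros at multiples of p, and
    what remains is the recursion at p. *)
Lemma Dops_hecke (b : nat -> C) : (forall X n, (2 <= n <= X)%nat -> euler_ops X b n = 0%C) ->
  forall p n, prime_nat p = true -> (1 <= n)%nat -> b (p * n)%nat = (e1 p * b n - e2 p * dilate p b n)%C.
Proof.
  intros H p n Hp Hn. assert (P2 := isp_pos p Hp).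
  (* X = p n suffices for the single index p n at which the recursion is read off. *)
  assert (Z := Dskip_reflect p (p * n) (p * n) (euler_op p b) Hp).
  rewrite <- Dops_split in Z by (auto; nia).
  assert (E : euler_op p b (p * n) = 0%C).
  { apply Z; [|nia|exists n; lia]. intros j Hj [c Hc]. apply H. split; [|lia]. destruct c; [lia|nia]. }
  unfold euler_op in E. rewrite dil_mult in E by lia.
  rewrite <- dil_dil in E by lia. rewrite dil_mult in E by lia.
  replace (b (p * n)%nat) with (b (p * n)%nat - e1 p * b n + e2 p * dilate p b n + (e1 p * b n - e2 p * dilate p b n))%C by ring.
  rewrite E. ring.
Qed.

(** * Recovering coefficients from values at large integers *)

Definition dirichlet_summand (b : nat -> C) (M n : nat) : C := (b n * RtoC (/ INR n ^ M))%C.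

(** [b O = 0] makes the index 0, with its junk power of 0, harmless in sums that start at 0 and in
    dilations. *)
Definition poly_bound0 (b : nat -> C) (A : R) (B : nat) : Prop :=
  0 <= A /\ b O = 0%C /\ forall n, (1 <= n)%nat -> Cmod (b n) <= A * INR n ^ B.

Lemma dil_wM (p M : nat) (b : nat -> C) (n : nat) : (1 <= p)%nat -> b O = 0%C ->
  dirichlet_summand (dilate p b) M n = (RtoC (/ INR p ^ M) * dilate p (dirichlet_summand b M) n)%C.
Proof.
  intros Hp H0. unfold dirichlet_summand, dilate. destruct (n mod p =? 0)%nat eqn:E; [|ring].
  apply mod_0_ex in E; auto. set (k := (n / p)%nat) in *.
  destruct (Nat.eq_dec k 0) as [K0|K0]; [rewrite K0, H0; ring|].
  rewrite E, mult_INR, Rpow_mult_distr.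
  assert (INR p <> 0) by (apply not_0_INR; lia). assert (INR k <> 0) by (now apply not_0_INR).
  rewrite Rinv_mult, RtoC_mult. ring.
Qed.

Lemma wM_Dop (p M : nat) (b : nat -> C) (l : C) : (1 <= p)%nat -> b O = 0%C -> sums_to (dirichlet_summand b M) l ->
  sums_to (dirichlet_summand (euler_op p b) M) ((1 - e1 p * RtoC (/ INR p ^ M) + e2 p * RtoC (/ INR (p * p) ^ M)) * l)%C.
Proof.
  intros Hp H0 H.
  assert (S1 := csums_scal (e1 p * RtoC (/ INR p ^ M))%C _ _ (csums_dil p _ _ Hp H)).
  assert (S2 := csums_scal (e2 p * RtoC (/ INR (p * p) ^ M))%C _ _ (csums_dil (p * p) _ _ ltac:(nia) H)).
  replace ((1 - e1 p * RtoC (/ INR p ^ M) + e2 p * RtoC (/ INR (p * p) ^ M)) * l)%C with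
    (l - e1 p * RtoC (/ INR p ^ M) * l + e2 p * RtoC (/ INR (p * p) ^ M) * l)%C by ring.
  eapply csums_ext; [|apply (csums_plus _ _ _ _ (csums_minus _ _ _ _ H S1) S2)].
  intros n. cbv beta. rewrite <- !Cmult_assoc, <- !dil_wM by (auto; nia).
  unfold dirichlet_summand, euler_op. ring.
Qed.

Lemma Dop_0 (p : nat) (b : nat -> C) : b O = 0%C -> euler_op p b O = 0%C.
Proof.
  intros H. unfold euler_op, dilate. rewrite !Nat.Div0.mod_0_l, !Nat.Div0.div_0_l. simpl. rewrite H. ring.
Qed.

Lemma dil_pb0 (p : nat) (b : nat -> C) (A : R) (B : nat) : (1 <= p)%nat -> poly_bound0 b A B -> poly_bound0 (dilate p b) A B.
Proof.
  intros Hp [HA [H0 H]]. split; auto. split.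
  - unfold dilate. now rewrite Nat.Div0.mod_0_l, Nat.Div0.div_0_l.
  - intros n Hn. unfold dilate. destruct (n mod p =? 0)%nat eqn:E.
    + apply mod_0_ex in E; auto. set (k := (n / p)%nat) in *.
      eapply Rle_trans; [apply H; nia|]. apply Rmult_le_compat_l; auto.
      apply pow_incr. split; [apply pos_INR|apply le_INR; nia].
    + rewrite Cmod_0. apply Rmult_le_pos; auto. apply pow_le, pos_INR.
Qed.

Lemma Dop_pb0 (p : nat) (b : nat -> C) (A : R) (B : nat) : (1 <= p)%nat -> poly_bound0 b A B ->
  poly_bound0 (euler_op p b) (A * (1 + Cmod (e1 p) + Cmod (e2 p))) B.
Proof.
  intros Hp H. assert (H1 := dil_pb0 p b A B Hp H). assert (H2 := dil_pb0 (p * p) b A B ltac:(nia) H).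
  destruct H as [HA [H0 H]]. destruct H1 as [_ [_ H1]]. destruct H2 as [_ [_ H2]].
  assert (C1 := Cmod_ge_0 (e1 p)). assert (C2 := Cmod_ge_0 (e2 p)).
  split; [apply Rmult_le_pos; lra|]. split; [now apply Dop_0|].
  intros n Hn. specialize (H n Hn). specialize (H1 n Hn). specialize (H2 n Hn).
  assert (M1 := Rmult_le_compat_l _ _ _ C1 H1). assert (M2 := Rmult_le_compat_l _ _ _ C2 H2).
  unfold euler_op. eapply Rle_trans; [apply Cmod_triangle|].
  rewrite <- !Cmod_mult in M1, M2.
  assert (T := Cmod_triang_minus (b n) (e1 p * dilate p b n)).
  replace (A * (1 + Cmod (e1 p) + Cmod (e2 p)) * INR n ^ B) with
    (A * INR n ^ B + Cmod (e1 p) * (A * INR n ^ B) + Cmod (e2 p) * (A * INR n ^ B)) by ring. lra.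
Qed.

Lemma Dops_pb0 (X : nat) (b : nat -> C) (A : R) (B : nat) : poly_bound0 b A B -> exists A', poly_bound0 (euler_ops X b) A' B.
Proof.
  intros H. induction X as [|X [A' IH]]; [now exists A|]. simpl.
  destruct (prime_nat (S X)); [|now exists A']. eexists. apply Dop_pb0; [lia|exact IH].
Qed.

Definition Efac (M p : nat) : C := (1 - e1 p * RtoC (/ INR p ^ M) + e2 p * RtoC (/ INR (p * p) ^ M))%C.

Fixpoint Eprod (M X : nat) : C :=
  match X with O => 1%C | S X' => (Eprod M X' * (if prime_nat (S X') then Efac M (S X') else 1))%C end.

Lemma Dops_csums (M X : nat) (b : nat -> C) (l : C) : b O = 0%C -> sums_to (dirichlet_summand b M) l ->
  euler_ops X b O = 0%C /\ sums_to (dirichlet_summand (euler_ops X b) M) (Eprod M X * l)%C.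
Proof.
  intros H0 H. induction X as [|X [I0 I1]].
  - simpl. split; auto. now rewrite Cmult_1_l.
  - simpl. destruct (prime_nat (S X)).
    + split; [now apply Dop_0|]. assert (W := wM_Dop (S X) M _ _ ltac:(lia) I0 I1).
      fold (Efac M (S X)) in W. replace (Eprod M X * Efac M (S X) * l)%C with (Efac M (S X) * (Eprod M X * l))%C by ring.
      exact W.
    + split; auto. now rewrite Cmult_1_r.
Qed.

Lemma csums_tail2 (u : nat -> C) (l : C) (N : nat) (T : R) :
  sums_to u l -> (forall k, Cmod (partial_sum u (N + k) - partial_sum u N) <= T) -> Cmod (l - partial_sum u N) <= T.
Proof.
  intros H HT. apply Rnot_lt_le. intros Hlt.
  destruct (H ((Cmod (l - partial_sum u N) - T) / 2) ltac:(lra)) as [M HM].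
  specialize (HM (N + M)%nat ltac:(lia)). specialize (HT M).
  assert (X := Cmod_dist l (partial_sum u (N + M)) (partial_sum u N)). rewrite (Cmod_sym l (partial_sum u (N + M))) in X. lra.
Qed.

(** The exponent M is split into B, which absorbs the growth of the coefficients, 2, which gives a
    telescoping tail, and r, which gives decay n^(-r) uniformly in j >= n. *)
Lemma wterm_bound (j n r B M : nat) : (1 <= n)%nat -> (n <= j)%nat -> (M = B + 2 + r)%nat ->
  INR j ^ B * / INR j ^ M <= / INR n ^ r * (2 * (/ INR j - / INR (S j))).
Proof.
  intros Hn Hj ->. assert (Pn : 1 <= INR n) by now apply (le_INR 1).
  assert (Pj : INR n <= INR j) by now apply le_INR.
  assert (Q := inv_sq_telescope (j - 1)). replace (S (j - 1)) with j in Q by lia.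
  rewrite !pow_add.
  assert (p1 : 0 < INR j ^ B) by (apply pow_lt; lra).
  assert (p2 : 0 < INR j ^ 2) by (apply pow_lt; lra).
  assert (p3 : 0 < INR j ^ r) by (apply pow_lt; lra).
  assert (p4 : 0 < INR n ^ r) by (apply pow_lt; lra).
  replace (INR j ^ B * / (INR j ^ B * INR j ^ 2 * INR j ^ r)) with (/ INR j ^ r * / INR j ^ 2) by (field; lra).
  apply Rmult_le_compat; auto; try (apply Rlt_le, Rinv_0_lt_compat; lra).
  apply Rinv_le_contravar; auto. apply pow_incr. lra.
Qed.

Lemma csum_zero_below (u : nat -> C) (n : nat) : (forall j, (j < n)%nat -> u j = 0%C) -> partial_sum u n = u n.
Proof.
  intros H. assert (Z : forall m, (m < n)%nat -> partial_sum u m = 0%C).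
  { induction m; intros Hm; simpl; [now apply H|]. rewrite IHm, H by lia. ring. }
  destruct n; [reflexivity|]. simpl. rewrite Z by lia. ring.
Qed.

Lemma pow_ratio_small (x eps : R) : 0 <= x < 1 -> 0 < eps -> exists r0, forall r, (r0 <= r)%nat -> x ^ r <= eps.
Proof.
  intros Hx He. destruct (pow_lt_1_zero x ltac:(rewrite Rabs_pos_eq; lra) eps He) as [r0 H].
  exists r0. intros r Hr. specialize (H r Hr). rewrite Rabs_pos_eq in H by (apply pow_le; lra). lra.
Qed.

(** A first nonzero coefficient at n <= X would contribute n^(-r), up to a constant, while all later
    terms are O((n + 1)^(-r)) and the sum is O((X + 1)^(-r)); letting r grow is a contradiction. *)
Lemma leading_zero (g : nat -> C) (A K : R) (B X r0 : nat) (S : nat -> C) : poly_bound0 g A B -> 0 <= K ->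
  (forall r, (r0 <= r)%nat -> sums_to (dirichlet_summand g (B + 2 + r)) (S r) /\ Cmod (S r) <= K / INR (X + 1) ^ r) ->
  forall n, (n <= X)%nat -> g n = 0%C.
Proof.
  intros [HA [H0 Hg]] HK HS n.
  induction n as [n IH] using (well_founded_induction lt_wf). intros Hn.
  destruct (Nat.eq_dec n 0) as [->|Hn0]; auto.
  assert (Pn : 1 <= INR n) by (apply (le_INR 1); lia).
  assert (PX : INR n + 1 <= INR (X + 1)) by (rewrite plus_INR; simpl; assert (Y := le_INR _ _ Hn); lra).
  apply Ceq_dist. intros eps He. replace (g n - 0)%C with (g n) by ring.
  set (C0 := INR n ^ (B + 2) * (K + 2 * A) + 1).
  assert (HC0 : 1 <= C0).
  { unfold C0. assert (0 <= INR n ^ (B + 2) * (K + 2 * A)); [|lra].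
    apply Rmult_le_pos; [apply pow_le; lra|lra]. }
  assert (Hx : 0 <= INR n / (INR n + 1) < 1).
  { split; [apply Rmult_le_pos; [lra|apply Rlt_le, Rinv_0_lt_compat; lra]|].
    apply (Rmult_lt_reg_r (INR n + 1)); [lra|]. unfold Rdiv. rewrite Rmult_assoc, Rinv_l; lra. }
  destruct (pow_ratio_small _ (eps / C0) Hx ltac:(apply Rdiv_lt_0_compat; lra)) as [r1 Hr1].
  set (r := max r0 r1). specialize (Hr1 r ltac:(lia)).
  destruct (HS r ltac:(lia)) as [HS1 HS2].
  set (M := (B + 2 + r)%nat) in *.
  (* All terms beyond n together, by the telescoping bound [wterm_bound] with n + 1 in place of
     n. *)
  assert (T : Cmod (S r - partial_sum (dirichlet_summand g M) n) <= A * (/ (INR n + 1) ^ r * 2)).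
  { apply csums_tail2; auto. intros k.
    apply Rle_trans with (A * (/ (INR n + 1) ^ r * (2 * (/ INR (n + 1) - / INR (n + k + 1))))).
    - induction k.
      + rewrite Nat.add_0_r. replace (partial_sum (dirichlet_summand g M) n - partial_sum (dirichlet_summand g M) n)%C with (RtoC 0) by ring.
        rewrite Cmod_0. right. ring.
      + rewrite Nat.add_succ_r. simpl partial_sum.
        set (j := Datatypes.S (n + k)) in *.
        replace (partial_sum (dirichlet_summand g M) (n + k) + dirichlet_summand g M j - partial_sum (dirichlet_summand g M) n)%C with
          ((partial_sum (dirichlet_summand g M) (n + k) - partial_sum (dirichlet_summand g M) n) + dirichlet_summand g M j)%C by ring.
        eapply Rle_trans; [apply Cmod_triangle|].
        assert (Bj : Cmod (dirichlet_summand g M j) <= A * (/ (INR n + 1) ^ r * (2 * (/ INR j - / INR (Datatypes.S j))))).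
        { unfold dirichlet_summand. rewrite Cmod_mult, Cmod_R.
          assert (0 < / INR j ^ M) by (apply Rinv_0_lt_compat, pow_lt, lt_0_INR; unfold j; lia).
          rewrite Rabs_pos_eq by lra.
          apply Rle_trans with (A * INR j ^ B * / INR j ^ M).
          - apply Rmult_le_compat_r; [lra|]. apply Hg. unfold j; lia.
          - rewrite Rmult_assoc. apply Rmult_le_compat_l; auto.
            replace (INR n + 1) with (INR (n + 1)) by (rewrite plus_INR; simpl; ring).
            apply (wterm_bound j (n + 1) r B M); unfold j; try lia. }
        replace (n + k + 1)%nat with j in IHk by (unfold j; lia).
        replace (j + 1)%nat with (Datatypes.S j) by lia. lra.
    - apply Rmult_le_compat_l; auto. apply Rmult_le_compat_l.
      + apply Rlt_le, Rinv_0_lt_compat, pow_lt. lra.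
      + assert (0 < / INR (n + k + 1)) by (apply Rinv_0_lt_compat, lt_0_INR; lia).
        assert (/ INR (n + 1) <= 1); [|lra]. rewrite <- Rinv_1. apply Rinv_le_contravar; [lra|].
        apply (le_INR 1). lia. }
  rewrite csum_zero_below in T.
  2:{ intros j Hj. unfold dirichlet_summand. rewrite (IH j Hj ltac:(lia)). ring. }
  assert (Pr : 0 < (INR n + 1) ^ r) by (apply pow_lt; lra).
  assert (S3 : Cmod (S r) <= K * / (INR n + 1) ^ r).
  { eapply Rle_trans; [apply HS2|]. unfold Rdiv. apply Rmult_le_compat_l; auto.
    apply Rinv_le_contravar; auto. apply pow_incr. lra. }
  assert (W : Cmod (dirichlet_summand g M n) <= (K + 2 * A) * / (INR n + 1) ^ r).
  { replace (dirichlet_summand g M n) with (S r - (S r - dirichlet_summand g M n))%C by ring.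
    eapply Rle_trans; [apply Cmod_triang_minus|]. lra. }
  unfold dirichlet_summand in W. rewrite Cmod_mult, Cmod_R, Rabs_pos_eq in W by (apply Rlt_le, Rinv_0_lt_compat, pow_lt; lra).
  assert (PM : 0 < INR n ^ M) by (apply pow_lt; lra).
  apply (Rmult_le_compat_r (INR n ^ M)) in W; [|lra].
  rewrite Rmult_assoc, Rinv_l, Rmult_1_r in W by lra.
  eapply Rle_trans; [apply W|].
  unfold M. rewrite pow_add.
  replace ((K + 2 * A) * / (INR n + 1) ^ r * (INR n ^ (B + 2) * INR n ^ r)) with
    (INR n ^ (B + 2) * (K + 2 * A) * (INR n / (INR n + 1)) ^ r).
  - apply Rle_trans with (C0 * (eps / C0)); [|right; field; lra].
    apply Rmult_le_compat; auto.
    + apply Rmult_le_pos; [apply pow_le; lra|lra].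
    + apply pow_le; lra.
    + unfold C0. lra.
  - unfold Rdiv. rewrite Rpow_mult_distr, pow_inv. ring.
Qed.

End Euler.

Lemma Cpower_INR (x : R) (n : nat) : 0 < x -> Cpower x (INR n) = RtoC (x ^ n).
Proof.
  intros Hx. unfold Cpower. rewrite <- RtoC_mult, Cexp_R, exp_INR_mult, exp_ln; auto.
Qed.

Lemma Cpower_opp (x : R) (s : C) : Cpower x (- s) = (/ Cpower x s)%C.
Proof. unfold Cpower. rewrite <- Cexp_opp. f_equal. ring. Qed.

Lemma Cpower_opp_INR (x : R) (n : nat) : 0 < x -> Cpower x (- INR n) = RtoC (/ x ^ n).
Proof.
  intros Hx. rewrite Cpower_opp, Cpower_INR by auto. rewrite RtoC_inv; auto.
  apply pow_nonzero. lra.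
Qed.

(** The value a 0 is arbitrary, as the series start at 1; it must become 0 before dilations are
    applied. *)
Definition zero_at0 (a : nat -> C) (n : nat) : C := match n with O => 0%C | _ => a n end.

Lemma ex_series_bounded (u : nat -> R) : (forall n, 0 <= u n) -> ex_series u -> exists A, 0 <= A /\ forall n, u n <= A.
Proof.
  intros Hu [L HL]. assert (S := fun n => series_pos_le u L n Hu HL).
  exists L. split.
  - specialize (S O). rewrite sum_O in S. specialize (Hu O). lra.
  - intros n. eapply Rle_trans; [|apply (S n)]. destruct n; [rewrite sum_O; lra|].
    rewrite sum_Sn. unfold plus; simpl.
    assert (0 <= sum_n u n); [|lra]. clear S. induction n; [rewrite sum_O; auto|].
    rewrite sum_Sn. unfold plus; simpl. specialize (Hu (S n)). lra.
Qed.

(** The terms of the convergent series of absolute values at s = B are bounded. *)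
Lemma abs_poly_bound (a : nat -> C) (B : nat) :
  ex_series (fun m => Cmod (dirichlet_term a (INR B) m)) -> exists A, poly_bound a A B.
Proof.
  intros H. destruct (ex_series_bounded _ (fun n => Cmod_ge_0 _) H) as [A [HA HB]].
  exists A. split; auto. intros m. specialize (HB m). unfold dirichlet_term in HB.
  assert (P : 0 < INR (S m)) by (apply lt_0_INR; lia).
  rewrite Cpower_opp_INR, Cmod_mult, Cmod_R in HB by auto.
  assert (PB : 0 < INR (S m) ^ B) by now apply pow_lt.
  rewrite Rabs_pos_eq in HB by (apply Rlt_le, Rinv_0_lt_compat; auto).
  apply (Rmult_le_compat_r (INR (S m) ^ B)) in HB; [|lra].
  rewrite Rmult_assoc, Rinv_l, Rmult_1_r in HB by lra. exact HB.
Qed.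

Lemma csums_shift (u : nat -> C) (l : C) : u O = 0%C -> sums_to (fun n => u (S n)) l -> sums_to u l.
Proof.
  intros H0 H eps He. destruct (H eps He) as [N HN]. exists (S N). intros n Hn.
  destruct n; [lia|]. replace (partial_sum u (S n)) with (partial_sum (fun n => u (S n)) n); [apply HN; lia|].
  clear - H0. induction n; [simpl; rewrite H0; ring|]. cbn [partial_sum] in *. rewrite IHn. ring.
Qed.

Lemma dirichlet_wM (a : nat -> C) (M : nat) (l : C) :
  is_series (V := C_NormedModule) (dirichlet_term a (INR M)) l -> sums_to (dirichlet_summand (zero_at0 a) M) l.
Proof.
  intros H. apply is_series_csums in H. apply csums_shift; [unfold dirichlet_summand; simpl; ring|].
  eapply csums_ext; [|exact H]. intros n. unfold dirichlet_term, dirichlet_summand.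
  rewrite Cpower_opp_INR by (apply lt_0_INR; lia). reflexivity.
Qed.

(** * The Euler product at large integers *)

Section HeckeRel.

Variables (N m : nat) (a : nat -> C) (F : C -> C).
Hypothesis (Hm : (1 <= m)%nat).

(** With k = 2 m, the inverse factor is 1 - e1 p^(-s) + e2 p^(-2 s) in all three cases of
    [euler_factor]. *)
Definition e1 (p : nat) : C :=
  if negb (N mod p =? 0)%nat then a p
  else if negb (N mod (p * p) =? 0)%nat then RtoC (INR p ^ (m - 1)) else 0%C.

Definition e2 (p : nat) : C :=
  if negb (N mod p =? 0)%nat then RtoC (INR p ^ (2 * m - 1)) else 0%C.

Lemma euler_factor_Efac (M p : nat) : (1 <= p)%nat ->
  euler_factor a N (2 * m) p (INR M) = (/ Efac e1 e2 M p)%C.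
Proof.
  intros Hp. assert (Pp : 0 < INR p) by (apply lt_0_INR; lia).
  assert (PM : INR p ^ M <> 0) by (apply pow_nonzero; lra).
  unfold euler_factor, Efac, e1, e2. destruct (negb (N mod p =? 0)%nat).
  - f_equal. rewrite Cpower_opp_INR by auto. f_equal.
    replace (INR (2 * m) - 1 - 2 * INR M)%C with (INR (2 * m - 1) + - INR (2 * M))%C.
    + rewrite Cpower_plus, Cpower_INR, Cpower_opp_INR by auto.
      f_equal. f_equal. rewrite mult_INR, Rpow_mult_distr. f_equal. rewrite Nat.mul_comm, pow_mult. simpl. ring.
    + rewrite minus_INR by lia. rewrite (mult_INR 2 M). simpl INR. rewrite RtoC_minus, RtoC_mult.
      replace (RtoC (1 + 1)) with (RtoC 2) by (f_equal; ring). ring.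
  - destruct (negb (N mod (p * p) =? 0)%nat).
    + f_equal.
      replace (INR (2 * m) / 2 - 1 - INR M)%C with (INR (m - 1) + - INR M)%C.
      * rewrite Cpower_plus, Cpower_INR, Cpower_opp_INR by auto. ring.
      * rewrite minus_INR by lia. rewrite (mult_INR 2 m). simpl INR. rewrite RtoC_minus, RtoC_mult.
        replace (RtoC (1 + 1)) with (RtoC 2) by (f_equal; ring). field.
    + replace (1 - 0 * RtoC (/ INR p ^ M) + 0 * RtoC (/ INR (p * p) ^ M))%C with (RtoC 1) by ring.
      field.
Qed.

Variables (A : R) (B : nat).
Hypothesis (HA : poly_bound a A B).

(** Large enough for a p, p^(m - 1) and p^(2 m - 1) at once. *)
Let A1 := A + 1.
Let B1 := (B + 2 * m)%nat.

Lemma e_bound (p : nat) : (1 <= p)%nat -> Cmod (e1 p) <= A1 * INR p ^ B1 /\ Cmod (e2 p) <= A1 * INR p ^ B1.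
Proof.
  intros Hp. destruct HA as [HA0 Ha]. assert (P : 1 <= INR p) by now apply (le_INR 1).
  assert (Q : forall j, (j <= B1)%nat -> 0 < INR p ^ j <= INR p ^ B1).
  { intros j Hj. split; [apply pow_lt; lra|now apply Rle_pow]. }
  assert (Z : 0 <= A1 * INR p ^ B1) by (unfold A1; destruct (Q O ltac:(lia)); apply Rmult_le_pos; lra).
  assert (S1 : forall j, (j <= B1)%nat -> Cmod (RtoC (INR p ^ j)) <= A1 * INR p ^ B1).
  { intros j Hj. destruct (Q j Hj). rewrite Cmod_R, Rabs_pos_eq by lra. unfold A1. nra. }
  unfold e1, e2. destruct (negb (N mod p =? 0)%nat).
  - split; [|apply S1; unfold B1; lia].
    destruct p; [lia|]. eapply Rle_trans; [apply Ha|]. destruct (Q B ltac:(unfold B1; lia)).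
    apply Rmult_le_compat; unfold A1; lra.
  - rewrite Cmod_0. split; auto. destruct (negb (N mod (p * p) =? 0)%nat); [|now rewrite Cmod_0].
    apply S1. unfold B1. lia.
Qed.

Lemma Efac_near (M p : nat) : (1 <= p)%nat -> Cmod (Efac e1 e2 M p - 1) <= 2 * A1 * (INR p ^ B1 * / INR p ^ M).
Proof.
  intros Hp. destruct (e_bound p Hp) as [E1 E2]. assert (P : 1 <= INR p) by now apply (le_INR 1).
  assert (PM : 0 < INR p ^ M) by (apply pow_lt; lra).
  assert (IM : 0 < / INR p ^ M) by now apply Rinv_0_lt_compat.
  unfold Efac.
  replace (1 - e1 p * RtoC (/ INR p ^ M) + e2 p * RtoC (/ INR (p * p) ^ M) - 1)%C with
    (e2 p * RtoC (/ INR (p * p) ^ M) - e1 p * RtoC (/ INR p ^ M))%C by ring.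
  eapply Rle_trans; [apply Cmod_triang_minus|]. rewrite !Cmod_mult, !Cmod_R.
  assert (I2 : 0 < / INR (p * p) ^ M <= / INR p ^ M).
  { rewrite mult_INR, Rpow_mult_distr. split; [apply Rinv_0_lt_compat; nra|].
    apply Rinv_le_contravar; auto. assert (1 <= INR p ^ M) by (now apply pow_R1_Rle). nra. }
  rewrite !Rabs_pos_eq by lra.
  assert (T1 : Cmod (e2 p) * / INR (p * p) ^ M <= A1 * INR p ^ B1 * / INR p ^ M)
    by (apply Rmult_le_compat; auto; try apply Cmod_ge_0; lra).
  assert (T2 : Cmod (e1 p) * / INR p ^ M <= A1 * INR p ^ B1 * / INR p ^ M)
    by (apply Rmult_le_compat_r; lra). lra.
Qed.

Lemma A1_pos : 1 <= A1.
Proof. destruct HA. unfold A1. lra. Qed.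

Lemma Efac_near_r (r n p : nat) : (1 <= n)%nat -> (n <= p)%nat ->
  Cmod (Efac e1 e2 (B1 + 2 + r) p - 1) <= 4 * A1 / INR n ^ r * (/ INR p - / INR (S p)).
Proof.
  intros Hn Hp. eapply Rle_trans; [apply Efac_near; lia|].
  assert (W := wterm_bound p n r B1 (B1 + 2 + r) Hn Hp eq_refl). assert (P := A1_pos).
  apply (Rmult_le_compat_l (2 * A1)) in W; [|lra]. eapply Rle_trans; [apply W|]. right. unfold Rdiv. ring.
Qed.

(** A further factor differs from 1 by at most eta (1/n - 1/(n + 1)), and these bounds telescope. As
    eta <= 1/2 the product never exceeds twice its value at X, which closes the induction. *)
Lemma Eprod_near (r X : nat) : 4 * A1 / INR (X + 1) ^ r <= / 2 -> forall j,
  Cmod (Eprod e1 e2 (B1 + 2 + r) (X + j) - Eprod e1 e2 (B1 + 2 + r) X) <=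
  2 * (4 * A1 / INR (X + 1) ^ r) * (/ INR (X + 1) - / INR (X + j + 1)) * Cmod (Eprod e1 e2 (B1 + 2 + r) X).
Proof.
  intros Hr. set (M := (B1 + 2 + r)%nat) in *. set (eta := 4 * A1 / INR (X + 1) ^ r) in *.
  assert (He : 0 < eta).
  { unfold eta. assert (P := A1_pos). apply Rdiv_lt_0_compat; [lra|]. apply pow_lt, lt_0_INR. lia. }
  set (P := Eprod e1 e2 M X). assert (P0 := Cmod_ge_0 P).
  induction j.
  - rewrite Nat.add_0_r. fold P. replace (P - P)%C with (RtoC 0) by ring. rewrite Cmod_0. right; ring.
  - rewrite Nat.add_succ_r. cbn [Eprod]. set (n := S (X + j)) in *.
    replace (X + j + 1)%nat with n in IHj by (unfold n; lia). replace (n + 1)%nat with (S n) by lia.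
    set (Q := Eprod e1 e2 M (X + j)) in *.
    assert (D0 : 0 <= / INR (X + 1) - / INR n <= 1).
    { assert (0 < / INR n) by (apply Rinv_0_lt_compat, lt_0_INR; unfold n; lia).
      assert (/ INR n <= / INR (X + 1)) by (apply Rinv_le_contravar; [apply lt_0_INR; lia|apply le_INR; unfold n; lia]).
      assert (/ INR (X + 1) <= 1); [|lra]. rewrite <- Rinv_1. apply Rinv_le_contravar; [lra|].
      apply (le_INR 1). lia. }
    assert (D1 : 0 <= / INR n - / INR (S n)).
    { assert (/ INR (S n) <= / INR n); [|lra]. apply Rinv_le_contravar; [apply lt_0_INR; unfold n; lia|apply le_INR; lia]. }
    assert (Hfac : Cmod ((if prime_nat n then Efac e1 e2 M n else 1) - 1) <= eta * (/ INR n - / INR (S n))).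
    { destruct (prime_nat n).
      - apply Efac_near_r; unfold n; lia.
      - replace (1 - 1)%C with (RtoC 0) by ring. rewrite Cmod_0. apply Rmult_le_pos; lra. }
    set (f := if prime_nat n then Efac e1 e2 M n else 1%C) in *.
    replace (Q * f - P)%C with ((Q - P) + (P + (Q - P)) * (f - 1))%C by ring.
    eapply Rle_trans; [apply Cmod_triangle|]. rewrite Cmod_mult.
    assert (T := Cmod_triangle P (Q - P)).
    assert (X1 := Cmod_ge_0 (f - 1)). assert (X2 := Cmod_ge_0 (P + (Q - P))).
    assert (Bd : Cmod (P + (Q - P)) <= 2 * Cmod P).
    { assert (2 * eta * (/ INR (X + 1) - / INR n) * Cmod P <= 1 * Cmod P); [|lra].
      apply Rmult_le_compat_r; auto. nra. }
    assert (Cmod (P + (Q - P)) * Cmod (f - 1) <= 2 * Cmod P * (eta * (/ INR n - / INR (S n)))).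
    { apply Rmult_le_compat; auto. }
    replace (2 * eta * (/ INR (X + 1) - / INR (S n)) * Cmod P) with
      (2 * eta * (/ INR (X + 1) - / INR n) * Cmod P + 2 * Cmod P * (eta * (/ INR n - / INR (S n)))) by ring.
    lra.
Qed.

Lemma Efac_neq0 (r p : nat) : 4 * A1 / INR 2 ^ r <= / 2 -> (2 <= p)%nat -> Efac e1 e2 (B1 + 2 + r) p <> 0%C.
Proof.
  intros Hr Hp E. assert (H := Efac_near_r r 2 p ltac:(lia) Hp). rewrite E in H.
  replace (0 - 1)%C with (- (1))%C in H by ring. rewrite Cmod_opp, Cmod_1 in H.
  assert (0 < / INR (S p)) by (apply Rinv_0_lt_compat, lt_0_INR; lia).
  assert (/ INR p <= 1) by (rewrite <- Rinv_1; apply Rinv_le_contravar; [lra|apply (le_INR 1); lia]).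
  assert (P := A1_pos). assert (0 < 4 * A1 / INR 2 ^ r).
  { apply Rdiv_lt_0_compat; [lra|]. apply pow_lt, lt_0_INR. lia. } nra.
Qed.

Lemma Eprod_neq0 (r X : nat) : 4 * A1 / INR 2 ^ r <= / 2 -> Eprod e1 e2 (B1 + 2 + r) X <> 0%C.
Proof.
  intros Hr. assert (N1 : RtoC 1 <> 0%C) by (intros E; apply RtoC_inj in E; lra).
  induction X; cbn [Eprod]; auto. apply Cmult_neq_0; auto.
  destruct (prime_nat (S X)) eqn:E; auto. apply Efac_neq0; auto. now apply isp_pos.
Qed.

Lemma epp_Eprod (r X : nat) : 4 * A1 / INR 2 ^ r <= / 2 ->
  euler_partial_product a N (2 * m) (INR (B1 + 2 + r)) X = (/ Eprod e1 e2 (B1 + 2 + r) X)%C.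
Proof.
  intros Hr. assert (N1 : RtoC 1 <> 0%C) by (intros E; apply RtoC_inj in E; lra).
  induction X; cbn [Eprod euler_partial_product]; [field; auto|].
  rewrite IHX. assert (E0 := Eprod_neq0 r X Hr).
  unfold prime_nat. destruct (prime_dec (Z.of_nat (S X))) as [H|H].
  - rewrite euler_factor_Efac by lia. assert (E1 := Efac_neq0 r (S X) Hr ltac:(destruct H; lia)).
    field. auto.
  - field. auto.
Qed.

(** Cancelling the factors up to X leaves the product over the primes beyond X, whose distance from
    1 is bounded by [Eprod_near] uniformly in the number of factors. *)
Lemma euler_near (r X : nat) (l : C) : (1 <= X)%nat -> 4 * A1 / INR 2 ^ r <= / 4 ->
  filterlim (euler_partial_product a N (2 * m) (INR (B1 + 2 + r))) eventually (locally (T := C_UniformSpace) l) ->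
  Cmod (Eprod e1 e2 (B1 + 2 + r) X * l - 1) <= 16 * A1 / INR (X + 1) ^ r.
Proof.
  intros HX Hr H.
  assert (PA := A1_pos).
  assert (P2 : 0 < INR 2 ^ r) by (apply pow_lt, lt_0_INR; lia).
  assert (PX : INR 2 ^ r <= INR (X + 1) ^ r) by (apply pow_incr; split; [apply pos_INR|apply le_INR; lia]).
  set (eta := 4 * A1 / INR (X + 1) ^ r).
  assert (He : 0 < eta) by (unfold eta; apply Rdiv_lt_0_compat; lra).
  assert (He4 : eta <= / 4).
  { eapply Rle_trans; [|apply Hr]. unfold eta, Rdiv. apply Rmult_le_compat_l; [lra|]. apply Rinv_le_contravar; lra. }
  set (M := (B1 + 2 + r)%nat) in *. set (P := Eprod e1 e2 M X).
  assert (NP : P <> 0%C) by (apply Eprod_neq0; lra).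
  assert (PP : 0 < Cmod P) by now apply Cmod_gt_0.
  replace (16 * A1 / INR (X + 1) ^ r) with (4 * eta) by (unfold eta; field; lra).
  assert (J : forall j, Cmod (P * / Eprod e1 e2 M (X + j) - 1) <= 4 * eta).
  { intros j. assert (G := Eprod_near r X ltac:(fold eta; lra) j). fold M in G. fold eta in G. fold P in G.
    assert (NQ : Eprod e1 e2 M (X + j) <> 0%C) by (apply Eprod_neq0; lra).
    set (Q := Eprod e1 e2 M (X + j)) in *.
    assert (PQ : 0 < Cmod Q) by now apply Cmod_gt_0.
    assert (D0 : 0 <= / INR (X + 1) - / INR (X + j + 1) <= 1).
    { assert (0 < / INR (X + j + 1)) by (apply Rinv_0_lt_compat, lt_0_INR; lia).
      assert (/ INR (X + j + 1) <= / INR (X + 1)) by (apply Rinv_le_contravar; [apply lt_0_INR; lia|apply le_INR; lia]).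
      assert (/ INR (X + 1) <= 1); [|lra]. rewrite <- Rinv_1. apply Rinv_le_contravar; [lra|].
      apply (le_INR 1). lia. }
    assert (G2 : Cmod (Q - P) <= 2 * eta * Cmod P).
    { eapply Rle_trans; [apply G|]. apply Rmult_le_compat_r; [lra|]. nra. }
    assert (G3 : Cmod P / 2 <= Cmod Q).
    { assert (T := Cmod_triang_inv P (P - Q)). replace (P - (P - Q))%C with Q in T by ring.
      rewrite (Cmod_sym P Q) in T. nra. }
    replace (P * / Q - 1)%C with ((P - Q) * / Q)%C by (field; auto).
    rewrite Cmod_mult, Cmod_inv, Cmod_sym by auto.
    apply (Rmult_le_reg_r (Cmod Q)); auto. rewrite Rmult_assoc, Rinv_l, Rmult_1_r by lra. nra. }
  apply Rnot_lt_le. intros Hlt.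
  set (gap := Cmod (P * l - 1) - 4 * eta) in *.
  assert (Hg : 0 < gap / (2 * (Cmod P))) by (unfold gap; apply Rdiv_lt_0_compat; lra).
  assert (L : locally (T := C_UniformSpace) l (fun y => Cmod (y - l) < gap / Cmod P)).
  { exists (mkposreal _ Hg). intros y Hy. apply (ball_Cmod l y (mkposreal _ Hg)) in Hy. simpl in Hy.
    replace (gap / Cmod P) with (2 * (gap / (2 * Cmod P))) by (field; lra). exact Hy. }
  destruct (H _ L) as [n0 Hn0]. specialize (Hn0 (X + n0)%nat ltac:(lia)). specialize (J n0).
  cbv beta in Hn0. unfold M in Hn0. rewrite epp_Eprod in Hn0 by lra. fold M in Hn0.
  set (q := (/ Eprod e1 e2 M (X + n0))%C) in *.
  assert (T := Cmod_dist (P * l) (P * q) 1). rewrite (Cmod_sym (P * l) (P * q)) in T.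
  replace (P * q - P * l)%C with (P * (q - l))%C in T by ring. rewrite Cmod_mult in T.
  apply (Rmult_lt_compat_l (Cmod P)) in Hn0; auto.
  replace (Cmod P * (gap / Cmod P)) with gap in Hn0 by (field; lra).
  unfold gap in *. lra.
Qed.

(** Dividing the series by the Euler factors up to X leaves 1 + O((X + 1)^(-r)) at s = B1 + 2 + r.
    So [leading_zero] identifies its coefficients up to X with those of the constant 1, as
    [Dops_hecke] requires. *)
Lemma hecke_rel : is_dirichlet_series a F -> euler_product a N (2 * m) F ->
  forall p n, prime_nat p = true -> (1 <= n)%nat ->
    zero_at0 a (p * n)%nat = (e1 p * zero_at0 a n - e2 p * dilate p (zero_at0 a) n)%C.
Proof.
  intros [s1 H1] [s2 H2]. apply Dops_hecke. intros X n [Hn2 HnX].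
  assert (PB : poly_bound0 (zero_at0 a) A1 B1).
  { destruct HA as [HA0 Ha]. split; [unfold A1; lra|]. split; auto. intros j Hj. destruct j; [lia|].
    simpl zero_at0. eapply Rle_trans; [apply Ha|].
    assert (P : 1 <= INR (S j)) by (apply (le_INR 1); lia).
    apply Rmult_le_compat; auto; [apply pow_le; lra|unfold A1; lra|apply Rle_pow; [auto|unfold B1; lia]]. }
  destruct (Dops_pb0 e1 e2 X _ _ _ PB) as [A' [HA' [Hz HB']]].
  set (d := euler_ops e1 e2 X (zero_at0 a)) in *.
  set (delta := fun n : nat => if (n =? 1)%nat then RtoC 1 else 0%C).
  set (g := fun n => (d n - delta n)%C).
  assert (Hg : poly_bound0 g (A' + 1) B1).
  { split; [lra|]. split; [unfold g, delta; simpl; rewrite Hz; ring|].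
    intros j Hj. assert (P : 1 <= INR j) by now apply (le_INR 1).
    unfold g. eapply Rle_trans; [apply Cmod_triang_minus|]. specialize (HB' j Hj).
    assert (Cmod (delta j) <= INR j ^ B1); [|lra].
    unfold delta. apply Rle_trans with 1; [|now apply pow_R1_Rle].
    destruct (j =? 1)%nat; [rewrite Cmod_1; lra|rewrite Cmod_0; lra]. }
  (* For r >= r1 one has 2^r >= 16 A1, that is 4 A1 / 2^r <= 1/4, as [euler_near] asks. *)
  destruct (pow_ratio_small (/ INR 2) (/ (16 * A1))) as [r1 Hr1].
  { simpl. lra. }
  { apply Rinv_0_lt_compat. assert (P := A1_pos). lra. }
  destruct (INR_unbounded (Rmax s1 s2 + 1)) as [r2 Hr2].
  assert (G : g n = 0%C).
  { apply (leading_zero g (A' + 1) (16 * A1) B1 X (max r1 r2)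
      (fun r => Eprod e1 e2 (B1 + 2 + r) X * F (INR (B1 + 2 + r)) - 1)%C); auto.
    { assert (P := A1_pos). lra. }
    intros r Hr.
    assert (Big : Rmax s1 s2 < INR (B1 + 2 + r)).
    { assert (INR r2 <= INR (B1 + 2 + r)) by (apply le_INR; lia). lra. }
    assert (Bs1 := Rmax_l s1 s2). assert (Bs2 := Rmax_r s1 s2).
    split.
    - assert (S := dirichlet_wM a _ _ (H1 (INR (B1 + 2 + r)) ltac:(simpl; lra))).
      destruct (Dops_csums e1 e2 (B1 + 2 + r) X (zero_at0 a) _ eq_refl S) as [_ S2]. fold d in S2.
      assert (S3 : sums_to (dirichlet_summand delta (B1 + 2 + r)) 1).
      { intros eps He. exists 1%nat. intros j Hj.
        replace (partial_sum (dirichlet_summand delta (B1 + 2 + r)) j) with (RtoC 1).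
        - replace (1 - 1)%C with (RtoC 0) by ring. rewrite Cmod_0. lra.
        - symmetry. induction Hj.
          + cbn [partial_sum]. unfold dirichlet_summand, delta. simpl (0 =? 1)%nat. simpl (1 =? 1)%nat.
            change (INR 1) with 1. rewrite pow1, Rinv_1. ring.
          + cbn [partial_sum]. rewrite IHHj. unfold dirichlet_summand, delta.
            rewrite (proj2 (Nat.eqb_neq (Datatypes.S m0) 1)) by lia. ring. }
      eapply csums_ext; [|apply (csums_minus _ _ _ _ S2 S3)].
      intros j. unfold dirichlet_summand, g. cbv beta. ring.
    - apply euler_near; [lia| |].
      + specialize (Hr1 r ltac:(lia)). rewrite pow_inv in Hr1.
        assert (P := A1_pos). unfold Rdiv.
        apply Rle_trans with (4 * A1 * / (16 * A1)); [apply Rmult_le_compat_l; lra|].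
        right. field. lra.
      + apply H2. simpl. lra. }
  unfold g, delta in G. rewrite (proj2 (Nat.eqb_neq n 1)) in G by lia.
  rewrite <- G. ring.
Qed.

End HeckeRel.

(** * Hecke operators on the Fourier series *)

Definition qexp (n : nat) (z : C) : C := Cexp (2 * PI * Ci * INR n * z).

Lemma Cmod_qexp (n : nat) (z : C) : Cmod (qexp n z) = exp (- (2 * PI * INR n * Im z)).
Proof. unfold qexp. rewrite Cmod_Cexp. f_equal. unfold Re, Im; simpl. ring. Qed.

(** Integral form of the first Taylor remainder; [Cexp_1_bound] and then [Cexp_2_bound] follow by
    estimating integrals. *)
Lemma cint_Cexp (h : C) : cint (fun t => h * Cexp (t * h))%C 0 1 = (Cexp h - 1)%C.
Proof.
  destruct h as [x y].
  rewrite (cint_pair _ 0 1 (exp x * cos y - 1) (exp x * sin y)).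
  - unfold Cexp, Cminus; simpl. apply Ceq; simpl; ring.
  - apply (is_RInt_ext (fun t => x * (exp (t * x) * cos (t * y)) - y * (exp (t * x) * sin (t * y)))).
    + intros t _. unfold Cexp, Re, Im; simpl. replace (t * x - 0 * y) with (t * x) by ring.
      replace (t * y + 0 * x) with (t * y) by ring. ring.
    + replace (exp x * cos y - 1) with (minus (exp (1 * x) * cos (1 * y)) (exp (0 * x) * cos (0 * y)))
        by (unfold minus, plus, opp; simpl; rewrite !Rmult_1_l, !Rmult_0_l, exp_0, cos_0; ring).
      apply (is_RInt_derive (V := R_CompleteNormedModule) (fun t => exp (t * x) * cos (t * y))).
      * intros t _. auto_derive; auto. ring.
      * intros t _. apply (ex_derive_continuous (K := R_AbsRing) (V := R_NormedModule)). auto_derive. auto.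
  - apply (is_RInt_ext (fun t => x * (exp (t * x) * sin (t * y)) + y * (exp (t * x) * cos (t * y)))).
    + intros t _. unfold Cexp, Re, Im; simpl. replace (t * x - 0 * y) with (t * x) by ring.
      replace (t * y + 0 * x) with (t * y) by ring. ring.
    + replace (exp x * sin y) with (minus (exp (1 * x) * sin (1 * y)) (exp (0 * x) * sin (0 * y)))
        by (unfold minus, plus, opp; simpl; rewrite !Rmult_1_l, !Rmult_0_l, exp_0, sin_0; ring).
      apply (is_RInt_derive (V := R_CompleteNormedModule) (fun t => exp (t * x) * sin (t * y))).
      * intros t _. auto_derive; auto. ring.
      * intros t _. apply (ex_derive_continuous (K := R_AbsRing) (V := R_NormedModule)). auto_derive. auto.
Qed.

Lemma Cexp_line_bound (h : C) (t : R) : 0 <= t <= 1 -> exp (Re (t * h)) <= exp (Cmod h).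
Proof.
  intros Ht. apply exp_le. eapply Rle_trans; [apply Rle_abs|]. eapply Rle_trans; [apply re_le_Cmod|].
  rewrite Cmod_mult, Cmod_R, Rabs_pos_eq by lra. assert (X := Cmod_ge_0 h). nra.
Qed.

Lemma Cexp_1_bound (h : C) : Cmod (Cexp h - 1) <= Cmod h * exp (Cmod h).
Proof.
  rewrite <- cint_Cexp.
  replace (Cmod h * exp (Cmod h)) with ((1 - 0) * (Cmod h * exp (Cmod h))) by ring.
  apply cint_norm_const; [lra|intros t; solve_ctn|].
  intros t Ht. rewrite Cmod_mult, Cmod_Cexp. apply Rmult_le_compat_l; [apply Cmod_ge_0|].
  now apply Cexp_line_bound.
Qed.

Lemma Cexp_2_bound (h : C) : Cmod (Cexp h - 1 - h) <= Cmod h * (Cmod h * exp (Cmod h)).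
Proof.
  replace (Cexp h - 1 - h)%C with (cint (fun t => h * (Cexp (t * h) - 1))%C 0 1).
  - replace (Cmod h * (Cmod h * exp (Cmod h))) with ((1 - 0) * (Cmod h * (Cmod h * exp (Cmod h)))) by ring.
    apply cint_norm_const; [lra|intros t; solve_ctn|].
    intros t Ht. rewrite Cmod_mult. apply Rmult_le_compat_l; [apply Cmod_ge_0|].
    eapply Rle_trans; [apply Cexp_1_bound|].
    assert (X := Cmod_ge_0 h).
    assert (E : Cmod (t * h) <= Cmod h) by (rewrite Cmod_mult, Cmod_R, Rabs_pos_eq by lra; nra).
    apply Rmult_le_compat; auto; [apply Cmod_ge_0|apply Rlt_le, exp_pos|now apply exp_le].
  - rewrite (cint_ext _ (fun t => h * Cexp (t * h) - h)%C) by (intros; ring).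
    rewrite (cint_minus (fun t => h * Cexp (t * h))%C (fun _ => h)) by (intros t; solve_ctn).
    rewrite cint_Cexp. f_equal.
    rewrite (cint_pair (fun _ => h) 0 1 ((1 - 0) * Re h) ((1 - 0) * Im h));
      try apply (is_RInt_const (V := R_NormedModule)).
    apply Ceq; simpl; ring.
Qed.

Lemma exp_decay_summable (A y : R) (B : nat) : 0 <= A -> 0 < y ->
  ex_series (fun m => A * INR (S m) ^ B * exp (- (INR (S m) * y))).
Proof.
  intros HA Hy.
  apply (ex_series_le (V := R_CompleteNormedModule) _
    (fun m => (A * (INR (B + 2) ^ (B + 2) / y ^ (B + 2))) * / INR (S m) ^ 2)).
  - intros m. assert (P : 1 <= INR (S m)) by (apply (le_INR 1); lia).
    change (Rabs (A * INR (S m) ^ B * exp (- (INR (S m) * y))) <= (A * (INR (B + 2) ^ (B + 2) / y ^ (B + 2))) * / INR (S m) ^ 2).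
    assert (p1 : 0 < INR (S m) ^ B) by (apply pow_lt; lra).
    assert (p2 : 0 < INR (S m) ^ 2) by (apply pow_lt; lra).
    assert (p3 : 0 < y ^ (B + 2)) by now apply pow_lt.
    rewrite Rabs_pos_eq by (apply Rmult_le_pos; [nra|apply Rlt_le, exp_pos]).
    assert (E := exp_neg_pow (B + 2) (INR (S m) * y) ltac:(nra)).
    rewrite Rpow_mult_distr, (pow_add (INR (S m))) in E.
    apply Rle_trans with (A * INR (S m) ^ B * (INR (B + 2) ^ (B + 2) / (INR (S m) ^ B * INR (S m) ^ 2 * y ^ (B + 2)))).
    + apply Rmult_le_compat_l; auto. nra.
    + right. field. lra.
  - apply (ex_series_scal_l (K := R_AbsRing) (V := R_NormedModule)). now apply ex_series_inv_pow.
Qed.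

(** * The Fourier series: holomorphy, periodicity and Hecke operators *)

Section Fourier.

Variables (a : nat -> C) (A : R) (B : nat).
Hypothesis (HA : poly_bound a A B).

Notation f := (fourier_series a).

Lemma fourier_csums_S (z : C) : 0 < Im z -> sums_to (fun m => a (S m) * qexp (S m) z)%C (f z).
Proof.
  intros Hz. destruct HA as [HA0 Ha].
  apply (csums_abs _ (fun m => A * INR (S m) ^ B * exp (- (INR (S m) * (2 * PI * Im z))))).
  - intros m. rewrite Cmod_mult, Cmod_qexp. apply Rmult_le_compat; auto; try apply Cmod_ge_0.
    + apply Rlt_le, exp_pos.
    + right. f_equal. ring.
  - apply exp_decay_summable; auto. assert (P := PI_RGT_0). nra.
Qed.

Lemma fourier_csums (z : C) : 0 < Im z -> sums_to (fun n => zero_at0 a n * qexp n z)%C (f z).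
Proof.
  intros Hz. apply csums_shift; [simpl; ring|]. now apply fourier_csums_S.
Qed.

Lemma fourier_cd (z : C) : 0 < Im z -> exists l, cderiv f z l.
Proof.
  intros Hz. destruct HA as [HA0 Ha]. assert (PP := PI_RGT_0).
  (* Half of the decay rate 2 pi Im z: for |y - z| <= Im z / 2 the factor exp(2 pi n |y - z|)
     consumes at most the other half. *)
  set (y0 := PI * Im z). assert (Hy0 : 0 < y0) by (unfold y0; nra).
  set (tm := fun m => (a (S m) * (2 * PI * Ci * INR (S m)) * qexp (S m) z)%C).
  assert (H2 : ex_series (fun m => A * (2 * PI) ^ 2 * INR (S m) ^ (B + 2) * exp (- (INR (S m) * y0)))).
  { apply exp_decay_summable; auto. apply Rmult_le_pos; auto. apply pow2_ge_0. }
  destruct H2 as [L HL].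
  assert (En : forall n, Cmod (2 * PI * Ci * INR n) = 2 * PI * INR n).
  { intros n. rewrite !Cmod_mult, Cmod_Ci, !Cmod_R, !Rabs_pos_eq; try lra; try apply pos_INR; lra. }
  assert (H1 : sums_to tm (CSeries tm)).
  { apply (csums_abs _ (fun m => A * (2 * PI) * INR (S m) ^ (B + 1) * exp (- (INR (S m) * (2 * PI * Im z))))).
    - intros m. unfold tm. rewrite !Cmod_mult, <- !Cmod_mult, Cmod_mult, (Cmod_mult (a (S m))), En, Cmod_qexp.
      replace (INR (S m) * (2 * PI * Im z)) with (2 * PI * INR (S m) * Im z) by ring.
      apply Rmult_le_compat_r; [apply Rlt_le, exp_pos|].
      rewrite pow_add, pow_1.
      assert (P : 0 <= INR (S m)) by apply pos_INR. specialize (Ha m).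
      replace (A * (2 * PI) * (INR (S m) ^ B * INR (S m))) with (A * INR (S m) ^ B * (2 * PI * INR (S m))) by ring.
      apply Rmult_le_compat_r; auto. nra.
    - apply exp_decay_summable; [nra|nra]. }
  assert (L0 : 0 <= L).
  { apply Rle_trans with (sum_n (fun m => A * (2 * PI) ^ 2 * INR (S m) ^ (B + 2) * exp (- (INR (S m) * y0))) 0).
    - rewrite sum_O. apply Rmult_le_pos; [|apply Rlt_le, exp_pos]. apply Rmult_le_pos; [|apply pow_le, pos_INR].
      apply Rmult_le_pos; auto. apply pow2_ge_0.
    - apply series_pos_le; auto. intros n. apply Rmult_le_pos; [|apply Rlt_le, exp_pos].
      apply Rmult_le_pos; [|apply pow_le, pos_INR]. apply Rmult_le_pos; auto. apply pow2_ge_0. }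
  exists (CSeries tm). intros eps He.
  exists (Rmin (Im z / 2) (eps / (L + 1))). split.
  { apply Rmin_case; [lra|]. apply Rdiv_lt_0_compat; lra. }
  intros y Hy.
  assert (B1 := Rmin_l (Im z / 2) (eps / (L + 1))). assert (B2 := Rmin_r (Im z / 2) (eps / (L + 1))).
  assert (Iy : 0 < Im y).
  { assert (T := im_le_Cmod (y - z)). rewrite Im_minus in T. apply Rabs_le_between in T. lra. }
  set (d := Cmod (y - z)) in *. assert (d0 : 0 <= d) by apply Cmod_ge_0.
  assert (S0 := csums_minus _ _ _ _ (csums_minus _ _ _ _ (fourier_csums_S y Iy) (fourier_csums_S z Hz))
     (csums_scal (y - z) _ _ H1)).
  cbv beta in S0.
  replace (f y - f z - CSeries tm * (y - z))%C with (f y - f z - (y - z) * CSeries tm)%C by ring.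
  apply Rle_trans with (L * (d * d)).
  - apply (csums_bound (fun n => a (S n) * qexp (S n) y - a (S n) * qexp (S n) z - (y - z) * tm n)%C (fun m => A * (2 * PI) ^ 2 * INR (S m) ^ (B + 2) * exp (- (INR (S m) * y0)) * (d * d))); [|now apply is_series_scal_r|exact S0].
    intros m. set (n := S m). unfold tm. fold n.
    set (h := (2 * PI * Ci * INR n * (y - z))%C).
    assert (Q : qexp n y = (qexp n z * Cexp h)%C).
    { unfold qexp, h. rewrite <- Cexp_plus. f_equal. ring. }
    rewrite Q.
    replace (a n * (qexp n z * Cexp h) - a n * qexp n z - (y - z) * (a n * (2 * PI * Ci * INR n) * qexp n z))%C
      with (a n * qexp n z * (Cexp h - 1 - h))%C by (unfold h; ring).
    assert (Hh : Cmod h = 2 * PI * INR n * d) by (unfold h; now rewrite Cmod_mult, En).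
    rewrite !Cmod_mult, Cmod_qexp.
    assert (Pn : 0 <= INR n) by apply pos_INR.
    assert (X := Cexp_2_bound h). rewrite Hh in X.
    assert (Y : exp (- (2 * PI * INR n * Im z)) * exp (2 * PI * INR n * d) <= exp (- (INR n * y0))).
    { rewrite <- exp_plus. apply exp_le. unfold y0.
      assert (0 <= 2 * PI * INR n * (Im z / 2 - d)) by (apply Rmult_le_pos; [apply Rmult_le_pos; lra|lra]). lra. }
    specialize (Ha m). fold n in Ha.
    assert (Ea := Cmod_ge_0 (a n)). assert (Ee := exp_pos (- (2 * PI * INR n * Im z))).
    apply Rle_trans with (A * INR n ^ B * (exp (- (2 * PI * INR n * Im z)) * (2 * PI * INR n * d * (2 * PI * INR n * d * exp (2 * PI * INR n * d))))).
    + rewrite Rmult_assoc. apply Rmult_le_compat; auto.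
      * apply Rmult_le_pos; [lra|apply Cmod_ge_0].
      * apply Rmult_le_compat_l; lra.
    + replace (A * INR n ^ B * (exp (- (2 * PI * INR n * Im z)) * (2 * PI * INR n * d * (2 * PI * INR n * d * exp (2 * PI * INR n * d)))))
       with (A * (2 * PI) ^ 2 * INR n ^ (B + 2) * (d * d) * (exp (- (2 * PI * INR n * Im z)) * exp (2 * PI * INR n * d)))
       by (rewrite pow_add; ring).
      replace (A * (2 * PI) ^ 2 * INR n ^ (B + 2) * exp (- (INR n * y0)) * (d * d)) with
        (A * (2 * PI) ^ 2 * INR n ^ (B + 2) * (d * d) * exp (- (INR n * y0))) by ring.
      apply Rmult_le_compat_l; auto.
      apply Rmult_le_pos; [|nra]. apply Rmult_le_pos; [|now apply pow_le]. apply Rmult_le_pos; auto. apply pow2_ge_0.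
  - assert (T : (L + 1) * d <= eps).
    { apply Rle_trans with ((L + 1) * (eps / (L + 1))); [apply Rmult_le_compat_l; lra|right; field; lra]. }
    nra.
Qed.

Lemma Cexp_2PI (n : nat) : Cexp (2 * PI * Ci * INR n) = 1%C.
Proof.
  replace (2 * PI * Ci * INR n)%C with (INR n * (2 * PI * Ci))%C by ring.
  rewrite Cexp_pow. replace (Cexp (2 * PI * Ci)) with (RtoC 1).
  - clear. induction n; simpl; [reflexivity|]. rewrite IHn. ring.
  - replace (2 * PI * Ci)%C with ((0, 2 * PI) : C) by (apply Ceq; unfold Re, Im; simpl; ring).
    unfold Cexp, Re, Im. cbn [fst snd]. rewrite exp_0, cos_2PI, sin_2PI. apply Ceq; simpl; ring.
Qed.

Lemma qexp_1 (n : nat) (z : C) : qexp n (z + 1) = qexp n z.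
Proof.
  unfold qexp. replace (2 * PI * Ci * INR n * (z + 1))%C with (2 * PI * Ci * INR n * z + 2 * PI * Ci * INR n)%C by ring.
  rewrite Cexp_plus, Cexp_2PI. ring.
Qed.

Lemma fourier_1 (z : C) : f (z + 1)%C = f z.
Proof.
  unfold fourier_series. f_equal. apply functional_extensionality. intros m.
  f_equal. apply (qexp_1 (S m) z).
Qed.

Lemma csums_csum (u : nat -> nat -> C) (l : nat -> C) (k : nat) : (forall b, sums_to (u b) (l b)) ->
  sums_to (fun n => partial_sum (fun b => u b n) k) (partial_sum l k).
Proof. intros H. induction k; simpl; auto. now apply csums_plus. Qed.

Lemma geom_csum (x : C) (k : nat) : ((x - 1) * partial_sum (fun b => x ^ b) k = x ^ S k - 1)%C.
Proof.
  induction k; [simpl; ring|]. cbn [partial_sum]. 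
  replace ((x - 1) * (partial_sum (fun b => x ^ b) k + x ^ S k))%C with
    ((x - 1) * partial_sum (fun b => x ^ b) k + (x - 1) * x ^ S k)%C by ring.
  rewrite IHk. simpl. ring.
Qed.

(** Orthogonality of characters modulo p, as a geometric sum whose ratio is a p-th root of unity. *)
Lemma root_sum (p n : nat) : (1 <= p)%nat ->
  partial_sum (fun b => Cexp (2 * PI * Ci * INR n * (INR b / INR p))%C) (p - 1) =
  if (n mod p =? 0)%nat then RtoC (INR p) else 0%C.
Proof.
  intros Hp. assert (Pp : 0 < INR p) by (apply lt_0_INR; lia).
  assert (Np : RtoC (INR p) <> 0%C) by (intros h; apply RtoC_inj in h; lra).
  assert (PP := PI_RGT_0).
  set (x := Cexp (2 * PI * Ci * INR n / INR p)%C).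
  rewrite (csum_ext _ (fun b => x ^ b)%C).
  2:{ intros b. unfold x. rewrite <- Cexp_pow. f_equal. field. auto. }
  assert (X1 : (x ^ p = 1)%C).
  { unfold x. rewrite <- Cexp_pow. replace (INR p * (2 * PI * Ci * INR n / INR p))%C with (2 * PI * Ci * INR n)%C by (field; auto).
    apply Cexp_2PI. }
  assert (Ex : x = Cexp (2 * PI * Ci * INR (n mod p) / INR p)%C).
  { unfold x. assert (D := Nat.div_mod_eq n p). rewrite D at 1. rewrite plus_INR, mult_INR, RtoC_plus, RtoC_mult.
    replace (2 * PI * Ci * (INR p * INR (n / p) + INR (n mod p)) / INR p)%C with
      (2 * PI * Ci * INR (n / p) + 2 * PI * Ci * INR (n mod p) / INR p)%C by (field; auto).
    rewrite Cexp_plus, Cexp_2PI. ring. }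
  destruct (n mod p =? 0)%nat eqn:E.
  - apply Nat.eqb_eq in E. rewrite E in Ex. simpl INR in Ex.
    replace (2 * PI * Ci * 0 / INR p)%C with (RtoC 0) in Ex by (field; auto). rewrite Cexp_0 in Ex. rewrite Ex.
    assert (P1 : forall b, (1 ^ b = 1)%C) by (induction b; simpl; [reflexivity|rewrite IHb; ring]).
    rewrite (csum_ext _ (fun _ => 1%C)) by apply P1.
    replace p with (S (p - 1)) at 2 by lia. generalize (p - 1)%nat as k. clear.
    induction k; [reflexivity|]. cbn [partial_sum]. rewrite IHk, (S_INR (S k)), RtoC_plus. reflexivity.
  - apply Nat.eqb_neq in E.
    assert (G := geom_csum x (p - 1)). replace (S (p - 1)) with p in G by lia. rewrite X1 in G.
    (* The real part of x is 1 - 2 sin(pi r / p)^2 with r = n mod p, and the sine is positive for 0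
       < r < p. *)
    assert (x <> 1%C).
    { intros h. rewrite Ex in h. apply (f_equal Re) in h.
      replace (2 * PI * Ci * INR (n mod p) / INR p)%C with (Ci * RtoC (2 * (PI * INR (n mod p) / INR p)))%C in h.
      2:{ rewrite RtoC_mult, RtoC_div, RtoC_mult by lra. field. auto. }
      replace (Ci * RtoC (2 * (PI * INR (n mod p) / INR p)))%C with ((0, 2 * (PI * INR (n mod p) / INR p)) : C) in h
        by (apply Ceq; unfold Re, Im; simpl; ring).
      unfold Cexp, Re, Im in h. cbn [fst snd RtoC] in h.
      rewrite exp_0, cos_2a_sin in h.
      assert (Hm := Nat.mod_upper_bound n p ltac:(lia)). apply lt_INR in Hm.
      assert (P0 : 0 < INR (n mod p)) by (apply lt_0_INR; lia).
      assert (0 < sin (PI * INR (n mod p) / INR p)); [|nra].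
      apply sin_gt_0.
      - apply Rdiv_lt_0_compat; nra.
      - apply (Rmult_lt_reg_r (INR p)); auto. unfold Rdiv. rewrite Rmult_assoc, Rinv_l, Rmult_1_r by lra. nra. }
    assert (Hx : (x - 1 <> 0)%C).
    { intros h. apply H. replace x with (x - 1 + 1)%C by ring. rewrite h. ring. }
    replace (partial_sum (fun b => x ^ b)%C (p - 1)) with (/ (x - 1) * ((x - 1) * partial_sum (fun b => x ^ b)%C (p - 1)))%C by (field; auto).
    rewrite G. ring.
Qed.

(** Summing over the translates keeps the exponents divisible by p, with coefficients a_(pk); the
    recursion then splits these into f(z) and f(p z). *)
Lemma fourier_hecke (p : nat) (c1 c2 : C) : (1 <= p)%nat ->
  (forall n, (1 <= n)%nat -> zero_at0 a (p * n)%nat = (c1 * zero_at0 a n - c2 * dilate p (zero_at0 a) n)%C) ->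
  forall z, 0 < Im z ->
  partial_sum (fun b => f ((z + INR b) / INR p)%C) (p - 1) = (INR p * (c1 * f z - c2 * f (INR p * z)))%C.
Proof.
  intros Hp Hrel z Hz. assert (Pp : 0 < INR p) by (apply lt_0_INR; lia).
  assert (Np : RtoC (INR p) <> 0%C) by (intros h; apply RtoC_inj in h; lra).
  assert (Iz : forall b, 0 < Im ((z + INR b) / INR p)).
  { intros b. unfold Cdiv. rewrite <- RtoC_inv by lra. unfold Im. simpl.
    assert (0 < / INR p) by now apply Rinv_0_lt_compat.
    assert (0 < snd z * / INR p) by (apply Rmult_lt_0_compat; auto). lra. }
  assert (Iz2 : 0 < Im (INR p * z)) by (unfold Im in *; simpl; nra).
  assert (S1 := csums_csum (fun b n => zero_at0 a n * qexp n ((z + INR b) / INR p))%C _ (p - 1)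
    (fun b => fourier_csums _ (Iz b))).
  assert (S2 : sums_to (fun k => INR p * (zero_at0 a (p * k)%nat * qexp k z))%C
     (partial_sum (fun b => f ((z + INR b) / INR p)%C) (p - 1))).
  { apply (csums_undil p); auto. eapply csums_ext; [|exact S1]. intros n. cbv beta.
    rewrite (csum_ext _ (fun b => (zero_at0 a n * qexp n (z / INR p)) * Cexp (2 * PI * Ci * INR n * (INR b / INR p)))%C).
    - rewrite csum_scal, root_sum by auto. unfold dilate. destruct (n mod p =? 0)%nat eqn:E; [|ring].
      apply mod_0_ex in E; auto. set (k := (n / p)%nat) in *.
      replace (qexp n (z / INR p)) with (qexp k z).
      + rewrite E. ring.
      + unfold qexp. f_equal. rewrite E, mult_INR, RtoC_mult. field. auto.
    - intros b. unfold qexp. rewrite <- (Cmult_assoc (zero_at0 a n)), <- Cexp_plus. f_equal. f_equal. field. auto. }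
  assert (S3 : sums_to (fun k => INR p * (zero_at0 a (p * k)%nat * qexp k z))%C (INR p * (c1 * f z - c2 * f (INR p * z)))%C).
  { apply csums_scal.
    eapply csums_ext; [|apply (csums_minus _ _ _ _ (csums_scal c1 _ _ (fourier_csums z Hz))
       (csums_scal c2 _ _ (csums_dil p _ _ Hp (fourier_csums _ Iz2))))].
    intros k. cbv beta. destruct (Nat.eq_dec k 0) as [->|Hk].
    - rewrite Nat.mul_0_r. unfold dilate. rewrite Nat.Div0.mod_0_l, Nat.Div0.div_0_l. simpl. ring.
    - rewrite Hrel by lia. unfold dilate. destruct (k mod p =? 0)%nat eqn:E; [|ring].
      apply mod_0_ex in E; auto. set (j := (k / p)%nat) in *.
      replace (qexp j (INR p * z)) with (qexp k z); [ring|].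
      unfold qexp. f_equal. rewrite E, mult_INR, RtoC_mult. ring. }
  apply (csums_unique _ _ _ S2 S3).
Qed.

End Fourier.

(** * The slash action *)

Definition mmul (A B : mat2 Z) : mat2 Z :=
  (Mat2 (ma A * ma B + mb A * mc B) (ma A * mb B + mb A * md B)
        (mc A * ma B + md A * mc B) (mc A * mb B + md A * md B))%Z.
Definition mdet (A : mat2 Z) : Z := (ma A * md A - mb A * mc A)%Z.
Definition mtr (A : mat2 Z) : Z := (ma A + md A)%Z.

Definition den (A : mat2 Z) (z : C) : C := (IZR (mc A) * z + IZR (md A))%C.
Definition act (A : mat2 Z) (z : C) : C := ((IZR (ma A) * z + IZR (mb A)) / den A z)%C.
Definition jac (A : mat2 Z) (z : C) : C := (IZR (mdet A) / (den A z * den A z))%C.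
(* The weight 2m slash operator, normalised so as not to change under scaling of A. *)
Definition slashZ (m : nat) (A : mat2 Z) (f : C -> C) (z : C) : C := (jac A z ^ m * f (act A z))%C.

Lemma mdet_mul (A B : mat2 Z) : mdet (mmul A B) = (mdet A * mdet B)%Z.
Proof. unfold mdet, mmul; simpl. ring. Qed.

Lemma den_neq0 (A : mat2 Z) (z : C) : (0 < mdet A)%Z -> 0 < Im z -> den A z <> 0%C.
Proof.
  intros HA Hz E. unfold den in E.
  assert (E2 := f_equal Im E). assert (E1 := f_equal Re E).
  destruct z as [x y]. unfold Re, Im in *. simpl in *.
  assert (c0 : IZR (mc A) = 0) by nra. rewrite c0 in E1.
  assert (d0 : IZR (md A) = 0) by lra.
  apply eq_IZR in c0, d0. unfold mdet in HA. rewrite c0, d0 in HA. lia.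
Qed.

Lemma Im_act (A : mat2 Z) (z : C) : (0 < mdet A)%Z -> 0 < Im z -> 0 < Im (act A z).
Proof.
  intros HA Hz. assert (N := den_neq0 A z HA Hz).
  assert (E : Im (act A z) = IZR (mdet A) * Im z / (Cmod (den A z) ^ 2)).
  { unfold act, mdet. rewrite minus_IZR, !mult_IZR.
    set (w := den A z) in *.
    assert (W1 : Re w = IZR (mc A) * Re z + IZR (md A)) by (unfold w, den, Re; simpl; ring).
    assert (W2 : Im w = IZR (mc A) * Im z) by (unfold w, den, Im; simpl; ring).
    assert (P : Cmod w ^ 2 <> 0) by (apply pow_nonzero; assert (0 < Cmod w) by (now apply Cmod_gt_0); lra).
    rewrite Cmod2_alt in *. clearbody w. destruct w as [p q], z as [x y]. unfold Re, Im in *. simpl in *.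
    subst p q. field. intros E. apply P. rewrite <- E. ring. }
  rewrite E. apply Rdiv_lt_0_compat.
  - apply Rmult_lt_0_compat; auto. now apply IZR_lt.
  - apply pow_lt. now apply Cmod_gt_0.
Qed.

Lemma den_mul (A B : mat2 Z) (z : C) : den B z <> 0%C ->
  den (mmul A B) z = (den A (act B z) * den B z)%C.
Proof.
  intros H. unfold act. unfold den at 1 2. unfold mmul; simpl. rewrite !plus_IZR, !mult_IZR, !RtoC_plus, !RtoC_mult.
  replace (den B z) with (IZR (mc B) * z + IZR (md B))%C in * by reflexivity. field. exact H.
Qed.

Lemma act_mul (A B : mat2 Z) (z : C) : den B z <> 0%C -> den A (act B z) <> 0%C ->
  act (mmul A B) z = act A (act B z).
Proof.
  intros H1 H2. unfold act at 1. rewrite den_mul by auto.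
  replace (act A (act B z)) with ((IZR (ma A) * act B z + IZR (mb A)) / den A (act B z))%C by reflexivity.
  assert (E : (IZR (ma (mmul A B)) * z + IZR (mb (mmul A B)) = (IZR (ma A) * act B z + IZR (mb A)) * den B z)%C).
  { unfold act, mmul; simpl. rewrite !plus_IZR, !mult_IZR, !RtoC_plus, !RtoC_mult.
    unfold den. unfold den in H1. field. exact H1. }
  rewrite E. field. auto.
Qed.

Lemma jac_mul (A B : mat2 Z) (z : C) : den B z <> 0%C -> den A (act B z) <> 0%C ->
  jac (mmul A B) z = (jac A (act B z) * jac B z)%C.
Proof.
  intros H1 H2. unfold jac. rewrite den_mul, mdet_mul, mult_IZR, RtoC_mult by auto. field. auto.
Qed.

Lemma sl_mul (m : nat) (A B : mat2 Z) (f : C -> C) (z : C) :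
  (0 < mdet A)%Z -> (0 < mdet B)%Z -> 0 < Im z ->
  slashZ m (mmul A B) f z = slashZ m B (slashZ m A f) z.
Proof.
  intros HA HB Hz. assert (N1 := den_neq0 B z HB Hz).
  assert (N2 := den_neq0 A (act B z) HA (Im_act B z HB Hz)).
  unfold slashZ. rewrite act_mul, jac_mul, Cpow_mul_l by auto. ring.
Qed.

(* Elements of the group ring Z[GL_2(Q)^+], acting on functions on the right; those
   annihilating f form a right ideal, which is moreover stable under left
   multiplication by Hecke operators of which f is an eigenvector ([Null_lmul]). *)
Definition mexpr := list (Z * mat2 Z).

Definition pos_dets (e : mexpr) : bool := forallb (fun t => (0 <? mdet (snd t))%Z) e.
Definition rmul (e : mexpr) (M : mat2 Z) : mexpr := map (fun t => (fst t, mmul (snd t) M)) e.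
Definition lmul (ms : list (mat2 Z)) (e : mexpr) : mexpr :=
  flat_map (fun t => map (fun be => (fst t, mmul be (snd t))) ms) e.
Definition smul (c : Z) (e : mexpr) : mexpr := map (fun t => ((c * fst t)%Z, snd t)) e.

Section Null.

Variables (m : nat) (f : C -> C).

Definition expr_eval (e : mexpr) (z : C) : C :=
  fold_right (fun t acc => IZR (fst t) * slashZ m (snd t) f z + acc)%C 0%C e.

Definition Null (e : mexpr) : Prop := pos_dets e = true /\ forall z, 0 < Im z -> expr_eval e z = 0%C.

Lemma ev_app (e1 e2 : mexpr) (z : C) : expr_eval (e1 ++ e2) z = (expr_eval e1 z + expr_eval e2 z)%C.
Proof. induction e1; simpl; [ring|]. rewrite IHe1. ring. Qed.

Lemma ev_smul (c : Z) (e : mexpr) (z : C) : expr_eval (smul c e) z = (IZR c * expr_eval e z)%C.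
Proof. induction e; simpl; [ring|]. rewrite IHe, mult_IZR, RtoC_mult. ring. Qed.

Lemma good_cons (t : Z * mat2 Z) (e : mexpr) : pos_dets (t :: e) = true -> (0 < mdet (snd t))%Z /\ pos_dets e = true.
Proof. unfold pos_dets; simpl. intros H. apply Bool.andb_true_iff in H. destruct H as [H1 H2]. apply Z.ltb_lt in H1. auto. Qed.

Lemma good_app (e1 e2 : mexpr) : pos_dets (e1 ++ e2) = andb (pos_dets e1) (pos_dets e2).
Proof. unfold pos_dets. apply forallb_app. Qed.

Lemma good_smul (c : Z) (e : mexpr) : pos_dets (smul c e) = pos_dets e.
Proof. induction e; simpl; auto. unfold pos_dets in *. simpl. now rewrite IHe. Qed.

Lemma ev_rmul (e : mexpr) (M : mat2 Z) (z : C) : pos_dets e = true -> (0 < mdet M)%Z -> 0 < Im z ->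
  expr_eval (rmul e M) z = (jac M z ^ m * expr_eval e (act M z))%C.
Proof.
  intros He HM Hz. induction e as [|t e IH]; [simpl; ring|].
  destruct (good_cons t e He) as [H1 H2]. simpl. rewrite IH by auto.
  rewrite sl_mul by auto. unfold slashZ at 1. ring.
Qed.

Lemma good_rmul (e : mexpr) (M : mat2 Z) : pos_dets e = true -> (0 < mdet M)%Z -> pos_dets (rmul e M) = true.
Proof.
  intros He HM. induction e as [|t e IH]; auto.
  destruct (good_cons t e He) as [H1 H2]. unfold pos_dets in *; simpl. rewrite IH by auto.
  rewrite Bool.andb_true_r. apply Z.ltb_lt. rewrite mdet_mul. now apply Z.mul_pos_pos.
Qed.

Lemma Null_rmul (e : mexpr) (M : mat2 Z) : Null e -> (0 < mdet M)%Z -> Null (rmul e M).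
Proof.
  intros [G H] HM. split; [now apply good_rmul|]. intros z Hz. rewrite ev_rmul by auto.
  rewrite H; [ring|]. now apply Im_act.
Qed.

Lemma Null_app (e1 e2 : mexpr) : Null e1 -> Null e2 -> Null (e1 ++ e2).
Proof.
  intros [G1 H1] [G2 H2]. split; [now rewrite good_app, G1, G2|].
  intros z Hz. rewrite ev_app, H1, H2 by auto. ring.
Qed.

Lemma Null_smul (c : Z) (e : mexpr) : Null e -> Null (smul c e).
Proof.
  intros [G H]. split; [now rewrite good_smul|]. intros z Hz. rewrite ev_smul, H by auto. ring.
Qed.

(** For T the sum of [ms], f|(T A) = (f|T)|A = lam f|A for each term, so the whole evaluation is
    multiplied by [lam]. In this way an unknown eigenvalue is eliminated. *)
Lemma Null_lmul (ms : list (mat2 Z)) (lam : C) (e : mexpr) :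
  forallb (fun M => (0 <? mdet M)%Z) ms = true ->
  (forall z, 0 < Im z -> expr_eval (map (fun M => (1%Z, M)) ms) z = (lam * f z)%C) ->
  Null e -> Null (lmul ms e).
Proof.
  intros Hms HT [G H].
  assert (GA : forall e, pos_dets e = true -> pos_dets (lmul ms e) = true).
  { clear - Hms. intros e. induction e as [|t e IH]; auto. intros He.
    destruct (good_cons t e He) as [H1 H2]. unfold lmul; simpl. rewrite good_app. fold (lmul ms e).
    rewrite IH by auto. rewrite Bool.andb_true_r. clear IH.
    induction ms as [|M ms' IHm]; auto. simpl in Hms. apply Bool.andb_true_iff in Hms. destruct Hms as [Q1 Q2].
    apply Z.ltb_lt in Q1. unfold pos_dets in *. simpl. rewrite IHm by auto. rewrite Bool.andb_true_r.
    apply Z.ltb_lt. rewrite mdet_mul. now apply Z.mul_pos_pos. }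
  split; [now apply GA|]. intros z Hz.
  assert (EV : forall e, pos_dets e = true -> expr_eval (lmul ms e) z = (lam * expr_eval e z)%C).
  { clear e G H. intros e. induction e as [|t e IH]; intros He; [simpl; ring|].
    destruct (good_cons t e He) as [H1 H2]. unfold lmul. simpl flat_map. rewrite ev_app.
    fold (lmul ms e). rewrite IH by auto. simpl expr_eval.
    assert (E : expr_eval (map (fun be => (fst t, mmul be (snd t))) ms) z =
       (IZR (fst t) * (jac (snd t) z ^ m * expr_eval (map (fun M => (1%Z, M)) ms) (act (snd t) z)))%C).
    { clear - Hms H1 Hz. induction ms as [|M ms' IHm]; [simpl; ring|]. simpl in Hms. apply Bool.andb_true_iff in Hms.
      destruct Hms as [Q1 Q2]. apply Z.ltb_lt in Q1. simpl. rewrite IHm by auto.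
      rewrite sl_mul by auto. unfold slashZ at 1. ring. }
    rewrite E, HT by (now apply Im_act). unfold slashZ. ring. }
  rewrite EV, H by auto. ring.
Qed.

Definition holoH (h : C -> C) : Prop := forall z, 0 < Im z -> exists l, cderiv h z l.

Lemma den_cd (A : mat2 Z) (z : C) : cderiv (den A) z (IZR (mc A)).
Proof.
  replace (RtoC (IZR (mc A))) with (IZR (mc A) * 1 + 0)%C by ring.
  apply (cd_plus (fun z => IZR (mc A) * z)%C (fun _ => RtoC (IZR (md A)))).
  - apply (cd_scal _ (fun z => z)). apply cd_id.
  - apply cd_const.
Qed.

Lemma sl_holo (A : mat2 Z) : (0 < mdet A)%Z -> holoH f -> holoH (slashZ m A f).
Proof.
  intros HA Hf z Hz. assert (N := den_neq0 A z HA Hz).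
  assert (Di := cd_comp _ _ _ _ _ (den_cd A z) (cd_inv _ N)). simpl in Di.
  assert (Hact : exists l, cderiv (act A) z l).
  { eexists. unfold act, Cdiv. apply (cd_mult (fun z => IZR (ma A) * z + IZR (mb A))%C (fun z => / den A z)%C); [|exact Di].
    apply cd_plus; [apply (cd_scal _ (fun z => z)), cd_id|apply cd_const]. }
  assert (Hjac : exists l, cderiv (jac A) z l).
  { eexists. eapply (cd_ext_loc (fun z => IZR (mdet A) * (/ den A z * / den A z))%C _ _ _ (Im z)).
    - exact Hz.
    - intros y Hy. assert (Iy : 0 < Im y).
      { assert (T := im_le_Cmod (y - z)). replace (Im (y - z)) with (Im y - Im z) in T by reflexivity.
        apply Rabs_le_between in T. lra. }
      unfold jac. field. now apply den_neq0.
    - apply cd_scal. apply (cd_mult (fun z => / den A z)%C (fun z => / den A z)%C); exact Di. }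
  destruct Hact as [l1 H1]. destruct Hjac as [l2 H2].
  destruct (cd_pow _ _ _ m H2) as [l3 H3].
  destruct (Hf (act A z) (Im_act A z HA Hz)) as [l4 H4].
  eexists. unfold slashZ. apply (cd_mult (fun z => jac A z ^ m)%C (fun z => f (act A z))); [exact H3|].
  apply (cd_comp (act A) f); eauto.
Qed.

Lemma ev_holo (e : mexpr) : holoH f -> pos_dets e = true -> holoH (expr_eval e).
Proof.
  intros Hf. induction e as [|t e IH]; intros He z Hz.
  - exists 0%C. apply (cd_const 0).
  - destruct (good_cons t e He) as [H1 H2].
    destruct (sl_holo (snd t) H1 Hf z Hz) as [l Hl]. destruct (IH H2 z Hz) as [l' Hl'].
    eexists. simpl expr_eval. apply (cd_plus (fun z => IZR (fst t) * slashZ m (snd t) f z)%C (expr_eval e)); [|exact Hl'].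
    apply cd_scal. exact Hl.
Qed.

End Null.

(** * Elliptic elements of infinite order *)

(** By compactness two powers u = kap^i and v = kap^j have close real parts. The identity (u - v)(u
    - conj v) = 2 u (Re u - Re v) makes u close to v or to conj v, and accordingly kap^(j - i) or
    kap^(i + j) is close to 1. *)
Lemma unit_pow_recur (kap : C) (del : R) : Cmod kap = 1 -> 0 < del ->
  exists n, (1 <= n)%nat /\ Cmod (kap ^ n - 1) < del.
Proof.
  intros Hk Hd.
  assert (U : forall n, Cmod (kap ^ n) = 1) by (intros n; rewrite Cmod_pow, Hk; apply pow1).
  set (x := fun n => Re (kap ^ n)).
  destruct (Bolzano_Weierstrass x (fun c => -1 <= c <= 1)) as [l Hl].
  - apply compact_P3.
  - intros n. assert (T := re_le_Cmod (kap ^ n)). rewrite U in T. apply Rabs_le_between in T. exact T.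
  - set (ep := Rmin (del * del / 8) 1).
    assert (Hep : 0 < ep) by (apply Rmin_case; nra).
    assert (Hep1 : ep <= del * del / 8) by apply Rmin_l.
    assert (NB : neighbourhood (disc l (mkposreal ep Hep)) l) by (exists (mkposreal ep Hep); intros y Hy; exact Hy).
    destruct (Hl _ 1%nat NB) as [i [Hi1 Hi2]].
    destruct (Hl _ (S i) NB) as [j [Hj1 Hj2]].
    unfold disc in Hi2, Hj2. simpl in Hi2, Hj2.
    assert (D : Rabs (x i - x j) < 2 * ep).
    { apply Rabs_def2 in Hi2, Hj2. apply Rabs_def1; lra. }
    assert (Uc : forall z, Cmod z = 1 -> (z * Cconj z = 1)%C).
    { intros z Hz. rewrite <- Cmod2_conj, Hz. f_equal. ring. }
    set (u := (kap ^ i)%C) in *. set (v := (kap ^ j)%C) in *.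
    assert (Uu : Cmod u = 1) by apply U. assert (Uv : Cmod v = 1) by apply U.
    assert (Eu := Uc u Uu). assert (Ev := Uc v Uv).
    assert (ID : ((u - v) * (u - Cconj v) = u * (2 * (x i) - 2 * (x j)))%C).
    { assert (Xi : (2 * x i = u + Cconj u)%C) by (unfold x; fold u; destruct u; apply Ceq; unfold Re, Im; simpl; ring).
      assert (Xj : (2 * x j = v + Cconj v)%C) by (unfold x; fold v; destruct v; apply Ceq; unfold Re, Im; simpl; ring).
      rewrite Xi, Xj. replace ((u - v) * (u - Cconj v))%C with (u * u - u * (v + Cconj v) + v * Cconj v)%C by ring.
      rewrite Ev, <- Eu. ring. }
    apply (f_equal Cmod) in ID. rewrite !Cmod_mult, Uu, Rmult_1_l in ID.
    replace (2 * x i - 2 * x j)%C with (RtoC (2 * (x i - x j))) in ID by (rewrite RtoC_mult, RtoC_minus; ring).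
    rewrite Cmod_R, Rabs_mult, (Rabs_pos_eq 2) in ID by lra.
    assert (B : Cmod (u - v) * Cmod (u - Cconj v) < del * del) by lra.
    assert (OR : Cmod (u - v) < del \/ Cmod (u - Cconj v) < del).
    { destruct (Rlt_or_le (Cmod (u - v)) del); auto. right.
      apply Rnot_le_lt. intros h. assert (del * del <= Cmod (u - v) * Cmod (u - Cconj v)) by (apply Rmult_le_compat; lra). lra. }
    destruct OR as [h|h].
    + exists (j - i)%nat. split; [lia|].
      replace v with (u * kap ^ (j - i))%C in h.
      * replace (u - u * kap ^ (j - i))%C with (- (u * (kap ^ (j - i) - 1)))%C in h by ring.
        rewrite Cmod_opp, Cmod_mult, Uu, Rmult_1_l in h. exact h.
      * unfold u, v. replace j with (i + (j - i))%nat at 2 by lia. clear.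
        generalize (j - i)%nat as k. induction i; intros k; simpl; [ring|]. rewrite <- IHi. ring.
    + exists (i + j)%nat. split; [lia|].
      replace (kap ^ (i + j))%C with (u * v)%C.
      * replace (u * v - 1)%C with (v * (u - Cconj v))%C by (rewrite <- Ev; ring).
        rewrite Cmod_mult, Uv, Rmult_1_l. exact h.
      * unfold u, v. clear. induction i; simpl; [ring|]. rewrite <- IHi. ring.
Qed.

(** Consecutive terms (V_n, V_(n+1)) of the Lucas sequence, V_n being the sum of the n-th powers of
    the roots of X^2 - t X + D. *)
Fixpoint lucas (t D : Z) (n : nat) : Z * Z :=
  match n with O => (2, t)%Z | S k => let p := lucas t D k in (snd p, t * snd p - D * fst p)%Z end.

Lemma lucas_pow (t D : Z) (lam lam' : C) (n : nat) : (lam + lam' = IZR t)%C -> (lam * lam' = IZR D)%C ->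
  RtoC (IZR (fst (lucas t D n))) = (lam ^ n + lam' ^ n)%C /\
  RtoC (IZR (snd (lucas t D n))) = (lam ^ S n + lam' ^ S n)%C.
Proof.
  intros Ht HD. induction n as [|n [I1 I2]].
  - simpl. split; [rewrite <- RtoC_plus; f_equal; ring|]. rewrite <- Ht. ring.
  - simpl lucas. cbv zeta. simpl fst. simpl snd. split; [exact I2|].
    rewrite minus_IZR, !mult_IZR, RtoC_minus, !RtoC_mult, I1, I2, <- Ht, <- HD. simpl. ring.
Qed.

(** Modulo l the recursion reads V_(n+2) = t V_(n+1), and it starts at V_1 = t. *)
Lemma lucas_mod (t D l : Z) (n : nat) : prime l -> (l | D)%Z -> ~ (l | t)%Z -> ~ (l | snd (lucas t D n))%Z.
Proof.
  intros Hl HD Ht. induction n; simpl; auto. intros H.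
  assert (H2 : (l | t * snd (lucas t D n))%Z).
  { replace (t * snd (lucas t D n))%Z with ((t * snd (lucas t D n) - D * fst (lucas t D n)) + D * fst (lucas t D n))%Z by ring.
    apply Z.divide_add_r; auto. now apply Z.divide_mul_l. }
  destruct (prime_mult _ Hl _ _ H2); auto.
Qed.

(* The eigenvalues are algebraic integers whose ratio is not a root of unity, by reduction modulo [l]. *)
Lemma eigen_ratio (t D l : Z) (lam lam' : C) (n : nat) : prime l -> (l | D)%Z -> ~ (l | t)%Z ->
  (lam + lam' = IZR t)%C -> (lam * lam' = IZR D)%C -> (1 <= n)%nat -> (lam ^ n)%C <> (lam' ^ n)%C.
Proof.
  intros Hl HD Ht H1 H2 Hn E. destruct n as [|n]; [lia|].
  destruct (lucas_pow t D lam lam' n H1 H2) as [_ I]. rewrite <- E in I.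
  assert (P : (lam ^ S n * lam' ^ S n = IZR (D ^ Z.of_nat (S n)))%C).
  { rewrite <- Cpow_mul_l, H2. rewrite <- pow_IZR. generalize (S n) as k. clear.
    induction k; simpl; [reflexivity|]. rewrite IHk, RtoC_mult. reflexivity. }
  rewrite <- E in P.
  set (s := snd (lucas t D n)) in *.
  (* Equal powers would give V^2 = 4 D^(n+1) for V = V_(n+1); the right side is divisible by l,
     contrary to [lucas_mod]. *)
  assert (S2 : (s * s = 4 * D ^ Z.of_nat (S n))%Z).
  { apply eq_IZR. apply RtoC_inj. rewrite !mult_IZR, !RtoC_mult, I, <- P.
    replace (lam ^ S n + lam ^ S n)%C with (2 * lam ^ S n)%C by ring.
    replace (RtoC (IZR 4)) with (2 * 2)%C by (rewrite <- RtoC_mult; f_equal; ring). ring. }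
  assert (Dv : (l | s * s)%Z).
  { rewrite S2. apply Z.divide_mul_r. rewrite Nat2Z.inj_succ, Z.pow_succ_r by lia. now apply Z.divide_mul_l. }
  destruct (prime_mult _ Hl _ _ Dv) as [h|h]; now apply (lucas_mod t D l n Hl HD Ht).
Qed.

(** The fixed points of M are the roots of a quadratic with negative discriminant. The values of
    [den M] at them are the eigenvalues of M, whence trace and determinant. *)
Lemma fixed_point (M : mat2 Z) : (mtr M * mtr M < 4 * mdet M)%Z ->
  exists z0, 0 < Im z0 /\ IZR (mc M) <> 0 /\
    (forall z, IZR (mc M) * (z * z) + (IZR (md M) - IZR (ma M)) * z - IZR (mb M) =
       IZR (mc M) * ((z - z0) * (z - Cconj z0)))%C /\
    (den M z0 + den M (Cconj z0) = IZR (mtr M))%C /\ (den M z0 * den M (Cconj z0) = IZR (mdet M))%C.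
Proof.
  destruct M as [a b c d]. unfold mtr, mdet, den; cbn [ma mb mc md]. intros H.
  assert (Hc : (c <> 0)%Z) by (intros ->; assert (X := Z.square_nonneg (a - d)); nia).
  assert (HR : (IZR a + IZR d) * (IZR a + IZR d) < 4 * (IZR a * IZR d - IZR b * IZR c)).
  { apply IZR_lt in H. rewrite !mult_IZR, minus_IZR, plus_IZR, !mult_IZR in H. exact H. }
  assert (Hc' : IZR c <> 0) by now apply not_0_IZR.
  rewrite plus_IZR, minus_IZR, !mult_IZR.
  set (A := IZR a) in *. set (B := IZR b) in *. set (C0 := IZR c) in *. set (D := IZR d) in *.
  set (r := sqrt (4 * (A * D - B * C0) - (A + D) * (A + D))).
  assert (Hr : 0 < r) by (apply sqrt_lt_R0; lra).
  assert (Hrr : r * r = 4 * (A * D - B * C0) - (A + D) * (A + D)) by (apply sqrt_sqrt; lra).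
  (* |c| in the denominator selects the root in the upper half-plane for either sign of c. *)
  set (x0 := (A - D) / (2 * C0)). set (y0 := r / (2 * Rabs C0)).
  assert (Pc : 0 < Rabs C0) by now apply Rabs_pos_lt.
  assert (Hy : 0 < y0) by (unfold y0; apply Rdiv_lt_0_compat; lra).
  assert (Hyy : y0 * y0 = r * r / (4 * (C0 * C0))).
  { unfold y0. replace (C0 * C0) with (Rabs C0 * Rabs C0); [field; lra|].
    rewrite <- Rabs_mult. apply Rabs_pos_eq. apply Rle_0_sqr. }
  rewrite Hrr in Hyy.
  exists (x0, y0). split; [exact Hy|]. split; [exact Hc'|].
  assert (Q1 : C0 * (x0 * x0 + y0 * y0) = - B) by (rewrite Hyy; unfold x0; field; auto).
  assert (Q2 : 2 * C0 * x0 = A - D) by (unfold x0; field; auto).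
  split; [|split].
  - intros [x y]. unfold Cconj. apply Ceq; unfold Re, Im; simpl; ring_simplify.
    + replace (C0 * x ^ 2 - C0 * y ^ 2 + x * D - x * A - B) with
       (C0 * x ^ 2 - C0 * y ^ 2 - x * (A - D) + - B) by ring. rewrite <- Q1, <- Q2. ring.
    + replace (2 * C0 * x * y + y * D - y * A) with (2 * C0 * x * y - y * (A - D)) by ring.
      rewrite <- Q2. ring.
  - unfold Cconj. apply Ceq; unfold Re, Im; simpl; [|ring].
    replace (C0 * x0 - 0 * y0 + D + (C0 * x0 - 0 * - y0 + D)) with (2 * C0 * x0 + 2 * D) by ring.
    rewrite Q2. ring.
  - unfold Cconj. apply Ceq; unfold Re, Im; simpl; [|ring].
    replace (A * D - B * C0) with (A * D + - B * C0) by ring. rewrite <- Q1.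
    replace A with (2 * C0 * x0 + D) by lra. ring.
Qed.

Section Elliptic.

Variables (m : nat) (M : mat2 Z) (l : Z) (h : C -> C) (sg : C).
Hypothesis (Hm : (1 <= m)%nat) (HD : (0 < mdet M)%Z) (Hell : (mtr M * mtr M < 4 * mdet M)%Z).
Hypothesis (Hl : prime l) (HlD : (l | mdet M)%Z) (Hlt : ~ (l | mtr M)%Z).
Hypothesis (Hsg : (sg * sg = 1)%C) (Hh : holoH h).
Hypothesis (Hinv : forall z, 0 < Im z -> slashZ m M h z = (sg * h z)%C).

(* Q vanishes at the fixed points of M and has weight -2, so psi is M-invariant up to
   sign; as M is a rotation of infinite order about its fixed point in the upper
   half-plane, psi is constant, hence equal to its value 0 there. *)
Let Q (z : C) : C := (IZR (mc M) * (z * z) + (IZR (md M) - IZR (ma M)) * z - IZR (mb M))%C.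
Let psi (z : C) : C := (Q z ^ m * h z)%C.

Lemma Q_act (z : C) : 0 < Im z -> Q (act M z) = (jac M z * Q z)%C.
Proof.
  intros Hz. assert (N := den_neq0 M z HD Hz).
  unfold Q, jac, act, mdet. rewrite minus_IZR, !mult_IZR, RtoC_minus, !RtoC_mult.
  unfold den in *. field. exact N.
Qed.

Lemma psi_act (z : C) : 0 < Im z -> psi (act M z) = (sg * psi z)%C.
Proof.
  intros Hz. unfold psi. rewrite Q_act, Cpow_mul_l by auto.
  assert (E := Hinv z Hz). unfold slashZ in E.
  replace (jac M z ^ m * Q z ^ m * h (act M z))%C with (Q z ^ m * (jac M z ^ m * h (act M z)))%C by ring.
  rewrite E. ring.
Qed.

Let it (n : nat) (z : C) : C := Nat.iter n (act M) z.

Lemma it_Im (n : nat) (z : C) : 0 < Im z -> 0 < Im (it n z).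
Proof. intros Hz. induction n; simpl; auto. now apply Im_act. Qed.

(** Even iterates cancel the sign [sg]. *)
Lemma psi_it (n : nat) (z : C) : 0 < Im z -> psi (it (2 * n) z) = psi z.
Proof.
  intros Hz. induction n; [reflexivity|].
  replace (2 * S n)%nat with (S (S (2 * n))) by lia.
  change (it (S (S (2 * n))) z) with (act M (act M (it (2 * n) z))).
  assert (I1 := it_Im (2 * n) z Hz). assert (I2 := Im_act M _ HD I1).
  rewrite !psi_act by auto. rewrite IHn, Cmult_assoc, Hsg. ring.
Qed.

Lemma psi_cd (z : C) : 0 < Im z -> exists d, cderiv psi z d.
Proof.
  intros Hz. destruct (Hh z Hz) as [d1 H1].
  assert (HQ : exists d, cderiv Q z d).
  { eexists. unfold Q. apply cd_minus; [|apply cd_const].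
    apply cd_plus; [apply cd_scal, cd_sqr|apply (cd_scal _ (fun z => z)), cd_id]. }
  destruct HQ as [d2 H2]. destruct (cd_pow _ _ _ m H2) as [d3 H3].
  eexists. apply (cd_mult (fun z => Q z ^ m)%C h); eauto.
Qed.

Lemma elliptic_zero : forall z, 0 < Im z -> h z = 0%C.
Proof.
  destruct (fixed_point M Hell) as [z0 [Iz0 [Hc [HQ [Htr Hdet]]]]].
  assert (Nc : RtoC (IZR (mc M)) <> 0%C) by (intros E; apply RtoC_inj in E; auto).
  assert (NB : forall z, 0 < Im z -> (z - Cconj z0 <> 0)%C).
  { intros z Hz E. apply (f_equal Im) in E. destruct z, z0. unfold Im in *; simpl in *. lra. }
  assert (Ncj : (z0 - Cconj z0 <> 0)%C) by now apply NB.
  set (lam := den M z0) in *. set (lam' := den M (Cconj z0)) in *.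
  assert (Nlam : lam <> 0%C) by now apply den_neq0.
  assert (Elam : lam' = Cconj lam).
  { unfold lam', lam, den. destruct z0. unfold Cconj, Cplus, Cmult; simpl. f_equal; ring. }
  set (kap := (lam' / lam)%C).
  assert (Ukap : Cmod kap = 1).
  { unfold kap. rewrite Cmod_div, Elam, Cmod_conj by auto. field. apply Rgt_not_eq. now apply Cmod_gt_0. }
  (* The Cayley transform to the unit disc centred at the fixed point; there M is multiplication by
     [kap], the ratio of its eigenvalues. *)
  set (u := fun z : C => ((z - z0) / (z - Cconj z0))%C).
  assert (Uact : forall z, 0 < Im z -> u (act M z) = (kap * u z)%C).
  { intros z Hz. assert (N := den_neq0 M z HD Hz).
    assert (F0 : forall w, (w = z0 \/ w = Cconj z0) ->
      (IZR (ma M) * w + IZR (mb M) = w * den M w)%C).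
    { intros w Hw. assert (E := HQ w). unfold den.
      replace (IZR (mc M) * ((w - z0) * (w - Cconj z0)))%C with (RtoC 0) in E by (destruct Hw as [-> | ->]; ring).
      replace (IZR (ma M) * w + IZR (mb M))%C with (w * (IZR (mc M) * w + IZR (md M)) - (IZR (mc M) * (w * w) + (IZR (md M) - IZR (ma M)) * w - IZR (mb M)))%C by ring.
      rewrite E. ring. }
    assert (G : forall w, (w = z0 \/ w = Cconj z0) -> den M w <> 0%C ->
      (act M z - w = IZR (mdet M) * (z - w) / (den M z * den M w))%C).
    { intros w Hw Nw. replace w with ((IZR (ma M) * w + IZR (mb M)) / den M w)%C at 1 by (rewrite (F0 w Hw); field; auto).
      unfold act, mdet. rewrite minus_IZR, !mult_IZR, RtoC_minus, !RtoC_mult.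
      unfold den in *. field. auto. }
    assert (Nlam' : lam' <> 0%C).
    { rewrite Elam. apply Cmod_gt_0. rewrite Cmod_conj. now apply Cmod_gt_0. }
    unfold u. rewrite (G z0), (G (Cconj z0)) by auto. fold lam lam'. unfold kap.
    assert (ND : RtoC (IZR (mdet M)) <> 0%C) by (intros E; apply RtoC_inj, eq_IZR in E; lia).
    assert (NZ := NB z Hz). field. auto. }
  assert (Uit : forall n z, 0 < Im z -> u (it n z) = (kap ^ n * u z)%C).
  { intros n z Hz. induction n; [simpl; ring|]. change (it (S n) z) with (act M (it n z)).
    rewrite Uact by now apply it_Im. rewrite IHn. simpl. ring. }
  assert (NK : forall n, (1 <= n)%nat -> (kap ^ n)%C <> 1%C).
  { intros n Hn E. apply (eigen_ratio (mtr M) (mdet M) l lam lam' n Hl HlD Hlt Htr Hdet Hn).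
    replace lam' with (kap * lam)%C by (unfold kap; field; auto). rewrite Cpow_mul_l, E. ring. }
  assert (Uinj : forall z w, 0 < Im z -> 0 < Im w -> (u w - u z = (w - z) * (z0 - Cconj z0) / ((w - Cconj z0) * (z - Cconj z0)))%C).
  { intros z w Hz Hw. unfold u. assert (N1 := NB z Hz). assert (N2 := NB w Hw). field. auto. }
  (* the orbit of z returns arbitrarily close to z without hitting it *)
  assert (RET : forall z del, 0 < Im z -> z <> z0 -> 0 < del ->
     exists y, 0 < Im y /\ y <> z /\ Cmod (y - z) < del /\ psi y = psi z).
  { intros z del Hz Hne Hdel.
    assert (N1 := NB z Hz).
    assert (Nz : (z - z0 <> 0)%C).
    { intros E. apply Hne. replace z with (z - z0 + z0)%C by ring. rewrite E. ring. }
    assert (Nu : u z <> 0%C).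
    { intros E. apply Nz. replace (z - z0)%C with (u z * (z - Cconj z0))%C by (unfold u; field; auto). rewrite E. ring. }
    set (a1 := Cmod (z - Cconj z0)). assert (Pa1 : 0 < a1) by now apply Cmod_gt_0.
    set (b1 := Cmod (z0 - Cconj z0)). assert (Pb1 : 0 < b1) by now apply Cmod_gt_0.
    assert (Pu : 0 < Cmod (u z)) by now apply Cmod_gt_0.
    assert (L1 : Cmod (u z) < 1).
    { unfold u. rewrite Cmod_div by auto. fold a1. apply (Rmult_lt_reg_r a1); auto.
      unfold Rdiv. rewrite Rmult_assoc, Rinv_l, Rmult_1_l, Rmult_1_r by lra.
      unfold a1, Cmod. apply sqrt_lt_1_alt. split; [nra|].
      clear - Iz0 Hz. destruct z, z0. unfold Cconj, Im in *; simpl in *. nra. }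
    (* y - z equals (u y - u z)(y - conj z0)(z - conj z0) / (z0 - conj z0), and |y - conj z0| <= b1
       / (1 - |u z|) because |u y| = |u z|. So |kap^(2n) - 1| < del' gives |y - z| < del. *)
    set (del' := del * (b1 * (1 - Cmod (u z)) / (b1 * a1 * Cmod (u z)))).
    assert (Hdel' : 0 < del').
    { unfold del'. apply Rmult_lt_0_compat; auto. apply Rdiv_lt_0_compat.
      - apply Rmult_lt_0_compat; lra.
      - repeat apply Rmult_lt_0_compat; auto. }
    (* The square, since only even iterates of M preserve [psi]. *)
    destruct (unit_pow_recur (kap * kap)%C del') as [n [Hn1 Hn2]]; auto.
    { rewrite Cmod_mult, Ukap. ring. }
    rewrite <- Cpow_2 in Hn2.
    exists (it (2 * n) z). assert (Iy := it_Im (2 * n) z Hz). set (y := it (2 * n) z) in *.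
    assert (N2 := NB y Iy).
    assert (Uy : u y = (kap ^ (2 * n) * u z)%C) by now apply Uit.
    assert (DU : (u y - u z = (kap ^ (2 * n) - 1) * u z)%C) by (rewrite Uy; ring).
    split; auto. split; [|split; [|now apply psi_it]].
    - intros E. rewrite E in DU.
      apply (NK (2 * n)%nat); [lia|].
      assert (Z : ((kap ^ (2 * n) - 1) * u z = 0)%C) by (rewrite <- DU; ring).
      replace (kap ^ (2 * n))%C with (((kap ^ (2 * n) - 1) * u z) / u z + 1)%C by (field; auto). rewrite Z. field. auto.
    - set (c1 := Cmod (y - Cconj z0)). assert (Pc1 : 0 < c1) by now apply Cmod_gt_0.
      assert (C1 : c1 * (1 - Cmod (u z)) <= b1).
      { assert (E : ((1 - u y) * (y - Cconj z0) = z0 - Cconj z0)%C) by (unfold u; field; auto).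
        apply (f_equal Cmod) in E. rewrite Cmod_mult in E. fold c1 b1 in E.
        assert (T := Cmod_triang_inv 1 (u y)). rewrite Cmod_1 in T.
        assert (Uyz : Cmod (u y) = Cmod (u z)).
        { rewrite Uy, Cmod_mult, Cmod_pow, Ukap, pow1. ring. }
        rewrite Uyz in T. rewrite <- E, Rmult_comm. apply Rmult_le_compat_r; lra. }
      assert (E := Uinj z y Hz Iy). rewrite DU in E. apply (f_equal Cmod) in E.
      assert (NP : ((y - Cconj z0) * (z - Cconj z0) <> 0)%C) by now apply Cmult_neq_0.
      rewrite Cmod_div, !Cmod_mult in E by auto. fold c1 a1 b1 in E.
      assert (E2 : Cmod (y - z) * b1 = Cmod (kap ^ (2 * n) - 1) * Cmod (u z) * (c1 * a1)).
      { rewrite E. field. lra. }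
      assert (F1 : Cmod (y - z) * b1 * (1 - Cmod (u z)) < del * b1 * (1 - Cmod (u z))).
      { rewrite E2.
        apply Rle_lt_trans with (Cmod (kap ^ (2 * n) - 1) * Cmod (u z) * a1 * b1).
        - replace (Cmod (kap ^ (2 * n) - 1) * Cmod (u z) * (c1 * a1) * (1 - Cmod (u z))) with
            (Cmod (kap ^ (2 * n) - 1) * Cmod (u z) * a1 * (c1 * (1 - Cmod (u z)))) by ring.
          apply Rmult_le_compat_l; auto. apply Rmult_le_pos; [|lra]. apply Rmult_le_pos; [apply Cmod_ge_0|lra].
        - apply Rlt_le_trans with (del' * Cmod (u z) * a1 * b1).
          + repeat apply Rmult_lt_compat_r; auto.
          + right. unfold del'. field. lra. }
      apply (Rmult_lt_reg_r (b1 * (1 - Cmod (u z)))); [apply Rmult_lt_0_compat; lra|]. lra. }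
  (* [psi] repeats its value at points other than z but arbitrarily close to it, so the derivative
     can only be 0. *)
  assert (D0 : forall z, 0 < Im z -> z <> z0 -> cderiv psi z 0).
  { intros z Hz Hne. destruct (psi_cd z Hz) as [d Hd].
    replace (RtoC 0) with d; auto. apply Ceq_dist. intros eps He. replace (d - 0)%C with d by ring.
    destruct (Hd eps He) as [del [Hdel HH]].
    destruct (RET z del Hz Hne Hdel) as [y [Iy [Ny [Cy Py]]]].
    specialize (HH y Cy). rewrite Py in HH.
    replace (psi z - psi z - d * (y - z))%C with (- (d * (y - z)))%C in HH by ring.
    rewrite Cmod_opp, Cmod_mult in HH.
    assert (0 < Cmod (y - z)).
    { apply Cmod_gt_0. intros E. apply Ny. replace y with (y - z + z)%C by ring. rewrite E. ring. }
    now apply (Rmult_le_reg_r (Cmod (y - z))). }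
  assert (P0 : psi z0 = 0%C).
  { unfold psi. replace (Q z0) with (RtoC 0).
    - destruct m; [lia|]. simpl. ring.
    - unfold Q. rewrite HQ. ring. }
  assert (PZ : forall z1, 0 < Im z1 -> z1 <> z0 -> psi z1 = 0%C).
  { intros z1 Hz1 Hne. set (w := (z1 - z0)%C).
    assert (Nw : w <> 0%C).
    { intros E. apply Hne. replace z1 with (w + z0)%C by (unfold w; ring). rewrite E. ring. }
    set (gam := fun t : R => (z0 + t * w)%C).
    assert (Ig : forall t, 0 <= t <= 1 -> 0 < Im (gam t)).
    { intros t Ht. unfold gam, w. destruct z1 as [x1 y1], z0 as [x0 y0]. unfold Im in *; simpl in *.
      destruct (Req_dec t 1) as [->|]; [lra|]. nra. }
    assert (Dg : forall s t, Cmod (gam s - gam t) = Rabs (s - t) * Cmod w).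
    { intros s t. unfold gam. replace (z0 + s * w - (z0 + t * w))%C with (RtoC (s - t) * w)%C by (rewrite RtoC_minus; ring).
      now rewrite Cmod_mult, Cmod_R. }
    assert (Pw : 0 < Cmod w) by now apply Cmod_gt_0.
    (* The real mean value theorem for [Re] and [Im] along the segment from z0 to z1. It asks for
       the derivative on the open segment only, which avoids the fixed point. *)
    assert (KEY : forall pr : C -> R, (forall x y, pr (x - y)%C = pr x - pr y) -> (forall x, Rabs (pr x) <= Cmod x) ->
       pr (psi z1) = pr (psi z0)).
    { intros pr Hpr Hb.
      destruct (MVT_gen (fun t => pr (psi (gam t))) 0 1 (fun _ => 0)) as [t [_ Ht]].
      - rewrite Rmin_left, Rmax_right by lra. intros t Ht. apply is_derive_Reals.
        intros eps He. assert (Ne : gam t <> z0).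
        { intros E. assert (E2 : gam t = gam 0) by (rewrite E; unfold gam; ring).
          assert (E3 := Dg t 0). rewrite E2 in E3.
          replace (gam 0 - gam 0)%C with (RtoC 0) in E3 by ring. rewrite Cmod_0, Rminus_0_r, Rabs_pos_eq in E3 by lra. nra. }
        destruct (D0 (gam t) (Ig t ltac:(lra)) Ne (eps / (2 * Cmod w))) as [del [Hdel HH]]; [apply Rdiv_lt_0_compat; lra|].
        assert (P : 0 < del / Cmod w) by (now apply Rdiv_lt_0_compat).
        exists (mkposreal _ P). intros s Hs0 Hs. simpl in Hs.
        assert (E : Cmod (gam (t + s) - gam t) = Rabs s * Cmod w) by (rewrite Dg; do 2 f_equal; ring).
        specialize (HH (gam (t + s))). rewrite E in HH.
        assert (Cs : Rabs s * Cmod w < del).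
        { apply (Rmult_lt_compat_r (Cmod w)) in Hs; auto. replace (del / Cmod w * Cmod w) with del in Hs by (field; lra). exact Hs. }
        specialize (HH Cs).
        replace (psi (gam (t + s)%R) - psi (gam t) - 0 * (gam (t + s)%R - gam t))%C with (psi (gam (t + s)%R) - psi (gam t))%C in HH by ring.
        rewrite <- Hpr, Rminus_0_r. unfold Rdiv. rewrite Rabs_mult, Rabs_inv.
        assert (Ps : 0 < Rabs s) by now apply Rabs_pos_lt.
        apply (Rmult_lt_reg_r (Rabs s)); auto. rewrite Rmult_assoc, Rinv_l, Rmult_1_r by lra.
        eapply Rle_lt_trans; [apply Hb|]. eapply Rle_lt_trans; [apply HH|].
        replace (eps / (2 * Cmod w) * (Rabs s * Cmod w)) with (eps / 2 * Rabs s) by (field; lra). nra.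
      - rewrite Rmin_left, Rmax_right by lra. intros t Ht.
        destruct (psi_cd (gam t) (Ig t Ht)) as [d Hd]. destruct (cd_bound _ _ _ Hd) as [d0 [K [Hd0 [HK HB]]]].
        intros eps He. exists (Rmin (d0 / Cmod w) (eps / (K * Cmod w))). split.
        { apply Rmin_case; apply Rdiv_lt_0_compat; nra. }
        intros s [_ Hs]. simpl in Hs |- *. unfold R_dist in *.
        assert (B1 := Rmin_l (d0 / Cmod w) (eps / (K * Cmod w))). assert (B2 := Rmin_r (d0 / Cmod w) (eps / (K * Cmod w))).
        rewrite <- Hpr. eapply Rle_lt_trans; [apply Hb|].
        eapply Rle_lt_trans; [apply HB; rewrite Dg|rewrite Dg].
        + assert (Hs2 : Rabs (s - t) < d0 / Cmod w) by lra.
          apply (Rmult_lt_compat_r (Cmod w)) in Hs2; auto. replace (d0 / Cmod w * Cmod w) with d0 in Hs2 by (field; lra). exact Hs2.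
        + assert (Hs2 : Rabs (s - t) < eps / (K * Cmod w)) by lra.
          apply (Rmult_lt_compat_r (K * Cmod w)) in Hs2; [|nra].
          replace (eps / (K * Cmod w) * (K * Cmod w)) with eps in Hs2 by (field; lra). lra.
      - rewrite Rmult_0_l in Ht. unfold gam in Ht.
        replace (z0 + RtoC 1 * w)%C with z1 in Ht by (unfold w; ring).
        replace (z0 + RtoC 0 * w)%C with z0 in Ht by ring. lra. }
    assert (E1 := KEY Re (fun x y => eq_refl) re_le_Cmod). assert (E2 := KEY Im (fun x y => eq_refl) im_le_Cmod).
    rewrite P0 in E1, E2. now apply Ceq. }
  assert (HZ : forall z, 0 < Im z -> z <> z0 -> h z = 0%C).
  { intros z Hz Hne. assert (E := PZ z Hz Hne). unfold psi in E.
    assert (NQ : (Q z ^ m <> 0)%C).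
    { apply Cpow_neq0. unfold Q. rewrite HQ. apply Cmult_neq_0; auto. apply Cmult_neq_0; auto.
      intros E2. apply Hne. replace z with (z - z0 + z0)%C by ring. rewrite E2. ring. }
    replace (h z) with (/ Q z ^ m * (Q z ^ m * h z))%C by (field; auto). rewrite E. ring. }
  (* At the fixed point Q vanishes, so h z0 = 0 is obtained from the zeros z0 + i r by
     continuity. *)
  intros z Hz. destruct (Ceq_dec z z0) as [->|Hne]; auto.
  destruct (Hh z0 Iz0) as [d Hd]. destruct (cd_bound _ _ _ Hd) as [d0 [K [Hd0 [HK HB]]]].
  apply Ceq_dist. intros eps He. replace (h z0 - 0)%C with (h z0) by ring.
  set (r := Rmin (d0 / 2) (eps / K)).
  assert (Pr : 0 < r) by (apply Rmin_case; [lra|now apply Rdiv_lt_0_compat]).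
  assert (R1 : r <= d0 / 2) by apply Rmin_l. assert (R2 : r <= eps / K) by apply Rmin_r.
  set (y := (z0 + Ci * r)%C).
  assert (Ey : Cmod (y - z0) = r).
  { unfold y. replace (z0 + Ci * r - z0)%C with (Ci * r)%C by ring. rewrite Cmod_mult, Cmod_Ci, Cmod_R, Rabs_pos_eq; lra. }
  assert (Iy : 0 < Im y) by (unfold y; destruct z0; unfold Im in *; simpl in *; lra).
  assert (Ny : y <> z0).
  { intros E. rewrite E in Ey. replace (z0 - z0)%C with (RtoC 0) in Ey by ring. rewrite Cmod_0 in Ey. lra. }
  specialize (HB y ltac:(lra)). rewrite (HZ y Iy Ny), Ey in HB.
  replace (0 - h z0)%C with (- h z0)%C in HB by ring. rewrite Cmod_opp in HB.
  apply (Rmult_le_compat_l K) in R2; [|lra]. replace (K * (eps / K)) with eps in R2 by (field; lra). lra.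
Qed.

End Elliptic.

Open Scope bool_scope.
Open Scope R_scope.

(** * Certificates *)

Definition mscale (k : Z) (M : mat2 Z) : mat2 Z := mat2_map (Z.mul k) M.

Lemma sl_mscale (m : nat) (k : Z) (M : mat2 Z) (f : C -> C) (z : C) :
  k <> 0%Z -> (0 < mdet M)%Z -> 0 < Im z -> slashZ m (mscale k M) f z = slashZ m M f z.
Proof.
  intros Hk HM Hz. assert (N := den_neq0 M z HM Hz).
  assert (K : RtoC (IZR k) <> 0%C) by (intros E; apply RtoC_inj in E; apply eq_IZR in E; auto).
  assert (D : den (mscale k M) z = (IZR k * den M z)%C).
  { unfold den, mscale; simpl. rewrite !mult_IZR, !RtoC_mult. ring. }
  unfold slashZ. f_equal; [f_equal|f_equal].
  - unfold jac. rewrite D. replace (mdet (mscale k M)) with (k * k * mdet M)%Z by (unfold mdet; simpl; ring).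
    rewrite !mult_IZR, !RtoC_mult. field. auto.
  - unfold act. rewrite D. unfold mscale; simpl. rewrite !mult_IZR, !RtoC_mult. field. auto.
Qed.

Definition meqb (A B : mat2 Z) : bool :=
  (ma A =? ma B)%Z && (mb A =? mb B)%Z && (mc A =? mc B)%Z && (md A =? md B)%Z.

Lemma meqb_eq (A B : mat2 Z) : meqb A B = true -> A = B.
Proof.
  unfold meqb. rewrite !Bool.andb_true_iff, !Z.eqb_eq. destruct A, B; simpl. intuition congruence.
Qed.

(** Proportional matrices act alike under [slashZ], so each is reduced to a primitive integral one
    whose first nonzero entry is positive; this decides equality of actions syntactically. *)
Definition mcontent (M : mat2 Z) : Z :=
  let s := if (ma M =? 0)%Z then mb M else ma M in
  ((if s <? 0 then -1 else 1) * Z.gcd (Z.gcd (ma M) (mb M)) (Z.gcd (mc M) (md M)))%Z.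

(* The comparison with M makes correctness independent of the gcd computation. *)
Definition mprim (M : mat2 Z) : mat2 Z :=
  let k := mcontent M in
  let P := mat2_map (fun x => x / k)%Z M in
  if (negb (k =? 0)%Z && (0 <? mdet P)%Z && meqb (mscale k P) M)%bool then P else M.

Lemma mprim_spec (m : nat) (M : mat2 Z) (f : C -> C) (z : C) :
  (0 < mdet M)%Z -> 0 < Im z -> slashZ m (mprim M) f z = slashZ m M f z.
Proof.
  intros HM Hz. unfold mprim. destruct andb eqn:E; auto.
  rewrite !Bool.andb_true_iff in E. destruct E as [[E1 E2] E3].
  apply Bool.negb_true_iff, Z.eqb_neq in E1. apply Z.ltb_lt in E2. apply meqb_eq in E3.
  rewrite <- (sl_mscale m _ _ f z E1 E2 Hz). now rewrite E3.
Qed.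

Fixpoint insert_term (c : Z) (M : mat2 Z) (e : mexpr) : mexpr :=
  match e with
  | [] => [(c, M)]
  | (c', M') :: e' => if meqb M M' then (c + c', M')%Z :: e' else (c', M') :: insert_term c M e'
  end.

(** Merging proportional matrices reduces the vanishing of an expression to a test on its
    coefficients. *)
Definition collect (e : mexpr) : mexpr := fold_right (fun t acc => insert_term (fst t) (mprim (snd t)) acc) [] e.
Definition is_zero (e : mexpr) : bool := forallb (fun t => (fst t =? 0)%Z) (collect e).

Lemma ev_ins (m : nat) (f : C -> C) (c : Z) (M : mat2 Z) (e : mexpr) (z : C) :
  expr_eval m f (insert_term c M e) z = (IZR c * slashZ m M f z + expr_eval m f e z)%C.
Proof.
  induction e as [|[c' M'] e IH]; simpl; auto. destruct meqb eqn:E; simpl.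
  - apply meqb_eq in E. subst M'. rewrite plus_IZR, RtoC_plus. ring.
  - rewrite IH. ring.
Qed.

Lemma ev_collect (m : nat) (f : C -> C) (e : mexpr) (z : C) :
  pos_dets e = true -> 0 < Im z -> expr_eval m f (collect e) z = expr_eval m f e z.
Proof.
  intros G Hz. induction e as [|t e IH]; auto. destruct (good_cons t e G) as [H1 H2].
  simpl. rewrite ev_ins, mprim_spec, IH by auto. reflexivity.
Qed.

Lemma is_zero_spec (m : nat) (f : C -> C) (e : mexpr) (z : C) :
  is_zero e = true -> pos_dets e = true -> 0 < Im z -> expr_eval m f e z = 0%C.
Proof.
  intros H G Hz. rewrite <- ev_collect by auto. unfold is_zero in H.
  induction (collect e) as [|t l IH]; auto. simpl in *. apply Bool.andb_true_iff in H. destruct H as [H1 H2].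
  apply Z.eqb_eq in H1. rewrite IH, H1 by auto. ring.
Qed.

(** * Certificate steps and their soundness *)

Definition combo := list (Z * nat * mat2 Z).

(* [SHecke p i] applies T_p to fact i on the left; a combination lists triples (c, i, M)
   standing for c times fact i times M; [SEll e s M l cb] uses e + s e|M = cb to conclude e = 0 when M is elliptic of
   infinite order, as witnessed by the prime l. *)
Inductive step :=
  | SHecke (p i : nat)
  | SLin (e : mexpr) (cb : combo)
  | SEll (e : mexpr) (s : Z) (M : mat2 Z) (l : Z) (cb : combo).

(** The usual p + 1 representatives of T_p, without the scalar factor, which only changes the
    eigenvalue. *)
Definition hecke_mats (p : nat) : list (mat2 Z) :=
  map (fun b => Mat2 1 (Z.of_nat b) 0 (Z.of_nat p))%Z (seq 0 p) ++ [Mat2 (Z.of_nat p) 0 0 1]%Z.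

Definition combine (fs : list mexpr) (cb : combo) : mexpr :=
  flat_map (fun t => smul (fst (fst t)) (rmul (nth (snd (fst t)) fs []) (snd t))) cb.
Definition combo_ok (cb : combo) : bool := forallb (fun t => (0 <? mdet (snd t))%Z) cb.

Definition step_ok (N : nat) (fs : list mexpr) (st : step) : option mexpr :=
  match st with
  | SHecke p i =>
      if ((p =? 2)%nat || (p =? 3)%nat) && negb (N mod p =? 0)%nat
      then Some (lmul (hecke_mats p) (nth i fs [])) else None
  | SLin e cb =>
      if pos_dets e && combo_ok cb && is_zero (e ++ smul (-1) (combine fs cb)) then Some e else None
  | SEll e s M l cb =>
      (* tr^2 < 4 det makes M elliptic, and a prime l dividing det but not tr excludes finite order
         ([eigen_ratio]). Restricting l to 2 and 3 replaces a primality test. *)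
      if pos_dets e && combo_ok cb && (s * s =? 1)%Z && (0 <? mdet M)%Z && (mtr M * mtr M <? 4 * mdet M)%Z
        && ((l =? 2)%Z || (l =? 3)%Z) && (mdet M mod l =? 0)%Z && negb (mtr M mod l =? 0)%Z
        && is_zero (e ++ smul s (rmul e M) ++ smul (-1) (combine fs cb))
      then Some e else None
  end.

Fixpoint run (N : nat) (sts : list step) (fs : list mexpr) : option (list mexpr) :=
  match sts with
  | [] => Some fs
  | st :: sts' => match step_ok N fs st with Some e => run N sts' (fs ++ [e]) | None => None end
  end.

Section Soundness.

Variables (m N : nat) (f : C -> C).
Hypothesis Hm : (1 <= m)%nat.
Hypothesis Hf : holoH f.
Hypothesis HT : forall p, (p = 2 \/ p = 3)%nat -> (N mod p <> 0)%nat -> exists lam : C,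
  forall z, 0 < Im z -> expr_eval m f (map (fun M => (1%Z, M)) (hecke_mats p)) z = (lam * f z)%C.

Lemma Null_nil : Null m f [].
Proof. split; auto. Qed.

(** An index out of range denotes the empty expression, which annihilates f, so certificates need no
    bounds check. *)
Lemma Null_nth (fs : list mexpr) (i : nat) : List.Forall (Null m f) fs -> Null m f (nth i fs []).
Proof.
  intros H. revert i. induction H; intros [|i]; simpl; auto using Null_nil.
Qed.

Lemma Null_combine (fs : list mexpr) (cb : combo) : List.Forall (Null m f) fs -> combo_ok cb = true ->
  Null m f (combine fs cb).
Proof.
  intros H. induction cb as [|t cb IH]; intros Hc; [apply Null_nil|].
  simpl in Hc. apply Bool.andb_true_iff in Hc. destruct Hc as [H1 H2]. apply Z.ltb_lt in H1.
  simpl. apply Null_app; auto. apply Null_smul, Null_rmul; auto. now apply Null_nth.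
Qed.

Lemma step_ok_spec (fs : list mexpr) (st : step) (e : mexpr) : List.Forall (Null m f) fs ->
  step_ok N fs st = Some e -> Null m f e.
Proof.
  intros H. destruct st as [p i|e' cb|e' s M l cb]; simpl; destruct andb eqn:E; try discriminate;
    intros X; injection X; intros <-; clear X; rewrite !Bool.andb_true_iff in E.
  - destruct E as [E1 E2]. apply Bool.orb_true_iff in E1. rewrite !Nat.eqb_eq in E1.
    apply Bool.negb_true_iff, Nat.eqb_neq in E2. destruct (HT p E1 E2) as [lam HL].
    apply (Null_lmul m f _ lam); auto; [|now apply Null_nth].
    destruct E1; subst p; reflexivity.
  - destruct E as [[E1 E2] E3]. split; auto. intros z Hz.
    destruct (Null_combine fs cb H E2) as [G1 G2].
    assert (Z := is_zero_spec m f _ z E3). rewrite good_app, good_smul, E1, G1 in Z.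
    specialize (Z eq_refl Hz). rewrite ev_app, ev_smul, G2 in Z by auto. rewrite <- Z. ring.
  - destruct E as [[[[[[[[E1 E2] E3] E4] E5] E6] E7] E8] E9]. split; auto.
    apply Z.eqb_eq in E3, E7. apply Z.ltb_lt in E4, E5. apply Bool.orb_true_iff in E6.
    rewrite !Z.eqb_eq in E6. apply Bool.negb_true_iff, Z.eqb_neq in E8.
    destruct (Null_combine fs cb H E2) as [G1 G2].
    assert (S1 : (IZR s * IZR s = 1)%C) by (rewrite <- RtoC_mult, <- mult_IZR, E3; reflexivity).
    assert (Pl : prime l) by (destruct E6; subst l; [apply prime_2|apply prime_3]).
    assert (L0 : l <> 0%Z) by (destruct E6; lia).
    (* As s^2 = 1, the relation e + s e|M = 0 reads e|M = - s e. *)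
    apply (elliptic_zero m M l (expr_eval m f e') (- IZR s)%C Hm E4 E5 Pl).
    + now apply Z.mod_divide.
    + intros D. now apply E8, Z.mod_divide.
    + rewrite <- S1. ring.
    + now apply ev_holo.
    + intros z Hz. assert (Z := is_zero_spec m f _ z E9).
      rewrite !good_app, !good_smul, E1, G1, good_rmul in Z by auto. specialize (Z eq_refl Hz).
      rewrite !ev_app, !ev_smul, G2, ev_rmul in Z by auto. unfold slashZ.
      transitivity (IZR s * IZR s * (jac M z ^ m * expr_eval m f e' (act M z)))%C; [rewrite S1; ring|].
      transitivity (IZR s * ((expr_eval m f e' z + (IZR s * (jac M z ^ m * expr_eval m f e' (act M z)) + IZR (-1) * 0)) - expr_eval m f e' z))%C; [ring|].
      rewrite Z. ring.
Qed.

Lemma run_spec (sts : list step) (fs fs' : list mexpr) : List.Forall (Null m f) fs ->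
  run N sts fs = Some fs' -> List.Forall (Null m f) fs'.
Proof.
  revert fs. induction sts as [|st sts IH]; simpl; intros fs H E.
  - injection E; intros <-; auto.
  - destruct (step_ok N fs st) as [e|] eqn:Q; [|discriminate]. apply (IH (fs ++ [e])); auto.
    apply Forall_app. split; auto. constructor; auto. eapply (step_ok_spec fs st); eauto.
Qed.

End Soundness.

Open Scope R_scope.

Open Scope Z_scope.

(** * Generators and certificates for the thirteen levels *)

Definition mx (a b c d : Z) : mat2 Z := Mat2 a b c d.

Definition rt (c : Z) (i : nat) (x y z t : Z) : Z * nat * mat2 Z := (c, i, Mat2 x y z t).

(* Together with T and -1 these generate Gamma_0(N), see [Gamma0_invariant]. *)
Definition gens (N : nat) : list (mat2 Z) :=
  match N with
  | 5%nat => [mx 1 0 5 1; mx 2 1 5 3; mx 3 1 5 2; mx 4 3 5 4]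
  | 6%nat => [mx 1 0 6 1; mx 5 2 12 5; mx 7 4 12 7; mx 5 4 6 5]
  | 7%nat => [mx 1 0 7 1; mx 2 1 7 4; mx 3 2 7 5; mx 4 1 7 2; mx 5 2 7 3; mx 6 5 7 6]
  | 8%nat => [mx 1 0 8 1; mx 3 1 8 3; mx 5 3 8 5; mx 7 6 8 7]
  | 9%nat => [mx 1 0 9 1; mx 2 1 9 5; mx 4 3 9 7; mx 5 1 9 2; mx 7 3 9 4; mx 8 7 9 8]
  | 10%nat => [mx 1 0 10 1; mx 3 2 10 7; mx 9 4 20 9; mx 11 6 20 11; mx 7 2 10 3; mx 9 8 10 9]
  | 11%nat => [mx 1 0 11 1; mx 2 1 11 6; mx 3 1 11 4; mx 4 1 11 3; mx 5 4 11 9; mx 6 1 11 2;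
      mx 7 5 11 8; mx 8 5 11 7; mx 9 4 11 5; mx 10 9 11 10]
  | 12%nat => [mx 1 0 12 1; mx 5 1 24 5; mx 7 2 24 7; mx 5 2 12 5; mx 7 4 12 7; mx 17 12 24 17;
      mx 19 15 24 19; mx 11 10 12 11]
  | 14%nat => [mx 1 0 14 1; mx 3 1 14 5; mx 5 1 14 3; mx 13 6 28 13; mx 15 8 28 15; mx 9 7 14 11;
      mx 11 7 14 9; mx 13 12 14 13]
  | 15%nat => [mx 1 0 15 1; mx 2 1 15 8; mx 4 1 15 4; mx 11 4 30 11; mx 7 6 15 13; mx 8 1 15 2;
      mx 19 12 30 19; mx 11 8 15 11; mx 13 6 15 7; mx 14 13 15 14]
  | 16%nat => [mx 1 0 16 1; mx 3 2 16 11; mx 5 4 16 13; mx 7 3 16 7; mx 9 5 16 9; mx 11 2 16 3;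
      mx 13 4 16 5; mx 15 14 16 15]
  | 17%nat => [mx 1 0 17 1; mx 2 1 17 9; mx 3 1 17 6; mx 4 3 17 13; mx 5 2 17 7; mx 6 1 17 3;
      mx 7 2 17 5; mx 8 7 17 15; mx 9 1 17 2; mx 10 7 17 12; mx 11 9 17 14; mx 12 7 17 10;
      mx 13 3 17 4; mx 14 9 17 11; mx 15 7 17 8; mx 16 15 17 16]
  | 23%nat => [mx 1 0 23 1; mx 2 1 23 12; mx 3 1 23 8; mx 4 1 23 6; mx 5 3 23 14; mx 6 1 23 4;
      mx 7 3 23 10; mx 8 1 23 3; mx 9 7 23 18; mx 10 3 23 7; mx 11 10 23 21; mx 12 1 23 2;
      mx 13 9 23 16; mx 14 3 23 5; mx 15 13 23 20; mx 16 9 23 13; mx 17 14 23 19; mx 18 7 23 9;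
      mx 19 14 23 17; mx 20 13 23 15; mx 21 10 23 11; mx 22 21 23 22]
  | _ => []
  end.

Definition inv_expr (g : mat2 Z) : mexpr := [(1, mx 1 0 0 1); (-1, g)].

(* Periodicity, the Fricke involution, and for even N the action of U_2. *)
Definition facts0 (N : nat) (w : Z) : list mexpr :=
  [inv_expr (mx 1 1 0 1); [(1, mx 0 (-1) (Z.of_nat N) 0); (- w, mx 1 0 0 1)]] ++
  (if (N mod 4 =? 0)%nat then [[(1, mx 1 0 0 1); (1, mx 2 1 0 2)]]
   else if (N mod 2 =? 0)%nat then [[(1, mx 1 0 0 2); (1, mx 1 1 0 2); (-1, mx 1 0 0 1)]]
   else []).

(* The certificates were found by a computer search; [levels_checked] verifies them. *)
Definition cert5 (w : Z) : list step :=
  (* Facts are numbered from [facts0] on, so at odd level this is fact 2. It is T conjugated by H,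
     and the next step is its inverse; every certificate begins with these two. *)
  [SLin (inv_expr (mx 1 0 (-5) 1)) [rt w 0 0 1 (-5) 0; rt 1 1 0 1 (-5) 0; rt (-1) 1 5 (-1) 5 0];
   SLin (inv_expr (mx 1 0 5 1)) [rt (-1) 2 1 0 5 1];
   SHecke 2 1;
   (* T_2 (H - w) has just been added. H exchanges the cosets (1 0; 0 2) and (2 0; 0 1), so only (1
      1; 0 2) is left, and for odd N this gives invariance under ((N + 1)/2 1; N 2). *)
   SLin (inv_expr (mx 3 1 5 2)) [rt (-1) 4 5 2 (-5) 0; rt 1 1 5 2 (-10) 0; rt 1 1 0 1 (-5) 0;
     rt 1 1 10 4 (-5) 0];
   SHecke 3 1;
   (* For T_3 two inner cosets remain, (1 1; 0 3) and (1 2; 0 3), hence two differences; here the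
      combination also draws on the earlier fact 5. *)
   SLin (inv_expr (mx 2 1 5 3)) [rt 1 0 7 3 (-10) (-3); rt (-1) 3 3 0 (-5) 3; rt (-1) 5 7 3 (-10) (-3);
     rt (-1) 6 5 3 (-5) 0; rt 1 1 5 3 (-15) 0; rt 1 1 0 1 (-5) 0; rt 1 1 5 (-3) 15 0;
     rt 1 1 15 9 (-5) 0];
   SLin (inv_expr (mx 4 3 5 4)) [rt (-1) 3 1 1 (-5) (-4); rt 1 0 1 0 0 1; rt 1 0 1 1 (-5) (-4)]].

Definition cert6 (w : Z) : list step :=
  [SLin (inv_expr (mx 1 0 (-6) 1)) [rt w 0 0 1 (-6) 0; rt 1 1 0 1 (-6) 0; rt (-1) 1 6 (-1) 6 0];
   SLin (inv_expr (mx 1 0 6 1)) [rt (-1) 3 1 0 6 1];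
   (* The Atkin-Lehner involution (4 1; 6 2) of determinant 2 acts by -1, in accordance with a_2 =
      2^(k/2 - 1). The same step occurs at levels 10 and 14. *)
   SLin [(1, mx 1 0 0 1); (1, mx 4 1 6 2)] [rt 1 2 1 0 3 1; rt w 2 3 1 (-3) 0; rt 1 1 3 1 (-6) 0;
     rt 1 1 0 1 (-6) 0; rt (-1) 1 3 1 (-3) 0];
   SLin (inv_expr (mx 5 4 6 5)) [rt (-1) 4 1 1 (-6) (-5); rt 1 0 1 0 0 1; rt 1 0 1 1 (-6) (-5)];
   SLin (inv_expr (mx 5 2 12 5)) [rt 1 0 1 0 0 1; rt 1 0 8 3 (-6) (-2); rt 1 0 2 1 (-18) (-8);
     rt (-1) 6 8 3 (-6) (-2); rt (-1) 5 2 1 (-18) (-8); rt 1 5 2 1 (-6) (-2)];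
   SLin (inv_expr (mx 7 4 12 7)) [rt (-1) 7 5 3 (-12) (-7); rt 1 0 1 0 0 1; rt 1 0 5 3 (-12) (-7)]].

Definition cert7 (w : Z) : list step :=
  [SLin (inv_expr (mx 1 0 (-7) 1)) [rt w 0 0 1 (-7) 0; rt 1 1 0 1 (-7) 0; rt (-1) 1 7 (-1) 7 0];
   SLin (inv_expr (mx 1 0 7 1)) [rt (-1) 2 1 0 7 1];
   SHecke 2 1;
   SLin (inv_expr (mx 4 1 7 2)) [rt (-1) 4 7 2 (-7) 0; rt 1 1 7 2 (-14) 0; rt 1 1 0 1 (-7) 0;
     rt 1 1 14 4 (-7) 0];
   SLin (inv_expr (mx 6 5 7 6)) [rt (-1) 3 1 1 (-7) (-6); rt 1 0 1 0 0 1; rt 1 0 1 1 (-7) (-6)];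
   SLin (inv_expr (mx 3 2 7 5)) [rt (-1) 0 1 1 (-7) (-6); rt 1 6 1 0 0 1; rt 1 5 1 1 (-7) (-6)];
   SLin (inv_expr (mx 5 2 7 3)) [rt (-1) 0 3 1 (-7) (-2); rt 1 7 6 1 (-7) (-1); rt 1 5 3 1 (-7) (-2);
     rt 1 0 1 0 0 1; rt (-1) 6 6 1 (-7) (-1)];
   SHecke 3 1;
   SLin (inv_expr (mx 2 1 7 4)) [rt (-1) 8 3 3 (-14) (-11); rt 1 0 1 0 0 1; rt (-1) 3 1 1 (-7) (-6);
     rt (-1) 9 7 4 7 7; rt 1 1 7 4 21 21; rt 1 1 14 11 21 21; rt 1 1 7 6 7 7; rt 1 1 21 12 7 7]].

Definition cert8 (w : Z) : list step :=
  [SLin (inv_expr (mx 1 0 (-8) 1)) [rt w 0 0 1 (-8) 0; rt 1 1 0 1 (-8) 0; rt (-1) 1 8 (-1) 8 0];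
   SLin (inv_expr (mx 1 0 8 1)) [rt (-1) 3 1 0 8 1];
   (* For 4 | N fact 2 says f(z + 1/2) = - f(z), and conjugation by H gives this companion, fact 5.
      The remaining generators are words of even length in the two, so the signs cancel; likewise at
      levels 12 and 16. *)
   SLin [(1, mx 1 0 0 1); (1, mx 1 0 (-4) 1)] [rt w 2 0 1 (-8) 0; rt 1 1 0 1 (-8) 0; rt 1 1 4 (-1) 8 0];
   SLin (inv_expr (mx 3 1 8 3)) [rt (-1) 2 2 1 (-16) (-6); rt 1 5 2 1 (-8) (-2); rt (-1) 5 2 1 0 2;
     rt 1 2 1 0 0 1];
   SLin (inv_expr (mx 5 3 8 5)) [rt (-1) 2 2 1 16 10; rt 1 5 2 1 16 10; rt (-1) 5 2 1 8 6;
     rt 1 2 1 0 0 1];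
   SLin (inv_expr (mx 7 6 8 7)) [rt (-1) 2 6 5 16 14; rt 1 2 1 1 (-8) (-7); rt (-1) 5 1 1 (-4) (-3);
     rt 1 5 1 1 0 1; rt (-1) 2 2 1 0 2; rt 1 2 1 0 0 1]].

Definition cert9 (w : Z) : list step :=
  [SLin (inv_expr (mx 1 0 (-9) 1)) [rt w 0 0 1 (-9) 0; rt 1 1 0 1 (-9) 0; rt (-1) 1 9 (-1) 9 0];
   SLin (inv_expr (mx 1 0 9 1)) [rt (-1) 2 1 0 9 1];
   SHecke 2 1;
   SLin (inv_expr (mx 5 1 9 2)) [rt (-1) 4 9 2 (-9) 0; rt 1 1 9 2 (-18) 0; rt 1 1 0 1 (-9) 0;
     rt 1 1 18 4 (-9) 0];
   SLin (inv_expr (mx 8 7 9 8)) [rt (-1) 3 1 1 (-9) (-8); rt 1 0 1 0 0 1; rt 1 0 1 1 (-9) (-8)];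
   SLin (inv_expr (mx 4 3 9 7)) [rt (-1) 0 1 1 (-9) (-8); rt 1 6 1 0 0 1; rt 1 5 1 1 (-9) (-8)];
   SLin (inv_expr (mx 2 1 9 5)) [rt 1 0 7 4 (-9) (-5); rt 1 0 1 0 0 1; rt (-1) 7 7 4 (-9) (-5)];
   SLin (inv_expr (mx 7 3 9 4)) [rt 1 6 7 4 (-9) (-5); rt 1 0 1 0 0 1; rt (-1) 7 7 4 (-9) (-5)]].

Definition cert10 (w : Z) : list step :=
  [SLin (inv_expr (mx 1 0 (-10) 1)) [rt w 0 0 1 (-10) 0; rt 1 1 0 1 (-10) 0; rt (-1) 1 10 (-1) 10 0];
   SLin (inv_expr (mx 1 0 10 1)) [rt (-1) 3 1 0 10 1];
   SLin [(1, mx 1 0 0 1); (1, mx 6 1 10 2)] [rt 1 2 1 0 5 1; rt w 2 5 1 (-5) 0; rt 1 1 5 1 (-10) 0;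
     rt 1 1 0 1 (-10) 0; rt (-1) 1 5 1 (-5) 0];
   SLin (inv_expr (mx 9 8 10 9)) [rt (-1) 4 1 1 (-10) (-9); rt 1 0 1 0 0 1; rt 1 0 1 1 (-10) (-9)];
   SLin (inv_expr (mx 9 4 20 9)) [rt 1 0 1 0 0 1; rt 1 0 12 5 (-10) (-4); rt 1 0 2 1 (-30) (-14);
     rt (-1) 6 12 5 (-10) (-4); rt (-1) 5 2 1 (-30) (-14); rt 1 5 2 1 (-10) (-4)];
   SLin (inv_expr (mx 11 6 20 11)) [rt (-1) 7 9 5 (-20) (-11); rt 1 0 1 0 0 1; rt 1 0 9 5 (-20) (-11)];
   SHecke 3 1;
   (* What T_3 provides, modulo known facts, is 1 - g plus its translate by M. As M has trace 4 and
      determinant 18, it is elliptic, and l = 3 shows that its order is infinite. *)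
   SEll (inv_expr (mx 3 2 10 7)) 1 (mx 8 5 (-10) (-4)) 3 [rt (-1) 0 13 25 (-30) (-57);
     rt (-1) 0 7 10 (-10) (-13); rt 1 7 13 25 (-30) (-57); rt (-1) 0 3 3 (-20) (-17);
     rt 1 6 7 10 (-10) (-13); rt 1 0 1 0 0 1; rt (-1) 4 1 1 (-10) (-9); rt (-1) 9 10 7 10 10;
     rt 1 1 10 7 30 30; rt 1 1 20 17 30 30; rt 1 1 10 9 10 10; rt 1 1 30 21 10 10;
     rt 1 5 8 5 (-10) (-4); rt (-1) 5 4 7 10 22];
   SLin (inv_expr (mx 7 2 10 3)) [rt 1 0 17 3 (-20) (-3); rt (-1) 4 3 0 (-10) 3;
     rt (-1) 10 17 3 (-20) (-3); rt (-1) 9 10 3 (-10) 0; rt 1 1 10 3 (-30) 0; rt 1 1 0 1 (-10) 0;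
     rt 1 1 10 (-3) 30 0; rt 1 1 30 9 (-10) 0]].

Definition cert11 (w : Z) : list step :=
  [SLin (inv_expr (mx 1 0 (-11) 1)) [rt w 0 0 1 (-11) 0; rt 1 1 0 1 (-11) 0; rt (-1) 1 11 (-1) 11 0];
   SLin (inv_expr (mx 1 0 11 1)) [rt (-1) 2 1 0 11 1];
   SHecke 2 1;
   SLin (inv_expr (mx 6 1 11 2)) [rt (-1) 4 11 2 (-11) 0; rt 1 1 11 2 (-22) 0; rt 1 1 0 1 (-11) 0;
     rt 1 1 22 4 (-11) 0];
   SLin (inv_expr (mx 10 9 11 10)) [rt (-1) 3 1 1 (-11) (-10); rt 1 0 1 0 0 1; rt 1 0 1 1 (-11) (-10)];
   SLin (inv_expr (mx 5 4 11 9)) [rt (-1) 0 1 1 (-11) (-10); rt 1 6 1 0 0 1; rt 1 5 1 1 (-11) (-10)];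
   SLin (inv_expr (mx 2 1 11 6)) [rt 1 0 9 5 (-11) (-6); rt 1 0 1 0 0 1; rt (-1) 7 9 5 (-11) (-6)];
   SLin (inv_expr (mx 9 4 11 5)) [rt 1 6 9 5 (-11) (-6); rt 1 0 1 0 0 1; rt (-1) 7 9 5 (-11) (-6)];
   SHecke 3 1;
   (* M has trace 1 and determinant 9. *)
   SEll (inv_expr (mx 7 5 11 8)) (-1) (mx 43 33 (-55) (-42)) 3 [rt 1 7 1 0 0 1; rt 1 0 4 3 (-11) (-8);
     rt (-1) 0 43 33 (-55) (-42); rt 1 3 12 9 (-77) (-57); rt 1 10 11 9 (-44) (-33);
     rt (-1) 1 11 9 (-132) (-99); rt (-1) 1 11 8 44 33; rt (-1) 1 77 57 132 99;
     rt (-1) 1 33 27 (-44) (-33)];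
   SLin (inv_expr (mx 3 1 11 4)) [rt 1 0 1 0 0 1; rt (-1) 7 9 5 (-11) (-6); rt (-1) 0 2 1 (-11) (-5);
     rt 1 6 9 5 (-11) (-6); rt 1 0 5 4 (-11) (-7); rt (-1) 3 6 3 (-55) (-26); rt (-1) 11 5 4 (-11) (-7);
     rt (-1) 10 11 4 22 11; rt 1 1 11 4 66 33; rt 1 1 11 5 22 11; rt 1 1 55 26 66 33;
     rt 1 1 33 12 22 11];
   SLin (inv_expr (mx 8 5 11 7)) [rt 1 11 9 5 (-11) (-6); rt 1 0 1 0 0 1; rt (-1) 7 9 5 (-11) (-6)];
   SLin (inv_expr (mx 4 1 11 3)) [rt 1 0 19 3 (-22) (-3); rt (-1) 3 3 0 (-11) 3;
     rt (-1) 11 19 3 (-22) (-3); rt (-1) 10 11 3 (-11) 0; rt 1 1 11 3 (-33) 0; rt 1 1 0 1 (-11) 0;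
     rt 1 1 11 (-3) 33 0; rt 1 1 33 9 (-11) 0]].

Definition cert12 (w : Z) : list step :=
  [SLin (inv_expr (mx 1 0 (-12) 1)) [rt w 0 0 1 (-12) 0; rt 1 1 0 1 (-12) 0; rt (-1) 1 12 (-1) 12 0];
   SLin (inv_expr (mx 1 0 12 1)) [rt (-1) 3 1 0 12 1];
   SLin [(1, mx 1 0 0 1); (1, mx 1 0 (-6) 1)] [rt w 2 0 1 (-12) 0; rt 1 1 0 1 (-12) 0;
     rt 1 1 6 (-1) 12 0];
   SLin (inv_expr (mx 5 2 12 5)) [rt (-1) 2 2 1 (-24) (-10); rt 1 5 2 1 (-12) (-4); rt (-1) 5 2 1 0 2;
     rt 1 2 1 0 0 1];
   SLin (inv_expr (mx 7 4 12 7)) [rt (-1) 2 2 1 24 14; rt 1 5 2 1 24 14; rt (-1) 5 2 1 12 8;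
     rt 1 2 1 0 0 1];
   SLin (inv_expr (mx 11 10 12 11)) [rt (-1) 2 10 9 24 22; rt 1 2 1 1 (-12) (-11);
     rt (-1) 5 1 1 (-6) (-5); rt 1 5 1 1 0 1; rt (-1) 2 2 1 0 2; rt 1 2 1 0 0 1];
   SLin (inv_expr (mx 5 1 24 5)) [rt (-1) 5 5 1 24 5; rt 1 2 5 1 (-6) (-1); rt (-1) 2 4 1 (-12) (-2);
     rt 1 5 1 0 6 1];
   SLin (inv_expr (mx 7 2 24 7)) [rt (-1) 2 10 3 (-48) (-14); rt 1 5 10 3 12 4; rt (-1) 2 4 1 12 4;
     rt 1 2 2 1 (-12) (-4); rt (-1) 5 2 1 0 2; rt 1 2 1 0 0 1];
   SLin (inv_expr (mx 17 12 24 17)) [rt (-1) 2 10 7 48 34; rt 1 5 10 7 48 34; rt (-1) 2 10 7 (-12) (-8);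
     rt 1 2 4 3 (-12) (-8); rt (-1) 5 2 1 12 8; rt 1 2 1 0 0 1];
   SLin (inv_expr (mx 19 15 24 19)) [rt (-1) 2 14 11 48 38; rt 1 2 5 4 (-24) (-19); rt (-1) 5 5 4 6 5;
     rt 1 2 4 3 12 10; rt (-1) 2 1 1 (-6) (-5); rt 1 5 1 1 0 1; rt (-1) 2 2 1 0 2; rt 1 2 1 0 0 1]].

Definition cert14 (w : Z) : list step :=
  [SLin (inv_expr (mx 1 0 (-14) 1)) [rt w 0 0 1 (-14) 0; rt 1 1 0 1 (-14) 0; rt (-1) 1 14 (-1) 14 0];
   SLin (inv_expr (mx 1 0 14 1)) [rt (-1) 3 1 0 14 1];
   SLin [(1, mx 1 0 0 1); (1, mx 8 1 14 2)] [rt 1 2 1 0 7 1; rt w 2 7 1 (-7) 0; rt 1 1 7 1 (-14) 0;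
     rt 1 1 0 1 (-14) 0; rt (-1) 1 7 1 (-7) 0];
   SLin (inv_expr (mx 13 12 14 13)) [rt (-1) 4 1 1 (-14) (-13); rt 1 0 1 0 0 1; rt 1 0 1 1 (-14) (-13)];
   SLin (inv_expr (mx 13 6 28 13)) [rt 1 0 1 0 0 1; rt 1 0 16 7 (-14) (-6); rt 1 0 2 1 (-42) (-20);
     rt (-1) 6 16 7 (-14) (-6); rt (-1) 5 2 1 (-42) (-20); rt 1 5 2 1 (-14) (-6)];
   SLin (inv_expr (mx 15 8 28 15)) [rt (-1) 7 13 7 (-28) (-15); rt 1 0 1 0 0 1; rt 1 0 13 7 (-28) (-15)];
   SHecke 3 1;
   (* M has trace 56 and determinant 1134 = 2 3^4 7; the sign of the relation is the Fricke
      eigenvalue [w]. *)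
   SEll (inv_expr (mx 11 7 14 9)) w (mx 728 467 (-1050) (-672)) 3 [rt 1 0 13 7 (-28) (-15);
     rt 1 0 1 0 0 1; rt (-1) 7 13 7 (-28) (-15); rt (-1) 5 8 5 (-42) (-26); rt 1 5 2 1 14 8;
     rt (-1) 0 276 177 (-602) (-386); rt 1 7 276 177 (-602) (-386); rt (-1) 4 24 15 (-238) (-148);
     rt (-1) 9 7 4 56 35; rt 1 1 7 4 168 105; rt 1 1 21 13 56 35; rt 1 1 119 74 168 105;
     rt 1 1 21 12 56 35; rt 1 5 1 1 (-28) (-19); rt (-1) 5 25 16 126 81; rt w 0 126 81 (-350) (-224);
     rt w 4 28 19 (-378) (-252); rt w 9 25 16 28 19; rt (-w) 1 25 16 84 57; rt (-w) 1 53 35 84 57;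
     rt (-w) 1 27 18 28 19; rt (-w) 1 75 48 28 19; rt w 0 728 467 (-1050) (-672);
     rt w 0 84 57 (-742) (-490); rt 1 1 126 81 (-350) (-224); rt (-1) 1 28 19 14 14];
   SLin (inv_expr (mx 3 1 14 5)) [rt 1 0 1 0 0 1; rt 1 4 3 1 (-28) (-9); rt 1 9 0 1 (-42) (-14);
     rt (-1) 1 0 1 (-126) (-42); rt (-1) 1 42 13 126 42; rt (-1) 1 28 9 42 14;
     rt (-1) 1 0 3 (-42) (-14); rt 1 0 3 (-1) 0 3; rt 1 0 9 3 (-42) (-13); rt (-1) 10 3 (-1) 0 3];
   SLin (inv_expr (mx 5 1 14 3)) [rt 1 0 9 2 (-14) (-3); rt 1 0 1 0 0 1; rt (-1) 10 9 2 (-14) (-3)];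
   SLin (inv_expr (mx 9 7 14 11)) [rt 1 0 1 0 0 1; rt (-1) 4 1 1 (-14) (-13); rt (-1) 9 14 11 14 14;
     rt 1 1 14 11 42 42; rt 1 1 28 25 42 42; rt 1 1 14 13 14 14; rt 1 1 42 33 14 14;
     rt (-1) 0 29 23 (-42) (-33); rt (-1) 0 3 3 (-28) (-25); rt 1 10 29 23 (-42) (-33)]].

Definition cert15 (w : Z) : list step :=
  [SLin (inv_expr (mx 1 0 (-15) 1)) [rt w 0 0 1 (-15) 0; rt 1 1 0 1 (-15) 0; rt (-1) 1 15 (-1) 15 0];
   SLin (inv_expr (mx 1 0 15 1)) [rt (-1) 2 1 0 15 1];
   SHecke 2 1;
   SLin (inv_expr (mx 8 1 15 2)) [rt (-1) 4 15 2 (-15) 0; rt 1 1 15 2 (-30) 0; rt 1 1 0 1 (-15) 0;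
     rt 1 1 30 4 (-15) 0];
   SLin (inv_expr (mx 14 13 15 14)) [rt (-1) 3 1 1 (-15) (-14); rt 1 0 1 0 0 1; rt 1 0 1 1 (-15) (-14)];
   SLin (inv_expr (mx 7 6 15 13)) [rt (-1) 0 1 1 (-15) (-14); rt 1 6 1 0 0 1; rt 1 5 1 1 (-15) (-14)];
   SLin (inv_expr (mx 2 1 15 8)) [rt 1 0 13 7 (-15) (-8); rt 1 0 1 0 0 1; rt (-1) 7 13 7 (-15) (-8)];
   SLin (inv_expr (mx 13 6 15 7)) [rt 1 6 13 7 (-15) (-8); rt 1 0 1 0 0 1; rt (-1) 7 13 7 (-15) (-8)];
   SLin (inv_expr (mx 2 1 15 8)) [rt 1 0 13 7 (-15) (-8); rt 1 0 1 0 0 1; rt (-1) 7 13 7 (-15) (-8)];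
   (* T_2 is applied to the invariance under (2 1; 15 8) in place of the Fricke relation. This feeds
      the elliptic step below, where M has trace -1 and determinant 4. *)
   SHecke 2 10;
   SEll (inv_expr (mx 11 8 15 11)) (-1) (mx 22 17 (-30) (-23)) 2 [rt (-1) 0 56 43 (-60) (-46);
     rt (-1) 0 4 2 0 1; rt (-1) 0 4 3 0 1; rt 1 6 56 43 (-60) (-46); rt (-1) 0 13 10 (-30) (-23);
     rt 1 9 13 10 (-30) (-23); rt 1 0 1 0 0 1; rt (-1) 0 22 17 (-30) (-23); rt (-1) 0 2 1 0 2;
     rt 1 11 2 1 0 1];
   SLin (inv_expr (mx 4 1 15 4)) [rt 1 0 11 3 (-15) (-4); rt 1 0 1 0 0 1; rt (-1) 12 11 3 (-15) (-4)];
   SHecke 2 13;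
   SLin (inv_expr (mx 11 4 30 11)) [rt 1 0 2 (-1) 0 2; rt 1 0 16 6 (-30) (-11); rt (-1) 7 2 (-1) 0 2;
     rt 1 0 1 0 0 1; rt 1 0 4 1 0 1; rt 1 0 8 3 (-60) (-22); rt (-1) 9 4 1 0 1;
     rt (-1) 14 8 3 (-30) (-11)];
   SLin (inv_expr (mx 19 12 30 19)) [rt (-1) 15 11 7 (-30) (-19); rt 1 0 1 0 0 1;
     rt 1 0 11 7 (-30) (-19)]].

Definition cert16 (w : Z) : list step :=
  [SLin (inv_expr (mx 1 0 (-16) 1)) [rt w 0 0 1 (-16) 0; rt 1 1 0 1 (-16) 0; rt (-1) 1 16 (-1) 16 0];
   SLin (inv_expr (mx 1 0 16 1)) [rt (-1) 3 1 0 16 1];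
   SLin [(1, mx 1 0 0 1); (1, mx 1 0 (-8) 1)] [rt w 2 0 1 (-16) 0; rt 1 1 0 1 (-16) 0;
     rt 1 1 8 (-1) 16 0];
   SLin (inv_expr (mx 3 2 16 11)) [rt (-1) 5 3 2 16 11; rt 1 2 3 2 (-8) (-5); rt (-1) 5 2 1 16 10;
     rt 1 2 1 0 0 1];
   SLin (inv_expr (mx 5 4 16 13)) [rt (-1) 2 6 5 (-32) (-26); rt 1 5 6 5 16 14; rt (-1) 2 1 1 (-8) (-7);
     rt 1 5 1 1 0 1; rt (-1) 2 2 1 0 2; rt 1 2 1 0 0 1];
   SLin (inv_expr (mx 7 3 16 7)) [rt (-1) 2 2 1 (-32) (-14); rt 1 5 2 1 (-16) (-6); rt (-1) 5 2 1 0 2;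
     rt 1 2 1 0 0 1];
   SLin (inv_expr (mx 9 5 16 9)) [rt (-1) 2 2 1 32 18; rt 1 5 2 1 32 18; rt (-1) 5 2 1 16 10;
     rt 1 2 1 0 0 1];
   SLin (inv_expr (mx 11 2 16 3)) [rt (-1) 2 6 1 32 6; rt 1 5 6 1 32 6; rt (-1) 2 6 1 (-16) (-2);
     rt 1 5 1 0 8 1];
   SLin (inv_expr (mx 13 4 16 5)) [rt (-1) 2 10 3 32 10; rt 1 2 3 1 (-16) (-5); rt (-1) 5 3 1 8 3;
     rt 1 2 2 1 (-16) (-6); rt (-1) 5 2 1 0 2; rt 1 2 1 0 0 1];
   SLin (inv_expr (mx 15 14 16 15)) [rt (-1) 2 14 13 32 30; rt 1 2 1 1 (-16) (-15);
     rt (-1) 5 1 1 (-8) (-7); rt 1 5 1 1 0 1; rt (-1) 2 2 1 0 2; rt 1 2 1 0 0 1]].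

Definition cert17 (w : Z) : list step :=
  [SLin (inv_expr (mx 1 0 (-17) 1)) [rt w 0 0 1 (-17) 0; rt 1 1 0 1 (-17) 0; rt (-1) 1 17 (-1) 17 0];
   SLin (inv_expr (mx 1 0 17 1)) [rt (-1) 2 1 0 17 1];
   SHecke 2 1;
   SLin (inv_expr (mx 9 1 17 2)) [rt (-1) 4 17 2 (-17) 0; rt 1 1 17 2 (-34) 0; rt 1 1 0 1 (-17) 0;
     rt 1 1 34 4 (-17) 0];
   SLin (inv_expr (mx 16 15 17 16)) [rt (-1) 3 1 1 (-17) (-16); rt 1 0 1 0 0 1; rt 1 0 1 1 (-17) (-16)];
   SLin (inv_expr (mx 8 7 17 15)) [rt (-1) 0 1 1 (-17) (-16); rt 1 6 1 0 0 1; rt 1 5 1 1 (-17) (-16)];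
   SLin (inv_expr (mx 2 1 17 9)) [rt 1 0 15 8 (-17) (-9); rt 1 0 1 0 0 1; rt (-1) 7 15 8 (-17) (-9)];
   SLin (inv_expr (mx 15 7 17 8)) [rt 1 6 15 8 (-17) (-9); rt 1 0 1 0 0 1; rt (-1) 7 15 8 (-17) (-9)];
   SHecke 3 1;
   SLin (inv_expr (mx 9 1 17 2)) [rt 1 0 8 1 (-17) (-2); rt 1 0 1 0 0 1; rt (-1) 9 8 1 (-17) (-2)];
   SHecke 3 11;
   SEll (inv_expr (mx 11 9 17 14)) (-1) (mx 93 71 (-102) (-77)) 3 [rt 1 0 1 0 0 1;
     rt 1 0 6 5 (-17) (-14); rt 1 0 3 1 0 3; rt 1 0 57 46 (-51) (-41); rt 1 0 6 5 (-51) (-41);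
     rt (-1) 9 3 1 0 3; rt 1 0 6 5 (-153) (-126); rt (-1) 6 57 46 (-51) (-41); rt 1 0 3 2 0 3;
     rt (-1) 0 93 71 (-102) (-77); rt 1 3 9 6 (-51) (-25); rt 1 10 51 43 (-51) (-34);
     rt (-1) 1 51 43 (-153) (-102); rt (-1) 1 0 3 (-51) (-34); rt (-1) 1 51 25 153 102;
     rt (-1) 1 153 129 (-51) (-34); rt 1 0 9 8 0 1; rt 1 7 135 113 (-153) (-128);
     rt 1 0 18 15 (-153) (-127); rt (-1) 6 135 113 (-153) (-128); rt 1 3 18 15 (-255) (-212);
     rt 1 10 51 42 102 85; rt (-1) 1 17 14 102 85; rt (-1) 1 153 127 306 255; rt (-1) 1 255 212 306 255;
     rt (-1) 1 153 126 102 85; rt (-1) 12 6 5 (-51) (-42)];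
   SLin (inv_expr (mx 12 7 17 10)) [rt 1 13 15 8 (-17) (-9); rt 1 0 1 0 0 1; rt (-1) 7 15 8 (-17) (-9)];
   SLin (inv_expr (mx 3 1 17 6)) [rt 1 0 14 5 (-17) (-6); rt 1 0 1 0 0 1; rt (-1) 13 14 5 (-17) (-6)];
   SLin (inv_expr (mx 4 3 17 13)) [rt 1 13 1 0 0 1; rt (-1) 7 46 37 (-51) (-41);
     rt (-1) 0 5 4 (-34) (-27); rt 1 6 46 37 (-51) (-41); rt 1 0 53 43 (-68) (-55);
     rt (-1) 3 15 12 (-187) (-149); rt (-1) 13 53 43 (-68) (-55); rt (-1) 10 17 13 85 68;
     rt 1 1 17 13 255 204; rt 1 1 34 27 85 68; rt 1 1 187 149 255 204; rt 1 1 51 39 85 68];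
   SLin (inv_expr (mx 14 9 17 11)) [rt 1 0 1 0 0 1; rt (-1) 16 13 10 (-17) (-13);
     rt (-1) 0 7 5 (-17) (-12); rt 1 13 13 10 (-17) (-13); rt 1 9 7 5 (-17) (-12)];
   SLin (inv_expr (mx 13 3 17 4)) [rt 1 0 1 0 0 1; rt (-1) 13 14 5 (-17) (-6);
     rt (-1) 0 10 3 (-17) (-5); rt 1 7 14 5 (-17) (-6); rt 1 17 10 3 (-17) (-5)];
   SLin (inv_expr (mx 7 2 17 5)) [rt 1 7 14 5 (-17) (-6); rt 1 0 1 0 0 1; rt (-1) 13 14 5 (-17) (-6)];
   SLin (inv_expr (mx 10 7 17 12)) [rt 1 0 7 5 (-17) (-12); rt (-1) 19 7 5 (-17) (-12);
     rt (-1) 0 13 10 (-17) (-13); rt 1 16 1 0 0 1; rt 1 7 13 10 (-17) (-13)];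
   SLin (inv_expr (mx 5 2 17 7)) [rt 1 0 1 0 0 1; rt (-1) 7 15 8 (-17) (-9); rt (-1) 0 2 1 (-17) (-8);
     rt 1 6 15 8 (-17) (-9); rt 1 0 11 7 (-17) (-10); rt (-1) 3 6 3 (-85) (-41);
     rt (-1) 13 11 7 (-17) (-10); rt (-1) 10 17 7 34 17; rt 1 1 17 7 102 51; rt 1 1 17 8 34 17;
     rt 1 1 85 41 102 51; rt 1 1 51 21 34 17];
   SLin (inv_expr (mx 6 1 17 3)) [rt 1 0 31 3 (-34) (-3); rt (-1) 3 3 0 (-17) 3;
     rt (-1) 13 31 3 (-34) (-3); rt (-1) 10 17 3 (-17) 0; rt 1 1 17 3 (-51) 0; rt 1 1 0 1 (-17) 0;
     rt 1 1 17 (-3) 51 0; rt 1 1 51 9 (-17) 0]].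

Definition cert23 (w : Z) : list step :=
  [SLin (inv_expr (mx 1 0 (-23) 1)) [rt w 0 0 1 (-23) 0; rt 1 1 0 1 (-23) 0; rt (-1) 1 23 (-1) 23 0];
   SLin (inv_expr (mx 1 0 23 1)) [rt (-1) 2 1 0 23 1];
   SHecke 2 1;
   SLin (inv_expr (mx 12 1 23 2)) [rt (-1) 4 23 2 (-23) 0; rt 1 1 23 2 (-46) 0; rt 1 1 0 1 (-23) 0;
     rt 1 1 46 4 (-23) 0];
   SLin (inv_expr (mx 22 21 23 22)) [rt (-1) 3 1 1 (-23) (-22); rt 1 0 1 0 0 1; rt 1 0 1 1 (-23) (-22)];
   SLin (inv_expr (mx 11 10 23 21)) [rt (-1) 0 1 1 (-23) (-22); rt 1 6 1 0 0 1; rt 1 5 1 1 (-23) (-22)];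
   SLin (inv_expr (mx 2 1 23 12)) [rt 1 0 21 11 (-23) (-12); rt 1 0 1 0 0 1;
     rt (-1) 7 21 11 (-23) (-12)];
   SLin (inv_expr (mx 21 10 23 11)) [rt 1 6 21 11 (-23) (-12); rt 1 0 1 0 0 1;
     rt (-1) 7 21 11 (-23) (-12)];
   SHecke 3 1;
   SLin (inv_expr (mx 12 (-1) (-23) 2)) [rt (-1) 8 12 (-1) (-23) 2];
   SHecke 2 11;
   SLin (inv_expr (mx 2 1 23 12)) [rt 1 0 21 11 (-23) (-12); rt 1 0 1 0 0 1;
     rt (-1) 7 21 11 (-23) (-12)];
   SHecke 3 13;
   (* Level 23 uses two elliptic matrices: trace 11 and determinant 36 with l = 2 here, trace -5 and
      determinant 9 with l = 3 in the next step. *)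
   SEll (inv_expr (mx 19 14 23 17)) (-1) (mx 40 26 (-46) (-29)) 2 [rt (-1) 0 136 86 (-138) (-87);
     rt (-1) 0 90 63 (-92) (-64); rt (-1) 0 2 1 92 64; rt 1 6 136 86 (-138) (-87);
     rt 1 7 90 63 (-92) (-64); rt (-1) 3 2 1 0 2; rt (-1) 0 22 13 (-46) (-27); rt 1 8 22 13 (-46) (-27);
     rt 1 0 1 0 0 1; rt 1 0 4 3 (-23) (-17); rt (-1) 5 4 3 (-23) (-17); rt (-1) 0 4 2 0 1;
     rt (-1) 3 4 3 0 1; rt (-1) 12 4 3 46 35; rt (-1) 0 66 51 (-46) (-35); rt (-1) 0 20 16 (-46) (-35);
     rt 1 7 44 24 (-46) (-25); rt 1 0 2 1 0 2; rt (-1) 6 44 24 (-46) (-25); rt (-1) 0 86 49 (-92) (-52);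
     rt 1 3 6 3 (-46) (-17); rt 1 7 86 49 (-92) (-52); rt 1 10 46 29 (-46) (-23);
     rt (-1) 1 46 29 (-138) (-69); rt (-1) 1 0 2 (-46) (-23); rt (-1) 1 46 17 138 69;
     rt (-1) 1 138 87 (-46) (-23); rt (-1) 0 40 26 (-46) (-29); rt (-1) 0 22 17 (-138) (-105);
     rt 1 14 22 17 (-46) (-35)];
   SEll (inv_expr (mx 13 9 23 16)) (-1) (mx 48 37 (-69) (-53)) 3 [rt (-1) 0 99 72 (-138) (-100);
     rt (-1) 0 18 12 (-69) (-44); rt 1 15 99 72 (-138) (-100); rt 1 5 18 12 (-69) (-44);
     rt 1 0 60 44 (-69) (-50); rt 1 3 9 6 69 50; rt 1 12 9 6 138 94; rt 1 0 15 11 (-69) (-50);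
     rt (-1) 15 48 37 (-69) (-53); rt 1 7 43 29 (-46) (-31); rt 1 0 3 2 (-23) (-15);
     rt (-1) 6 43 29 (-46) (-31); rt 1 3 9 6 (-138) (-91); rt 1 10 0 1 (-69) (-46);
     rt (-1) 1 0 1 (-207) (-138); rt (-1) 1 23 15 69 46; rt (-1) 1 138 91 207 138;
     rt (-1) 1 0 3 (-69) (-46); rt 1 0 1 0 0 1];
   SLin (inv_expr (mx 9 7 23 18)) [rt 1 0 6 5 (-23) (-19); rt 1 7 238 191 (-253) (-203);
     rt 1 0 15 12 (-92) (-73); rt (-1) 6 238 191 (-253) (-203); rt 1 3 5 4 (-69) (-55);
     rt 1 10 23 19 (-115) (-92); rt (-1) 1 23 19 (-345) (-276); rt (-1) 1 92 73 345 276;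
     rt (-1) 1 69 55 115 92; rt (-1) 1 69 57 (-115) (-92); rt 1 0 41 34 (-69) (-57);
     rt (-1) 16 41 34 (-69) (-57); rt 1 0 1 0 0 1; rt (-1) 0 35 29 (-46) (-38);
     rt (-1) 0 2 2 (-23) (-21); rt 1 15 35 29 (-46) (-38); rt 1 5 2 2 (-23) (-21);
     rt 1 0 24 20 (-23) (-19); rt 1 3 1 1 (-23) (-19); rt 1 12 1 1 0 2; rt (-1) 0 41 33 (-46) (-37);
     rt 1 7 41 33 (-46) (-37)];
   SLin (inv_expr (mx 3 1 23 8)) [rt 1 0 1 0 0 1; rt 1 7 129 44 (-138) (-47); rt 1 0 9 3 (-69) (-22);
     rt (-1) 6 129 44 (-138) (-47); rt 1 3 3 1 (-46) (-15); rt 1 10 0 1 (-69) (-23);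
     rt (-1) 1 0 1 (-207) (-69); rt (-1) 1 69 22 207 69; rt (-1) 1 46 15 69 23;
     rt (-1) 1 0 3 (-69) (-23); rt 1 0 3 (-1) 0 3; rt (-1) 16 3 (-1) 0 3];
   SLin (inv_expr (mx 4 1 23 6)) [rt 1 0 2 (-1) 0 2; rt 1 0 8 2 (-46) (-11); rt (-1) 15 2 (-1) 0 2;
     rt (-1) 5 8 2 (-46) (-11); rt (-1) 0 4 0 0 1; rt (-1) 3 4 1 0 1; rt (-1) 12 4 1 46 12];
   SLin (inv_expr (mx 5 3 23 14)) [rt 1 0 18 11 (-23) (-14); rt 1 0 1 0 0 1;
     rt (-1) 17 18 11 (-23) (-14)];
   SLin (inv_expr (mx 6 1 23 4)) [rt 1 0 17 3 (-23) (-4); rt 1 0 1 0 0 1; rt (-1) 15 17 3 (-23) (-4)];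
   SLin (inv_expr (mx 7 3 23 10)) [rt 1 0 1 0 0 1; rt 1 0 16 7 (-23) (-10); rt (-1) 16 16 7 (-23) (-10)];
   SLin (inv_expr (mx 8 1 23 3)) [rt 1 7 22 1 (-23) (-1); rt 1 0 1 0 0 1; rt (-1) 6 22 1 (-23) (-1);
     rt 1 0 15 2 (-23) (-3); rt (-1) 16 15 2 (-23) (-3)];
   SLin (inv_expr (mx 10 3 23 7)) [rt 1 7 129 44 (-138) (-47); rt 1 0 9 3 (-69) (-22);
     rt (-1) 6 129 44 (-138) (-47); rt (-1) 0 20 7 (-23) (-8); rt 1 3 3 1 (-46) (-15);
     rt 1 7 20 7 (-23) (-8); rt 1 0 1 0 0 1; rt 1 10 0 1 (-69) (-23); rt (-1) 1 0 1 (-207) (-69);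
     rt (-1) 1 69 22 207 69; rt (-1) 1 46 15 69 23; rt (-1) 1 0 3 (-69) (-23); rt 1 0 3 (-1) 0 3;
     rt (-1) 16 3 (-1) 0 3];
   SLin (inv_expr (mx 14 3 23 5)) [rt 1 0 9 2 (-23) (-5); rt (-1) 8 9 2 (-23) (-5);
     rt (-w) 0 23 1 (-23) 0; rt (-w) 0 69 14 (-115) (-23); rt w 17 23 1 (-23) 0;
     rt (-1) 1 69 14 (-115) (-23); rt 1 1 0 1 (-23) 0];
   SLin (inv_expr (mx 15 13 23 20)) [rt (-1) 7 20 23 (-23) (-26); rt (-1) 0 3 3 (-46) (-43);
     rt 1 6 20 23 (-23) (-26); rt 1 0 1 0 0 1; rt (-1) 3 1 1 (-23) (-22); rt (-1) 10 23 20 23 23;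
     rt 1 1 23 20 69 69; rt 1 1 46 43 69 69; rt 1 1 23 22 23 23; rt 1 1 69 60 23 23;
     rt (-1) 0 47 41 (-69) (-60); rt 1 16 47 41 (-69) (-60)];
   SLin (inv_expr (mx 16 9 23 13)) [rt 1 0 1 0 0 1; rt (-1) 7 109 56 (-115) (-59);
     rt (-1) 0 6 3 (-23) (-10); rt 1 6 109 56 (-115) (-59); rt 1 0 21 11 (-23) (-12);
     rt (-1) 3 2 1 (-23) (-11); rt (-1) 7 21 11 (-23) (-12); rt (-1) 10 23 13 (-46) (-23);
     rt 1 1 23 13 (-138) (-69); rt 1 1 23 10 138 69; rt 1 1 23 11 46 23; rt 1 1 69 39 (-46) (-23);
     rt (-1) 0 44 25 (-69) (-39); rt 1 16 44 25 (-69) (-39)];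
   SLin (inv_expr (mx 17 14 23 19)) [rt 1 0 1 0 0 1; rt 1 0 6 5 (-23) (-19);
     rt (-1) 0 35 29 (-46) (-38); rt (-1) 0 2 2 (-23) (-21); rt 1 15 35 29 (-46) (-38);
     rt 1 5 2 2 (-23) (-21); rt 1 0 24 20 (-23) (-19); rt 1 3 1 1 (-23) (-19); rt 1 12 1 1 0 2];
   SLin (inv_expr (mx 18 7 23 9)) [rt 1 0 1 0 0 1; rt (-1) 5 2 1 (-23) (-11); rt 1 0 5 2 (-23) (-9);
     rt (-1) 3 5 2 (-23) (-9); rt (-w) 17 92 37 (-115) (-46); rt (-1) 1 92 37 (-115) (-46);
     rt 1 1 23 11 46 23];
   SLin (inv_expr (mx 20 13 23 15)) [rt 1 0 3 2 (-23) (-15); rt (-1) 3 3 2 (-23) (-15);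
     rt (-1) 0 10 7 (-23) (-16); rt 1 16 1 0 0 1; rt 1 8 10 7 (-23) (-16)]].

Definition cert (N : nat) (w : Z) : list step :=
  match N with
  | 5%nat => cert5 w
  | 6%nat => cert6 w
  | 7%nat => cert7 w
  | 8%nat => cert8 w
  | 9%nat => cert9 w
  | 10%nat => cert10 w
  | 11%nat => cert11 w
  | 12%nat => cert12 w
  | 14%nat => cert14 w
  | 15%nat => cert15 w
  | 16%nat => cert16 w
  | 17%nat => cert17 w
  | 23%nat => cert23 w
  | _ => []
  end.

Definition expr_eqb (e1 e2 : mexpr) : bool :=
  (length e1 =? length e2)%nat &&
  forallb (fun t => (fst (fst t) =? fst (snd t)) && meqb (snd (fst t)) (snd (snd t))) (List.combine e1 e2).

Definition check (N : nat) (w : Z) : bool :=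
  match run N (cert N w) (facts0 N w) with
  | Some fs => forallb (fun g => existsb (expr_eqb (inv_expr g)) fs) (gens N)
  | None => false
  end.

Open Scope R_scope.

(** The weight does not occur in [check], so two computations per level, one for each sign [w],
    serve all even k. *)
Lemma levels_checked :
  forallb (fun N => check N 1 && check N (-1)) [5; 6; 7; 8; 9; 10; 11; 12; 14; 15; 16; 17; 23]%nat = true.
Proof. vm_compute. reflexivity. Qed.

(** * The initial relations for the Fourier series *)

Lemma INR_C_neq0 (p : nat) : (0 < p)%nat -> RtoC (INR p) <> 0%C.
Proof. intros H E. apply RtoC_inj in E. apply lt_INR in H. simpl in H. lra. Qed.

Lemma sl_upper (m : nat) (p b : nat) (h : C -> C) (z : C) : (0 < p)%nat ->
  slashZ m (Mat2 1 (Z.of_nat b) 0 (Z.of_nat p))%Z h z = ((/ INR p) ^ m * h ((z + INR b) / INR p))%C.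
Proof.
  intros Hp. assert (P := INR_C_neq0 p Hp). unfold slashZ, jac, act, den, mdet. cbn [ma mb mc md].
  replace (1 * Z.of_nat p - Z.of_nat b * 0)%Z with (Z.of_nat p) by ring.
  rewrite <- !INR_IZR_INZ. f_equal; [f_equal|f_equal]; field; auto.
Qed.

Lemma sl_dilation (m : nat) (p : nat) (h : C -> C) (z : C) : (0 < p)%nat ->
  slashZ m (Mat2 (Z.of_nat p) 0 0 1)%Z h z = (INR p ^ m * h (INR p * z))%C.
Proof.
  intros Hp. unfold slashZ, jac, act, den, mdet. cbn [ma mb mc md].
  replace (Z.of_nat p * 1 - 0 * 0)%Z with (Z.of_nat p) by ring.
  rewrite <- !INR_IZR_INZ. f_equal; [f_equal|f_equal]; field; intros E; apply RtoC_inj in E; lra.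
Qed.

Lemma sl_id (m : nat) (h : C -> C) (z : C) : slashZ m (Mat2 1 0 0 1)%Z h z = h z.
Proof.
  rewrite (sl_upper m 1 0) by lia. simpl INR.
  replace ((z + 0%R) / 1%R)%C with z by (field; intros E; apply RtoC_inj in E; lra).
  replace (/ 1%R)%C with (RtoC 1) by (field; intros E; apply RtoC_inj in E; lra).
  rewrite <- RtoC_pow, pow1. ring.
Qed.

Section Relations.

Variables (N m : nat) (a : nat -> C) (w : Z).
Local Notation f := (fourier_series a).
Hypothesis HN : (0 < N)%nat.
Hypothesis Hm : (1 <= m)%nat.
Hypothesis HW : forall z, 0 < Im z ->
  f (- / (INR N * z))%C = (IZR w * (INR N * (z * z)) ^ m * f z)%C.
Hypothesis HH : forall p, prime_nat p = true -> forall z, 0 < Im z ->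
  partial_sum (fun b => f ((z + INR b) / INR p)%C) (p - 1) = (INR p * (e1 N m a p * f z - e2 N m p * f (INR p * z)))%C.

Lemma sl_T (z : C) : slashZ m (Mat2 1 1 0 1)%Z f z = f z.
Proof.
  rewrite (sl_upper m 1 1) by lia. simpl INR.
  replace ((z + 1%R) / 1%R)%C with (z + 1)%C by (field; intros E; apply RtoC_inj in E; lra).
  replace (/ 1%R)%C with (RtoC 1) by (field; intros E; apply RtoC_inj in E; lra).
  rewrite fourier_1, <- RtoC_pow, pow1. ring.
Qed.

Lemma sl_fricke (z : C) : 0 < Im z -> slashZ m (Mat2 0 (-1) (Z.of_nat N) 0)%Z f z = (IZR w * f z)%C.
Proof.
  intros Hz. assert (P := INR_C_neq0 N HN).
  assert (Z0 : z <> 0%C) by (intros E; apply (f_equal Im) in E; simpl in E; lra).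
  unfold slashZ, jac, act, den, mdet. cbn [ma mb mc md].
  replace (0 * 0 - -1 * Z.of_nat N)%Z with (Z.of_nat N) by ring. rewrite <- !INR_IZR_INZ.
  replace ((0 * z + -1) / (INR N * z + 0))%C with (- / (INR N * z))%C by (field; auto).
  rewrite HW by auto.
  transitivity (IZR w * ((INR N / ((INR N * z + 0) * (INR N * z + 0))) * (INR N * (z * z))) ^ m * f z)%C.
  - rewrite (Cpow_mul_l (INR N / _)). ring.
  - replace (INR N / ((INR N * z + 0) * (INR N * z + 0)) * (INR N * (z * z)))%C with (RtoC 1) by (field; auto).
    rewrite <- RtoC_pow, pow1. ring.
Qed.

Lemma isp_23 (p : nat) : (p = 2 \/ p = 3)%nat -> prime_nat p = true.
Proof.
  intros Hp. unfold prime_nat. destruct prime_dec as [|n]; auto. exfalso. apply n.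
  destruct Hp; subst p; [apply prime_2|apply prime_3].
Qed.

Lemma hecke_eigen (p : nat) : (p = 2 \/ p = 3)%nat -> (N mod p <> 0)%nat ->
  exists lam : C, forall z, 0 < Im z ->
    expr_eval m f (map (fun M => (1%Z, M)) (hecke_mats p)) z = (lam * f z)%C.
Proof.
  intros Hp Hd. exists (INR p * a p * (/ INR p) ^ m)%C. intros z Hz.
  assert (P0 : (0 < p)%nat) by lia. assert (P := INR_C_neq0 p P0).
  assert (Pp := isp_23 p Hp).
  assert (E : expr_eval m f (map (fun M => (1%Z, M)) (hecke_mats p)) z =
    ((/ INR p) ^ m * partial_sum (fun b => f ((z + INR b) / INR p)%C) (p - 1) + INR p ^ m * f (INR p * z))%C).
  { unfold hecke_mats. rewrite map_app, ev_app. f_equal.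
    - destruct Hp; subst p; cbn [seq map expr_eval fold_right fst snd partial_sum Nat.sub];
        rewrite !sl_upper by lia; ring.
    - cbn [map expr_eval fold_right fst snd]. rewrite sl_dilation by auto. rewrite Cmult_1_l, Cplus_0_r. reflexivity. }
  rewrite E, HH by auto. unfold e1, e2. apply Nat.eqb_neq in Hd. rewrite Hd. cbn [negb].
  (* The term p^(k-1) f(p z) of the recursion cancels the coset (p 0; 0 1), since p^(-m) p p^(2m -
     1) = p^m; only a multiple of f(z) remains. *)
  rewrite RtoC_pow. replace (INR p ^ (2 * m - 1))%C with (INR p ^ m * INR p ^ (m - 1))%C
    by (rewrite <- Cpow_add_r; f_equal; lia).
  assert (Q : ((/ INR p) ^ m * INR p * INR p ^ (m - 1) = 1)%C).
  { rewrite <- Cmult_assoc, <- Cpow_S. replace (S (m - 1)) with m by lia.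
    rewrite <- Cpow_mul_l, Cinv_l, <- RtoC_pow, pow1; auto. }
  transitivity (INR p * a p * (/ INR p) ^ m * f z + INR p ^ m * f (INR p * z)
     * (1 - (/ INR p) ^ m * INR p * INR p ^ (m - 1)))%C; [ring|]. rewrite Q. ring.
Qed.

Lemma facts0_Null : List.Forall (Null m f) (facts0 N w).
Proof.
  assert (N0 : (0 < Z.of_nat N)%Z) by lia.
  unfold facts0. apply Forall_app. split.
  - constructor; [|constructor; [|constructor]].
    + split; [reflexivity|]. intros z Hz. cbn [expr_eval inv_expr fold_right fst snd]. unfold mx.
      rewrite sl_id, sl_T. ring.
    + split.
      * unfold pos_dets; cbn [forallb snd]. rewrite !Bool.andb_true_r. unfold mdet, mx; cbn [ma mb mc md].
        apply Z.ltb_lt. lia.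
      * intros z Hz. cbn [expr_eval fold_right fst snd]. unfold mx. rewrite sl_id, sl_fricke by auto.
        rewrite opp_IZR, RtoC_opp. ring.
  - destruct (N mod 4 =? 0)%nat eqn:E4; [|destruct (N mod 2 =? 0)%nat eqn:E2]; constructor; try constructor.
    + reflexivity.
    + intros z Hz. cbn [expr_eval fold_right fst snd]. unfold mx. rewrite sl_id.
      (* U_2 f = 0 is used at 2 z, so that the two arguments become z and z + 1/2. *)
      assert (Hz2 : 0 < Im (2 * z)%C) by (simpl; destruct z; simpl in *; lra).
      assert (X := HH 2 (isp_23 2 (or_introl eq_refl)) (2 * z)%C Hz2). cbn [partial_sum Nat.sub] in X.
      unfold e1, e2 in X. change (2 * 2)%nat with 4%nat in X. rewrite E4 in X.
      assert (E2 : (N mod 2 =? 0)%nat = true).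
      { apply Nat.eqb_eq. apply Nat.eqb_eq in E4. apply Nat.Lcm0.mod_divide.
        apply Nat.Lcm0.mod_divide in E4. destruct E4 as [q ->]. exists (q * 2)%nat. lia. }
      rewrite E2 in X. cbn [negb] in X. simpl INR in X.
      unfold slashZ, jac, act, den, mdet. cbn [ma mb mc md]. change (2 * 2 - 1 * 0)%Z with 4%Z.
      replace (4 / ((0 * z + 2) * (0 * z + 2)))%C with (RtoC 1) by (apply Ceq; unfold Re, Im; destruct z; simpl; field).
      replace ((2 * z + 0%R) / (1 + 1)%R)%C with z in X
        by (apply Ceq; unfold Re, Im; destruct z; simpl; field).
      rewrite <- RtoC_pow, pow1.
      replace ((2 * z + 1) / (0 * z + 2))%C with ((2 * z + 1) / (1 + 1)%R)%C
        by (f_equal; f_equal; apply Ceq; unfold Re, Im; destruct z; simpl; ring).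
      transitivity (f z + f ((2 * z + 1) / (1 + 1)%R))%C; [ring|]. rewrite X. ring.
    + reflexivity.
    + intros z Hz. cbn [expr_eval fold_right fst snd]. unfold mx. rewrite sl_id.
      rewrite (sl_upper m 2 0), (sl_upper m 2 1) by lia.
      assert (X := HH 2 (isp_23 2 (or_introl eq_refl)) z Hz). cbn [partial_sum Nat.sub] in X.
      unfold e1, e2 in X. change (2 * 2)%nat with 4%nat in X. rewrite E4, E2 in X. cbn [negb] in X. rewrite RtoC_pow in X.
      transitivity ((/ INR 2) ^ m * (f ((z + INR 0) / INR 2) + f ((z + INR 1) / INR 2)) - f z)%C; [ring|].
      rewrite X.
      (* The eigenvalue 2^(k/2 - 1) of U_2 cancels the normalisation of the slash operator, which
         makes the relation independent of the weight. *)
      assert (Q : ((/ INR 2) ^ m * (INR 2 * INR 2 ^ (m - 1)) = 1)%C).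
      { rewrite <- Cpow_S. replace (S (m - 1)) with m by lia.
        rewrite <- Cpow_mul_l, Cinv_l, <- RtoC_pow, pow1; auto. apply INR_C_neq0. lia. }
      transitivity ((/ INR 2) ^ m * (INR 2 * INR 2 ^ (m - 1)) * f z - f z)%C; [ring|]. rewrite Q. ring.
Qed.

Lemma expr_eqb_eq (e1 e2 : mexpr) : expr_eqb e1 e2 = true -> e1 = e2.
Proof.
  unfold expr_eqb. revert e2. induction e1 as [|[c M] e IH]; intros [|[c' M'] e'] H; auto; try discriminate.
  simpl in H. apply Bool.andb_true_iff in H. destruct H as [L H].
  rewrite !Bool.andb_true_iff in H. destruct H as [[H1 H2] H3].
  apply Z.eqb_eq in H1. apply meqb_eq in H2. subst. f_equal. apply IH. apply Bool.andb_true_iff. auto.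
Qed.

Hypothesis Hcd : holoH f.
Hypothesis Hc : check N w = true.

Lemma gens_invariant (g : mat2 Z) : In g (gens N) -> forall z, 0 < Im z -> slashZ m g f z = f z.
Proof.
  intros Hg z Hz. unfold check in Hc. destruct run as [fs|] eqn:R; [|discriminate].
  assert (Q := run_spec m N f Hm Hcd hecke_eigen _ _ _ facts0_Null R).
  rewrite forallb_forall in Hc. specialize (Hc g Hg). apply existsb_exists in Hc.
  destruct Hc as [e [He1 He2]]. apply expr_eqb_eq in He2. subst e.
  rewrite List.Forall_forall in Q. destruct (Q _ He1) as [_ H]. specialize (H z Hz).
  cbn [expr_eval inv_expr fold_right fst snd] in H. unfold mx in H. rewrite sl_id in H.
  transitivity (f z - (1 * f z + (-1 * slashZ m g f z + 0)))%C; [ring|]. rewrite H. ring.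
Qed.

End Relations.

Open Scope R_scope.

Open Scope Z_scope.

(** * Generators of Gamma_0(N) *)

(* Certifies that the intervals ((a-1)/c, (a+1)/c), for (a b; c d) in the list,
   cover [n/k, 1) up to points of denominator less than N. *)
Fixpoint covers (N n k : Z) (hs : list (mat2 Z)) : bool :=
  match hs with
  | [] => k <=? n
  | g :: gs' =>
      ((((ma g - 1) * k <? n * mc g) || (((ma g - 1) * k =? n * mc g) && (k / Z.gcd n k <? N)))
       && (0 <? mc g)) && covers N (ma g + 1) (mc g) gs'
  end.

(** Walking to the right keeps n / k <= r / c. The intervals are open, and a common endpoint of two
    neighbours is excluded by the hypothesis that r / c is no fraction with denominator below N. *)
Lemma covers_spec (N c r : Z) (hs : list (mat2 Z)) : forall n k,
  0 < k -> 0 < c -> r < c -> n * c <= k * r ->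
  (forall k l, 0 < k < N -> k * r <> l * c) ->
  covers N n k hs = true -> exists g, In g hs /\ Z.abs (mc g * r - ma g * c) < c.
Proof.
  induction hs as [|g hs IH]; intros n k Hk Hc Hr Hn Hex H; simpl in H.
  - apply Z.leb_le in H. nia.
  - rewrite !Bool.andb_true_iff, Bool.orb_true_iff, Bool.andb_true_iff in H.
    destruct H as [[H0 H1] H2]. rewrite !Z.ltb_lt in *. rewrite Z.eqb_eq in H0.
    assert (L : (ma g - 1) * c < mc g * r).
    { destruct H0 as [H0|[H0 H3]].
      - assert ((ma g - 1) * k * c < mc g * r * k) by nia. nia.
      - assert (G : 0 < Z.gcd n k).
        { assert (X := Z.gcd_nonneg n k). destruct (Z.eq_dec (Z.gcd n k) 0) as [E|]; [|lia].
          apply Z.gcd_eq_0_r in E. lia. }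
        destruct (Z.gcd_divide_l n k) as [n' En]. destruct (Z.gcd_divide_r n k) as [k' Ek].
        set (e := Z.gcd n k) in *.
        assert (K' : k / e = k') by (rewrite Ek; apply Z.div_mul; lia).
        rewrite K' in H3. assert (0 < k') by nia.
        assert (n * c < k * r).
        { assert (k' * r <> n' * c) by (apply Hex; lia). nia. }
        assert ((ma g - 1) * k * c < mc g * r * k) by nia. nia. }
    destruct (Z_lt_le_dec (mc g * r) ((ma g + 1) * c)) as [U|U].
    + exists g. split; [now left|]. lia.
    + destruct (IH (ma g + 1) (mc g) H1 Hc Hr U Hex H2) as [h [Hh1 Hh2]]. exists h. split; auto. now right.
Qed.

Open Scope R_scope.

Definition levels : list nat := [5; 6; 7; 8; 9; 10; 11; 12; 14; 15; 16; 17; 23]%nat.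

Lemma gens_checked :
  forallb (fun N => covers (Z.of_nat N) 0 1 (gens N) &&
    forallb (fun g => (mdet g =? 1)%Z && (mc g mod Z.of_nat N =? 0)%Z) (gens N)) levels = true.
Proof. vm_compute. reflexivity. Qed.

Section Generation.

Variables (N m : nat) (f : C -> C).
Hypothesis HN : In N levels.
Hypothesis HT : forall z, f (z + 1)%C = f z.
Hypothesis Hgens : forall g, In g (gens N) -> forall z, 0 < Im z -> slashZ m g f z = f z.

Definition invariant (g : mat2 Z) : Prop := forall z, 0 < Im z -> slashZ m g f z = f z.

Definition madj (g : mat2 Z) : mat2 Z := Mat2 (md g) (- mb g)%Z (- mc g)%Z (ma g).

Lemma mdet_madj (g : mat2 Z) : mdet (madj g) = mdet g.
Proof. unfold mdet, madj; simpl. ring. Qed.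

Lemma mmul_madj (g A : mat2 Z) : mdet A = 1%Z -> mmul (mmul g A) (madj A) = g.
Proof.
  destruct g as [a b c d], A as [x y u v]. unfold mdet, mmul, madj. cbn [ma mb mc md]. intros E.
  f_equal.
  - transitivity (a * (x * v - y * u))%Z; [ring|rewrite E; ring].
  - transitivity (b * (x * v - y * u))%Z; [ring|rewrite E; ring].
  - transitivity (c * (x * v - y * u))%Z; [ring|rewrite E; ring].
  - transitivity (d * (x * v - y * u))%Z; [ring|rewrite E; ring].
Qed.

Lemma invariant_mul (A B : mat2 Z) : (0 < mdet A)%Z -> (0 < mdet B)%Z ->
  invariant A -> invariant B -> invariant (mmul A B).
Proof.
  intros dA dB HA HB z Hz. rewrite sl_mul by auto. unfold slashZ at 1.
  rewrite HA by (now apply Im_act). now apply HB.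
Qed.

Lemma invariant_madj (A : mat2 Z) : mdet A = 1%Z -> invariant A -> invariant (madj A).
Proof.
  intros dA HA z Hz. assert (dA' := mdet_madj A). rewrite dA in dA'.
  transitivity (slashZ m (madj A) (slashZ m A f) z).
  - unfold slashZ at 1 2. rewrite HA; auto. apply Im_act; lia || auto.
  - rewrite <- sl_mul by (lia || auto).
    replace (mmul A (madj A)) with (Mat2 1 0 0 1)%Z; [apply sl_id|].
    unfold mmul, madj, mdet in *; simpl in *. f_equal; lia.
Qed.

Lemma periodic_Z (j : Z) (z : C) : f (z + IZR j)%C = f z.
Proof.
  assert (P : forall (n : nat) z, f (z + INR n)%C = f z).
  { induction n; intros y.
    - f_equal. simpl. ring.
    - rewrite S_INR, RtoC_plus, Cplus_assoc, HT. apply IHn. }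
  destruct (Z_le_dec 0 j) as [H|H].
  - rewrite <- (Z2Nat.id j H), <- INR_IZR_INZ. apply P.
  - rewrite <- (P (Z.to_nat (- j)) (z + IZR j)%C). f_equal.
    rewrite INR_IZR_INZ, Z2Nat.id, opp_IZR, RtoC_opp by lia. ring.
Qed.

Lemma invariant_T (j : Z) : invariant (Mat2 1 j 0 1)%Z.
Proof.
  intros z Hz. unfold slashZ, jac, act, den, mdet. cbn [ma mb mc md].
  replace (1 * 1 - j * 0)%Z with 1%Z by ring.
  assert (N1 : RtoC 1 <> 0%C) by (intros E; apply RtoC_inj in E; lra).
  assert (D : (0 * z + 1)%C = RtoC 1) by ring. rewrite D.
  replace (1 / (1 * 1))%C with (RtoC 1) by (field; auto).
  replace ((1 * z + IZR j) / 1)%C with (z + IZR j)%C by (field; auto).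
  rewrite periodic_Z, <- RtoC_pow, pow1. ring.
Qed.

Lemma invariant_neg (g : mat2 Z) : (0 < mdet g)%Z -> invariant (mscale (-1) g) -> invariant g.
Proof. intros dg H z Hz. rewrite <- (sl_mscale m (-1)) by (lia || auto). auto. Qed.

(** Descent on |c|. For c > 0 write -d = c j + r with 0 <= r < c. The point r / c lies in the
    interval of some generator h, which says precisely that g T^j h has a lower left entry smaller
    than c in absolute value. Negative c is reached through -g, which acts as g does. *)
Lemma Gamma0_invariant (g : mat2 Z) : Gamma0 N g -> invariant g.
Proof.
  assert (X := gens_checked). rewrite forallb_forall in X. specialize (X N HN).
  apply Bool.andb_true_iff in X. destruct X as [Cov Gd]. rewrite forallb_forall in Gd.
  assert (N5 : (5 <= Z.of_nat N)%Z).
  { unfold levels in HN. simpl in HN. lia. }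
  assert (P : forall (n : nat) g, (Z.abs (mc g) <= Z.of_nat n)%Z -> Gamma0 N g -> invariant g);
    [|intros G; apply (P (Z.to_nat (Z.abs (mc g)))); auto; lia].
  clear g. induction n as [|n IHn].
  - intros g Hn [dg _]. assert (c0 : mc g = 0%Z) by lia.
    destruct g as [a b c d]. simpl in *. subst c.
    assert (H1 : (a = 1 /\ d = 1 \/ a = -1 /\ d = -1)%Z).
    { assert (E : (a * d = 1)%Z) by lia. destruct (Z.mul_eq_1 a d E); subst a; lia. }
    destruct H1 as [[-> ->]|[-> ->]]; [apply invariant_T|].
    apply invariant_neg; [unfold mdet; cbn [ma mb mc md]; lia|]. unfold mscale, mat2_map; simpl.
    apply invariant_T.
  - assert (Pos : forall g, (0 < mc g)%Z -> (mc g <= Z.of_nat (S n))%Z -> Gamma0 N g -> invariant g).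
    { intros g Hc Hcn [dg [t Ht]].
      set (c := mc g) in *. set (d := md g) in *. set (r := ((- d) mod c)%Z). set (j := ((- d) / c)%Z).
      assert (Ed : (- d = c * j + r)%Z) by (apply Z.div_mod; lia).
      assert (Hr : (0 <= r < c)%Z) by (apply Z.mod_pos_bound; lia).
      assert (NC : (Z.of_nat N <= c)%Z) by (apply Z.divide_pos_le; [lia|exists t; exact Ht]).
      (* As det g = 1, r is prime to c, so the reduced denominator of r / c is c, which is at least
         N. *)
      assert (Hex : forall k l, (0 < k < Z.of_nat N)%Z -> (k * r <> l * c)%Z).
      { intros k l Hk E.
        assert (Dk : (c | k)%Z).
        { exists (- (k * mb g) - ma g * (l + k * j))%Z.
          transitivity (k * (ma g * d - mb g * c))%Z; [rewrite dg; ring|].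
          replace d with (- (c * j + r))%Z by lia.
          transitivity (- ma g * k * c * j - ma g * (k * r) - k * mb g * c)%Z; [ring|]. rewrite E. ring. }
        apply Z.divide_pos_le in Dk; lia. }
      destruct (covers_spec (Z.of_nat N) c r (gens N) 0 1) as [h [Hh1 Hh2]]; auto; try lia.
      specialize (Gd h Hh1). apply Bool.andb_true_iff in Gd. destruct Gd as [dh Nh].
      apply Z.eqb_eq in dh, Nh. apply Z.mod_divide in Nh; [|lia].
      (* The lower left entry of g T^j h is c a' - r c', where (a', c') is the first column of h. *)
      set (Xm := mmul (Mat2 1 j 0 1)%Z h).
      assert (dX : mdet Xm = 1%Z) by (unfold Xm; rewrite mdet_mul, dh; unfold mdet; cbn [ma mb mc md]; lia).
      assert (IX : invariant Xm).
      { apply invariant_mul; try (rewrite ?dh; unfold mdet; cbn [ma mb mc md]; lia); [apply invariant_T|].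
        intros z. now apply Hgens. }
      replace g with (mmul (mmul g Xm) (madj Xm)).
      - assert (dg' : mdet g = 1%Z) by (unfold mdet; fold c d; lia).
        apply invariant_mul; rewrite ?mdet_madj, ?mdet_mul, ?dX, ?dg'; try lia; [|now apply invariant_madj].
        apply IHn.
        + replace (mc (mmul g Xm)) with (- (mc h * r - ma h * c))%Z; [lia|].
          unfold Xm, mmul; cbn [ma mb mc md]. fold c d. replace d with (- (c * j + r))%Z by lia. ring.
        + split.
          * assert (Y := mdet_mul g Xm). rewrite dX, dg' in Y. unfold mdet in Y. lia.
          * unfold Xm, mmul; cbn [ma mb mc md]. fold c d. apply Z.divide_add_r.
            -- exists (t * (1 * ma h + j * mc h))%Z. rewrite Ht. ring.
            -- destruct Nh as [q ->]. exists (d * q)%Z. ring.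
      - now apply mmul_madj. }
    intros g Hn G. destruct (Z_lt_le_dec 0 (mc g)) as [H|H]; [apply Pos; auto; lia|].
    destruct (Z.eq_dec (mc g) 0) as [H0|H0]; [apply IHn; auto; lia|].
    destruct G as [dg Ng].
    apply invariant_neg; [unfold mdet; lia|]. apply Pos; unfold mscale, mat2_map; cbn [ma mb mc md]; try lia.
    split; cbn [ma mb mc md]; [lia|]. destruct Ng as [q ->]. exists (-1 * q)%Z. ring.
Qed.

End Generation.

(** * Comparison with the slash operator of the statement, and conclusion *)

Lemma slash_sl (m : nat) (g : mat2 Z) (f : C -> C) (z : C) : mdet g = 1%Z -> 0 < Im z ->
  slash (2 * m) (mat2_map IZR g) f z = slashZ m g f z.
Proof.
  intros dg Hz. assert (Nd : den g z <> 0%C) by (apply den_neq0; lia || auto).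
  unfold slash, slashZ. f_equal.
  unfold mat2_map; cbn [ma mb mc md]. rewrite <- !mult_IZR, <- minus_IZR. fold (mdet g). rewrite dg.
  unfold Rpower. rewrite ln_1, Rmult_0_r, exp_0. fold (den g z).
  unfold jac. rewrite dg, Cpow_mult_r.
  replace (den g z ^ 2)%C with (den g z * den g z)%C by (simpl; ring).
  assert (Q : (1 / (den g z * den g z) * (den g z * den g z))%C = RtoC 1) by (field; auto).
  assert (Q' := Cpow_mul_l (1 / (den g z * den g z)) (den g z * den g z) m).
  rewrite Q, <- RtoC_pow, pow1 in Q'.
  assert (Np : ((den g z * den g z) ^ m)%C <> 0%C) by (apply Cpow_neq0, Cmult_neq_0; auto).
  transitivity ((1 / (den g z * den g z)) ^ m * (den g z * den g z) ^ m * / (den g z * den g z) ^ m)%C.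
  - now rewrite <- Q'.
  - field. auto.
Qed.

Theorem theorem1 (N k : nat) (a : nat -> C) (F : C -> C)
  (hN : In N [5; 6; 7; 8; 9; 10; 11; 12; 14; 15; 16; 17; 23]%nat)
  (hk0 : (0 < k)%nat) (hk : Nat.Even k)
  (hF : is_dirichlet_series a F)
  (hEBV : EBV F)
  (hfe : functional_equation N k F)
  (hep : euler_product a N k F) :
  forall g : mat2 Z, Gamma0 N g ->
  forall z : C, 0 < Im z ->
    slash k (mat2_map IZR g) (fourier_series a) z = fourier_series a z.
Proof.
  intros g Hg z Hz. destruct hk as [m Ek]. subst k.
  assert (Hm : (1 <= m)%nat) by lia.
  assert (N0 : (0 < N)%nat) by (simpl in hN; lia).
  (* Absolute convergence is part of the Euler product hypothesis; a large integer point of that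
     half-plane serves as B. *)
  assert (HB : exists A B, poly_bound a A B).
  { destruct hep as [sg H]. destruct (INR_unbounded (sg + 1)) as [B HB].
    destruct (abs_poly_bound a B) as [A HA]; [|eauto].
    destruct (H (RtoC (INR B))) as [H1 _]; [simpl; lra|exact H1]. }
  destruct HB as [A [B HB]].
  destruct (fricke N m a A B F N0 HB hF hEBV hfe) as [eps [Heps HW]].
  (* The sign becomes an integer, the form in which the certificates carry it. *)
  assert (Hw : exists w, (w = 1%Z \/ w = (-1)%Z) /\ IZR w = eps).
  { destruct Heps; subst eps; [exists 1%Z|exists (-1)%Z]; auto. }
  destruct Hw as [w [Hw Ew]]. subst eps.
  assert (Hc : check N w = true).
  { assert (X := levels_checked). rewrite forallb_forall in X. specialize (X N hN).
    apply Bool.andb_true_iff in X. destruct X. destruct Hw; subst w; auto. }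
  rewrite slash_sl by (auto; destruct Hg as [H _]; unfold mdet; lia).
  apply (Gamma0_invariant N m (fourier_series a)); auto.
  - apply fourier_1.
  - apply (gens_invariant N m a w); auto.
    + intros p Hp. apply (fourier_hecke a A B HB).
      * apply isp_pos in Hp. lia.
      * intros n. now apply (hecke_rel N m a F Hm A B).
    + intros y Hy. now apply (fourier_cd a A B HB).
Qed.
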